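(* Let $w\in\widetilde{\mathrm{Sp}}(2n)$. Then: (i) If $w$ lies in the closure of $\widetilde{\mathrm{Sp}}^+_{\mathrm{ell}}(2n)$, then $\pi(w)$ has spectrum $\{e^{\pm i\theta_1},\dots,e^{\pm i\theta_n}\}$ with $\theta_j\in[0,\pi]$ for every $j$, and $$\mathrm{dist}_G(\mathrm{id},w)\le\frac{2\pi}{n}\mu(w)=\frac1n\sum_{j=1}^n\theta_j.$$ (ii) If there is a timelike curve from $\mathrm{id}$ to $w$ and $w$ is not in the closure of $\widetilde{\mathrm{Sp}}^+_{\mathrm{ell}}(2n)$, then $\mathrm{dist}_G(\mathrm{id},w)=+\infty$.
   Context: $\omega_0=\sum_j\mathrm{d}x_j\wedge\mathrm{d}y_j$ on $\mathbb{R}^{2n}$, $J_0$ the standard complex structure with $\omega_0(u,v)=J_0u\cdot v$; $\mathrm{Sp}(2n)$, $\mathrm{sp}(2n)=\{X:(u,v)\mapsto\omega_0(u,Xv)\text{ symmetric}\}$, $\mathrm{sp}^+(2n)$ those with this form positive definite, $G(X)=(\det X)^{1/(2n)}$ on $\mathrm{sp}^+(2n)$, extended by $0$ to its boundary. $\widetilde{\mathrm{Sp}}(2n)$ is the universal cover (homotopy classes of paths from $\mathrm{id}$), $\pi(w)=w(1)$. A $C^1$ curve is timelike if $W'W^{-1}\in\mathrm{sp}^+(2n)$ and causal if $W'W^{-1}$ is nonzero and in the closure of $\mathrm{sp}^+(2n)$ (for curves in $\widetilde{\mathrm{Sp}}(2n)$, via projection); $\mathrm{length}_G(W)=\int G(W'W^{-1})\,\mathrm{d}t$.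 Write $w_0\le w_1$ if $w_0=w_1$ or there is a causal curve from $w_0$ to $w_1$ in $\widetilde{\mathrm{Sp}}(2n)$ (a partial order). $\mathrm{dist}_G(w_0,w_1)=\sup\mathrm{length}_G(\gamma)$ over causal curves $\gamma$ from $w_0$ to $w_1$ if $w_0\le w_1$, and $0$ otherwise. Krein form: $\kappa(w,w')=\langle -iJ_0w,w'\rangle$ on $\mathbb{C}^{2n}$ with $\langle a,b\rangle=\sum a_k\overline{b_k}$. For an eigenvalue $\lambda$ on the unit circle $\mathbb{U}$ of $W\in\mathrm{Sp}(2n)$, its Krein signature $(p(\lambda),q(\lambda))$ is the signature of $\kappa$ on the generalized eigenspace; $\lambda$ is Krein-positive if $\kappa$ is positive definite there. $\mathrm{Sp}^+_{\mathrm{ell}}(2n)$ is the set of $W$ all of whose eigenvalues lie in $\mathbb{U}\setminus\{\pm1\}$, with those of positive imaginary part Krein-positive; $\widetilde{\mathrm{Sp}}^+_{\mathrm{ell}}(2n)$ is the set of classes of paths $w$ with $w(0)=\mathrm{id}$, $w((0,1])\subset\mathrm{Sp}^+_{\mathrm{ell}}(2n)$. Let $\upsilon(W)=(-1)^m\prod_{\lambda\in\sigma(W)\cap\mathbb{U}\setminus\{\pm1\}}\lambda^{p(\lambda)}$, with $2m$ the total algebraic multiplicity of negative real eigenvalues of $W$. The homogeneous Maslov quasimorphism $\mu:\widetilde{\mathrm{Sp}}(2n)\to\mathbb{R}$ is the unique continuous function with $e^{2\pi i\mu(w)}=\upsilon(\pi(w))$ and $\mu(\mathrm{id})=0$. 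*)

(* Defs.v *)
From HB Require Import structures.
From mathcomp Require Import all_boot all_order all_algebra.
From mathcomp Require Import all_classical all_reals all_analysis.
From mathcomp Require Import complex.
Import Order.TTheory GRing.Theory Num.Theory.
Import numFieldNormedType.Exports.

Set Implicit Arguments.
Unset Strict Implicit.
Unset Printing Implicit Defensive.

Local Open Scope ring_scope.
Local Open Scope classical_set_scope.

Section Defs.
Variables (R : realType) (n : nat).

(* R^{2n} with coordinates (x_1..x_n, y_1..y_n), vectors as columns. *)
Notation M := 'M[R]_(n + n).
Notation V := 'cV[R]_(n + n).

Definition omega0 (u v : V) : R :=
  \sum_(j < n) (u (lshift n j) 0 * v (rshift n j) 0
              - u (rshift n j) 0 * v (lshift n j) 0).

(* J_0, characterized by omega0 u v = (J0 u) . v *)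
Definition J0 : M := block_mx 0 (- 1%:M) 1%:M 0.

Definition symplectic (W : M) : Prop :=
  forall u v : V, omega0 (W *m u) (W *m v) = omega0 u v.

Definition sp (X : M) : Prop :=
  forall u v : V, omega0 u (X *m v) = omega0 v (X *m u).

Definition sp_plus : set M :=
  [set X | sp X /\ forall u : V, u != 0 -> 0 < omega0 u (X *m u)].

(* G = det^{1/(2n)} on sp^+, extended by 0 (to the boundary). *)
Definition G (X : M) : R :=
  if `[< sp_plus X >] then powR (\det X) (((n + n)%:R : R)^-1) else 0.

(* C^1 curves: W : R -> M (a C^1 map on R; only its restriction to [0,1]
   matters).  Curves are parametrized by [0,1]. *)
Definition is_C1 (W : R -> M) : Prop :=
  (forall t, derivable W t 1) /\ continuous (derive1 W).

Definition velocity (W : R -> M) (t : R) : M := derive1 W t *m invmx (W t).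

Definition causal_curve (W : R -> M) : Prop :=
  is_C1 W /\
  (forall t, t \in `[0, 1] -> symplectic (W t)) /\
  (forall t, t \in `[0, 1] ->
     velocity W t != 0 /\ closure sp_plus (velocity W t)).

Definition timelike_curve (W : R -> M) : Prop :=
  is_C1 W /\
  (forall t, t \in `[0, 1] -> symplectic (W t)) /\
  (forall t, t \in `[0, 1] -> sp_plus (velocity W t)).

Definition lengthG (W : R -> M) : \bar R :=
  (\int[@lebesgue_measure R]_(t in `[0%R, 1%R]) (G (velocity W t))%:E)%E.

(* Elements of the universal cover: continuous paths [0,1] -> Sp(2n) from id,
   up to homotopy rel endpoints. *)
Definition is_path (p : R -> M) : Prop :=
  {within `[0, 1], continuous p} /\ p 0 = 1 /\
  (forall t, t \in `[0, 1] -> symplectic (p t)).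

Definition htpy_track (p q : R -> M) (A : set M) : Prop :=
  exists H : R * R -> M,
    {within `[0, 1] `*` `[0, 1], continuous H} /\
    (forall t, t \in `[0, 1] -> H (0, t) = p t /\ H (1, t) = q t) /\
    (forall s, s \in `[0, 1] -> H (s, 0) = 1 /\ A (H (s, 1))) /\
    (forall s t, s \in `[0, 1] -> t \in `[0, 1] -> symplectic (H (s, t))).

(* same element of the universal cover *)
Definition homotopic (p q : R -> M) : Prop := htpy_track p q [set p 1].

Definition cmx (W : M) : 'M[R[i]]_(n + n) := map_mx (fun x => (x%:C)%C) W.

Definition J0c : 'M[R[i]]_(n + n) := cmx J0.

Definition kappa (w w' : 'cV[R[i]]_(n + n)) : R[i] :=
  \sum_(k < n + n) (- 'i%C * (J0c *m w) k 0) * conjc (w' k 0).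

(* generalized eigenspace of lambda (as row space of transposed columns) *)
Definition gen_eigenspace (W : M) (l : R[i]) : 'M[R[i]]_(n + n) :=
  kermx (((cmx W - l%:M) ^+ (n + n))^T).

Definition krein_posdef_on (E : 'M[R[i]]_(n + n)) : Prop :=
  forall v : 'rV[R[i]]_(n + n), (v <= E)%MS -> v != 0 -> 0 < kappa v^T v^T.

Definition krein_positive (W : M) (l : R[i]) : Prop :=
  krein_posdef_on (gen_eigenspace W l).

(* p(lambda): positive index of inertia of kappa on the generalized
   eigenspace = maximal dimension of a subspace on which kappa is positive
   definite. *)
Definition krein_p (W : M) (l : R[i]) : nat :=
  \max_(k < (n + n).+1 |
        `[< exists Vs : 'M[R[i]]_(n + n),
              (Vs <= gen_eigenspace W l)%MS /\ \rank Vs = k /\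
              krein_posdef_on Vs >]) k.

Definition eigenvalue (W : M) (l : R[i]) : Prop := root (char_poly (cmx W)) l.

Definition Sp_ell (W : M) : Prop :=
  symplectic W /\
  (forall l, eigenvalue W l -> `|l| = 1 /\ l != 1 /\ l != -1) /\
  (forall l, eigenvalue W l -> 0 < complex.Im l -> krein_positive W l).

Definition upsilon (W : M) : R[i] :=
  let m2 := (\sum_(l \in [set l | eigenvalue W l /\ (l < 0)%R])
               mup l (char_poly (cmx W)))%N in
  (-1) ^+ (m2./2) *
  \big[*%R/1]_(l \in [set l | eigenvalue W l /\ `|l| = 1 /\ l != 1 /\ l != -1])
     l ^+ krein_p W l.

Definition expi (x : R) : R[i] := Complex (cos x) (sin x).

(* continuous lift of upsilon along the path w, starting at 0;
   its value at 1 is the Maslov quasimorphism mu([w]). *)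
Definition maslov_lift (w : R -> M) (f : R -> R) : Prop :=
  {within `[0, 1], continuous f} /\ f 0 = 0 /\
  (forall t, t \in `[0, 1] -> expi (2 * pi * f t) = upsilon (w t)).

(* [w] lies in the closure of tilde Sp^+_ell(2n) (universal cover topology) *)
Definition in_closure_ell (w : R -> M) : Prop :=
  forall eps : R, 0 < eps ->
    exists v : R -> M, is_path v /\
      (forall t, t \in `]0, 1] -> Sp_ell (v t)) /\
      htpy_track w v (ball (w 1) eps).

Definition causal_to (w : R -> M) (W : R -> M) : Prop :=
  causal_curve W /\ W 0 = 1 /\ homotopic W w.

Definition timelike_to (w : R -> M) (W : R -> M) : Prop :=
  timelike_curve W /\ W 0 = 1 /\ homotopic W w.

Definition dist_id (w : R -> M) : \bar R :=
  if `[< exists W, causal_to w W >]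
  then ereal_sup [set lengthG W | W in causal_to w]
  else 0%E.

End Defs.

(* Main.v *)
(** The form [omega0 x (W x)] is positive exactly when [W] is elliptic with Krein-positive
    eigenvalues in the upper half plane, and a timelike curve from the identity keeps this form
    positive as long as it avoids the eigenvalue [-1].

    (i) A causal curve to [w] is pushed into a timelike one by small rotations.  The argument of
    [det (1 + W (1 + i eta J))] is monotone along a timelike curve and drops by a fixed amount,
    uniformly in [eta], at a crossing of [-1]; a homotopy to an elliptic path forbids such a drop,
    so the pushed curve stays elliptic.  There, for a polynomial [Q] close to [arccos], the trace
    of [Q ((W + W^-1) / 2) / 2] is close to the sum of the angles and, by the inequality between
    arithmetic and geometric means, grows at speed at least [n G].  The function [upsilon] is
    continuous: it is the limit of the product of [l / |l|] over the eigenvalues [l] in the open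
    unit disc of the strict Krein contractions [W (1 + i eta J)].  Hence its lift can be followed
    along the homotopy to the elliptic path, where it is the sum of the angles.

    (ii) A timelike curve to [w] must reach a [P] with [P v = - v].  The shears
    [1 + s omega0 (v, .) v] commute with [P]; conjugating the part of the curve before [P] by them
    and letting [s] tend to infinity gives homotopic timelike curves of unbounded length. *)
Require Import Defs.
From HB Require Import structures.
From mathcomp Require Import all_boot all_order all_algebra.
From mathcomp Require Import fingroup perm.
From mathcomp Require Import all_classical all_reals all_analysis.
From mathcomp Require Import complex spectral ring lra zify.
Import Order.TTheory GRing.Theory Num.Theory.
Import numFieldNormedType.Exports.
Set Implicit Arguments.
Unset Strict Implicit.
Unset Printing Implicit Defensive.
Local Open Scope ring_scope.

(** Eigenvalues collide along a curve and cannot be followed smoothly, so the arguments use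
    symmetric quantities. The sum of the angles is differentiated through polynomials in [W]; these
    approximate [arccos] uniformly only away from [1] and [-1], so the length is bounded on [[a, 1]]
    and then [a] tends to [0]. The factor [1 + i eta J] is there because [det (1 + W)] is real and
    vanishes at a crossing, where it has no argument. For small [eta > 0] the Krein form strictly
    decreases under [W (1 + i eta J)], which keeps eigenvalues off the unit circle; the argument
    then moves at a speed of order [1 / eta] during a time [eta], so its drop survives as [eta]
    tends to [0]. Continuity in the eigenvalues is obtained along ultrafilters, where all labelled
    roots converge at once. In the push, a steady right rotation makes the velocity definite, and a
    larger backward left rotation, paid for on a short interval where the velocity is already
    definite, keeps the endpoint off the eigenvalue [-1]. In (ii), commutation with [P] is what lets
    the conjugated beginning join the unchanged end. *)

(** * Spectral mapping over an algebraically closed field *)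

Section Triangular.
Variable C : comNzRingType.

Lemma trig_mulmx m (A B : 'M[C]_m) : is_trig_mx A -> is_trig_mx B ->
  is_trig_mx (A *m B) /\ forall i, (A *m B) i i = A i i * B i i.
Proof.
move=> /is_trig_mxP tA /is_trig_mxP tB; split.
  apply/is_trig_mxP => i j ij; rewrite mxE big1 // => k _.
  case: (ltnP i k) => ik; first by rewrite tA ?mul0r.
  by rewrite (tB k j) ?mulr0 // (leq_ltn_trans ik).
move=> i; rewrite mxE (bigD1 i) //= big1 ?addr0 // => k ki.
case: (ltngtP i k) => ik; first by rewrite tA ?mul0r.
  by rewrite (tB k i) ?mulr0.
by move: ki; rewrite -(val_inj ik) eqxx.
Qed.

Lemma trig_horner m (A : 'M[C]_m.+1) (f : {poly C}) : is_trig_mx A ->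
  is_trig_mx (horner_mx A f) /\ forall i, (horner_mx A f) i i = f.[A i i].
Proof.
move=> tA; elim/poly_ind: f => [|f c [tf df]].
  by rewrite rmorph0; split => [|i]; [exact: mx0_is_trig | rewrite mxE horner0].
rewrite rmorphD rmorphM /= horner_mx_X horner_mx_C.
have [t d] := trig_mulmx tf tA; split=> [|i].
  apply/is_trig_mxP => i j ij; rewrite mxE (is_trig_mxP t) // mxE.
  by rewrite -val_eqE /= ltn_eqF // mulr0n addr0.
by rewrite mxE [X in X + _]d df mxE eqxx mulr1n hornerMXaddC.
Qed.

Lemma char_poly_eval m (A : 'M[C]_m) a : (char_poly A).[a] = \det (a%:M - A).
Proof.
rewrite /char_poly -horner_evalE -det_map_mx; congr (\det _).
apply/matrixP => i j; rewrite !mxE /= horner_evalE hornerD hornerN hornerC.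
by case: (i == j); rewrite ?mulr1n ?mulr0n ?hornerX ?horner0.
Qed.

Lemma char_poly_tr m (A : 'M[C]_m) : char_poly A^T = char_poly A.
Proof.
rewrite /char_poly -det_tr; congr (\det _); apply/matrixP => i j.
by rewrite !mxE eq_sym.
Qed.

End Triangular.

Lemma char_poly_similar (K : fieldType) m (P A : 'M[K]_m) : P \in unitmx ->
  char_poly (P *m A *m invmx P) = char_poly A.
Proof.
move=> uP; rewrite /char_poly /char_poly_mx.
pose p := map_mx (@polyC K) P; pose q := map_mx (@polyC K) (invmx P).
have pq : p *m q = 1%:M by rewrite -map_mxM mulmxV // map_mx1.
have -> : 'X%:M - map_mx (@polyC K) (P *m A *m invmx P) =
          p *m ('X%:M - map_mx (@polyC K) A) *m q.
  rewrite mulmxBr mulmxBl !map_mxM -/p -/q; congr (_ - _).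
  by rewrite scalar_mxC -mulmxA pq mulmx1.
rewrite !det_mulmx mulrC mulrA -det_mulmx.
by rewrite (mulmx1C pq) det1 mul1r.
Qed.

Section SpectralMapping.
Variables (C : numClosedFieldType) (m : nat) (A : 'M[C]_m.+1) (s : seq C).
Hypothesis chA : char_poly A = \prod_(x <- s) ('X - x%:P).

Lemma triangularize : exists P T : 'M[C]_m.+1, [/\ P \in unitmx,
  A = invmx P *m T *m P, is_trig_mx T & perm_eq s [seq T i i | i <- enum 'I_m.+1]].
Proof.
have [P uP tP] := Schur A (ltn0Sn m).
have Pu : P \in unitmx by exact: unitarymx_unit.
exists P, (P *m A *m invmx P); split=> //.
- by rewrite !mulmxA mulVmx // mul1mx -!mulmxA mulVmx // mulmx1.
- by move: tP; rewrite /similar_to conjumx.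
apply: prod_XsubC_eq; rewrite -chA -(char_poly_similar A Pu) char_poly_trig.
  by rewrite big_map enumT.
by move: tP; rewrite /similar_to conjumx.
Qed.

Lemma trace_horner (f : {poly C}) : \tr (horner_mx A f) = \sum_(x <- s) f.[x].
Proof.
have [P [T [uP -> tT sT]]] := triangularize.
rewrite horner_mx_uconjC // mxtrace_mulC mulmxA mulmxV // mul1mx.
rewrite (perm_big _ sT) big_map enumT /mxtrace; apply: eq_bigr => i _.
by have [_ ->] := trig_horner f tT.
Qed.

Lemma det_horner (f : {poly C}) : \det (horner_mx A f) = \prod_(x <- s) f.[x].
Proof.
have [P [T [uP -> tT sT]]] := triangularize.
rewrite horner_mx_uconjC // !det_mulmx mulrAC -det_mulmx mulVmx // det1 mul1r.
have [tf df] := trig_horner f tT.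
rewrite det_trig // (perm_big _ sT) big_map enumT; apply: eq_bigr => i _.
by rewrite df.
Qed.

End SpectralMapping.

(** Factoring [E] through its row and column bases, idempotence and cancellation give
    [row_base E *m col_base E = 1], an identity matrix whose size is the rank; the trace allows the
    two factors to be exchanged. *)
Lemma mxrank_idem (K : fieldType) m (E : 'M[K]_m) : E *m E = E ->
  (\rank E)%:R = \tr E.
Proof.
move=> EE; have cE := mulmx_base E.
have fR : row_free (row_base E) := row_base_free E.
have fC : row_full (col_base E) := col_base_full E.
have RC : row_base E *m col_base E = 1%:M.
  apply: (row_free_inj fR); apply: (row_full_inj fC).
  have EE' : col_base E *m row_base E *m (col_base E *m row_base E) = col_base E *m row_base E by rewrite cE.
  by rewrite mul1mx -[RHS]EE' !mulmxA.
by rewrite -[in RHS]cE mxtrace_mulC RC mxtrace1.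
Qed.

Lemma root_prod_XsubC_disjoint (K : fieldType) (s t : seq K) :
  {in s, forall x, x \notin t} ->
  coprimep (\prod_(x <- s) ('X - x%:P)) (\prod_(x <- t) ('X - x%:P)).
Proof.
move=> st; rewrite big_seq; apply: (big_ind (fun p => coprimep p _)).
- exact: coprime1p.
- by move=> p q cp cq; rewrite coprimepMl cp.
- by move=> x xs; rewrite coprimep_sym coprimep_XsubC root_prod_XsubC st.
Qed.

(** A Bezout relation [u g + v h = 1] makes [v h], evaluated at [A], a projection onto the kernel of
    [g]. Its rank is its trace, and by spectral mapping the trace sums [1] over [s] and [0] over
    [t]. *)
Lemma mxrank_ker_prod (C : numClosedFieldType) m (A : 'M[C]_m.+1) (s t : seq C) :
  char_poly A = \prod_(x <- s ++ t) ('X - x%:P) ->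
  {in s, forall x, x \notin t} ->
  \rank (kermx (horner_mx A (\prod_(x <- s) ('X - x%:P)))) = size s.
Proof.
move=> chA st; set g := \prod_(x <- s) _; set h := \prod_(x <- t) ('X - x%:P).
have chgh : char_poly A = g * h by rewrite chA big_cat.
have [[u v] /= uv] : exists uv : {poly C} * {poly C}, uv.1 * g + uv.2 * h = 1.
  have /Bezout_eq1_coprimepP [uv] := root_prod_XsubC_disjoint st.
  by exists uv.
pose E := horner_mx A (v * h).
have gh0 : horner_mx A (h * g) = 0.
  by rewrite mulrC -chgh Cayley_Hamilton.
have E1 : E = 1 - horner_mx A (u * g).
  by rewrite -[1](rmorph1 (horner_mx A)) -uv rmorphD /= addrC addKr.
have Eg : E *m horner_mx A g = 0.
  rewrite -[_ *m _]/(E * _) -rmorphM -mulrA rmorphM [X in _ * X]gh0.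
  by rewrite mulr0.
have EE : E *m E = E.
  rewrite {2}E1 mulmxBr mulmx1 -[X in _ - X]/(E * _) -rmorphM.
  have -> : v * h * (u * g) = (h * g) * (u * v) by ring.
  by rewrite (rmorphM (horner_mx A) (h * g)) /= gh0 mul0r subr0.
have -> : \rank (kermx (horner_mx A g)) = \rank E.
  apply/eqmx_rank/andP; split; last by apply/sub_kermxP.
  apply/row_subP => i; set x := row _ _.
  have xg : x *m horner_mx A g = 0.
    by apply/sub_kermxP; rewrite row_sub.
  have -> : x = x *m E.
    by rewrite E1 mulmxBr mulmx1 [u * g]mulrC rmorphM [X in _ - X]mulmxA xg mul0mx subr0.
  exact: submxMl.
apply/eqP; rewrite -(eqr_nat C) mxrank_idem // (trace_horner chA) big_cat /=.
rewrite [X in X + _]big_seq [X in _ + X]big_seq [X in _ + X]big1.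
  rewrite addr0 (eq_bigr (fun=> 1)).
    by rewrite -big_seq big_const_seq count_predT iter_addr_0.
  move=> x xs; have /(congr1 (fun p => p.[x])) := uv.
  rewrite !hornerE (_ : g.[x] = 0) ?mulr0 ?add0r //.
  by apply/rootP; rewrite root_prod_XsubC.
move=> x xt; rewrite hornerM (_ : h.[x] = 0) ?mulr0 //.
by apply/rootP; rewrite root_prod_XsubC.
Qed.

(** * Real quadratic forms, pencils and determinant inequalities *)

Section QuadraticForms.
Variable R : realType.
Local Notation C := R[i].
Local Notation toC := (real_complex R).

Definition qform m (S : 'M[R]_m) (u : 'cV[R]_m) : R := (u^T *m S *m u) 0 0.

Lemma qformD m (S T : 'M[R]_m) u : qform (S + T) u = qform S u + qform T u.
Proof. by rewrite /qform mulmxDr mulmxDl mxE. Qed.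

Lemma qformZ m (S : 'M[R]_m) a u : qform (a *: S) u = a * qform S u.
Proof. by rewrite /qform -scalemxAr -scalemxAl mxE. Qed.

Lemma qform1 m (u : 'cV[R]_m) : qform 1%:M u = \sum_i u i 0 ^+ 2.
Proof. by rewrite /qform mulmx1 mxE; apply: eq_bigr => i _; rewrite mxE expr2. Qed.

Lemma qform1_gt0 m (u : 'cV[R]_m) : u != 0 -> 0 < qform 1%:M u.
Proof.
move=> u0; rewrite qform1 lt_def sumr_ge0 ?andbT => [|i _]; last exact: sqr_ge0.
apply: contra u0; rewrite psumr_eq0 => [/allP a|i _]; last exact: sqr_ge0.
apply/eqP/matrixP => i j; rewrite ord1 mxE; apply/eqP.
by rewrite -sqrf_eq0; apply: (implyP (a i _)); rewrite ?mem_index_enum.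
Qed.

Definition posdef m (S : 'M[R]_m) := forall u, u != 0 -> 0 < qform S u.

Lemma posdef_ge0 m (S : 'M[R]_m) u : posdef S -> 0 <= qform S u.
Proof.
move=> pS; have [->|/pS/ltW //] := eqVneq u 0.
by rewrite /qform mulmx0 mxE.
Qed.

Lemma posdef_unit m (S : 'M[R]_m) : posdef S -> S \in unitmx.
Proof.
move=> pS; rewrite -row_free_unit -kermx_eq0; apply/eqP/row_matrixP => i.
rewrite row0; apply/eqP/negP => /negP ne.
have nz : (row i (kermx S))^T != 0.
  by apply: contra ne => /eqP e; rewrite -[row _ _]trmxK e trmx0.
have := pS _ nz; rewrite /qform trmxK.
have -> : row i (kermx S) *m S = 0 by apply/sub_kermxP; rewrite row_sub.
by rewrite mul0mx mxE ltxx.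
Qed.

Lemma complex_row_split m (v : 'rV[C]_m) :
  v = map_mx toC (map_mx (@complex.Re R) v) +
      'i%C *: map_mx toC (map_mx (@complex.Im R) v).
Proof. by apply/matrixP => i j; rewrite !mxE [LHS]complexE. Qed.

Lemma herm_complex_row m (S : 'M[R]_m) (a b : 'rV[R]_m) : S^T = S ->
  (map_mx toC a + 'i%C *: map_mx toC b) *m map_mx toC S *m
  (map_mx toC a - 'i%C *: map_mx toC b)^T =
  (toC (qform S a^T + qform S b^T))%:M.
Proof.
move=> sS; apply/matrixP => i j; rewrite !ord1 /= [RHS]mxE eqxx mulr1n.
rewrite linearB /= linearZ /= mulmxBr !mulmxDl -!scalemxAl -!scalemxAr !map_trmx.
rewrite -!map_mxM /= /qform !trmxK rmorphD /=.
have e : (b *m S *m a^T) 0 0 = (a *m S *m b^T) 0 0.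
  have <- : (b *m S *m a^T)^T 0 0 = (b *m S *m a^T) 0 0 by rewrite [LHS]mxE.
  by rewrite !trmx_mul trmxK sS mulmxA.
have mE (X : 'M[R]_1) : (map_mx toC X) 0 0 = toC (X 0 0) by rewrite mxE.
have E (X Y Z T : 'M[C]_1) : (X + 'i%C *: Y - ('i%C *: Z + 'i%C *: ('i%C *: T))) 0 0
   = X 0 0 + 'i%C * Y 0 0 - ('i%C * Z 0 0 + 'i%C * ('i%C * T 0 0)) by rewrite !mxE.
rewrite E !mE e mulrA -expr2 sqr_i; ring.
Qed.

(** An eigenvector [a + i b] of the pencil, paired with its conjugate, gives real values of both
    forms, so its eigenvalue is their real quotient. The vectors [a] and [b] are recorded so that
    the sign of [T] can decide the sign of [x]. *)
Lemma pencil_roots m (S T : 'M[R]_m) :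
  S^T = S -> T^T = T -> posdef S ->
  exists s : seq R, [/\ size s = m,
    char_poly (invmx S *m T) = \prod_(x <- s) ('X - x%:P) &
    forall x, x \in s -> exists a b : 'cV[R]_m, (a != 0) || (b != 0) /\
      qform T a + qform T b = x * (qform S a + qform S b)].
Proof.
move=> sS sT pS; have uS := posdef_unit pS.
pose M := invmx S *m T.
have [r Er] := closed_field_poly_normal (char_poly (map_mx toC M)).
have mon : lead_coef (char_poly (map_mx toC M)) = 1.
  by apply/monicP; exact: char_poly_monic.
rewrite mon scale1r in Er.
have key z : z \in r -> exists x, z = toC x /\ (exists a b : 'cV[R]_m,
    (a != 0) || (b != 0) /\ qform T a + qform T b = x * (qform S a + qform S b)).
  move=> zr; have : root (char_poly (map_mx toC M)) z.
    by rewrite Er root_prod_XsubC.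
  rewrite -char_poly_tr -eigenvalue_root_char => /eigenvalueP [v vM v0].
  have vT : v *m map_mx toC T = z *: (v *m map_mx toC S).
    move: vM; rewrite map_trmx trmx_mul sT trmx_inv sS map_mxM mulmxA map_invmx.
    move=> /(congr1 (fun X => X *m map_mx toC S)).
    by rewrite mulmxKV ?map_unitmx // scalemxAl.
  have vs := complex_row_split v.
  set a := map_mx (@complex.Re R) v in vs; set b := map_mx (@complex.Im R) v in vs.
  pose w := (map_mx toC a - 'i%C *: map_mx toC b)^T.
  have ab0 : (a != 0) || (b != 0).
    rewrite -negb_and; apply: contra v0 => /andP[/eqP a0 /eqP b0].
    by rewrite vs a0 b0 !map_mx0 scaler0 addr0.
  have pos : 0 < qform S a^T + qform S b^T.
    have nz (u : 'rV[R]_m) : u != 0 -> u^T != 0.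
      by apply: contra => /eqP e; rewrite -[u]trmxK e trmx0.
    case/orP: ab0 => /nz/pS p.
      by rewrite ltr_wpDr // posdef_ge0.
    by rewrite ltr_wpDl // posdef_ge0.
  have /matrixP/(_ 0 0) : v *m map_mx toC T *m w = z *: (v *m map_mx toC S *m w).
    by rewrite vT -scalemxAl.
  rewrite {1 2}vs !herm_complex_row // !mxE !mulr1n => e.
  exists ((qform T a^T + qform T b^T) / (qform S a^T + qform S b^T)); split.
    rewrite rmorphM fmorphV /= e mulfK //.
    by rewrite (fmorph_eq0 (real_complex R)) gt_eqF.
  exists a^T, b^T; split; last by rewrite divfK // gt_eqF.
  case/orP: ab0 => h; apply/orP; [left|right];
    by apply: contra h => /eqP e'; rewrite -[X in X == _]trmxK e' trmx0.
have [s rs] : exists s : seq R, r = map toC s.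
  exists (map (@complex.Re R) r); rewrite -map_comp -[LHS]map_id.
  by apply/eq_in_map => z /key [x [-> _]].
have chM : char_poly M = \prod_(x <- s) ('X - x%:P).
  apply: (map_poly_inj (real_complex R)).
  rewrite map_char_poly Er rs big_map rmorph_prod; apply: eq_bigr => x _.
  by rewrite rmorphB /= map_polyX map_polyC.
exists s; split=> //.
  have := size_char_poly M; rewrite chM size_prod_XsubC; by case.
move=> x xs; have xr : toC x \in r by rewrite rs map_f.
by have [y [/complexI -> ab]] := key _ xr.
Qed.

Lemma det_pencil m (S T : 'M[R]_m) s : S \in unitmx -> size s = m ->
  char_poly (invmx S *m T) = \prod_(x <- s) ('X - x%:P) ->
  \det T = \det S * \prod_(x <- s) x.
Proof.
move=> uS ss ch; have := char_poly_det (invmx S *m T).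
rewrite det_mulmx det_inv -horner_coef0 ch horner_prod => /esym.
rewrite (eq_bigr (fun x => (-1) * x)); last by move=> x _; rewrite !hornerE; ring.
rewrite big_split /= big_const_seq count_predT ss iter_mulr_1 => /mulfI <- //.
  by rewrite mulrA mulfV ?mul1r // -unitfE -unitmxE.
by rewrite expf_neq0 // oppr_eq0 oner_eq0.
Qed.

Lemma det_pencil_add m (S T : 'M[R]_m) s : S \in unitmx -> size s = m ->
  char_poly (invmx S *m T) = \prod_(x <- s) ('X - x%:P) ->
  \det (S + T) = \det S * \prod_(x <- s) (1 + x).
Proof.
move=> uS ss ch; have := char_poly_eval (invmx S *m T) (-1).
have -> : ((-1)%:M - invmx S *m T) = - (invmx S *m (S + T)).
  have -> : (-1)%:M = - 1%:M :> 'M[R]_m by apply/matrixP => i j; rewrite !mxE mulNrn.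
  by rewrite mulmxDr mulVmx // opprD.
rewrite -[X in \det X]scaleN1r detZ det_mulmx det_inv ch horner_prod => /esym.
rewrite (eq_bigr (fun x => (-1) * (1 + x))); last by move=> x _; rewrite !hornerE; ring.
rewrite big_split /= big_const_seq count_predT ss iter_mulr_1 => /mulfI <- //.
  by rewrite mulrA mulfV ?mul1r // -unitfE -unitmxE.
by rewrite expf_neq0 // oppr_eq0 oner_eq0.
Qed.

Lemma trace_char_poly m (M : 'M[R]_m) s : (0 < m)%N ->
  char_poly M = \prod_(x <- s) ('X - x%:P) -> size s = m ->
  \tr M = \sum_(x <- s) x.
Proof.
move=> m0 ch ss; apply: oppr_inj; rewrite -char_poly_trace // ch -ss.
by rewrite coefPn_prod_XsubC // -lt0n ss.
Qed.

Lemma posdef1 m : posdef (1%:M : 'M[R]_m).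
Proof. by move=> u; exact: qform1_gt0. Qed.

Lemma pencil_pos m (S T : 'M[R]_m) : S^T = S -> T^T = T -> posdef S -> posdef T ->
  exists s : seq R, [/\ size s = m,
    char_poly (invmx S *m T) = \prod_(x <- s) ('X - x%:P) & {in s, forall x, 0 < x}].
Proof.
move=> sS sT pS pT; have [s [ss ch ev]] := pencil_roots sS sT pS.
exists s; split=> // x /ev [a [b [ab e]]].
have p (U : 'M[R]_m) : posdef U -> 0 < qform U a + qform U b.
  move=> pU; case/orP: ab => /pU h.
    by rewrite ltr_wpDr // posdef_ge0.
  by rewrite ltr_wpDl // posdef_ge0.
by rewrite -(pmulr_lgt0 _ (p _ pS)) -e p.
Qed.

Lemma pencil_ge0 m (S T : 'M[R]_m) : S^T = S -> T^T = T -> posdef S ->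
  (forall u, 0 <= qform T u) ->
  exists s : seq R, [/\ size s = m,
    char_poly (invmx S *m T) = \prod_(x <- s) ('X - x%:P) & {in s, forall x, 0 <= x}].
Proof.
move=> sS sT pS pT; have [s [ss ch ev]] := pencil_roots sS sT pS.
exists s; split=> // x /ev [a [b [ab e]]].
have p : 0 < qform S a + qform S b.
  case/orP: ab => /pS h.
    by rewrite ltr_wpDr // posdef_ge0.
  by rewrite ltr_wpDl // posdef_ge0.
by rewrite -(pmulr_lge0 _ p) -e addr_ge0.
Qed.

Lemma posdef_det_gt0 m (S : 'M[R]_m) : S^T = S -> posdef S -> 0 < \det S.
Proof.
move=> sS pS; have [s [ss ch s0]] := pencil_pos (trmx1 _ _) sS (@posdef1 m) pS.
rewrite (det_pencil (unitmx1 _ _) ss ch) det1 mul1r big_seq.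
exact: prodr_gt0.
Qed.

Lemma prod_1D_ge (s : seq R) : {in s, forall x, 0 <= x} ->
  1 + \sum_(x <- s) x <= \prod_(x <- s) (1 + x) /\ 0 <= \sum_(x <- s) x.
Proof.
elim: s => [|x s IH] h; first by rewrite !big_nil addr0.
have [i1 i2] := IH (fun y ys => h y (mem_behead (s := x :: s) ys)).
have x0 := h x (mem_head _ _); rewrite !big_cons; split; last exact: addr_ge0.
have : 0 <= x * \sum_(j <- s) j by exact: mulr_ge0.
have : x * (1 + \sum_(j <- s) j) <= x * \prod_(j <- s) (1 + j) by exact: ler_wpM2l.
nra.
Qed.

(** The eigenvalues [x] of the pencil are nonnegative, so [det (S + T) / det S] is the product of
    the [1 + x], at least [1] plus their sum. The second bound makes [G] monotone; the first, with
    [S] the identity, turns a large trace into a large determinant. *)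
Lemma det_posdefD_ge m (S T : 'M[R]_m) : (0 < m)%N ->
  S^T = S -> T^T = T -> posdef S -> (forall u, 0 <= qform T u) ->
  \det S * (1 + \tr (invmx S *m T)) <= \det (S + T) /\
  \det S <= \det (S + T).
Proof.
move=> m0 sS sT pS pT; have [s [ss ch s0]] := pencil_ge0 sS sT pS pT.
have dS := posdef_det_gt0 sS pS; have uS := posdef_unit pS.
rewrite (det_pencil_add uS ss ch) (trace_char_poly m0 ch ss).
have [h1 h2] := prod_1D_ge s0.
split; first by rewrite ler_pM2l.
by rewrite ler_peMr ?(ltW dS) // (le_trans _ h1) // lerDl.
Qed.

Lemma posdef_inv m (S : 'M[R]_m) : S^T = S -> posdef S ->
  (invmx S)^T = invmx S /\ posdef (invmx S).
Proof.
move=> sS pS; have uS := posdef_unit pS.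
have sI : (invmx S)^T = invmx S by rewrite trmx_inv sS.
split=> // u u0; have : invmx S *m u != 0.
  by apply: contra u0 => /eqP e; rewrite -[u](mulKVmx uS) e mulmx0.
by move/pS; rewrite /qform trmx_mul sI -!mulmxA mulKVmx // mulmxA.
Qed.

(** The eigenvalues of [N *m S] are those of the pencil formed by the inverse of [N] and [S], hence
    positive; the claim compares their geometric and arithmetic means. *)
Lemma trace_det_AMGM m (N S : 'M[R]_m) : (0 < m)%N ->
  N^T = N -> S^T = S -> posdef N -> posdef S ->
  0 < \tr (N *m S) /\ \det N * \det S <= (\tr (N *m S) / m%:R) ^+ m.
Proof.
move=> m0 sN sS pN pS; have [sI pI] := posdef_inv sN pN.
have [s [ss ch s0]] := pencil_pos sI sS pI pS.
rewrite invmxK in ch; have uI := posdef_unit pI.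
have uN := posdef_unit pN.
have := det_pencil uI ss; rewrite invmxK => /(_ _ ch).
rewrite det_inv => ->; rewrite mulrA mulfV ?mul1r; last by rewrite -unitfE -unitmxE.
rewrite (trace_char_poly m0 ch ss); split.
  case: s ss s0 {ch} => [|x s]; first by move=> /= e; rewrite -e in m0.
  move=> _ s0; rewrite big_cons ltr_pwDl ?s0 ?mem_head //.
  by rewrite big_seq sumr_ge0 // => y ys; rewrite ltW // s0 // inE ys orbT.
have h := leif_AGM (A := 'I_(size s)) (E := tnth (in_tuple s)).
have [|+ _] := h; first by move=> i _; rewrite ltW // s0 // mem_tnth.
by rewrite card_ord => h2; rewrite -ss !(big_tnth _ _ s).
Qed.

End QuadraticForms.

(** * Symplectic linear algebra and the function [G] *)

Section Symplectic.
Variables (R : realType) (n : nat).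
Local Notation M := 'M[R]_(n + n).
Local Notation V := 'cV[R]_(n + n).
Local Notation J := (J0 R n).

Lemma trJ : J^T = - J.
Proof.
by rewrite /J0 tr_block_mx !trmx0 linearN /= !trmx1 opp_block_mx !oppr0 opprK.
Qed.

Lemma JJ : J *m J = -1%:M.
Proof.
rewrite /J0 mulmx_block !(mul0mx, mulmx0, mulmx1, mul1mx, mulNmx, add0r, addr0, oppr0).
by rewrite [in RHS]scalar_mx_block opp_block_mx !oppr0.
Qed.

Lemma detJ : \det J = 1.
Proof.
pose U : M := block_mx 1%:M (- 1%:M) 0 1%:M; pose L : M := block_mx 1%:M 0 1%:M 1%:M.
have -> : J = U *m L *m U.
  rewrite /J0 /U /L !mulmx_block.
  by rewrite !(mulmx1, mul1mx, mulmx0, mul0mx, mulmxN, mulNmx, add0r, addr0, subrr, oppr0, addNr).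
by rewrite !det_mulmx /U /L det_ublock det_lblock !det1 !mulr1.
Qed.

Lemma omegaE (u v : V) : omega0 u v = (u^T *m J^T *m v) 0 0.
Proof.
rewrite trJ mulmxN mulNmx mxE /omega0 -[u]vsubmxK -[v]vsubmxK.
set a := usubmx u; set b := dsubmx u; set c := usubmx v; set d := dsubmx v.
rewrite tr_col_mx /J0 mul_row_block !(mulmx0, mulmx1, mulmxN, add0r, addr0).
rewrite mul_row_col mulNmx mxE [X in _ + X]mxE ![(_ *m _) _ _]mxE opprD opprK.
rewrite [RHS]addrC -sumrB; apply: eq_bigr => j _.
by rewrite !col_mxEu !col_mxEd !mxE.
Qed.

Lemma omegaD (u v w : V) : omega0 u (v + w) = omega0 u v + omega0 u w.
Proof. by rewrite !omegaE mulmxDr mxE. Qed.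
Lemma omegaDl (u v w : V) : omega0 (u + v) w = omega0 u w + omega0 v w.
Proof. by rewrite !omegaE linearD /= !mulmxDl mxE. Qed.
Lemma omegaZ a (u v : V) : omega0 u (a *: v) = a * omega0 u v.
Proof. by rewrite !omegaE -scalemxAr mxE. Qed.
Lemma omegaZl a (u v : V) : omega0 (a *: u) v = a * omega0 u v.
Proof. by rewrite !omegaE linearZ /= -!scalemxAl mxE. Qed.
Lemma omegaN (u v : V) : omega0 u (- v) = - omega0 u v.
Proof. by rewrite -scaleN1r omegaZ mulN1r. Qed.
Lemma omegaNl (u v : V) : omega0 (- u) v = - omega0 u v.
Proof. by rewrite -scaleN1r omegaZl mulN1r. Qed.
Lemma omegaC (u v : V) : omega0 u v = - omega0 v u.
Proof.
rewrite /omega0 -sumrN; apply: eq_bigr => j _.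
by rewrite [RHS]opprB ![_ * u _ _]mulrC.
Qed.
Lemma omegaxx (u : V) : omega0 u u = 0.
Proof. by apply/eqP; rewrite -[_ == 0](@mulrn_eq0 _ _ 2) mulr2n {2}omegaC subrr. Qed.
Lemma omega0r (u : V) : omega0 u 0 = 0.
Proof. by rewrite omegaE mulmx0 mxE. Qed.

Lemma omegaJ (u v : V) : omega0 u (J *m v) = (u^T *m v) 0 0.
Proof. by rewrite omegaE -!mulmxA (mulmxA J^T) trJ mulNmx JJ opprK mul1mx. Qed.

Lemma sympE (W : M) : symplectic W <-> W^T *m J *m W = J.
Proof.
have e (u v : V) : omega0 (W *m u) (W *m v) = - (u^T *m (W^T *m J *m W) *m v) 0 0.
  by rewrite omegaE trmx_mul trJ mulmxN mulNmx mxE !mulmxA.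
have e' (u v : V) : omega0 u v = - (u^T *m J *m v) 0 0.
  by rewrite omegaE trJ mulmxN mulNmx mxE.
split=> h; last by move=> u v; rewrite e e' h.
apply/matrixP => i j; have := h (delta_mx i 0) (delta_mx j 0).
by rewrite e e' => /oppr_inj; rewrite !trmx_delta -!rowE -!colE !mxE.
Qed.

Lemma symp_mul (A B : M) : symplectic A -> symplectic B -> symplectic (A *m B).
Proof. by move=> sA sB u v; rewrite -!mulmxA sA sB. Qed.

(** The inverse of a symplectic matrix, written as a polynomial in its entries: it stays continuous
    and differentiable along a curve even at times where [W] is not known to be symplectic. *)
Definition sinv (W : M) : M := - (J *m W^T *m J).

Lemma symp_inv (W : M) : symplectic W ->
  [/\ W \in unitmx, invmx W = sinv W & symplectic (sinv W)].
Proof.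
move=> sW; have /sympE h := sW.
have l : sinv W *m W = 1%:M by rewrite /sinv mulNmx -!mulmxA (mulmxA W^T) h JJ opprK.
have [_ u] := mulmx1_unit l.
have e : invmx W = sinv W by rewrite -[LHS]mul1mx -l mulmxK.
split=> // x y; rewrite -{2}[x](mulKVmx u) -{2}[y](mulKVmx u) e.
by rewrite sW.
Qed.

Lemma symp_omega_inv (W : M) (u v : V) : symplectic W ->
  omega0 u (W *m v) = omega0 (invmx W *m u) v.
Proof.
by move=> sW; have [uW _ _] := symp_inv sW; rewrite -{1}[u](mulKVmx uW) sW.
Qed.

(** The one-parameter group [exp (a J)]: with [J] as multiplication by [i], this is multiplication
    by [e^(i a)]. *)
Definition Rot (a : R) : M := (cos a)%:M + sin a *: J.

Lemma Rot0 : Rot 0 = 1%:M.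
Proof. by rewrite /Rot cos0 sin0 scale0r addr0. Qed.

Lemma RotD a b : Rot a *m Rot b = Rot (a + b).
Proof.
apply/matrixP => i j; rewrite /Rot mulmxDl !mulmxDr !mul_scalar_mx -!scalemxAl.
rewrite mul_mx_scalar -scalemxAr JJ cosD sinD.
rewrite !mxE; case: (i == j); rewrite ?mulr1n ?mulr0n ?mulr1 ?mulr0 ?oppr0; ring.
Qed.

Lemma RotN a : Rot a *m Rot (- a) = 1%:M.
Proof. by rewrite RotD subrr Rot0. Qed.

Lemma RotJ a : Rot a *m J = J *m Rot a.
Proof.
by rewrite /Rot mulmxDl mulmxDr mul_scalar_mx mul_mx_scalar -scalemxAl -scalemxAr.
Qed.

Lemma Rot_symp a : symplectic (Rot a).
Proof.
apply/sympE; have -> : (Rot a)^T = Rot (- a).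
  by rewrite /Rot linearD /= tr_scalar_mx linearZ /= trJ cosN sinN scalerN scaleNr.
by rewrite RotJ -mulmxA RotD addNr Rot0 mulmx1.
Qed.

Lemma omega_Rot (x : V) a : omega0 x (Rot a *m x) = sin a * qform 1%:M x.
Proof.
rewrite /Rot mulmxDl mul_scalar_mx omegaD omegaZ omegaxx mulr0 add0r.
by rewrite -scalemxAl omegaZ omegaJ /qform mulmx1.
Qed.

Definition sform (X : M) : M := J^T *m X.

Lemma omega_qform (X : M) u : omega0 u (X *m u) = qform (sform X) u.
Proof. by rewrite omegaE /qform /sform !mulmxA. Qed.

Lemma det_sform X : \det (sform X) = \det X.
Proof. by rewrite det_mulmx det_tr detJ mul1r. Qed.

Lemma spE (X : M) : sp X <-> (sform X)^T = sform X.
Proof.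
have e (u v : V) : omega0 u (X *m v) = (u^T *m sform X *m v) 0 0.
  by rewrite omegaE /sform !mulmxA.
have e' (u v : V) : omega0 v (X *m u) = (u^T *m (sform X)^T *m v) 0 0.
  have -> : (u^T *m (sform X)^T *m v) 0 0 = (u^T *m (sform X)^T *m v)^T 0 0 by rewrite [RHS]mxE.
  by rewrite !trmx_mul !trmxK e mulmxA.
split=> h; last by move=> u v; rewrite e e' h.
apply/matrixP => i j; have := h (delta_mx i 0) (delta_mx j 0).
by rewrite e e' !trmx_delta -!rowE -!colE !mxE => ->.
Qed.

Lemma sp_plusE X : @sp_plus R n X <-> (sform X)^T = sform X /\ posdef (sform X).
Proof.
split=> -[h1 h2]; split; try exact/spE.
  by move=> u u0; rewrite -omega_qform h2.
by move=> u u0; rewrite omega_qform h2.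
Qed.

(** The cone of semidefinite forms. It contains the closure of [sp_plus], and its stability under
    sums and conjugation is immediate. *)
Definition psd (X : M) := sp X /\ forall u : V, 0 <= omega0 u (X *m u).

Lemma sp_plus_psd X : @sp_plus R n X -> psd X.
Proof.
by move=> X0; split=> [|u]; [case: X0 | rewrite omega_qform posdef_ge0; case/sp_plusE: X0].
Qed.

Lemma spD X Y : @sp R n X -> sp Y -> sp (X + Y).
Proof. by move=> hX hY u v; rewrite !mulmxDl !omegaD hX hY. Qed.
Lemma spZ a X : @sp R n X -> sp (a *: X).
Proof. by move=> hX u v; rewrite -!scalemxAl !omegaZ hX. Qed.
Lemma sp_conj W X : symplectic W -> @sp R n X -> sp (W *m X *m invmx W).
Proof. by move=> sW hX u v; rewrite -!mulmxA !(symp_omega_inv _ _ sW) hX. Qed.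

Lemma sp_plus_add X Y : @sp_plus R n X -> psd Y -> sp_plus (X + Y).
Proof.
move=> [h1 h2] [k1 k2]; split; first exact: spD.
by move=> u u0; rewrite mulmxDl omegaD ltr_pwDl ?h2.
Qed.
Lemma sp_plusZ a X : 0 < a -> @sp_plus R n X -> sp_plus (a *: X).
Proof.
move=> a0 [h1 h2]; split; first exact: spZ.
by move=> u u0; rewrite -scalemxAl omegaZ mulr_gt0 ?h2.
Qed.
Lemma psdD X Y : psd X -> psd Y -> psd (X + Y).
Proof.
move=> [h1 h2] [k1 k2]; split; first exact: spD.
by move=> u; rewrite mulmxDl omegaD addr_ge0.
Qed.
Lemma psdZ a X : 0 <= a -> psd X -> psd (a *: X).
Proof.
move=> a0 [h1 h2]; split; first exact: spZ.
by move=> u; rewrite -scalemxAl omegaZ mulr_ge0.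
Qed.
Lemma sp_plus_conj W X : symplectic W -> @sp_plus R n X ->
  sp_plus (W *m X *m invmx W).
Proof.
move=> sW [h1 h2]; split; first exact: sp_conj.
move=> u u0; rewrite -!mulmxA (symp_omega_inv _ _ sW) h2 //.
have [uW _ _] := symp_inv sW.
by apply: contra u0 => /eqP e; rewrite -[u](mulKVmx uW) e mulmx0.
Qed.
Lemma psd_conj W X : symplectic W -> psd X -> psd (W *m X *m invmx W).
Proof.
move=> sW [h1 h2]; split; first exact: sp_conj.
by move=> u; rewrite -!mulmxA (symp_omega_inv _ _ sW).
Qed.

Lemma sp_J : sp J.
Proof.
apply/spE; rewrite /sform trJ mulNmx JJ opprK; exact: trmx1.
Qed.
Lemma sp_plusJ : sp_plus J.
Proof.
apply/sp_plusE; rewrite /sform trJ mulNmx JJ opprK; split; first exact: trmx1.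
exact: posdef1.
Qed.

Lemma G_ge0 (X : M) : 0 <= G X.
Proof. by rewrite /G; case: ifP => // _; exact: powR_ge0. Qed.

Lemma G_sp_plus (X : M) : sp_plus X -> G X = powR (\det X) ((n + n)%:R^-1).
Proof. by move=> h; rewrite /G; case: asboolP. Qed.

Lemma sp_plus_det (X : M) : sp_plus X -> 0 < \det X.
Proof. by move=> /sp_plusE[s p]; rewrite -det_sform posdef_det_gt0. Qed.

Lemma G_mono (X Y : M) : (0 < n)%N -> psd X -> psd Y -> G X <= G (X + Y).
Proof.
move=> n0 pX pY; rewrite {1}/G; case: asboolP => [hX|_]; last exact: G_ge0.
have hXY := sp_plus_add hX pY; rewrite G_sp_plus //.
have /sp_plusE[sX qX] := hX; case: pY => /spE sY qY.
apply: ge0_ler_powR; rewrite ?nnegrE ?invr_ge0 ?ler0n ?(ltW (sp_plus_det _)) //.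
have := @det_posdefD_ge _ _ (sform X) (sform Y) (ltn_addr n n0) sX sY qX.
rewrite -mulmxDr -/(sform _) !det_sform => -[|_ //].
by move=> u; rewrite -omega_qform.
Qed.

Lemma GZ a (X : M) : (0 < n)%N -> 0 < a -> G (a *: X) = a * G X.
Proof.
move=> n0 a0; have nn : (n + n)%:R != 0 :> R by rewrite pnatr_eq0 -lt0n ltn_addr.
rewrite /G; case: asboolP => h; case: asboolP => k; rewrite ?mulr0 //.
- rewrite detZ powRM ?exprn_ge0 ?ltW ?sp_plus_det // -powR_mulrn ?ltW //.
  by rewrite -powRrM divff // powRr1 ?ltW.
- by case: k; rewrite -[X](scalerK (lt0r_neq0 a0)); apply: sp_plusZ; rewrite ?invr_gt0.
- by case: h; apply: sp_plusZ.
Qed.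

Lemma GJ W (X : M) : symplectic W -> G (W *m X *m invmx W) = G X.
Proof.
move=> sW; have [uW iW siW] := symp_inv sW.
have bk Y : invmx W *m (W *m Y *m invmx W) *m invmx (invmx W) = Y.
  by rewrite invmxK !mulmxA mulVmx // mul1mx -mulmxA mulVmx // mulmx1.
rewrite /G; case: asboolP => h; case: asboolP => k //.
- by rewrite !det_mulmx mulrAC -det_mulmx mulmxV // det1 mul1r.
- by case: k; rewrite -(bk X) iW; apply: sp_plus_conj; rewrite // -iW.
- by case: h; apply: sp_plus_conj.
Qed.

End Symplectic.

Local Open Scope classical_set_scope.

(** * Limits and derivatives of matrix-valued maps *)

Section MatrixLimits.
Variable K : numFieldType.

Lemma cvg_mxP (T : Type) (F : set_system T) {FF : Filter F} m k
    (f : T -> 'M[K]_(m, k)) (A : 'M[K]_(m, k)) :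
  (forall i j, f x i j @[x --> F] --> A i j) -> f x @[x --> F] --> A.
Proof.
move=> h B [P PA PB]; apply: (@filterS _ F FF [set x | forall i j, P i j (f x i j)]).
  by move=> x Px; apply: PB.
apply: filter_forall => i; apply: filter_forall => j; exact: h (PA i j).
Qed.

Lemma cvg_mx_entry (T : Type) (F : set_system T) {FF : Filter F} m k
    (f : T -> 'M[K]_(m, k)) (A : 'M[K]_(m, k)) i j :
  f x @[x --> F] --> A -> f x i j @[x --> F] --> A i j.
Proof.
move=> h; apply: (@cvg_comp _ _ _ f (fun B : 'M[K]_(m, k) => B i j) _ _ _ h).
exact: coord_continuous.
Qed.

Lemma cvg_sumr (T : Type) (F : set_system T) {FF : Filter F} (I : Type) (r : seq I)
    (P : pred I) (f : I -> T -> K) (a : I -> K) :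
  (forall i, P i -> f i x @[x --> F] --> a i) ->
  \sum_(i <- r | P i) f i x @[x --> F] --> \sum_(i <- r | P i) a i.
Proof. by move=> h; apply: cvg_big => //; exact: add_continuous. Qed.

Lemma cvg_prodr (T : Type) (F : set_system T) {FF : Filter F} (I : Type) (r : seq I)
    (P : pred I) (f : I -> T -> K) (a : I -> K) :
  (forall i, P i -> f i x @[x --> F] --> a i) ->
  \prod_(i <- r | P i) f i x @[x --> F] --> \prod_(i <- r | P i) a i.
Proof. by move=> h; apply: cvg_big => //; exact: mul_continuous. Qed.

Lemma cvg_mulmx (T : Type) (F : set_system T) {FF : Filter F} m k l
    (f : T -> 'M[K]_(m, k)) (g : T -> 'M[K]_(k, l)) (A : 'M[K]_(m, k)) (B : 'M[K]_(k, l)) :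
  f x @[x --> F] --> A -> g x @[x --> F] --> B ->
  f x *m g x @[x --> F] --> A *m B.
Proof.
move=> fA gB; apply: cvg_mxP => i j; rewrite mxE.
under eq_cvg do rewrite mxE.
by apply: cvg_sumr => s _; apply: cvgM; exact: cvg_mx_entry.
Qed.

Lemma cvg_trmx (T : Type) (F : set_system T) {FF : Filter F} m k
    (f : T -> 'M[K]_(m, k)) (A : 'M[K]_(m, k)) :
  f x @[x --> F] --> A -> (f x)^T @[x --> F] --> A^T.
Proof.
move=> fA; apply: cvg_mxP => i j; rewrite mxE.
under eq_cvg do rewrite mxE.
exact: cvg_mx_entry.
Qed.

Lemma cvg_scalar_mx (T : Type) (F : set_system T) {FF : Filter F} m
    (f : T -> K) (a : K) :
  f x @[x --> F] --> a -> (f x)%:M @[x --> F] --> (a%:M : 'M[K]_m).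
Proof.
move=> fa; apply: cvg_mxP => i j; rewrite mxE.
under eq_cvg do rewrite mxE.
by case: (i == j); rewrite ?mulr0n ?mulr1n //; exact: cvg_cst.
Qed.

Lemma cvg_det (T : Type) (F : set_system T) {FF : Filter F} m
    (f : T -> 'M[K]_m) (A : 'M[K]_m) :
  f x @[x --> F] --> A -> \det (f x) @[x --> F] --> \det A.
Proof.
move=> fA; apply: cvg_sumr => s _; apply: cvgM; first exact: cvg_cst.
by apply: cvg_prodr => i _; exact: cvg_mx_entry.
Qed.

End MatrixLimits.

Lemma cvg_pair2 (T : Type) (F : set_system T) (FF : Filter F) (U V : topologicalType)
    (f : T -> U) (g : T -> V) (a : U) (b : V) :
  f x @[x --> F] --> a -> g x @[x --> F] --> b -> (f x, g x) @[x --> F] --> (a, b).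
Proof. exact: cvg_pair. Qed.

Section MatrixDerivatives.
Variable R : realType.

Lemma is_derive_bigsum (I : Type) (r : seq I) (P : pred I)
    (f : I -> R -> R) (df : I -> R) (t : R) :
  (forall i, is_derive t 1 (f i) (df i)) ->
  is_derive t 1 (fun x => \sum_(i <- r | P i) f i x) (\sum_(i <- r | P i) df i).
Proof.
move=> h; elim: r => [|i r IH].
  rewrite big_nil (_ : (fun x => _) = cst 0); first exact: is_derive_cst.
  by apply/funext => x; rewrite big_nil.
rewrite big_cons; case: ifP => Pi.
  rewrite (_ : (fun x => _) = f i + (fun x => \sum_(i <- r | P i) f i x)).
    exact: is_deriveD.
  by apply/funext => x; rewrite big_cons Pi.
rewrite (_ : (fun x => _) = (fun x => \sum_(i <- r | P i) f i x)) //.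
by apply/funext => x; rewrite big_cons Pi.
Qed.

Lemma is_deriveMr (f g : R -> R) (t df dg : R) :
  is_derive t 1 f df -> is_derive t 1 g dg ->
  is_derive t 1 (fun x => f x * g x) (df * g t + f t * dg).
Proof.
move=> hf hg; have := is_deriveM hf hg.
by rewrite /GRing.scale /= addrC [g t * _]mulrC.
Qed.

(** Entrywise, so that the product and chain rules reduce to the scalar ones. *)
Definition mder m k (W : R -> 'M[R]_(m, k)) (t : R) (D : 'M[R]_(m, k)) :=
  forall i j, is_derive t 1 (fun x => W x i j) (D i j).

Lemma mder_mul m k l (V : R -> 'M[R]_(m, k)) (W : R -> 'M[R]_(k, l)) (t : R) DV DW :
  mder V t DV -> mder W t DW ->
  mder (fun x => V x *m W x) t (DV *m W t + V t *m DW).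
Proof.
move=> hV hW i j; rewrite !mxE -big_split /=.
rewrite (_ : (fun x => _) = fun x => \sum_s V x i s * W x s j).
  by apply: is_derive_bigsum => s; apply: is_deriveMr.
by apply/funext => x; rewrite mxE.
Qed.

Lemma mder_cst m k (A : 'M[R]_(m, k)) t : mder (fun=> A) t 0.
Proof. by move=> i j; rewrite mxE; exact: is_derive_cst. Qed.

Lemma mder_add m k (V W : R -> 'M[R]_(m, k)) t DV DW :
  mder V t DV -> mder W t DW -> mder (fun x => V x + W x) t (DV + DW).
Proof.
move=> hV hW i j; rewrite !mxE.
rewrite (_ : (fun x => _) = (fun x => V x i j) + (fun x => W x i j)).
  exact: is_deriveD.
by apply/funext => x; rewrite mxE.
Qed.

Lemma mder_opp m k (V : R -> 'M[R]_(m, k)) t DV :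
  mder V t DV -> mder (fun x => - V x) t (- DV).
Proof.
move=> hV i j; rewrite !mxE.
rewrite (_ : (fun x => _) = - (fun x => V x i j)); first exact: is_deriveN.
by apply/funext => x; rewrite mxE.
Qed.

Lemma mder_tr m k (V : R -> 'M[R]_(m, k)) t DV :
  mder V t DV -> mder (fun x => (V x)^T) t DV^T.
Proof.
move=> hV i j; rewrite !mxE.
rewrite (_ : (fun x => _) = (fun x => V x j i)) //.
by apply/funext => x; rewrite mxE.
Qed.

Lemma mder_scale m k (f : R -> R) (A : 'M[R]_(m, k)) (t df : R) :
  is_derive t 1 f df -> mder (fun x => f x *: A) t (df *: A).
Proof.
move=> hf i j; rewrite !mxE.
rewrite (_ : (fun x => _) = fun x => f x * A i j).
  by have := is_deriveMr hf (is_derive_cst (A i j) t 1); rewrite mulr0 addr0.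
by apply/funext => x; rewrite mxE.
Qed.

Lemma mder_comp m k (W : R -> 'M[R]_(m, k)) (f : R -> R) (t : R) DW (df : R) :
  mder W (f t) DW -> is_derive t 1 f df -> mder (fun x => W (f x)) t (df *: DW).
Proof.
move=> hW hf i j; rewrite !mxE mulrC.
exact: (is_derive1_comp (hW i j) hf).
Qed.

Lemma mder_trace m (W : R -> 'M[R]_m) (t : R) D :
  mder W t D -> is_derive t 1 (fun x => \tr (W x)) (\tr D).
Proof. by move=> h; apply: is_derive_bigsum => i. Qed.

Lemma mder_eq m k (W : R -> 'M[R]_(m, k)) t D D' : mder W t D -> D = D' -> mder W t D'.
Proof. by move=> + <-. Qed.

Lemma is_C1P n (W : R -> 'M[R]_(n + n)) : is_C1 W <->
  exists D : R -> 'M[R]_(n + n), (forall t, mder W t (D t)) /\ continuous D.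
Proof.
split=> [[h1 h2]|[D [h1 h2]]].
  exists (derive1 W); split=> // t i j; rewrite derive1E derive_mx // mxE.
  by apply: DeriveDef => //; move/derivable_mxP: (h1 t).
have dW t : derivable W t 1 by apply/derivable_mxP => i j; have [] := h1 t i j.
have e : derive1 W = D.
  apply/funext => t; rewrite derive1E derive_mx //; apply/matrixP => i j.
  by rewrite mxE; have [] := h1 t i j.
by split; [exact: dW | rewrite e; exact: h2].
Qed.

Lemma mder_derive1 n (W : R -> 'M[R]_(n + n)) t D : mder W t D -> derive1 W t = D.
Proof.
move=> h; rewrite derive1E derive_mx; last by apply/derivable_mxP => i j; have [] := h i j.
by apply/matrixP => i j; rewrite mxE; have [] := h i j.
Qed.

Lemma mder_continuous m k (W : R -> 'M[R]_(m, k)) (t : R) D : mder W t D -> {for t, continuous W}.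
Proof.
move=> h; apply: cvg_mxP => i j; have [d _] := h i j.
by apply: differentiable_continuous; apply/derivable1_diffP.
Qed.

End MatrixDerivatives.

(** * Paths and homotopies in the symplectic group *)

Section Paths.
Variables (R : realType) (n : nat).
Local Notation M := 'M[R]_(n + n).

(** The retraction of the line onto [[0, 1]], written with absolute values so that its continuity is
    immediate. Precomposition with it turns continuity within the interval into continuity on the
    line. *)
Definition clamp (x : R) : R := (1 + `|x| - `|x - 1|) / 2.

Lemma clamp_id x : 0 <= x <= 1 -> clamp x = x.
Proof.
by move=> /andP[h1 h2]; rewrite /clamp ger0_norm // ler0_norm; [field | lra].
Qed.

Lemma clamp_lo x : x <= 0 -> clamp x = 0.
Proof. by move=> h; rewrite /clamp ler0_norm // ler0_norm; [field | lra]. Qed.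

Lemma clamp_hi x : 1 <= x -> clamp x = 1.
Proof. by move=> h; rewrite /clamp ger0_norm ?ger0_norm; [field | lra | lra]. Qed.

Lemma clamp_itv x : 0 <= clamp x <= 1.
Proof.
have [h|h] := leP x 0; first by rewrite clamp_lo // lexx ler01.
have [h1|h1] := leP 1 x; first by rewrite clamp_hi // lexx ler01.
by rewrite clamp_id !ltW.
Qed.

Lemma clamp_continuous : continuous clamp.
Proof.
move=> x; apply: cvgM; last exact: cvg_cst.
apply: cvgB; first apply: cvgD; first exact: cvg_cst.
  exact: norm_continuous.
by apply: cvg_norm; apply: cvgB; [exact: cvg_id | exact: cvg_cst].
Qed.

Lemma within_clamp (T : topologicalType) (p : R -> T) :
  {within `[0, 1], continuous p} <-> continuous (p \o clamp).
Proof.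
split=> [/subspace_continuousP h x|h].
  have cx : `[0, 1]%classic (clamp x) by rewrite /= in_itv /= clamp_itv.
  apply: (@cvg_comp _ _ _ clamp p _ (within `[0, 1] (nbhs (clamp x)))).
    move=> B wB; apply: (@filterS _ (nbhs x) _ (clamp @^-1` [set y | `[0, 1]%classic y -> B y])).
      by move=> y; apply; rewrite /= in_itv /= clamp_itv.
    by apply: clamp_continuous.
  exact: h.
apply: (@subspace_eq_continuous _ _ _ (p \o clamp)); last exact: continuous_subspaceT.
by move=> x; rewrite inE /= in_itv /= => hx; rewrite clamp_id.
Qed.

Lemma within_clamp2 (T : topologicalType) (H : R * R -> T) :
  {within `[0, 1] `*` `[0, 1], continuous H} <->
  continuous (fun z => H (clamp z.1, clamp z.2)).
Proof.
pose c (z : R * R) := (clamp z.1, clamp z.2).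
have cc : continuous c.
  move=> z; apply: (@cvg_pair2 _ _ _ _ _ (fun z => clamp z.1) (fun z => clamp z.2)).
    apply: (@cvg_comp _ _ _ fst clamp); [exact: cvg_fst | exact: clamp_continuous].
  apply: (@cvg_comp _ _ _ snd clamp); [exact: cvg_snd | exact: clamp_continuous].
have ci z : (`[0, 1] `*` `[0, 1]) (c z) by split; rewrite /= in_itv /= clamp_itv.
split=> [/subspace_continuousP h x|h].
  apply: (@cvg_comp _ _ _ c H _ (within (`[0, 1] `*` `[0, 1]) (nbhs (c x)))); last exact: h.
  move=> B wB.
  apply: (@filterS _ (nbhs x) _ (c @^-1` [set y | (`[0, 1] `*` `[0, 1]) y -> B y])).
    by move=> y; apply.
  exact: cc.
apply: (@subspace_eq_continuous _ _ _ (H \o c)); last exact: continuous_subspaceT.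
move=> x; rewrite inE => -[/=]; rewrite !in_itv /= => h1 h2.
by rewrite /c !clamp_id //; case: x {h1 h2}.
Qed.

Lemma in01 (t : R) : (t \in (`[0, 1] : set R)) = (0 <= t <= 1).
Proof. by rewrite mem_setE in_itv. Qed.

Lemma htpy_trackE (p q : R -> M) A : htpy_track p q A <->
  exists H : R * R -> M, [/\ continuous H,
    (forall t, 0 <= t <= 1 -> H (0, t) = p t /\ H (1, t) = q t),
    (forall s, 0 <= s <= 1 -> H (s, 0) = 1 /\ A (H (s, 1))) &
    (forall s t, 0 <= s <= 1 -> 0 <= t <= 1 -> symplectic (H (s, t)))].
Proof.
split=> -[H]; last first.
  move=> [h1 h2 h3 h4]; exists H; split; first exact: continuous_subspaceT.
  by split=> [t|]; [rewrite in01; exact: h2 | split=> [s|s t]; rewrite !in01; [exact: h3|exact: h4]].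
move=> [/within_clamp2 h1 [h2 [h3 h4]]]; exists (fun z => H (clamp z.1, clamp z.2)).
have c0 : clamp 0 = 0 by exact: clamp_lo.
have c1 : clamp 1 = 1 by exact: clamp_hi.
split=> //.
- by move=> t tI; rewrite /= c0 c1 clamp_id //; apply: h2; rewrite in01.
- by move=> s sI; rewrite /= c0 c1 clamp_id //; apply: h3; rewrite in01.
- by move=> s t sI tI; rewrite /= !clamp_id //; apply: h4; rewrite in01.
Qed.

Lemma htpy_track_trans (p q r : R -> M) A B :
  htpy_track p q A -> htpy_track q r B -> htpy_track p r (A `|` B).
Proof.
move=> /htpy_trackE[H [h1 h2 h3 h4]] /htpy_trackE[K [k1 k2 k3 k4]].
(* One formula instead of a gluing of two halves: for [s <= 1/2] the two [K] terms cancel; for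
   [s >= 1/2] the [H] term is frozen at [H (1, t) = K (0, t)], which the last term removes. *)
pose L (z : R * R) := H (clamp (2 * z.1), z.2) + K (clamp (2 * z.1 - 1), z.2) - K (0, z.2).
have Llo s t : 0 <= s -> s <= 2^-1 -> L (s, t) = H (2 * s, t).
  move=> s0 s2; rewrite /L /= [clamp (_ - _)]clamp_lo; last by lra.
  by rewrite addrK clamp_id //; lra.
have Lhi s t : s <= 1 -> 0 <= t <= 1 -> 2^-1 <= s -> L (s, t) = K (2 * s - 1, t).
  move=> s1 tI s2; rewrite /L /= clamp_hi; last by lra.
  have [_ ->] := h2 _ tI; have [-> _] := k2 _ tI; rewrite addrAC subrr add0r.
  by rewrite clamp_id //; lra.
have Lcase s t : 0 <= s <= 1 -> 0 <= t <= 1 ->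
    (exists2 s', 0 <= s' <= 1 & L (s, t) = H (s', t) /\ L (s, 0) = H (s', 0) /\ L (s, 1) = H (s', 1))
 \/ (exists2 s', 0 <= s' <= 1 & L (s, t) = K (s', t) /\ L (s, 0) = K (s', 0) /\ L (s, 1) = K (s', 1)).
  move=> /andP[s0 s1] tI; have [s2|/ltW s2] := leP s 2^-1.
    by left; exists (2 * s); [lra | rewrite !Llo].
  by right; exists (2 * s - 1); [lra | rewrite !Lhi // ?lexx ?ler01].
apply/htpy_trackE; exists L; split.
- move=> z; apply: cvgB; first apply: cvgD.
  + apply: (@cvg_comp _ _ _ (fun z : R * R => (clamp (2 * z.1), z.2)) H _ _ _ _ (h1 _)).
    apply: (@cvg_pair2 _ _ _ _ _ (fun z : R * R => clamp (2 * z.1)) snd); last exact: cvg_snd.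
    apply: (@cvg_comp _ _ _ (fun z : R * R => 2 * z.1) clamp _ _ _ _ (@clamp_continuous _)).
    by apply: cvgM; [exact: cvg_cst | exact: cvg_fst].
  + apply: (@cvg_comp _ _ _ (fun z : R * R => (clamp (2 * z.1 - 1), z.2)) K _ _ _ _ (k1 _)).
    apply: (@cvg_pair2 _ _ _ _ _ (fun z : R * R => clamp (2 * z.1 - 1)) snd); last exact: cvg_snd.
    apply: (@cvg_comp _ _ _ (fun z : R * R => 2 * z.1 - 1) clamp _ _ _ _ (@clamp_continuous _)).
    by apply: cvgB; [apply: cvgM; [exact: cvg_cst | exact: cvg_fst] | exact: cvg_cst].
  + apply: (@cvg_comp _ _ _ (fun z : R * R => (0, z.2)) K _ _ _ _ (k1 _)).
    by apply: (@cvg_pair2 _ _ _ _ _ (fun z : R * R => 0) snd); [exact: cvg_cst | exact: cvg_snd].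
- move=> t tI; rewrite Llo ?invr_ge0 // Lhi // ?invf_le1 ?ler1n //.
  rewrite mulr0 mulr1 (_ : 2 - 1 = 1 :> R); last by ring.
  by have [-> _] := h2 _ tI; have [_ ->] := k2 _ tI.
- move=> s sI; have [||] := Lcase s 0 sI; first by rewrite lexx ler01.
    by move=> [s' s'I [_ [-> ->]]]; have [-> a] := h3 _ s'I; split; last left.
  by move=> [s' s'I [_ [-> ->]]]; have [-> a] := k3 _ s'I; split; last right.
- move=> s t sI tI; have [|] := Lcase s t sI tI.
    by move=> [s' s'I [-> _]]; exact: h4.
  by move=> [s' s'I [-> _]]; exact: k4.
Qed.

Lemma htpy_track_sub (p q : R -> M) (A B : set M) :
  A `<=` B -> htpy_track p q A -> htpy_track p q B.
Proof.
move=> AB [H [h1 [h2 [h3 h4]]]]; exists H; split => //; split => //; split => // s sI.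
by have [? /AB] := h3 s sI.
Qed.

Lemma homotopic_end (p q : R -> M) : homotopic p q -> q 1 = p 1.
Proof.
have i1 : 0 <= (1 : R) <= 1 by rewrite lexx ler01.
by move=> /htpy_trackE[H [_ h2 h3 _]]; have [_ <-] := h2 _ i1; have [_ ->] := h3 _ i1.
Qed.

Lemma homotopic_sym (p q : R -> M) : homotopic p q -> homotopic q p.
Proof.
move=> h; have e := homotopic_end h.
move: h => /htpy_trackE[H [h1 h2 h3 h4]].
have rI (s : R) : 0 <= s <= 1 -> 0 <= 1 - s <= 1 by lra.
apply/htpy_trackE; exists (fun z => H (1 - z.1, z.2)); split.
- move=> z; apply: (@cvg_comp _ _ _ (fun z : R * R => (1 - z.1, z.2)) H _ _ _ _ (h1 _)).
  apply: (@cvg_pair2 _ _ _ _ _ (fun z : R * R => 1 - z.1) snd); last exact: cvg_snd.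
  by apply: cvgB; [exact: cvg_cst | exact: cvg_fst].
- by move=> t tI; rewrite /= subr0 subrr; have [-> ->] := h2 _ tI.
- by move=> s /rI sI /=; have [-> /= ->] := h3 _ sI; rewrite e.
- by move=> s t /rI sI tI; exact: h4.
Qed.

Lemma homotopic_trans (p q r : R -> M) :
  homotopic p q -> homotopic q r -> homotopic p r.
Proof.
move=> h1 h2; have := htpy_track_trans h1 h2.
by rewrite (homotopic_end h1) setUid.
Qed.

Lemma homotopic_track (p q r : R -> M) (B : set M) :
  homotopic p q -> htpy_track q r B -> B (q 1) -> htpy_track p r B.
Proof.
move=> h1 h2 Bq; apply: htpy_track_sub (htpy_track_trans h1 h2).
by move=> X [/= ->|//]; rewrite -(homotopic_end h1).
Qed.

End Paths.

(** * Calculus in one variable *)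

Section RealTools.
Variable R : realType.

(** A quadratic error estimate can be checked case by case, which suits functions defined through
    absolute values. *)
Lemma is_derive_quad (f : R -> R) (x d : R) :
  (forall z, `|f z - f x - d * (z - x)| <= (z - x) ^+ 2) -> is_derive x 1 f d.
Proof.
move=> h.
have c : h0^-1 *: ((f \o shift x) (h0 *: 1) - f x) @[h0 --> 0^'] --> d.
  apply/cvgrPdist_lt => e e0; near=> y.
  have y0 : y != 0 by near: y; exact: nbhs_dnbhs_neq.
  have -> : d - y^-1 *: ((f \o shift x) (y *: 1) - f x) =
            - (y^-1 * (f (y + x) - f x - d * (y + x - x))).
    by rewrite /= /GRing.scale /= mulr1 addrK; field.
  rewrite normrN normrM normfV.
  have := h (y + x); rewrite addrK => hy.
  apply: (@le_lt_trans _ _ (`|y|^-1 * `|y| ^+ 2)).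
    by rewrite ler_pM2l ?invr_gt0 ?normr_gt0 // -normrX (ger0_norm (sqr_ge0 _)).
  rewrite expr2 mulKf ?normr_eq0 //; near: y; exact: dnbhs0_lt.
by apply: DeriveDef; [apply/cvg_ex; exists d | apply/cvg_lim].
Unshelve. all: by end_near. Qed.

Definition pos (x : R) : R := (x + `|x|) / 2.
(** This is [max(x, 0)^2]: of class C1 and zero on a half line. The cut-offs and the nonaffine time
    changes below are combinations of its translates. *)
Definition psq (x : R) : R := x * pos x.

Lemma pos_id x : 0 <= x -> pos x = x.
Proof. by move=> x0; rewrite /pos ger0_norm //; field. Qed.
Lemma pos_0 x : x <= 0 -> pos x = 0.
Proof. by move=> x0; rewrite /pos ler0_norm // subrr mul0r. Qed.
Lemma pos_continuous : continuous pos.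
Proof.
move=> x; apply: cvgM; last exact: cvg_cst.
by apply: cvgD; [exact: cvg_id | exact: norm_continuous].
Qed.

Lemma is_derive_psq (x : R) : is_derive x 1 psq (2 * pos x).
Proof.
apply: is_derive_quad => z; rewrite /psq.
have sq : 0 <= (z - x) ^+ 2 by exact: sqr_ge0.
have z2 : 0 <= z ^+ 2 by exact: sqr_ge0.
have x2 : 0 <= x ^+ 2 by exact: sqr_ge0.
have [x0|/ltW x0] := leP 0 x; have [z0|/ltW z0] := leP 0 z.
- rewrite (pos_id x0) (pos_id z0) (_ : _ - _ = (z - x) ^+ 2); last by ring.
  by rewrite ger0_norm.
- rewrite (pos_id x0) (pos_0 z0) (_ : _ - _ = (z - x) ^+ 2 - z ^+ 2); last by ring.
  have xz : 0 <= x * - z by rewrite mulr_ge0 // oppr_ge0.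
  rewrite ger0_norm; first by lra.
  by rewrite (_ : _ - _ = x ^+ 2 + 2 * (x * - z)); [lra | ring].
- rewrite (pos_0 x0) (pos_id z0) (_ : _ - _ = z ^+ 2); last by ring.
  have xz : 0 <= z * - x by rewrite mulr_ge0 // oppr_ge0.
  rewrite ger0_norm // (_ : (z - x) ^+ 2 = z ^+ 2 + 2 * (z * - x) + x ^+ 2); [lra | ring].
- by rewrite (pos_0 x0) (pos_0 z0) (_ : _ - _ = 0) ?normr0 //; ring.
Qed.

Lemma is_derive_comp (f g : R -> R) (t a b : R) :
  is_derive (g t) 1 f a -> is_derive t 1 g b -> is_derive t 1 (fun x => f (g x)) (b * a).
Proof. by move=> hf hg; rewrite mulrC; exact: is_derive1_comp. Qed.

Lemma is_derive_affine (a b t : R) : is_derive t 1 (fun x => a + b * x) b.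
Proof. by apply: is_derive_quad => z; rewrite (_ : _ - _ = 0) ?normr0 ?sqr_ge0 //; ring. Qed.

Lemma is_derive_eq (f : R -> R) (t a b : R) : is_derive t 1 f a -> a = b -> is_derive t 1 f b.
Proof. by move=> + <-. Qed.

Lemma is_derive_continuous (f : R -> R) (t a : R) : is_derive t 1 f a -> {for t, continuous f}.
Proof. by case=> d _; apply: differentiable_continuous; apply/derivable1_diffP. Qed.

Lemma incr_of_derive (f df : R -> R) (a b : R) : a < b ->
  (forall x, a <= x <= b -> is_derive x 1 f (df x)) ->
  exists2 c, a < c < b & f b - f a = df c * (b - a).
Proof.
move=> ab h; have [||c cab e] := @MVT _ f df a b ab.
- by move=> x; rewrite in_itv /= => /andP[? ?]; apply: h; rewrite !ltW.
- apply/subspace_continuousP => x /=; rewrite in_itv /= => /h/is_derive_continuous cx.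
  exact: cvg_within_filter.
by exists c.
Qed.

Lemma is_deriveP (f : R -> R) (t d : R) : is_derive t 1 f d <->
  h^-1 * (f (h + t) - f t) @[h --> 0^'] --> d.
Proof.
have e : (fun h => h^-1 *: ((f \o shift t) (h *: 1) - f t)) = (fun h => h^-1 * (f (h + t) - f t)).
  by apply/funext => h; rewrite /= /GRing.scale /= mulr1.
split=> [[c <-]|c].
  by move: c; rewrite /derivable e /derive e.
by apply: DeriveDef; rewrite /derivable /derive e; [apply/cvg_ex; exists d | apply/cvg_lim].
Qed.

Lemma mder_limP m k (W : R -> 'M[R]_(m, k)) (t : R) D : mder W t D <->
  h^-1 *: (W (h + t) - W t) @[h --> 0^'] --> D.
Proof.
split=> [h|h].
  apply: cvg_mxP => i j; have /is_deriveP := h i j.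
  by apply: cvg_trans; apply: near_eq_cvg; near=> y; rewrite !mxE.
move=> i j; apply/is_deriveP; have hh : (x^-1 *: (W (x + t) - W t)) i j @[x --> 0^'] --> D i j by exact: cvg_mx_entry.
move: hh; by apply: cvg_trans; apply: near_eq_cvg; near=> y; rewrite !mxE.
Unshelve. all: by end_near. Qed.

End RealTools.

Lemma cvg_invmx_unit (K : numFieldType) (T : Type) (F : set_system T) {FF : Filter F} m
    (f : T -> 'M[K]_m) (A : 'M[K]_m) : A \in unitmx ->
  f x @[x --> F] --> A -> invmx (f x) @[x --> F] --> invmx A.
Proof.
move=> uA fA; have dA : \det (f x) @[x --> F] --> \det A by exact: cvg_det.
have d0 : \det A != 0 by rewrite -unitfE -unitmxE.
have nu : \forall x \near F, f x \in unitmx.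
  have /cvgrPdist_lt/(_ `|\det A|) := dA; rewrite normr_gt0 => /(_ d0).
  apply: filterS => x; rewrite unitmxE unitfE; apply: contraTneq => ->.
  by rewrite subr0 ltxx.
have c : (\det (f x))^-1 *: \adj (f x) @[x --> F] --> invmx A.
  rewrite /invmx uA; apply: cvgZ; first exact: cvgV.
  apply: cvg_mxP => i j; rewrite !mxE; under eq_cvg do rewrite !mxE.
  rewrite /cofactor; apply: cvgM; first exact: cvg_cst.
  apply: cvg_det; apply: cvg_mxP => a b; rewrite !mxE; under eq_cvg do rewrite !mxE.
  exact: cvg_mx_entry.
apply: cvg_trans c; apply: near_eq_cvg; apply: filterS nu => x ux.
by rewrite /invmx ux.
Qed.

(** * Derivative of the inverse and uniform comparison of forms *)

Section MatrixTools.
Variable R : realType.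

Lemma mder_inv m (A : R -> 'M[R]_m) (t : R) D : A t \in unitmx -> mder A t D ->
  mder (fun x => invmx (A x)) t (- (invmx (A t) *m D *m invmx (A t))).
Proof.
move=> uA dA; have cA : A (h + t) @[h --> 0^'] --> A t.
  have cA := mder_continuous dA.
  apply: (@cvg_comp _ _ _ (fun h => h + t) A _ (nbhs t) _ _ cA).
  apply: cvg_within_filter.
  have : h + t @[h --> nbhs (0 : R)] --> 0 + t.
    by apply: cvgD; [exact: cvg_id | exact: cvg_cst].
  by rewrite add0r.
apply/mder_limP; have /mder_limP lA := dA.
have c : - (invmx (A (h + t)) *m (h^-1 *: (A (h + t) - A t)) *m invmx (A t)) @[h --> 0^'] -->
    - (invmx (A t) *m D *m invmx (A t)).
  apply: cvgN; apply: cvg_mulmx; last exact: cvg_cst.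
  by apply: cvg_mulmx => //; exact: cvg_invmx_unit.
apply: cvg_trans c; apply: near_eq_cvg; near=> h.
have uh : A (h + t) \in unitmx.
  rewrite unitmxE unitfE; near: h.
  have /cvgrPdist_lt/(_ `|\det (A t)|) : \det (A (h + t)) @[h --> 0^'] --> \det (A t) by exact: cvg_det.
  rewrite normr_gt0 -unitfE -unitmxE => /(_ uA).
  by apply: filterS => x; apply: contraTneq => ->; rewrite subr0 ltxx.
rewrite -scalemxAr -scalemxAl -scalerN; congr (_ *: _).
by rewrite mulmxBr mulmxBl mulVmx // mul1mx mulmxK // opprB.
Unshelve. all: by end_near. Qed.

Lemma qformZu m (S : 'M[R]_m) c u : qform S (c *: u) = c ^+ 2 * qform S u.
Proof.
rewrite /qform (_ : (c *: u)^T = c *: u^T); last by apply/matrixP => i j; rewrite !mxE.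
by rewrite -!scalemxAl -scalemxAr scalerA mxE expr2.
Qed.

Definition sphere m : set 'rV[R]_m := [set u | qform 1%:M u^T = 1].

Lemma cvg_qform (T : Type) (F : set_system T) {FF : Filter F} m
    (S : T -> 'M[R]_m) (u : T -> 'cV[R]_m) (S0 : 'M[R]_m) (u0 : 'cV[R]_m) :
  S x @[x --> F] --> S0 -> u x @[x --> F] --> u0 ->
  qform (S x) (u x) @[x --> F] --> qform S0 u0.
Proof.
move=> hS hu; apply: cvg_mx_entry.
by apply: cvg_mulmx => //; apply: cvg_mulmx => //; exact: cvg_trmx.
Qed.

Lemma compact_sphere m : compact (@sphere m).
Proof.
have cb : compact [set v : 'rV[R]_m | forall i, `[(-1 : R), 1]%classic (v ord0 i)].
  by apply: (@rV_compact R m (fun=> `[(-1 : R), 1]%classic)) => i; exact: segment_compact.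
apply: (subclosed_compact _ cb).
  have cq : continuous (fun u : 'rV[R]_m => qform 1%:M u^T).
    move=> u; apply: (@cvg_qform _ (nbhs u) _ m (fun=> 1%:M) (fun u : 'rV[R]_m => u^T)).
      exact: cvg_cst.
    by apply: (@cvg_trmx _ _ _ _ _ _ id); exact: cvg_id.
  have -> : @sphere m = (fun u : 'rV[R]_m => qform 1%:M u^T) @^-1` [set 1] by [].
  apply: closed_comp; first by move=> u _; exact: cq.
  exact: closed_eq.
move=> u; rewrite /sphere /= qform1 => h i; rewrite in_itv /=.
have : u ord0 i ^+ 2 <= 1.
  rewrite -h (bigD1 i) //= mxE lerDl sumr_ge0 // => j _; exact: sqr_ge0.
by move=> h'; apply/andP; split; nra.
Qed.

(** On the product of the interval with the unit sphere, which is compact, [S] has a positive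
    minimum and [T] a maximum; homogeneity extends the comparison to all vectors. *)
Lemma form_dominates m (S T : R -> 'M[R]_m) (a b : R) :
  continuous S -> continuous T -> (forall t, a <= t <= b -> posdef (S t)) ->
  exists2 e : R, 0 < e & forall t, a <= t <= b -> forall u,
    e * qform (T t) u <= qform (S t) u.
Proof.
move=> cS cT pS; pose K : set (R * 'rV[R]_m) := `[a, b] `*` @sphere m.
have [K0|/set0P K0] := eqVneq K set0.
  exists 1 => // t tab u; have [->|u0] := eqVneq u 0.
    by rewrite /qform !mulmx0 !mxE mulr0.
  exfalso; suff : K (t, (Num.sqrt (qform 1%:M u))^-1 *: u^T) by rewrite K0.
  split; rewrite /sphere /= ?in_itv //= linearZ /= trmxK qformZu.
  by rewrite exprVn sqr_sqrtr ?ltW ?qform1_gt0 // mulVf // gt_eqF ?qform1_gt0.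
have cK : compact K by apply: compact_setX; [exact: segment_compact | exact: compact_sphere].
have cf (U : R -> 'M[R]_m) : continuous U ->
    {within K, continuous (fun z : R * 'rV[R]_m => qform (U z.1) z.2^T)}.
  move=> cU; apply: continuous_subspaceT => z.
  apply: (@cvg_qform _ _ _ _ (fun z : R * 'rV[R]_m => U z.1) (fun z : R * 'rV[R]_m => z.2^T)).
    by apply: (@cvg_comp _ _ _ fst U); [exact: cvg_fst | exact: cU].
  by apply: (@cvg_trmx _ _ _ _ _ _ snd); exact: cvg_snd.
have [[t1 u1] z1K min] := compact_EVT_min K0 cK (cf _ cS).
have [[t2 u2] z2K max] := compact_EVT_max K0 cK (cf _ cT).
rewrite inE in z1K; case: z1K => /=; rewrite in_itv /= => t1I u1S.
set mi := qform (S t1) u1^T in min; set ma := qform (T t2) u2^T in max.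
have mi0 : 0 < mi.
  apply: pS => //; apply/eqP => e; move: u1S; rewrite /sphere /= e /qform mulmx0 mxE.
  by move/eqP; rewrite eq_sym oner_eq0.
(* The summand [1] keeps the denominator positive when the maximum [ma] is zero. *)
exists (mi / (1 + `|ma|)); first by rewrite divr_gt0 // ltr_pwDl.
move=> t tI u; have [->|u0] := eqVneq u 0.
  by rewrite /qform !mulmx0 !mxE mulr0.
set r := qform 1%:M u; have r0 : 0 < r by exact: qform1_gt0.
pose c := (Num.sqrt r)^-1; have cc : c * c = r^-1.
  by rewrite -expr2 exprVn sqr_sqrtr // ltW.
have sc (U : 'M[R]_m) : qform U (c *: u^T)^T = r^-1 * qform U u.
  by rewrite linearZ /= trmxK qformZu expr2 cc.
have zK : (t, c *: u^T) \in K.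
  rewrite inE; split; rewrite /= ?in_itv //= /sphere /= sc -/r mulVf //.
  by rewrite gt_eqF.
have := max _ zK; have := min _ zK; rewrite !sc => h1 h2.
rewrite -(ler_pM2l (_ : 0 < r^-1)) ?invr_gt0 // mulrCA.
apply: le_trans h1; apply: le_trans (_ : mi / (1 + `|ma|) * `|ma| <= _).
  apply: ler_wpM2l; first by rewrite divr_ge0 ?ltW // addr_ge0.
  by apply: le_trans h2 _; exact: ler_norm.
rewrite mulrAC ler_pdivrMr; last by rewrite ltr_pwDl.
by apply: ler_wpM2l; rewrite ?(ltW mi0) // lerDr ler01.
Qed.

End MatrixTools.

(** * Integrals of nonnegative functions *)

Section Integral.
Variable R : realType.
Local Notation mu := (@lebesgue_measure R).

(** Measurability of [f] and [g] is not assumed: the integral of a nonnegative function is a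
    supremum over simple functions below it, and this supremum is monotone. *)
Lemma le_integral_ge0 (D : set R) (f g : R -> R) :
  (forall x, D x -> 0 <= f x) -> (forall x, D x -> f x <= g x) ->
  (\int[mu]_(x in D) (f x)%:E <= \int[mu]_(x in D) (g x)%:E)%E.
Proof.
move=> f0 fg; rewrite !ge0_integralE; first last.
- by move=> x Dx; rewrite lee_fin f0.
- by move=> x Dx; rewrite lee_fin (le_trans (f0 _ Dx)) ?fg.
apply: le_ereal_sup => _ [h hf <-]; exists h => // x; apply: le_trans (hf x) _.
by rewrite /patch; case: ifPn => // /set_mem Dx; rewrite lee_fin fg.
Qed.

Lemma integral_itv_cst (a b c : R) : a <= b ->
  (\int[mu]_(x in `[a, b]) c%:E = (c * (b - a))%:E)%E.
Proof.
move=> ab; rewrite integral_cst //= lebesgue_measure_itv /= lte_fin.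
move: ab; rewrite le_eqVlt => /orP[/eqP ->|->]; first by rewrite ltxx subrr mulr0 mule0.
by rewrite -EFinD -EFinM.
Qed.

Lemma integral_ge_cst (f : R -> R) (a b c : R) : 0 <= a -> a <= b -> b <= 1 ->
  (forall x, 0 <= x <= 1 -> 0 <= f x) -> 0 <= c -> (forall x, a <= x <= b -> c <= f x) ->
  ((c * (b - a))%:E <= \int[mu]_(x in `[0%R, 1%R]) (f x)%:E)%E.
Proof.
move=> a0 ab b1 f0 c0 cf; rewrite -integral_itv_cst //.
rewrite integral_mkcond [leRHS]integral_mkcond.
rewrite (_ : (fun=> c%:E) \_ `[a, b] = fun x => (c * \1_(`[a, b] : set R) x)%:E); last first.
  apply/funext => x; rewrite /patch indicE mem_setE.
  by case: ifP => _; rewrite ?mulr1 ?mulr0.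
rewrite (_ : (fun x => (f x)%:E) \_ `[0%R, 1%R] = fun x => (f x * \1_(`[0, 1] : set R) x)%:E); last first.
  apply/funext => x; rewrite /patch indicE mem_setE.
  by case: ifP => _; rewrite ?mulr1 ?mulr0.
apply: le_integral_ge0 => x _; first by rewrite mulr_ge0 // indicE; case: (_ \in _).
rewrite !indicE !mem_setE !in_itv /=.
case: (boolP (a <= x <= b)) => [/andP[ax xb]|_].
  by rewrite (le_trans a0 ax) (le_trans xb b1) /= !mulr1 cf // ax.
rewrite mulr0; case: (boolP (0 <= x <= 1)) => [h|_]; last by rewrite mulr0.
by rewrite mulr1 f0.
Qed.

End Integral.

(** * Causal and rotated curves, and positivity of the form of [W] *)

Section Curves.
Variables (R : realType) (n : nat).
Hypothesis n0 : (0 < n)%N.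
Local Notation M := 'M[R]_(n + n).
Local Notation V := 'cV[R]_(n + n).
Local Notation J := (J0 R n).

Definition C1on (W D : R -> M) := (forall t, mder W t (D t)) /\ continuous D.

Lemma C1on_cont W D : C1on W D -> continuous W.
Proof. by move=> [h _] t; exact: mder_continuous (h t). Qed.

Lemma timelikeE (W : R -> M) : timelike_curve W <-> exists D, [/\ C1on W D,
  (forall t, 0 <= t <= 1 -> symplectic (W t)) &
  (forall t, 0 <= t <= 1 -> sp_plus (D t *m invmx (W t)))].
Proof.
split=> [[/is_C1P[D hD] [h1 h2]]|[D [hD h1 h2]]].
  exists D; split=> // t tI; first by apply: h1; rewrite in01.
  by have := h2 t; rewrite in01 /velocity (mder_derive1 (hD.1 t)); apply.
split; first by apply/is_C1P; exists D.
by split=> t; rewrite in01 => tI; [exact: h1 | rewrite /velocity (mder_derive1 (hD.1 t)); exact: h2].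
Qed.

Lemma causalE (W : R -> M) : causal_curve W <-> exists D, [/\ C1on W D,
  (forall t, 0 <= t <= 1 -> symplectic (W t)) &
  (forall t, 0 <= t <= 1 -> D t *m invmx (W t) != 0 /\
     closure (@sp_plus R n) (D t *m invmx (W t)))].
Proof.
split=> [[/is_C1P[D hD] [h1 h2]]|[D [hD h1 h2]]].
  exists D; split=> // t tI; first by apply: h1; rewrite in01.
  by have := h2 t; rewrite in01 /velocity (mder_derive1 (hD.1 t)); apply.
split; first by apply/is_C1P; exists D.
by split=> t; rewrite in01 => tI; [exact: h1 | rewrite /velocity (mder_derive1 (hD.1 t)); exact: h2].
Qed.

Lemma lengthGE (W D : R -> M) : C1on W D -> lengthG W =
  (\int[@lebesgue_measure R]_(t in `[0%R, 1%R]) (G (D t *m invmx (W t)))%:E)%E.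
Proof.
move=> [h _]; rewrite /lengthG; apply: eq_integral => t _.
by rewrite /velocity (mder_derive1 (h t)).
Qed.

Lemma sp_plus_neq0 (X : M) : sp_plus X -> X != 0.
Proof.
move=> hX; apply: contraTneq (sp_plus_det hX) => ->.
by rewrite -(scale0r (1%:M : M)) detZ expr0n addn_eq0 (gtn_eqF n0) mul0r ltxx.
Qed.

Lemma timelike_causal (W : R -> M) : timelike_curve W -> causal_curve W.
Proof.
move=> [h1 [h2 h3]]; split=> //; split=> // t tI; split.
  exact: sp_plus_neq0 (h3 t tI).
by apply: subset_closure; exact: h3.
Qed.

Lemma cvg_omega (T : Type) (F : set_system T) {FF : Filter F} (u : V) (X : T -> M) (X0 : M) v :
  X x @[x --> F] --> X0 -> omega0 u (X x *m v) @[x --> F] --> omega0 u (X0 *m v).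
Proof.
move=> hX; rewrite omegaE; under eq_cvg do rewrite omegaE.
apply: cvg_mx_entry; apply: cvg_mulmx; first exact: cvg_cst.
by apply: cvg_mulmx => //; exact: cvg_cst.
Qed.

Lemma closure_psd (X : M) : closure (@sp_plus R n) X -> psd X.
Proof.
move=> hX.
have cl (f : M -> R) : continuous f -> (forall Y, sp_plus Y -> 0 <= f Y) -> 0 <= f X.
  move=> cf f0; rewrite leNgt; apply/negP => fX.
  have /hX [Y [hY /= fY]] : nbhs X (f @^-1` [set y | y < 0]).
    by apply: cf; apply: lt_nbhsl.
  by have := f0 _ hY; rewrite leNgt fY.
have co u v : continuous (fun Y : M => omega0 u (Y *m v)).
  by move=> Y; apply: (@cvg_omega _ (nbhs Y) _ u (fun Y => Y)); exact: cvg_id.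
split=> [u v|u]; last by apply: (cl (fun Y => omega0 u (Y *m u))) => // Y /sp_plus_psd[_]; apply.
have h u' v' : omega0 v' (X *m u') <= omega0 u' (X *m v').
  rewrite -subr_ge0; apply: (cl (fun Y => omega0 u' (Y *m v') - omega0 v' (Y *m u'))).
    by move=> Y; apply: (@cvgB _ _ _ (nbhs Y) _ (fun Y : M => omega0 u' (Y *m v')) (fun Y : M => omega0 v' (Y *m u'))); exact: co.
  by move=> Y [e _]; rewrite e subrr.
by apply/eqP; rewrite eq_le !h.
Qed.

Lemma mder_Rot (phi : R -> R) (t d : R) : is_derive t 1 phi d ->
  mder (fun x => Rot n (phi x)) t (d *: (J *m Rot n (phi t))).
Proof.
move=> h.
have hc : is_derive t 1 (fun x => cos (phi x)) (d * - sin (phi t)).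
  exact: is_derive_comp.
have hs : is_derive t 1 (fun x => sin (phi x)) (d * cos (phi t)).
  exact: is_derive_comp.
have -> : (fun x => Rot n (phi x)) = fun x => cos (phi x) *: 1%:M + sin (phi x) *: J.
  by apply/funext => x; rewrite /Rot scalemx1.
apply: mder_eq (mder_add (mder_scale _ hc) (mder_scale _ hs)) _.
rewrite /Rot mulmxDr mul_mx_scalar -scalemxAr JJ scalerDr !scalerA mulrN scaleNr scalerN.
by rewrite addrC.
Qed.

Lemma cvg_Rot (T : Type) (F : set_system T) {FF : Filter F} (f : T -> R) (a : R) :
  f x @[x --> F] --> a -> Rot n (f x) @[x --> F] --> Rot n a.
Proof.
move=> fa; apply: cvgD.
  apply: cvg_scalar_mx; apply: (@cvg_comp _ _ _ f cos _ _ _ fa); exact: continuous_cos.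
apply: cvgZ; last exact: cvg_cst.
apply: (@cvg_comp _ _ _ f sin _ _ _ fa); exact: continuous_sin.
Qed.

(** The left factor adds a multiple of [J] to the velocity and the right factor a multiple of
    [W J W^-1], all conjugated by the left rotation, as [rcurve_vel] shows. Both added generators
    are definite, so rotations can create or spend definiteness. *)
Definition rcurve (phi chi : R -> R) (W : R -> M) t :=
  Rot n (phi t) *m W t *m Rot n (chi t).
Definition rcurveD (phi dphi chi dchi : R -> R) (W D : R -> M) t :=
  Rot n (phi t) *m (dphi t *: (J *m W t) + D t + dchi t *: (W t *m J)) *m Rot n (chi t).

Lemma rcurve_C1 (phi dphi chi dchi : R -> R) W D : C1on W D ->
  (forall t : R, is_derive t 1 phi (dphi t)) -> continuous dphi ->
  (forall t : R, is_derive t 1 chi (dchi t)) -> continuous dchi ->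
  C1on (rcurve phi chi W) (rcurveD phi dphi chi dchi W D).
Proof.
move=> hW hp cp hc cc; split=> t.
  apply: mder_eq (mder_mul (mder_mul (mder_Rot (hp t)) (hW.1 t)) (mder_Rot (hc t))) _.
  rewrite /rcurveD; move: (@RotJ _ n (phi t)); move: (Rot n (phi t)) (Rot n (chi t)) => P Q PJ.
  rewrite !(mulmxDr, mulmxDl) -!scalemxAl -!scalemxAr -!scalemxAl.
  by rewrite !mulmxA PJ.
apply: cvg_mulmx; last by apply: cvg_Rot; exact: is_derive_continuous (hc t).
apply: cvg_mulmx; first by apply: cvg_Rot; exact: is_derive_continuous (hp t).
have cW := C1on_cont hW.
apply: cvgD; first apply: cvgD; last first.
- by apply: cvgZ; [exact: cc | apply: cvg_mulmx; [exact: cW | exact: cvg_cst]].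
- exact: hW.2.
- by apply: cvgZ; [exact: cp | apply: cvg_mulmx; [exact: cvg_cst | exact: cW]].
Qed.

Lemma rcurve_symp phi chi W t : symplectic (W t) -> symplectic (rcurve phi chi W t).
Proof. by move=> h; do !apply: symp_mul => //; exact: Rot_symp. Qed.

Lemma rcurve_vel phi dphi chi dchi W D t : symplectic (W t) ->
  rcurveD phi dphi chi dchi W D t *m invmx (rcurve phi chi W t) =
  Rot n (phi t) *m (dphi t *: J + D t *m invmx (W t) +
     dchi t *: (W t *m J *m invmx (W t))) *m invmx (Rot n (phi t)).
Proof.
move=> sW; have [uW _ _] := symp_inv sW.
have [ur _ _] := symp_inv (@Rot_symp R n (phi t)).
have [uc _ _] := symp_inv (@Rot_symp R n (chi t)).
have uV : rcurve phi chi W t \in unitmx.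
  by have [] := symp_inv (rcurve_symp phi chi sW).
rewrite -[RHS](mulmxK uV); congr (_ *m _).
rewrite /rcurve !mulmxA mulmxKV // /rcurveD; congr (_ *m _); rewrite -!mulmxA; congr (_ *m _).
by rewrite !mulmxDl -!scalemxAl -!mulmxA !mulVmx // !mulmx1.
Qed.

(** For the fixed vector [z = (W b + 1) x], the quantity [k t = - omega0 z ((W t + 1)^-1 z)] starts
    at [0], because [W 0 + 1] is twice the identity, and ends at [omega0 x (W b x)]. With
    [y = (W t + 1)^-1 z], its derivative is the positive form of the velocity at [W t y]. *)
Lemma no_minus1_form (W D : R -> M) (b : R) : C1on W D -> W 0 = 1%:M ->
  (forall t, 0 <= t <= b -> symplectic (W t)) ->
  (forall t, 0 <= t <= b -> sp_plus (D t *m invmx (W t))) ->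
  (forall t, 0 < t <= b -> forall x : V, x != 0 -> W t *m x != - x) ->
  0 < b -> forall x : V, x != 0 -> 0 < omega0 x (W b *m x).
Proof.
move=> hW W0 sW pW nm b0 x x0.
have uK t : 0 <= t <= b -> W t + 1%:M \in unitmx.
  move=> tI; rewrite -unitmx_tr -row_free_unit -kermx_eq0; apply/eqP/row_matrixP => i.
  rewrite row0; apply/eqP/negP => /negP ne.
  set r := row i _ in ne; have rk : r *m (W t + 1%:M)^T = 0.
    by apply/sub_kermxP; rewrite row_sub.
  have y0 : r^T != 0 by apply: contra ne => /eqP e; rewrite -[r]trmxK e trmx0.
  have e : W t *m r^T = - r^T.
    apply/eqP; rewrite -addr_eq0 -[X in _ + X]mul1mx -mulmxDl.
    by rewrite -[_ *m _]trmxK trmx_mul trmxK rk trmx0.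
  move: tI; rewrite le_eqVlt => /andP[/orP[/eqP t0|t0] tb].
    move: e; rewrite -t0 W0 mul1mx => /eqP; rewrite -addr_eq0 -mulr2n -scaler_nat.
    by rewrite scaler_eq0 pnatr_eq0 /= (negPf y0).
  by have := nm t; rewrite t0 tb => /(_ isT _ y0); rewrite e eqxx.
pose z := (W b + 1%:M) *m x.
have bI : 0 <= b <= b by rewrite lexx ltW.
have z0 : z != 0.
  by apply: contra x0 => /eqP e; rewrite -[x](mulKmx (uK b bI)) -/z e mulmx0.
pose B t := invmx (W t + 1%:M).
pose k t := - omega0 z (B t *m z).
have dB t : 0 <= t <= b -> mder B t (- (B t *m D t *m B t)).
  move=> tI; apply: mder_inv; first exact: uK.
  by rewrite -[X in mder _ _ X]addr0; apply: mder_add; [exact: hW.1 | exact: mder_cst].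
have dk t : 0 <= t <= b -> is_derive t 1 k (omega0 z (B t *m D t *m B t *m z)).
  move=> tI; have := mder_mul (mder_mul (mder_cst (- (z^T *m J^T)) t) (dB t tI)) (mder_cst z t).
  move=> /(_ 0 0); rewrite mul0mx add0r mulmx0 addr0.
  rewrite (_ : (fun x0 => _) = k); last first.
    by apply/funext => s; rewrite /k omegaE !mulmxA !mulNmx mxE.
  move=> hh; apply: is_derive_eq hh _; rewrite omegaE.
  by rewrite mulNmx mulmxN opprK !mulmxA.
have k0 : k 0 = 0.
  rewrite /k; have -> : B 0 = 2^-1 *: 1%:M.
    have u : W 0 + 1%:M \in unitmx by apply: uK; rewrite lexx ltW.
    have e : (W 0 + 1%:M) *m (2^-1 *: 1%:M) = 1%:M.
      rewrite W0 -scalemxAr mulmx1; apply/matrixP => i j; rewrite !mxE.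
      by case: (i == j); rewrite ?mulr1n ?mulr0n; field.
    by rewrite -[RHS](mulKmx u) e mulmx1.
  by rewrite -scalemxAl omegaZ mul1mx omegaxx mulr0 oppr0.
have [c /andP[c0 cb]] := incr_of_derive b0 dk.
have cI : 0 <= c <= b by rewrite !ltW.
have sc := sW c cI; have [uc _ _] := symp_inv sc.
have dpos : 0 < omega0 z (B c *m D c *m B c *m z).
  pose y := B c *m z.
  have zy : z = (W c + 1%:M) *m y by rewrite /y mulKVmx // uK.
  have y0 : y != 0 by apply: contra z0 => /eqP e; rewrite zy e mulmx0.
  (* The adjoint of [(W + 1)^-1] with respect to [omega0] is [W (W + 1)^-1], because [W] is
     symplectic. *)
  have adj u : omega0 z (B c *m u) = omega0 (W c *m y) u.
    pose q := B c *m u.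
    have eq : u = (W c + 1%:M) *m q by rewrite /q mulKVmx // uK.
    by rewrite -/q [in RHS]eq [in LHS]zy !mulmxDl !mul1mx omegaD omegaDl sc addrC.
  rewrite -(mulmxA _ (B c) z) -/y -(mulmxA (B c) (D c) y) adj.
  have -> : D c *m y = D c *m invmx (W c) *m (W c *m y).
    by rewrite -(mulmxA (D c)) mulKmx.
  apply: (pW c cI).2; apply: contra y0 => /eqP e.
  by rewrite -[y](mulKmx uc) e mulmx0.
rewrite k0 subr0 => kb; have kb0 : 0 < k b by rewrite kb subr0 mulr_gt0.
move: kb0; rewrite /k /B /z mulKmx ?uK // mulmxDl mul1mx omegaDl omegaxx addr0.
by rewrite omegaC opprK.
Qed.

End Curves.

(** * The Krein form and elliptic matrices *)

Section Krein.
Variables (R : realType) (n : nat).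
Hypothesis n0 : (0 < n)%N.
Local Notation C := R[i].
Local Notation M := 'M[R]_(n + n).
Local Notation V := 'cV[R]_(n + n).
Local Notation CV := 'cV[C]_(n + n).
Local Notation J := (J0 R n).
Local Notation Jc := (J0c R n).
Local Notation toC := (real_complex R).

Lemma cmxE (A : M) i j : cmx A i j = toC (A i j).
Proof. by rewrite mxE. Qed.

Definition star (y : CV) : 'rV[C]_(n + n) := (map_mx (@conjc R) y)^T.
(** The symplectic form extended to a skew-hermitian form: [kappa] is [-i] times it. Its diagonal
    values are imaginary, so the Krein sign of [x] is the sign of the imaginary part of [Hf x x]. *)
Definition Hf (x y : CV) : C := (star y *m Jc *m x) 0 0.

Lemma starD y z : star (y + z) = star y + star z.
Proof. by apply/matrixP => i j; rewrite !mxE rmorphD. Qed.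
Lemma starZ a y : star (a *: y) = conjc a *: star y.
Proof. by apply/matrixP => i j; rewrite !mxE rmorphM. Qed.
Lemma star_mul (A : M) y : star (cmx A *m y) = star y *m cmx A^T.
Proof.
apply/matrixP => i j; rewrite !mxE rmorph_sum /=; apply: eq_bigr => k _.
by rewrite rmorphM /= !cmxE conjc_real mulrC !mxE.
Qed.

Lemma kappaE x y : kappa x y = - 'i%C * Hf x y.
Proof.
rewrite /kappa /Hf -mulmxA mxE mulr_sumr; apply: eq_bigr => k _.
by rewrite !mxE -!mulrA [conjc _ * _]mulrC.
Qed.

Lemma HfDl x y z : Hf (x + y) z = Hf x z + Hf y z.
Proof. by rewrite /Hf mulmxDr mxE. Qed.
Lemma HfDr x y z : Hf x (y + z) = Hf x y + Hf x z.
Proof. by rewrite /Hf starD !mulmxDl mxE. Qed.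
Lemma HfZl a x y : Hf (a *: x) y = a * Hf x y.
Proof. by rewrite /Hf -scalemxAr mxE. Qed.
Lemma HfZr a x y : Hf x (a *: y) = conjc a * Hf x y.
Proof. by rewrite /Hf starZ -!scalemxAl mxE. Qed.
Lemma Hf0l y : Hf 0 y = 0.
Proof. by rewrite /Hf mulmx0 mxE. Qed.
Lemma cmxM (A B : M) : cmx (A *m B) = cmx A *m cmx B.
Proof. exact: map_mxM. Qed.

Lemma Hf_symp W x y : symplectic W -> Hf (cmx W *m x) (cmx W *m y) = Hf x y.
Proof.
move=> /sympE e; rewrite /Hf star_mul !mulmxA -!(mulmxA (star y)) /J0c -!cmxM.
by rewrite e.
Qed.

Lemma HfC x y : Hf y x = - conjc (Hf x y).
Proof.
have JT i j : Jc i j = - Jc j i.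
  rewrite /J0c !cmxE -rmorphN; congr toC.
  by have /matrixP/(_ j i) := trJ R n; rewrite [LHS]mxE [RHS]mxE.
have Jr i j : conjc (Jc i j) = Jc i j by rewrite /J0c cmxE conjc_real.
have E a b : Hf a b = \sum_i \sum_j conjc (b i 0) * Jc i j * a j 0.
  rewrite /Hf mxE exchange_big /=; apply: eq_bigr => j _.
  by rewrite mxE mulr_suml; apply: eq_bigr => i _; rewrite !mxE.
rewrite !E rmorph_sum -sumrN exchange_big /=; apply: eq_bigr => i _.
rewrite rmorph_sum -sumrN; apply: eq_bigr => j _.
by rewrite !rmorphM /= conjcK Jr JT; ring.
Qed.

Lemma Hf_im x : complex.Re (Hf x x) = 0.
Proof.
have := HfC x x; case: (Hf x x) => a b /= [e _].
by lra.
Qed.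

Lemma kappa_real x : kappa x x = toC (complex.Im (Hf x x)).
Proof.
rewrite kappaE; have := Hf_im x; case: (Hf x x) => a b /= ->.
by apply/eqP; rewrite eq_complex /=; apply/andP; split; apply/eqP; ring.
Qed.

Definition cre (x : CV) : V := map_mx (@complex.Re R) x.
Definition cim (x : CV) : V := map_mx (@complex.Im R) x.

Lemma csplit x : x = map_mx toC (cre x) + 'i%C *: map_mx toC (cim x).
Proof. by apply/matrixP => i j; rewrite !mxE [LHS]complexE. Qed.

Definition Qc (W : M) (x : CV) : R := omega0 (cre x) (W *m cre x) + omega0 (cim x) (W *m cim x).

Lemma Qc_Hf W x : Qc W x = - complex.Re (Hf (cmx W *m x) x).
Proof.
rewrite /Qc; set a := cre x; set b := cim x; rewrite {1 2}(csplit x) -/a -/b.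
have sE : star (map_mx toC a + 'i%C *: map_mx toC b) = map_mx toC a^T - 'i%C *: map_mx toC b^T.
  apply/matrixP => i j; rewrite !mxE; apply/eqP; rewrite eq_complex /=.
  by apply/andP; split; apply/eqP; ring.
have E (c d : V) : map_mx toC c^T *m Jc *m (cmx W *m map_mx toC d) =
     (toC (- omega0 c (W *m d)))%:M.
  rewrite /J0c /cmx -!map_mxM /=; apply/matrixP => i j; rewrite !ord1 [LHS]mxE [RHS]mxE mulr1n.
  by congr toC; rewrite omegaE trJ mulmxN mulNmx [X in - X]mxE opprK.
rewrite /Hf sE !(mulmxDr, mulmxBl) -!scalemxAr -!scalemxAl !E !mxE !mulr1n.
rewrite /=; ring.
Qed.

Lemma csplit_neq0 x : x != 0 -> (cre x != 0) || (cim x != 0).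
Proof.
rewrite -negb_and; apply: contra => /andP[/eqP a /eqP b].
by rewrite (csplit x) a b !map_mx0 scaler0 addr0.
Qed.

Lemma Qc_gt0 W x : (forall u : V, u != 0 -> 0 < omega0 u (W *m u)) -> x != 0 -> 0 < Qc W x.
Proof.
move=> h /csplit_neq0; have g u : 0 <= omega0 u (W *m u).
  by have [->|/h/ltW//] := eqVneq u 0; rewrite mulmx0 omega0r.
by case/orP => /h k; [rewrite ltr_wpDr | rewrite ltr_wpDl].
Qed.

(** The bridge between the real form of [W] and the Krein form: on an eigenvector the former has the
    sign of [Im l] times the Krein sign. *)
Lemma Qc_eigen W x l : cmx W *m x = l *: x ->
  Qc W x = complex.Im l * complex.Im (Hf x x).
Proof.
move=> e; rewrite Qc_Hf e HfZl; have := Hf_im x; case: (Hf x x) => a b /= ->.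
by case: l {e} => c d /=; ring.
Qed.

Lemma eigenvec W l : Defs.eigenvalue W l -> exists2 x : CV, x != 0 & cmx W *m x = l *: x.
Proof.
rewrite /Defs.eigenvalue -char_poly_tr -eigenvalue_root_char => /eigenvalueP[v vW v0].
exists v^T; first by apply: contra v0 => /eqP e; rewrite -[v]trmxK e trmx0.
by rewrite -[cmx W *m _]trmxK trmx_mul trmxK vW linearZ.
Qed.

Lemma eigen_unit W l x : symplectic W -> cmx W *m x = l *: x ->
  Hf x x != 0 -> `|l| = 1.
Proof.
move=> sW e h; have := Hf_symp x x sW; rewrite e HfZl HfZr mulrA.
rewrite -{2}[Hf x x]mul1r => /(mulIf h); rewrite -sqr_normc => /eqP.
by rewrite sqrf_eq1 => /orP[/eqP//|/eqP k]; have := normr_ge0 l; rewrite k oppr_ge0 ler10.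
Qed.

(* The hypothesis says that no eigenvector for [l] is isotropic. *)
Lemma gen_eigen_semisimple W l : symplectic W -> `|l| = 1 ->
  (forall x, x != 0 -> cmx W *m x = l *: x -> Hf x x != 0) ->
  forall k (y : CV), (cmx W - l%:M) ^+ k *m y = 0 -> cmx W *m y = l *: y \/ k = 0%N.
Proof.
move=> sW l1 nz; have ll : conjc l * l = 1 by rewrite mulrC -sqr_normc l1 expr1n.
(* A Jordan chain of length two, [y] over [x], is impossible: invariance of [Hf] applied to [y] and
   [x] leaves [conjc l * Hf x x = 0]. *)
have two (y : CV) : (cmx W - l%:M) *m ((cmx W - l%:M) *m y) = 0 -> (cmx W - l%:M) *m y = 0.
  set x := _ *m y => /eqP; rewrite mulmxBl mul_scalar_mx subr_eq0 => /eqP e.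
  apply/eqP; apply: contraT => x0; have := nz _ x0 e.
  have exy : cmx W *m y = x + l *: y by rewrite /x mulmxBl mul_scalar_mx subrK.
  have : Hf y x = Hf (cmx W *m y) (cmx W *m x) by rewrite Hf_symp.
  rewrite e HfZr exy HfDl HfZl mulrDr mulrA ll mul1r => /eqP.
  rewrite -{1}[Hf y x]add0r (inj_eq (addIr _)) eq_sym mulf_eq0 => /orP[|/eqP->]; last by rewrite eqxx.
  by move/eqP => l0; move: ll; rewrite l0 mul0r => /eqP; rewrite eq_sym oner_eq0.
elim=> [|k IH] y; first by right.
rewrite exprSr -mulmxA => h; left; apply/eqP; rewrite -subr_eq0 -mul_scalar_mx -mulmxBl.
case: (IH _ h) => [e|k0].
  apply/eqP/two; rewrite mulmxBl e mul_scalar_mx subrr //.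
by move: h; rewrite k0 expr0 mul1mx => ->.
Qed.

Lemma gen_eigenspaceP W l (v : 'rV[C]_(n + n)) : (v <= gen_eigenspace W l)%MS <->
  (cmx W - l%:M) ^+ (n + n) *m v^T = 0.
Proof.
split=> [/sub_kermxP e|e]; first by rewrite -[_ *m _]trmxK trmx_mul trmxK e trmx0.
by apply/sub_kermxP; rewrite -[_ *m _]trmxK trmx_mul trmxK e trmx0.
Qed.

(** By [Qc_eigen] no eigenvector is isotropic and no eigenvalue is real. The absence of isotropic
    eigenvectors forces the eigenvalues onto the unit circle and makes them semisimple, so
    positivity on eigenvectors is positivity on generalized eigenspaces. *)
Lemma form_ell (W : M) : symplectic W ->
  (forall u : V, u != 0 -> 0 < omega0 u (W *m u)) -> Sp_ell W.
Proof.
move=> sW h.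
have nz l x : x != 0 -> cmx W *m x = l *: x -> 0 < complex.Im l * complex.Im (Hf x x).
  by move=> x0 e; rewrite -(Qc_eigen e) Qc_gt0.
have nz' l x : x != 0 -> cmx W *m x = l *: x -> Hf x x != 0.
  by move=> x0 /(nz _ _ x0); apply: contraTneq => ->; rewrite /= mulr0 ltxx.
have un l : Defs.eigenvalue W l -> `|l| = 1.
  by move=> /eigenvec[x x0 e]; apply: eigen_unit sW e (nz' _ _ x0 e).
split=> //; split=> l el.
  split; first exact: un.
  have [x x0 /(nz _ _ x0) p] := eigenvec el.
  by split; apply/eqP => k; move: p; rewrite k /= ?oppr0 mul0r ltxx.
move=> il v /gen_eigenspaceP/(gen_eigen_semisimple sW (un _ el) (nz' l)) [e|].
  move=> v0; have v0' : v^T != 0 by apply: contra v0 => /eqP e'; rewrite -[v]trmxK e' trmx0.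
  by have := nz _ _ v0' e; rewrite pmulr_rgt0 // kappa_real ltcR.
by move/eqP; rewrite addn_eq0 (gtn_eqF n0).
Qed.

Definition conjv (x : CV) : CV := map_mx (@conjc R) x.

Lemma conjvK x : conjv (conjv x) = x.
Proof. by apply/matrixP => i j; rewrite !mxE conjcK. Qed.
Lemma conjv_eq0 x : (conjv x == 0) = (x == 0).
Proof.
have z0 : conjv 0 = 0 by apply/matrixP => i j; rewrite !mxE conjc0.
by apply/eqP/eqP => [e|->//]; rewrite -[x]conjvK e.
Qed.
Lemma conjv_mul (W : M) x : conjv (cmx W *m x) = cmx W *m conjv x.
Proof.
apply/matrixP => i j; rewrite !mxE rmorph_sum /=; apply: eq_bigr => k _.
by rewrite rmorphM /= cmxE conjc_real !mxE.
Qed.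
Lemma Hf_conjv x y : Hf (conjv x) (conjv y) = conjc (Hf x y).
Proof.
rewrite /Hf !mxE rmorph_sum; apply: eq_bigr => j _; rewrite rmorphM !mxE; congr (_ * _).
by rewrite rmorph_sum; apply: eq_bigr => i _; rewrite rmorphM /= /J0c cmxE conjc_real !mxE.
Qed.

Lemma gen_eigen_conj W l k (y : CV) : (cmx W - l%:M) ^+ k *m y = 0 ->
  (cmx W - (conjc l)%:M) ^+ k *m conjv y = 0.
Proof.
move=> h; have step z : conjv ((cmx W - l%:M) *m z) = (cmx W - (conjc l)%:M) *m conjv z.
  rewrite !mulmxBl !mul_scalar_mx -conjv_mul; apply/matrixP => i j.
  by rewrite !mxE rmorphB rmorphM.
suff -> : (cmx W - (conjc l)%:M) ^+ k *m conjv y = conjv ((cmx W - l%:M) ^+ k *m y).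
  by rewrite h; apply/eqP; rewrite conjv_eq0.
elim: k y {h} => [|k IH] y; first by rewrite !expr0 !mul1mx.
by rewrite (exprS _ k) [in RHS](exprS _ k) -!mulmxA step IH.
Qed.

Lemma eigenvalue_conj (W : M) l : Defs.eigenvalue W l -> Defs.eigenvalue W (conjc l).
Proof.
move=> /eigenvec[x x0 e]; rewrite /Defs.eigenvalue -char_poly_tr -eigenvalue_root_char.
apply/eigenvalueP; exists (conjv x)^T; last first.
  by rewrite -conjv_eq0 in x0; apply: contra x0 => /eqP e'; rewrite -[conjv x]trmxK e' trmx0.
rewrite -trmx_mul -conjv_mul e -linearZ /=; congr trmx.
by apply/matrixP => i j; rewrite !mxE rmorphM.
Qed.

End Krein.

(** * Infinite distance outside the closure *)

Section Infinite.
Variables (R : realType) (n : nat).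
Hypothesis n0 : (0 < n)%N.
Local Notation M := 'M[R]_(n + n).
Local Notation V := 'cV[R]_(n + n).
Local Notation J := (J0 R n).

Lemma continuous_itv_path (W : R -> M) : continuous W -> {within `[0, 1], continuous W}.
Proof. exact: continuous_subspaceT. Qed.

(** Stopping the curve just before its end gives elliptic paths, and shortening the curve is a
    homotopy that keeps the endpoint in a small ball. The end itself may have eigenvalue [-1], so
    only membership in the closure follows. *)
Lemma timelike_no_minus1_closure (w W : R -> M) : timelike_to w W ->
  (forall t, 0 < t < 1 -> forall x : V, x != 0 -> W t *m x != - x) ->
  in_closure_ell w.
Proof.
move=> [/timelikeE[D [hW sW pW]] [W0 hWw]] nm e e0.
have cW := C1on_cont hW.
(* [d] must be below [1] and below the radius [r] that continuity provides at the end; [r / (r + 1)]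
   is below both. *)
have [d /andP[d0 d1] hd] : exists2 d : R, 0 < d < 1 &
    forall s, 0 <= s <= 1 -> ball (W 1) e (W (1 - s * d)).
  have /nbhs_ballP[r /= r0 hr] : nbhs (1 : R) (W @^-1` ball (W 1) e).
    by apply: cW; apply: nbhsx_ballx.
  have rr : 0 < r / (r + 1) < 1.
    by rewrite divr_gt0 ?addr_gt0 //= ltr_pdivrMr ?addr_gt0 //; lra.
  exists (r / (r + 1)) => // s /andP[s0 s1]; apply: hr.
  rewrite /ball /= opprB addrC subrK ger0_norm; last first.
    by rewrite mulr_ge0 // divr_ge0 ?ltW // addr_gt0.
  apply: (@le_lt_trans _ _ (r / (r + 1))).
    by rewrite ler_piMl // divr_ge0 ?ltW // addr_gt0.
  by rewrite ltr_pdivrMr ?addr_gt0 //; nra.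
have cv : continuous (fun t => W ((1 - d) * t)).
  move=> t; apply: (@cvg_comp _ _ _ (fun t => (1 - d) * t) W _ _ _ _ (cW _)).
  by apply: cvgM; [exact: cvg_cst | exact: cvg_id].
have dI t : 0 <= t <= 1 -> 0 <= (1 - d) * t <= 1 by move=> /andP[? ?]; apply/andP; split; nra.
exists (fun t => W ((1 - d) * t)); split; last split.
- split; first exact: continuous_itv_path.
  split; first by rewrite mulr0.
  by move=> t; rewrite in01 => /dI/sW.
- move=> t; rewrite mem_setE in_itv /= => /andP[t0 t1].
  have tI : 0 <= (1 - d) * t <= 1 by apply: dI; rewrite ltW.
  apply: (form_ell n0); first exact: sW.
  have sub s : 0 <= s <= (1 - d) * t -> 0 <= s <= 1.
    by move: tI => /andP[_ ?] /andP[-> /=] /le_trans; apply.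
  apply: (no_minus1_form hW W0) => //.
  + by move=> s /sub/sW.
  + by move=> s /sub/pW.
  + move=> s /andP[s0 st]; apply: nm; rewrite s0 /= (le_lt_trans st) //; nra.
  + by apply: mulr_gt0 => //; lra.
apply: (homotopic_track (homotopic_sym hWw)).
  apply/htpy_trackE; exists (fun z => W ((1 - z.1 * d) * z.2)); split.
  - move=> z; apply: (@cvg_comp _ _ _ (fun z : R * R => (1 - z.1 * d) * z.2) W _ _ _ _ (cW _)).
    apply: cvgM; last exact: cvg_snd.
    apply: cvgB; first exact: cvg_cst.
    by apply: cvgM; [exact: cvg_fst | exact: cvg_cst].
  - by move=> t _ /=; rewrite mul0r subr0 !mul1r.
  - by move=> s sI /=; rewrite mulr0 mulr1 (homotopic_end hWw); split=> //; exact: hd.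
  - move=> s t /andP[s0 s1] /andP[t0' t1'] /=.
    have h1 : 0 <= s * d by rewrite mulr_ge0 // ltW.
    have h2 : s * d <= 1 by nra.
    by apply: sW; apply/andP; split; nra.
rewrite (homotopic_end hWw); exact: ballxx.
Qed.

Section Shear.
Variable v : V.

Definition shear : M := v *m (v^T *m J^T).

Lemma shearE (u : V) : shear *m u = omega0 v u *: v.
Proof.
rewrite /shear -mulmxA [X in v *m X](_ : _ = (omega0 v u)%:M) ?mul_mx_scalar //.
by apply/matrixP => i j; rewrite !ord1 omegaE [RHS]mxE mulr1n.
Qed.

(** The symplectic transvections along [v]: [shear] squares to zero, so they form a one-parameter
    group. *)
Definition sg (s : R) : M := 1%:M + s *: shear.

Lemma sgE s u : sg s *m u = u + (s * omega0 v u) *: v.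
Proof. by rewrite /sg mulmxDl mul1mx -scalemxAl shearE scalerA. Qed.

Lemma mx_ext (A B : M) : (forall u : V, A *m u = B *m u) -> A = B.
Proof.
move=> h; apply/matrixP => i j; have /matrixP/(_ i 0) := h (delta_mx j 0).
by rewrite -!colE !mxE.
Qed.

Lemma sgD s t : sg s *m sg t = sg (s + t).
Proof.
apply: mx_ext => u; rewrite -mulmxA !sgE omegaD omegaZ omegaxx !mulr0 addr0.
by rewrite -addrA -scalerDl mulrDl [X in _ + X *: _]addrC.
Qed.

Lemma sg0 : sg 0 = 1%:M.
Proof. by rewrite /sg scale0r addr0. Qed.

Lemma sg_symp s : symplectic (sg s).
Proof.
move=> x y; rewrite !sgE omegaD !omegaDl !omegaZ !omegaZl omegaxx.
rewrite (omegaC v x) [omega0 x v]omegaC; ring.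
Qed.

Lemma sg_inv s : invmx (sg s) = sg (- s).
Proof.
have [u _ _] := symp_inv (sg_symp s).
by rewrite -[LHS]mulmx1 -sg0 -(subrr s) -sgD mulKmx.
Qed.

(** [P] and its inverse both send [v] to [- v], and the two signs cancel in [omega0 (v, .) v]. *)
Lemma sg_comm P s : symplectic P -> P *m v = - v -> sg s *m P *m sg (- s) = P.
Proof.
move=> sP Pv; have [uP _ _] := symp_inv sP.
have iv : invmx P *m v = - v by rewrite -[v]opprK -Pv mulmxN mulKmx ?opprK.
have c : sg s *m P = P *m sg s.
  apply: mx_ext => u; rewrite -!mulmxA !sgE mulmxDr -scalemxAr Pv; congr (_ + _).
  by rewrite (symp_omega_inv _ _ sP) iv omegaNl mulrN scaleNr scalerN.
by rewrite c -mulmxA sgD subrr sg0 mulmx1.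
Qed.

Definition Lc s (A : M) : M := sg s *m A *m sg (- s).

Lemma Lc_inv s A : symplectic A -> invmx (Lc s A) = sg s *m invmx A *m sg (- s).
Proof.
move=> sA; have [uA _ _] := symp_inv sA.
have [uL _ _] : [/\ Lc s A \in unitmx, True & True].
  by have [] := symp_inv (symp_mul (symp_mul (sg_symp s) sA) (sg_symp (- s))).
rewrite -[RHS](mulKmx uL); have -> : Lc s A *m (sg s *m invmx A *m sg (- s)) = 1%:M.
  rewrite /Lc !mulmxA -(mulmxA _ (sg (- s)) (sg s)) sgD addNr sg0 mulmx1.
  by rewrite -(mulmxA _ A) mulmxV // mulmx1 sgD subrr sg0.
by rewrite mulmx1.
Qed.

End Shear.

Definition fro (A : M) : R := \sum_i \sum_j A i j ^+ 2.

(** Used backwards: one large value of the bilinear form forces a large Frobenius norm. Each entry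
    is at most one plus its square. *)
Lemma fro_omega (y : V) : exists2 K : R, 0 < K &
  forall A : M, `|omega0 y (A *m y)| <= K * (1 + fro A).
Proof.
pose c i j := (y^T *m J^T) 0 i * y j 0.
pose K := 1 + \sum_i \sum_j `|c i j|; pose N := (n + n)%:R : R.
have N1 : 1 <= N by rewrite ler1n addn_gt0 n0.
have cK i j : `|c i j| <= K.
  rewrite /K (bigD1 i) //= (bigD1 j) //= addrA addrA -[X in X <= _]addr0 lerD //.
    by rewrite -addrA addrCA lerDl addr_ge0 // sumr_ge0.
  by rewrite sumr_ge0 // => a _; rewrite sumr_ge0.
have K1 : 1 <= K by rewrite lerDl sumr_ge0 // => a _; rewrite sumr_ge0.
exists (K * (N * N)); first by rewrite !mulr_gt0 ?(lt_le_trans ltr01).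
move=> A; have -> : omega0 y (A *m y) = \sum_i \sum_j c i j * A i j.
  rewrite omegaE mulmxA mxE exchange_big /=; apply: eq_bigr => j _.
  by rewrite mxE mulr_suml; apply: eq_bigr => i _; rewrite /c mulrAC.
apply: le_trans (_ : \sum_i \sum_j K * (1 + A i j ^+ 2) <= _).
  apply: (le_trans (ler_norm_sum _ _ _)); apply: ler_sum => i _.
  apply: (le_trans (ler_norm_sum _ _ _)); apply: ler_sum => j _.
  rewrite normrM; apply: ler_pM => //.
  have := sqr_ge0 (`|A i j| - 1); rewrite -(real_normK (num_real (A i j))); nra.
under eq_bigr do rewrite -mulr_sumr big_split /= sumr_const card_ord.
rewrite -mulr_sumr big_split /= sumr_const card_ord -/(fro A).
rewrite -mulrA ler_pM2l; last exact: lt_le_trans ltr01 K1.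
rewrite -mulr_natr -/N -[X in X * _]mulr_natl mulr1 mulrDr mulr1 lerD2l.
have f0 : 0 <= fro A by rewrite sumr_ge0 // => i _; rewrite sumr_ge0 // => j _; exact: sqr_ge0.
by rewrite ler_peMl // mulr_ege1.
Qed.

(** This is [det (1 + T) >= 1 + tr T] for the form [T] of [h J h^-1], whose trace is the squared
    Frobenius norm of [h^-1]. *)
Lemma G_JhJ_ge (h : M) : symplectic h ->
  powR (1 + fro (invmx h)) ((n + n)%:R^-1) <= G (J + h *m J *m invmx h).
Proof.
move=> sh; have pY := psd_conj sh (sp_plus_psd (sp_plusJ R n)).
have pJ := sp_plusJ R n.
rewrite G_sp_plus; last exact: sp_plus_add.
have /sp_plusE[sJ qJ] := pJ; have [/spE sY qY] := pY.
have := @det_posdefD_ge _ _ _ _ (ltn_addr n n0) sJ sY qJ.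
have e1 : sform J = 1%:M by rewrite /sform trJ mulNmx JJ opprK.
rewrite e1 invmx1 mul1mx det1 mul1r => -[|tr _].
  by move=> u; rewrite -omega_qform.
have trE : \tr (sform (h *m J *m invmx h)) = fro (invmx h).
  have [uh ih sih] := symp_inv sh.
  rewrite /mxtrace /fro exchange_big /=; apply: eq_bigr => i _.
  have -> : sform (h *m J *m invmx h) i i = qform (sform (h *m J *m invmx h)) (delta_mx i 0).
    by rewrite /qform trmx_delta -rowE -colE !mxE.
  rewrite -omega_qform -!mulmxA (symp_omega_inv _ _ sh) omegaJ -colE.
  by rewrite mxE; apply: eq_bigr => j _; rewrite !mxE expr2.
rewrite trE in tr; apply: ge0_ler_powR; rewrite ?nnegrE ?invr_ge0 ?ler0n //.
- by rewrite addr_ge0 // sumr_ge0 // => i _; rewrite sumr_ge0 // => j _; exact: sqr_ge0.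
- by apply: ltW; apply: sp_plus_det; exact: sp_plus_add.
- by rewrite -[\det (_ + _)]det_sform /sform mulmxDr -!/(sform _) e1.
Qed.

Lemma cvg_sinv (T : Type) (F : set_system T) {FF : Filter F} (f : T -> M) (A : M) :
  f x @[x --> F] --> A -> sinv (f x) @[x --> F] --> sinv A.
Proof.
move=> fA; apply: cvgN; apply: cvg_mulmx; last exact: cvg_cst.
by apply: cvg_mulmx; [exact: cvg_cst | exact: cvg_trmx].
Qed.

Lemma cvg_sg (T : Type) (F : set_system T) {FF : Filter F} (v : V) (f : T -> R) (a : R) :
  f x @[x --> F] --> a -> sg v (f x) @[x --> F] --> sg v a.
Proof. by move=> fa; apply: cvgD; [exact: cvg_cst | apply: cvgZ => //; exact: cvg_cst]. Qed.

Lemma continuous_bounded01 (f : R -> R) : continuous f ->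
  exists2 K : R, 0 <= K & forall t, 0 <= t <= 1 -> `|f t| <= K.
Proof.
move=> cf; have [|c _ h] := @EVT_max R (fun t => `|f t|) 0 1 ler01.
  by apply: continuous_subspaceT => x; apply: cvg_norm; exact: cf.
by exists `|f c| => // t tI; apply: h; rewrite in_itv.
Qed.

Lemma continuous_compm (f : R -> R) (W : R -> M) :
  continuous f -> continuous W -> continuous (fun t => W (f t)).
Proof. by move=> cf cW t; apply: (@cvg_comp _ _ _ f W _ _ _ (cf t)); exact: cW. Qed.

Section Detour.
Variables (W D : R -> M) (ts : R) (v : V).
Hypotheses (hW : C1on W D) (W0 : W 0 = 1%:M).
Hypotheses (sW : forall t, 0 <= t <= 1 -> symplectic (W t)).
Hypotheses (pW : forall t, 0 <= t <= 1 -> sp_plus (D t *m invmx (W t))).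
Hypotheses (ts01 : 0 < ts < 1) (v0 : v != 0) (Pv : W ts *m v = - v).

(** On the first half of the time interval [a] runs from [0] to [ts] while [b] waits at [ts]; on the
    second half [a] waits and [b] runs from [ts] to [1]. Both speeds vanish at [1/2], so the
    conjugated beginning and the unchanged end join in a C1 way. *)
Let a (t : R) : R := ts - 4 * ts * psq (2^-1 - t).
Let da (t : R) : R := 8 * ts * pos (2^-1 - t).
Let b (t : R) : R := ts + 4 * (1 - ts) * psq (t - 2^-1).
Let db (t : R) : R := 8 * (1 - ts) * pos (t - 2^-1).
(** Conjugation by the shear fixes [W ts], so at every time one of the two moving terms equals
    [W ts] and cancels the last one: a single formula covers both halves. *)
Let Wt s t : M := Lc v s (W (a t)) + W (b t) - W ts.
Let Dt s t : M := da t *: Lc v s (D (a t)) + db t *: D (b t).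

Lemma is_derive_a (t : R) : is_derive t 1 a (da t).
Proof.
have h1 : is_derive t 1 (fun x => psq (2^-1 + (-1) * x)) ((-1) * (2 * pos (2^-1 + (-1) * t))).
  by apply: is_derive_comp; [exact: is_derive_psq | exact: is_derive_affine].
have h2 := is_derive_comp (is_derive_affine ts (- (4 * ts)) _) h1.
have -> : a = (fun x => ts + - (4 * ts) * psq (2^-1 + -1 * x)).
  by apply/funext => x; rewrite /a mulN1r mulNr.
by apply: is_derive_eq h2 _; rewrite /da (_ : 2^-1 + -1 * t = 2^-1 - t); ring.
Qed.

Lemma is_derive_b (t : R) : is_derive t 1 b (db t).
Proof.
have h1 : is_derive t 1 (fun x => psq (- 2^-1 + 1 * x)) (1 * (2 * pos (- 2^-1 + 1 * t))).
  by apply: is_derive_comp; [exact: is_derive_psq | exact: is_derive_affine].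
have h2 := is_derive_comp (is_derive_affine ts (4 * (1 - ts)) _) h1.
have -> : b = (fun x => ts + 4 * (1 - ts) * psq (- 2^-1 + 1 * x)).
  by apply/funext => x; rewrite /b mul1r [- _ + _]addrC.
by apply: is_derive_eq h2 _; rewrite /db (_ : - 2^-1 + 1 * t = t - 2^-1); ring.
Qed.

Lemma cont_pos_affine (c d e : R) : continuous (fun t : R => c * pos (d + e * t)).
Proof.
move=> t; apply: cvgM; first exact: cvg_cst.
apply: (@cvg_comp _ _ _ (fun t : R => d + e * t) (@pos R) _ _ _ _ (@pos_continuous R _)).
by apply: cvgD; [exact: cvg_cst | apply: cvgM; [exact: cvg_cst | exact: cvg_id]].
Qed.

Lemma cont_da : continuous da.
Proof.
have -> : da = (fun t => 8 * ts * pos (2^-1 + -1 * t)) by apply/funext => t; rewrite /da mulN1r.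
exact: cont_pos_affine.
Qed.

Lemma cont_db : continuous db.
Proof.
have -> : db = (fun t => 8 * (1 - ts) * pos (- 2^-1 + 1 * t)).
  by apply/funext => t; rewrite /db mul1r [- _ + _]addrC.
exact: cont_pos_affine.
Qed.

Lemma cont_a : continuous a.
Proof. by move=> t; exact: is_derive_continuous (is_derive_a t). Qed.
Lemma cont_b : continuous b.
Proof. by move=> t; exact: is_derive_continuous (is_derive_b t). Qed.

Lemma Wt_C1 s : C1on (Wt s) (Dt s).
Proof.
have cD f : continuous f -> continuous (fun t => D (f t)).
  by move=> cf t; apply: (@cvg_comp _ _ _ f D _ _ _ (cf t)); exact: hW.2.
split=> t.
  have h1 := mder_comp (hW.1 (a t)) (is_derive_a t).
  have h2 := mder_comp (hW.1 (b t)) (is_derive_b t).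
  have h3 := mder_mul (mder_mul (mder_cst (sg v s) t) h1) (mder_cst (sg v (- s)) t).
  apply: mder_eq (mder_add (mder_add h3 h2) (mder_opp (mder_cst (W ts) t))) _.
  by rewrite mul0mx add0r mulmx0 addr0 oppr0 addr0 /Dt /Lc -!scalemxAr -!scalemxAl.
apply: cvgD.
  apply: cvgZ; first exact: cont_da.
  apply: cvg_mulmx; last exact: cvg_cst.
  by apply: cvg_mulmx; [exact: cvg_cst | exact: cD cont_a t].
by apply: cvgZ; [exact: cont_db | exact: cD cont_b t].
Qed.

Lemma low_half t : 0 <= t <= 2^-1 -> [/\ 0 <= a t <= ts, b t = ts, 0 <= da t & db t = 0].
Proof.
move=> /andP[t0 t1]; have h : 0 <= 2^-1 - t by lra.
have k : t - 2^-1 <= 0 by lra.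
case/andP: ts01 => ts0 ts1.
rewrite /a /b /da /db /psq (pos_id h) (pos_0 k) !mulr0 addr0; split=> //; last by nra.
have : 0 <= (2^-1 - t) * (2^-1 - t) <= 4^-1 by apply/andP; split; nra.
by move=> /andP[? ?]; apply/andP; split; nra.
Qed.

Lemma high_half t : 2^-1 <= t <= 1 -> [/\ a t = ts, ts <= b t <= 1, da t = 0 & 0 <= db t].
Proof.
move=> /andP[t0 t1]; have h : 0 <= t - 2^-1 by lra.
have k : 2^-1 - t <= 0 by lra.
case/andP: ts01 => ts0 ts1.
rewrite /a /b /da /db /psq (pos_id h) (pos_0 k) !mulr0 subr0; split=> //; last by nra.
have : 0 <= (t - 2^-1) * (t - 2^-1) <= 4^-1 by apply/andP; split; nra.
by move=> /andP[? ?]; apply/andP; split; nra.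
Qed.

Let sP : symplectic (W ts).
Proof. by apply: sW; case/andP: ts01 => ? ?; rewrite !ltW. Qed.

Lemma Wt_low s t : 0 <= t <= 2^-1 -> Wt s t = Lc v s (W (a t)).
Proof. by move=> /low_half[_ e _ _]; rewrite /Wt e addrK. Qed.

Lemma Wt_high s t : 2^-1 <= t <= 1 -> Wt s t = W (b t).
Proof. by move=> /high_half[e _ _ _]; rewrite /Wt e /Lc sg_comm // addrAC subrr add0r. Qed.

Lemma Wt_symp s t : 0 <= t <= 1 -> symplectic (Wt s t).
Proof.
move=> /andP[t0 t1]; case/andP: ts01 => ts0 ts1; have [h|/ltW h] := leP t 2^-1.
  have I : 0 <= t <= 2^-1 by rewrite t0.
  have [/andP[a0 a1] _ _ _] := low_half I; rewrite Wt_low //.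
  apply: symp_mul; last exact: sg_symp.
  by apply: symp_mul; [exact: sg_symp | apply: sW; rewrite a0 /= (le_trans a1) // ltW].
have I : 2^-1 <= t <= 1 by rewrite h.
have [_ /andP[b0 b1] _ _] := high_half I; rewrite Wt_high //; apply: sW.
by rewrite b1 andbT (le_trans _ b0) // ltW.
Qed.

Lemma Wt_0 s : Wt s 0 = 1%:M.
Proof.
have I : 0 <= (0 : R) <= 2^-1 by rewrite lexx /= invr_ge0.
rewrite Wt_low //; have -> : a 0 = 0.
  by rewrite /a /psq subr0 pos_id ?invr_ge0 //; field.
by rewrite W0 /Lc mulmx1 sgD subrr sg0.
Qed.

Lemma Wt_1 s : Wt s 1 = W 1.
Proof.
have I : 2^-1 <= (1 : R) <= 1 by rewrite lexx andbT invf_le1 // ler1n.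
rewrite Wt_high //; have -> : b 1 = 1; last by [].
by rewrite /b /psq pos_id; [field | rewrite subr_ge0 invf_le1 // ler1n].
Qed.

(** The velocity of [Wt] vanishes at [1/2], where the curve is therefore not timelike. A rotation by
    [phi] on both sides repairs this: it turns at speed [e] on the first half and is brought back on
    the second, so that [phi] is [0] at both ends. *)
Let phi e (t : R) : R := e * (t - 4 * psq (t - 2^-1)).
Let dphi e (t : R) : R := e * (1 - 8 * pos (t - 2^-1)).

Lemma is_derive_phi e (t : R) : is_derive t 1 (phi e) (dphi e t).
Proof.
have h1 : is_derive t 1 (fun x => psq (- 2^-1 + 1 * x)) (1 * (2 * pos (- 2^-1 + 1 * t))).
  by apply: is_derive_comp; [exact: is_derive_psq | exact: is_derive_affine].
have h2 := is_derive_comp (is_derive_affine 0 (- (4 * e)) _) h1.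
have h3 : is_derive t 1 (fun x => (0 + e * x) + (0 + - (4 * e) * psq (- 2^-1 + 1 * x)))
   (e + 1 * (2 * pos (- 2^-1 + 1 * t)) * - (4 * e)) := is_deriveD (is_derive_affine 0 e t) h2.
have -> : phi e = (fun x => (0 + e * x) + (0 + - (4 * e) * psq (- 2^-1 + 1 * x))).
  by apply/funext => x; rewrite /phi (_ : - 2^-1 + 1 * x = x - 2^-1); ring.
by apply: is_derive_eq h3 _; rewrite /dphi (_ : - 2^-1 + 1 * t = t - 2^-1); ring.
Qed.

Lemma cont_dphi e : continuous (dphi e).
Proof.
move=> t; apply: cvgM; first exact: cvg_cst.
apply: cvgB; first exact: cvg_cst.
have := @cont_pos_affine 8 (- 2^-1) 1 t.
by rewrite (_ : (fun t => _) = fun t => 8 * pos (t - 2^-1)) // ; apply/funext => x; rewrite mul1r addrC.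
Qed.

Let Gam e s := rcurve (phi e) (phi e) (Wt s).
Let GamD e s := rcurveD (phi e) (dphi e) (phi e) (dphi e) (Wt s) (Dt s).

Lemma Gam_C1 e s : C1on (Gam e s) (GamD e s).
Proof.
by apply: rcurve_C1; [exact: Wt_C1 | exact: is_derive_phi | exact: cont_dphi
  | exact: is_derive_phi | exact: cont_dphi].
Qed.

Let Y e s t := dphi e t *: J + Dt s t *m invmx (Wt s t) + dphi e t *: (Wt s t *m J *m invmx (Wt s t)).

(** The return of the rotation on the second half must cost less than the velocity of [W] provides
    there; compactness of the time interval yields a suitable [e], chosen independently of the
    shear. *)
Lemma slack : exists2 e : R, 0 < e & forall t, 0 <= t <= 1 ->
  psd ((1 - ts) *: (D t *m invmx (W t)) - e *: (J + W t *m J *m invmx (W t))).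
Proof.
case/andP: ts01 => ts0 ts1.
pose S t := sform ((1 - ts) *: (D t *m sinv (W t))).
pose T t := sform (J + W t *m J *m sinv (W t)).
have cW := C1on_cont hW.
have cS : continuous S.
  move=> t; apply: cvg_mulmx; first exact: cvg_cst.
  apply: cvgZ; first exact: cvg_cst.
  by apply: cvg_mulmx; [exact: hW.2 | apply: cvg_sinv; exact: cW].
have cT : continuous T.
  move=> t; apply: cvg_mulmx; first exact: cvg_cst.
  apply: cvgD; first exact: cvg_cst.
  apply: cvg_mulmx; last by apply: cvg_sinv; exact: cW.
  by apply: cvg_mulmx; [exact: cW | exact: cvg_cst].
have [|e e0 he] := @form_dominates R (n + n) S T 0 1 cS cT.
  move=> t tI; have [_ iW _] := symp_inv (sW tI); rewrite /S -iW.
  have /sp_plusE[] // : sp_plus ((1 - ts) *: (D t *m invmx (W t))).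
  by apply: sp_plusZ; [rewrite subr_gt0 | exact: pW].
exists e => // t tI; have [_ iW _] := symp_inv (sW tI).
have pJ := sp_plusJ R n.
split.
  apply: spD; first by apply: spZ; case: (pW tI).
  rewrite -scaleNr; apply: spZ; apply: spD; first exact: sp_J.
  by apply: sp_conj; [exact: sW | exact: sp_J].
move=> u; rewrite mulmxBl omegaD omegaN subr_ge0 -scalemxAl omegaZ !omega_qform.
by rewrite iW; exact: he.
Qed.

Lemma Y_low e s t : 0 <= t <= 2^-1 -> exists2 Z, psd Z &
  Y e s t = e *: (J + Wt s t *m J *m invmx (Wt s t)) + Z.
Proof.
move=> tI; have [/andP[a0 a1] eb da0 db0] := low_half tI; case/andP: ts01 => ts0 ts1.
have aI : 0 <= a t <= 1 by rewrite a0 /= (le_trans a1) // ltW.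
have sa := sW aI; have [ua _ _] := symp_inv sa.
exists (da t *: (sg v s *m (D (a t) *m invmx (W (a t))) *m invmx (sg v s))).
  apply: psdZ => //; apply: psd_conj; first exact: sg_symp.
  by apply: sp_plus_psd; exact: pW.
have dp : dphi e t = e.
  by rewrite /dphi pos_0 ?mulr0 ?subr0 ?mulr1 //; case/andP: tI => ? ?; lra.
have ed : Dt s t *m invmx (Wt s t) =
    da t *: (sg v s *m (D (a t) *m invmx (W (a t))) *m invmx (sg v s)).
  rewrite /Dt db0 scale0r addr0 -scalemxAl; congr (_ *: _).
  rewrite Wt_low // Lc_inv // /Lc sg_inv !mulmxA.
  by rewrite -(mulmxA _ (sg v (- s)) (sg v s)) sgD addNr sg0 mulmx1.
rewrite /Y dp ed; move: (sg v s *m _ *m _) (_ *m J *m _) => X K.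
by apply/matrixP => i j; rewrite !mxE; ring.
Qed.

(** The speed of [b] and the amount by which [dphi] falls below [e] are both multiples of [t - 1/2],
    so the bound of [slack] absorbs the loss at every time. *)
Lemma Y_high e s t : 2^-1 <= t <= 1 ->
  psd ((1 - ts) *: (D (b t) *m invmx (W (b t))) - e *: (J + W (b t) *m J *m invmx (W (b t)))) ->
  exists2 Z, psd Z & Y e s t = e *: (J + Wt s t *m J *m invmx (Wt s t)) + Z.
Proof.
move=> tI h; have [ea /andP[b0 b1] da0 db0] := high_half tI.
have t2 : 0 <= t - 2^-1 by case/andP: tI => ? ?; lra.
exists ((8 * (t - 2^-1)) *: ((1 - ts) *: (D (b t) *m invmx (W (b t)))
     - e *: (J + W (b t) *m J *m invmx (W (b t))))).
  by apply: psdZ => //; rewrite mulr_ge0.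
rewrite /Y /Dt /dphi da0 scale0r add0r Wt_high // /db pos_id // -scalemxAl.
move: (D (b t) *m _) (W (b t) *m J *m _) => X K.
by apply/matrixP => i j; rewrite !mxE; ring.
Qed.

Lemma Gam_vel e s t : 0 <= t <= 1 -> GamD e s t *m invmx (Gam e s t) =
  Rot n (phi e t) *m Y e s t *m invmx (Rot n (phi e t)).
Proof. by move=> tI; apply: rcurve_vel; exact: Wt_symp. Qed.

Lemma phi0 e : phi e 0 = 0.
Proof. by rewrite /phi /psq pos_0 ?mulr0 ?subr0 ?mulr0 // sub0r oppr_le0 invr_ge0. Qed.
Lemma phi1 e : phi e 1 = 0.
Proof.
rewrite /phi /psq pos_id; last by rewrite subr_ge0 invf_le1 // ler1n.
by field.
Qed.

Lemma Gam_homotopic e s : homotopic (Gam e s) W.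
Proof.
have cW := C1on_cont hW.
have r01 (s' : R) : 0 <= s' <= 1 -> 0 <= 1 - s' <= 1 by lra.
have I0 : 0 <= (0 : R) <= 1 by rewrite lexx ler01.
have I1 : 0 <= (1 : R) <= 1 by rewrite lexx ler01.
(* Scaling [e] and [s] to zero together undoes rotation and shear with fixed endpoints; what remains
   is [W] with another parametrization. *)
apply: (@homotopic_trans _ _ _ (Wt 0)).
  apply/htpy_trackE; exists (fun z => rcurve (phi ((1 - z.1) * e)) (phi ((1 - z.1) * e)) (Wt ((1 - z.1) * s)) z.2).
  have c1 (f : R -> R) (z : R * R) : continuous f -> f y.2 @[y --> z] --> f z.2.
    by move=> cf; apply: (@cvg_comp _ _ _ snd f); [exact: cvg_snd | exact: cf].
  have c2 (c : R) (z : R * R) : (1 - y.1) * c @[y --> z] --> (1 - z.1) * c.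
    by apply: cvgM; [apply: cvgB; [exact: cvg_cst | exact: cvg_fst] | exact: cvg_cst].
  have c3 (f : R -> R) (z : R * R) : continuous f -> W (f y.2) @[y --> z] --> W (f z.2).
    by move=> cf; apply: (@cvg_comp _ _ _ (fun y : R * R => f y.2) W _ _ _ (c1 _ _ cf)); exact: cW.
  split.
  - move=> z.
    have cp : phi ((1 - y.1) * e) y.2 @[y --> z] --> phi ((1 - z.1) * e) z.2.
      apply: cvgM; first exact: c2.
      apply: (c1 (fun t => t - 4 * psq (t - 2^-1))) => t.
      have := is_derive_continuous (is_derive_phi 1 t).
      by rewrite /phi (_ : (fun t => _) = fun t => t - 4 * psq (t - 2^-1)) //; apply/funext => x; rewrite mul1r.
    apply: cvg_mulmx; last exact: cvg_Rot.
    apply: cvg_mulmx; first exact: cvg_Rot.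
    apply: cvgB; last exact: cvg_cst.
    apply: cvgD; last exact: c3 cont_b.
    apply: cvg_mulmx; last by apply: cvg_sg; apply: cvgN; exact: c2.
    by apply: cvg_mulmx; [apply: cvg_sg; exact: c2 | exact: c3 cont_a].
  - move=> t _ /=; rewrite subr0 subrr !mul1r !mul0r; split=> //.
    by rewrite /rcurve /phi mul0r Rot0 mul1mx mulmx1.
  - move=> s' _ /=; rewrite /rcurve phi0 phi1 Rot0 !mul1mx !mulmx1 Wt_0 Wt_1; split=> //.
    by rewrite /Gam /rcurve phi1 Rot0 mul1mx mulmx1 Wt_1.
  - by move=> s' t _ tI; apply: rcurve_symp; exact: Wt_symp.
(* Without shear the curve is [W] run along [tau], and convex combinations of [tau] with the
   identity of the time interval give the homotopy. *)
pose tau t := a t + b t - ts.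
have tauE t : 0 <= t <= 1 -> Wt 0 t = W (tau t) /\ 0 <= tau t <= 1.
  move=> /andP[t0 t1]; case/andP: ts01 => ts0 ts1; have [h|/ltW h] := leP t 2^-1.
    have I : 0 <= t <= 2^-1 by rewrite t0.
    have [/andP[a0 a1] eb _ _] := low_half I.
    rewrite Wt_low // /Lc oppr0 sg0 mul1mx mulmx1 /tau eb addrK a0 (le_trans a1) //.
    exact: ltW.
  have I : 2^-1 <= t <= 1 by rewrite h.
  have [ea /andP[b0 b1] _ _] := high_half I; rewrite Wt_high // /tau ea addrAC subrr add0r.
  by rewrite b1 (le_trans _ b0) // ltW.
apply/htpy_trackE; exists (fun z => W ((1 - z.1) * tau z.2 + z.1 * z.2)); split.
- move=> z; apply: (@cvg_comp _ _ _ (fun z : R * R => (1 - z.1) * tau z.2 + z.1 * z.2) W _ _ _ _ (cW _)).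
  apply: cvgD; last by apply: cvgM; [exact: cvg_fst | exact: cvg_snd].
  apply: cvgM; first by apply: cvgB; [exact: cvg_cst | exact: cvg_fst].
  apply: (@cvg_comp _ _ _ snd tau); first exact: cvg_snd.
  by apply: cvgB; [apply: cvgD; [exact: cont_a | exact: cont_b] | exact: cvg_cst].
- move=> t tI /=; have [-> _] := tauE t tI.
  by rewrite subr0 subrr !mul1r !mul0r addr0 add0r.
- have a0 : a 0 = 0 by rewrite /a /psq subr0 pos_id ?invr_ge0 //; field.
  have a1 : a 1 = ts by rewrite /a /psq pos_0 ?mulr0 ?subr0 // subr_le0 invf_le1 // ler1n.
  have b0 : b 0 = ts by rewrite /b /psq pos_0 ?mulr0 ?addr0 // sub0r oppr_le0 invr_ge0.
  have b1 : b 1 = 1 by rewrite /b /psq pos_id; [field | rewrite subr_ge0 invf_le1 // ler1n].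
  move=> s' _ /=; rewrite /tau a0 b0 a1 b1 add0r subrr !mulr0 add0r W0 Wt_1; split=> //=.
  by congr W; ring.
- move=> s' t /andP[s0 s1] tI /=; have [_ /andP[h1 h2]] := tauE t tI.
  by case/andP: tI => t0 t1; apply: sW; apply/andP; split; nra.
Qed.

(** Up to a factor this value is the coefficient of [s^2] in [detour_long]. It is [0] at the start,
    where [W] is the identity, and its derivative there is a positive multiple of the form of the
    initial velocity at [v], so it is positive soon after. *)
Lemma big_somewhere : exists m0 t1 r : R, [/\ 0 < m0, 0 < r, 0 <= t1 - r, t1 + r <= 2^-1 &
  forall t, t1 - r <= t <= t1 + r -> m0 <= omega0 v (W (a t) *m v)].
Proof.
case/andP: ts01 => ts0 ts1; have cW := C1on_cont hW.
pose m t := omega0 v (W (a t) *m v); pose q t := omega0 v (D (a t) *m v).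
have dm (t : R) : is_derive t 1 m (da t * q t).
  have := mder_mul (mder_mul (mder_cst (v^T *m J^T) t) (mder_comp (hW.1 (a t)) (is_derive_a t))) (mder_cst v t).
  move=> /(_ 0 0); rewrite mul0mx add0r mulmx0 addr0 -scalemxAr -scalemxAl mxE.
  rewrite (_ : (fun x0 => _) = m); last by apply/funext => s; rewrite /m omegaE !mulmxA.
  by rewrite /q omegaE !mulmxA.
have cq : continuous q.
  have cDa : continuous (fun t => D (a t)) := continuous_compm cont_a hW.2.
  by move=> t; apply: (@cvg_omega _ _ _ (nbhs t) _ v (fun t => D (a t))); exact: cDa.
have a0 : a 0 = 0 by rewrite /a /psq subr0 pos_id ?invr_ge0 //; field.
have q0 : 0 < q 0.
  have I0 : 0 <= (0 : R) <= 1 by rewrite lexx ler01.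
  by have [_ /(_ _ v0)] := pW I0; rewrite W0 invmx1 mulmx1 /q a0.
have /nbhs_ballP[r /= r0 hr] : nbhs (0 : R) (q @^-1` [set y | 0 < y]).
  by apply: cq; exact: lt_nbhsr.
pose t1 := Num.min r 2^-1 / 2.
have t1r : 0 < t1 /\ t1 < r /\ t1 < 2^-1.
  have h1 : 0 < Num.min r 2^-1 by rewrite lt_min r0 invr_gt0 ltr0n.
  have h2 : Num.min r 2^-1 <= r by rewrite ge_min lexx.
  have h3 : Num.min r 2^-1 <= 2^-1 by rewrite ge_min lexx orbT.
  by rewrite /t1; split; [lra | split; lra].
case: t1r => t10 [t1r t12].
have mt1 : 0 < m t1.
  have [c /andP[c0 c1] e] := incr_of_derive t10 (fun x _ => dm x).
  have m0 : m 0 = 0 by rewrite /m a0 W0 mul1mx omegaxx.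
  move: e; rewrite m0 !subr0 => ->; apply: mulr_gt0 => //; apply: mulr_gt0.
    by rewrite /da pos_id; [nra | lra].
  by apply: hr; rewrite /ball /= sub0r normrN gtr0_norm //; lra.
have cm : {for t1, continuous m} by exact: is_derive_continuous (dm t1).
have /nbhs_ballP[r' /= r'0 hr'] : nbhs t1 (m @^-1` [set y | m t1 / 2 < y]).
  by apply: cm; apply: lt_nbhsr; lra.
pose rr := Num.min (r' / 2) (Num.min t1 (2^-1 - t1)).
have rr0 : 0 < rr by rewrite !lt_min t10 subr_gt0 t12 divr_gt0.
have rr1 : rr <= r' / 2 by rewrite ge_min lexx.
have rr2 : rr <= t1 by rewrite !ge_min lexx orbT.
have rr3 : rr <= 2^-1 - t1 by rewrite !ge_min lexx !orbT.
exists (m t1 / 2), t1, rr; split=> //; [lra | lra | lra |].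
move=> t /andP[h1 h2]; apply: ltW; apply: hr'; rewrite /ball /= ltr_norml.
by apply/andP; split; lra.
Qed.

(** On the interval of [big_somewhere] the inverse of the sheared curve grows like [s^2], so by
    [G_JhJ_ge] the part of the velocity due to the rotations has arbitrarily large [G]. Its weight
    [e] is fixed before [s] is chosen. *)
Lemma detour_long (A : R) : exists e s, 0 < e /\
  (forall t, 0 <= t <= 1 -> sp_plus (GamD e s t *m invmx (Gam e s t))) /\
  (A%:E <= lengthG (Gam e s))%E.
Proof.
have [e e0 he] := slack; have [m0 [t1 [r [m00 r0 lo hi hm]]]] := big_somewhere.
case/andP: ts01 => ts0 ts1; have cW := C1on_cont hW.
have dec s t : 0 <= t <= 1 -> exists2 Z, psd Z &
    Y e s t = e *: (J + Wt s t *m J *m invmx (Wt s t)) + Z.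
  move=> /andP[t0 t2]; have [h|/ltW h] := leP t 2^-1.
    by apply: Y_low; rewrite t0.
  have I : 2^-1 <= t <= 1 by rewrite h.
  have [_ /andP[b0 b1] _ _] := high_half I.
  by apply: Y_high => //; apply: he; rewrite b1 andbT (le_trans _ b0) // ltW.
have pJ := sp_plusJ R n.
have pE s t : 0 <= t <= 1 -> sp_plus (e *: (J + Wt s t *m J *m invmx (Wt s t))).
  move=> tI; apply: sp_plusZ => //; apply: sp_plus_add => //.
  by apply: psd_conj; [exact: Wt_symp | exact: sp_plus_psd].
have GY s t : 0 <= t <= 1 -> e * G (J + Wt s t *m J *m invmx (Wt s t)) <=
    G (GamD e s t *m invmx (Gam e s t)).
  move=> tI; rewrite Gam_vel // GJ; last exact: Rot_symp.
  have [Z pZ ->] := dec s t tI; rewrite -GZ //; apply: G_mono => //.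
  by apply: sp_plus_psd; exact: pE.
(* For this [y] the number [be] is the squared length of [v], so the shear moves [y] by a nonzero
   multiple of [v]. *)
pose y := J *m v; pose be := omega0 v y.
have be0 : 0 < be by rewrite /be /y omegaJ; have := qform1_gt0 v0; rewrite /qform mulmx1.
have [K K0 hK] := fro_omega y.
have ci (u u' : V) : continuous (fun t => omega0 u (sinv (W (a t)) *m u')).
  have cWa : continuous (fun t => W (a t)) := continuous_compm cont_a cW.
  move=> t; apply: (@cvg_omega _ _ _ (nbhs t) _ u (fun t => sinv (W (a t)))).
  by apply: (@cvg_sinv _ (nbhs t) _ (fun t => W (a t))); exact: cWa.
have [c1 c10 h1] := continuous_bounded01 (ci y y).
have [c2 c20 h2] := continuous_bounded01 (ci v y).
have [c3 c30 h3] := continuous_bounded01 (ci y v).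
(* [A'] is the value which, times the weight [e] and the interval length [2 r], gives [|A|]; [B] is
   the determinant producing it under the root in [G]. *)
pose A' := `|A| / (2 * r * e); have A'0 : 0 <= A' by rewrite divr_ge0 // !mulr_ge0 // ltW.
pose B := A' ^+ (n + n); have B0 : 0 <= B by exact: exprn_ge0.
pose q := be ^+ 2 * m0; have q0 : 0 < q by rewrite mulr_gt0 // exprn_gt0.
(* Chosen so that the quadratic term [s^2 q] beats the linear term, the constant term and the target
   [K * B]; the last summand ensures [s >= 1]. *)
pose s := (be * (c2 + c3) + c1 + K * B + 1) / q + 1.
have KB : 0 <= K * B by rewrite mulr_ge0 // ltW.
have bc : 0 <= be * (c2 + c3) by rewrite mulr_ge0 ?addr_ge0 // ltW.
have sq : s * q = be * (c2 + c3) + c1 + K * B + 1 + q.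
  by rewrite /s mulrDl divfK ?mul1r // gt_eqF.
have s1 : 1 <= s by rewrite /s lerDr divr_ge0 ?ltW //; lra.
have low t : t1 - r <= t <= t1 + r -> B <= 1 + fro (invmx (Wt s t)).
  move=> tI; have tI2 : 0 <= t <= 2^-1 by case/andP: tI => h5 h6; rewrite (le_trans lo h5) (le_trans h6 hi).
  have t01 : 0 <= t <= 1 by case/andP: tI2 => -> h5; rewrite (le_trans h5) // invf_le1 // ler1n.
  have [/andP[a0 a1] _ _ _] := low_half tI2.
  have aI : 0 <= a t <= 1 by rewrite a0 /= (le_trans a1) // ltW.
  have sa := sW aI; have [ua ia sia] := symp_inv sa.
  rewrite -(ler_pM2l K0); apply: le_trans (hK _); rewrite Wt_low // Lc_inv //.
  rewrite -mulmxA -mulmxA (symp_omega_inv _ _ (sg_symp v s)) sg_inv sgE -/be.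
  rewrite mulmxDr -scalemxAr omegaD !omegaDl !omegaZ !omegaZl ia.
  have mv : omega0 v (sinv (W (a t)) *m v) <= - m0.
    rewrite -ia -[X in omega0 X _](mulKVmx ua).
    have -> : omega0 (W (a t) *m (invmx (W (a t)) *m v)) (invmx (W (a t)) *m v) = - omega0 v (W (a t) *m v).
      by rewrite mulKVmx // (symp_omega_inv v v sa) [X in - X]omegaC opprK.
    by rewrite lerN2 hm.
  have := h1 t t01; have := h2 t t01; have := h3 t t01; rewrite !ler_norml.
  set x1 := omega0 y (_ *m y); set x2 := omega0 v (_ *m y); set x3 := omega0 y (_ *m v).
  set x4 := omega0 v (_ *m v) in mv *.
  move=> /andP[x3l x3h] /andP[x2l x2h] /andP[x1l x1h].
  rewrite -normrN; apply: le_trans (ler_norm _).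
  have sb : 0 <= s * be by rewrite mulr_ge0 ?ltW // (lt_le_trans ltr01).
  have e1 : - (x1 + - s * be * x2 + - s * be * (x3 + - s * be * x4)) =
     - x1 + s * be * (x2 + x3) + (s * be) ^+ 2 * (- x4) by ring.
  have ee : forall z, z = - x1 + s * be * (x2 + x3) + (s * be) ^+ 2 * (- x4) -> K * B <= z.
    move=> _ ->; have f1 : - (s * be * (c2 + c3)) <= s * be * (x2 + x3).
      by rewrite -mulrN ler_wpM2l // opprD lerD.
    have f2 : (s * be) ^+ 2 * m0 <= (s * be) ^+ 2 * (- x4).
      by apply: ler_wpM2l; [exact: sqr_ge0 | rewrite lerNr].
    have f3 : (s * be) ^+ 2 * m0 = s * (s * q) by rewrite /q; ring.
    have f4 : c1 + K * B + 1 + q <= s * (c1 + K * B + 1 + q).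
      by rewrite ler_peMl // !addr_ge0 ?(ltW q0) //.
    have f5 : s * (s * q) = s * be * (c2 + c3) + s * (c1 + K * B + 1 + q) by rewrite sq; ring.
    lra.
  by apply: ee; ring.
exists e, s; split=> //; split.
  move=> t tI; rewrite Gam_vel //; apply: sp_plus_conj; first exact: Rot_symp.
  by have [Z pZ ->] := dec s t tI; apply: sp_plus_add => //; exact: pE.
rewrite (lengthGE (Gam_C1 e s)).
apply: le_trans (_ : ((e * A') * ((t1 + r) - (t1 - r)))%:E <= _)%E.
  rewrite lee_fin; apply: (le_trans (ler_norm A)).
  have -> : e * A' * (t1 + r - (t1 - r)) = `|A| by rewrite /A'; field; rewrite !gt_eqF.
  by [].
apply: integral_ge_cst => //; [lra | lra | | |].
- by move=> x _; exact: G_ge0.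
- by rewrite mulr_ge0 // ltW.
move=> t tI; have t01 : 0 <= t <= 1.
  by case/andP: tI => h5 h6; rewrite (le_trans lo h5) (le_trans h6) // (le_trans hi) // invf_le1 // ler1n.
apply: le_trans (GY s t t01); rewrite ler_pM2l //.
apply: le_trans (G_JhJ_ge (Wt_symp s t01)).
have nn : (n + n)%:R != 0 :> R by rewrite pnatr_eq0 -lt0n ltn_addr.
have -> : A' = powR B ((n + n)%:R^-1).
  by rewrite /B -powR_mulrn // -powRrM divff // powRr1.
apply: ge0_ler_powR; rewrite ?nnegrE ?invr_ge0 ?ler0n //; last exact: low.
exact: le_trans B0 (low t tI).
Qed.

Lemma detour_exists (A : R) : exists W' : R -> M,
  [/\ causal_curve W', W' 0 = 1%:M, homotopic W' W & (A%:E <= lengthG W')%E].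
Proof.
have [e [s [e0 [pG lG]]]] := detour_long A; exists (Gam e s); split=> //.
- apply: timelike_causal => //; apply/timelikeE; exists (GamD e s); split=> //; first exact: Gam_C1.
  by move=> t tI; apply: rcurve_symp; exact: Wt_symp.
- by rewrite /Gam /rcurve Wt_0 phi0 Rot0 mul1mx mulmx1.
- exact: Gam_homotopic.
Qed.

End Detour.

Lemma dist_infinite (w W : R -> M) : timelike_to w W ->
  ~ in_closure_ell w -> dist_id w = +oo%E.
Proof.
move=> tW nc; have := tW; move=> [/timelikeE[D [hW sW pW]] [W0 hWw]].
have [ts [v [ts01 v0 Pv]]] : exists (ts : R) (v : V), [/\ 0 < ts < 1, v != 0 & W ts *m v = - v].
  apply: contrapT => nex; apply: nc; apply: (timelike_no_minus1_closure tW) => t t01 x x0.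
  by apply/eqP => e; apply: nex; exists t, x.
rewrite /dist_id; case: asboolP => [_|[]]; last first.
  by exists W; split; [apply: timelike_causal => //; apply/timelikeE; exists D | ].
apply/eqyP => A A0.
have [W' [cW' W'0 hW' lW']] := detour_exists hW W0 sW pW ts01 v0 Pv A.
apply: le_trans lW' _; apply: ereal_sup_ubound; exists W' => //; split=> //; split=> //.
exact: homotopic_trans hW' hWw.
Qed.

End Infinite.

(** * Complex limits and derivatives by real and imaginary parts *)

Section ComplexLimits.
Variable R : realType.
Local Notation C := R[i].
Local Notation toC := (real_complex R).
Local Notation Re := (@complex.Re R).
Local Notation Im := (@complex.Im R).

Lemma cReD (a b : C) : Re (a + b) = Re a + Re b. Proof. by case: a b => [? ?] [? ?]. Qed.
Lemma cImD (a b : C) : Im (a + b) = Im a + Im b. Proof. by case: a b => [? ?] [? ?]. Qed.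
Lemma cReN (a : C) : Re (- a) = - Re a. Proof. by case: a. Qed.
Lemma cImN (a : C) : Im (- a) = - Im a. Proof. by case: a. Qed.
Lemma cReM (a b : C) : Re (a * b) = Re a * Re b - Im a * Im b. Proof. by case: a b => [? ?] [? ?]. Qed.
Lemma cImM (a b : C) : Im (a * b) = Re a * Im b + Im a * Re b. Proof. by case: a b => [? ?] [? ?]. Qed.
Lemma C_ext (a b : C) : Re a = Re b -> Im a = Im b -> a = b.
Proof. by case: a b => [? ?] [? ?] /= -> ->. Qed.
Lemma Re_sum (I : Type) (r : seq I) (P : pred I) (f : I -> C) :
  Re (\sum_(i <- r | P i) f i) = \sum_(i <- r | P i) Re (f i).
Proof. exact: (big_morph Re cReD). Qed.
Lemma Im_sum (I : Type) (r : seq I) (P : pred I) (f : I -> C) :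
  Im (\sum_(i <- r | P i) f i) = \sum_(i <- r | P i) Im (f i).
Proof. exact: (big_morph Im cImD). Qed.

Definition ccvg (T : Type) (F : set_system T) (f : T -> C) (a : C) :=
  Re (f x) @[x --> F] --> Re a /\ Im (f x) @[x --> F] --> Im a.

Section CF.
Variables (T : Type) (F : set_system T) (FF : Filter F).

Lemma ccvg_cst (a : C) : ccvg F (fun=> a) a.
Proof. by split; exact: cvg_cst. Qed.

Lemma ccvgD f g a b : ccvg F f a -> ccvg F g b -> ccvg F (fun x => f x + g x) (a + b).
Proof.
move=> [f1 f2] [g1 g2]; split.
  by under eq_fun do rewrite cReD; rewrite cReD; apply: cvgD.
by under eq_fun do rewrite cImD; rewrite cImD; apply: cvgD.
Qed.

Lemma ccvgN f a : ccvg F f a -> ccvg F (fun x => - f x) (- a).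
Proof.
move=> [f1 f2]; split.
  by under eq_fun do rewrite cReN; rewrite cReN; apply: cvgN.
by under eq_fun do rewrite cImN; rewrite cImN; apply: cvgN.
Qed.

Lemma ccvgM f g a b : ccvg F f a -> ccvg F g b -> ccvg F (fun x => f x * g x) (a * b).
Proof.
move=> [f1 f2] [g1 g2]; split.
  by under eq_fun do rewrite cReM; rewrite cReM; apply: cvgB; apply: cvgM.
by under eq_fun do rewrite cImM; rewrite cImM; apply: cvgD; apply: cvgM.
Qed.

Lemma ccvg_conj f a : ccvg F f a -> ccvg F (fun x => conjc (f x)) (conjc a).
Proof.
move=> [f1 f2]; split.
  rewrite (_ : (fun x => _) = (fun x => Re (f x))); first by case: (a) f1.
  by apply/funext => x; case: (f x).
rewrite (_ : (fun x => _) = (fun x => - Im (f x))); last by apply/funext => x; case: (f x).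
have -> : Im (conjc a) = - Im a by case: (a).
exact: cvgN.
Qed.

Lemma ccvg_toC (f : T -> R) (a : R) : f x @[x --> F] --> a -> ccvg F (fun x => toC (f x)) (toC a).
Proof. by move=> h; split=> //=; exact: cvg_cst. Qed.

Lemma ccvg_sum (I : Type) (r : seq I) (P : pred I) (f : I -> T -> C) (a : I -> C) :
  (forall i, P i -> ccvg F (f i) (a i)) ->
  ccvg F (fun x => \sum_(i <- r | P i) f i x) (\sum_(i <- r | P i) a i).
Proof.
move=> h; elim: r => [|i r IH].
  by under eq_fun do rewrite big_nil; rewrite big_nil; exact: ccvg_cst.
under eq_fun do rewrite big_cons; rewrite big_cons; case: ifP => // Pi.
by apply: ccvgD => //; exact: h.
Qed.

Lemma ccvg_prod (I : Type) (r : seq I) (P : pred I) (f : I -> T -> C) (a : I -> C) :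
  (forall i, P i -> ccvg F (f i) (a i)) ->
  ccvg F (fun x => \prod_(i <- r | P i) f i x) (\prod_(i <- r | P i) a i).
Proof.
move=> h; elim: r => [|i r IH].
  by under eq_fun do rewrite big_nil; rewrite big_nil; exact: ccvg_cst.
under eq_fun do rewrite big_cons; rewrite big_cons; case: ifP => // Pi.
by apply: ccvgM => //; exact: h.
Qed.

Definition mcvg m k (A : T -> 'M[C]_(m, k)) (A0 : 'M[C]_(m, k)) :=
  forall i j, ccvg F (fun x => A x i j) (A0 i j).

Lemma mcvg_cst m k (A : 'M[C]_(m, k)) : mcvg (fun=> A) A.
Proof. by move=> i j; exact: ccvg_cst. Qed.

Lemma mcvgD m k (A B : T -> 'M[C]_(m, k)) A0 B0 : mcvg A A0 -> mcvg B B0 ->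
  mcvg (fun x => A x + B x) (A0 + B0).
Proof.
by move=> a b i j; under eq_fun do rewrite mxE; rewrite mxE; apply: ccvgD; [exact: a | exact: b].
Qed.

Lemma mcvgM m k l (A : T -> 'M[C]_(m, k)) (B : T -> 'M[C]_(k, l)) A0 B0 : mcvg A A0 -> mcvg B B0 ->
  mcvg (fun x => A x *m B x) (A0 *m B0).
Proof.
move=> a b i j; under eq_fun do rewrite mxE; rewrite mxE.
by apply: (@ccvg_sum _ _ _ (fun k x => A x i k * B x k j)) => u _; apply: ccvgM; [exact: a | exact: b].
Qed.

Lemma mcvgZ m k (f : T -> C) (A : T -> 'M[C]_(m, k)) a A0 : ccvg F f a -> mcvg A A0 ->
  mcvg (fun x => f x *: A x) (a *: A0).
Proof.
by move=> h b i j; under eq_fun do rewrite mxE; rewrite mxE; apply: ccvgM => //; exact: b.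
Qed.

Lemma mcvgN m k (A : T -> 'M[C]_(m, k)) A0 : mcvg A A0 -> mcvg (fun x => - A x) (- A0).
Proof. by move=> a i j; under eq_fun do rewrite mxE; rewrite mxE; apply: ccvgN; exact: a. Qed.

Lemma mcvg_det m (A : T -> 'M[C]_m) A0 : mcvg A A0 -> ccvg F (fun x => \det (A x)) (\det A0).
Proof.
move=> a; apply: (@ccvg_sum _ _ _ (fun (s : 'S_m) x => (-1) ^+ s * \prod_i A x i (s i))) => s _.
apply: ccvgM; first exact: ccvg_cst.
by apply: (@ccvg_prod _ _ _ (fun i x => A x i (s i))) => i _; exact: a.
Qed.

Lemma mcvg_cmx n (W : T -> 'M[R]_(n + n)) W0 : W x @[x --> F] --> W0 ->
  mcvg (fun x => cmx (W x)) (cmx W0).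
Proof.
move=> h i j; under eq_fun do rewrite mxE; rewrite mxE; apply: ccvg_toC.
exact: (@cvg_mx_entry _ _ F _ _ _ W W0).
Qed.

End CF.

Lemma ccvg_unique (T : Type) (F : set_system T) (FF : ProperFilter F) (f : T -> C) a b :
  ccvg F f a -> ccvg F f b -> a = b.
Proof. by move=> [a1 a2] [b1 b2]; apply: C_ext; [exact: cvg_unique a1 b1 | exact: cvg_unique a2 b2]. Qed.

Definition cder (f : R -> C) (t : R) (d : C) :=
  is_derive t 1 (fun x => Re (f x)) (Re d) /\ is_derive t 1 (fun x => Im (f x)) (Im d).

Lemma cder_eq f t d d' : cder f t d -> d = d' -> cder f t d'. Proof. by move=> h <-. Qed.

Lemma cder_cst a t : cder (fun=> a) t 0.
Proof. by split; exact: is_derive_cst. Qed.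

Lemma cderD f g t a b : cder f t a -> cder g t b -> cder (fun x => f x + g x) t (a + b).
Proof.
move=> [f1 f2] [g1 g2]; split.
  by under eq_fun do rewrite cReD; rewrite cReD; exact: is_deriveD f1 g1.
by under eq_fun do rewrite cImD; rewrite cImD; exact: is_deriveD f2 g2.
Qed.

Lemma cderM f g t a b : cder f t a -> cder g t b -> cder (fun x => f x * g x) t (a * g t + f t * b).
Proof.
move=> [f1 f2] [g1 g2]; split.
  under eq_fun do rewrite cReM; apply: is_derive_eq (is_deriveB (is_deriveMr f1 g1) (is_deriveMr f2 g2)) _.
  by rewrite cReD !cReM; ring.
under eq_fun do rewrite cImM; apply: is_derive_eq (is_deriveD (is_deriveMr f1 g2) (is_deriveMr f2 g1)) _.
by rewrite cImD !cImM; ring.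
Qed.

Lemma cder_sum (I : Type) (r : seq I) (P : pred I) (f : I -> R -> C) (a : I -> C) t :
  (forall i, cder (f i) t (a i)) ->
  cder (fun x => \sum_(i <- r | P i) f i x) t (\sum_(i <- r | P i) a i).
Proof.
move=> h; elim: r => [|i r IH].
  by under eq_fun do rewrite big_nil; rewrite big_nil; exact: cder_cst.
by under eq_fun do rewrite big_cons; rewrite big_cons; case: ifP => // Pi; apply: cderD.
Qed.

Lemma cder_prod (I : eqType) (r : seq I) (f : I -> R -> C) (a : I -> C) t : uniq r ->
  (forall i, cder (f i) t (a i)) ->
  cder (fun x => \prod_(i <- r) f i x) t (\sum_(i <- r) a i * \prod_(j <- r | j != i) f j t).
Proof.
move=> + h; elim: r => [_|i r IH /= /andP[ir ur]].
  by under eq_fun do rewrite big_nil; rewrite big_nil; exact: cder_cst.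
under eq_fun do rewrite big_cons; apply: cder_eq (cderM (h i) (IH ur)) _.
rewrite big_cons; congr (_ + _).
  rewrite big_cons eqxx /=; congr (_ * _); rewrite big_seq [RHS]big_seq_cond.
  by apply: eq_bigl => j; case: (boolP (j \in r)) => //= jr; symmetry; apply: contraNneq ir => <-.
rewrite mulr_sumr; apply: eq_big_seq => j jr.
have ij : i != j by apply: contraNneq ir => ->.
by rewrite big_cons ij mulrCA.
Qed.

(** A permutation other than the identity moves at least two indices, so each term in the derivative
    of its product keeps an off-diagonal entry of the identity matrix; only the diagonal product
    contributes. *)
Lemma cder_det1 m (A : R -> 'M[C]_m) (t : R) (D : 'M[C]_m) : A t = 1%:M ->
  (forall i j, cder (fun x => A x i j) t (D i j)) -> cder (fun x => \det (A x)) t (\tr D).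
Proof.
move=> A1 h; rewrite /determinant.
pose a (s : 'S_m) : C := (-1) ^+ s * \sum_(i : 'I_m) D i (s i) * \prod_(j | j != i) A t j (s j).
have hs (s : 'S_m) : cder (fun x => (-1) ^+ s * \prod_i A x i (s i)) t (a s).
  have hp := @cder_prod _ (enum 'I_m) (fun i x => A x i (s i)) (fun i => D i (s i)) t (enum_uniq _) (fun i => h i (s i)).
  have {}hp : cder (fun x => \prod_i A x i (s i)) t (\sum_(i : 'I_m) D i (s i) * \prod_(j | j != i) A t j (s j)).
    rewrite (_ : (fun x => _) = (fun x => \prod_(i <- enum 'I_m) A x i (s i))); last first.
      by apply/funext => x; rewrite big_enum.
    apply: cder_eq hp _; rewrite big_enum /=; apply: eq_bigr => i _; congr (_ * _).
    by rewrite big_enum_cond.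
  by apply: cder_eq (cderM (cder_cst ((-1) ^+ s) t) hp) _; rewrite mul0r add0r.
apply: cder_eq (@cder_sum _ _ _ (fun (s : 'S_m) x => (-1) ^+ s * \prod_i A x i (s i)) a t hs) _.
rewrite (bigD1 1%g) //= big1 ?addr0 => [|s s1].
  rewrite /a odd_perm1 expr0 mul1r; apply: eq_bigr => i _; rewrite perm1 big1 ?mulr1 // => j _.
  by rewrite perm1 A1 mxE eqxx.
rewrite /a big1 ?mulr0 // => i _.
have [j ji sj] : exists2 j, j != i & s j != j.
  apply: contrapT => hn; move/eqP: s1; apply; apply/permP => j; rewrite perm1.
  have fx k : k != i -> s k = k.
    by move=> ki; apply/eqP/negPn/negP => sk; apply: hn; exists k.
  have [->|] := eqVneq j i; last exact: fx.
  apply/eqP/negPn/negP => si; have := fx _ si; move/perm_inj => e; by rewrite e eqxx in si.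
by rewrite (bigD1 j) //= A1 mxE eq_sym (negPf sj) mul0r mulr0.
Qed.

Lemma cder_mulmx m k l (P : 'M[C]_(m, k)) (A : R -> 'M[C]_(k, l)) (t : R) (D : 'M[C]_(k, l)) :
  (forall i j, cder (fun x => A x i j) t (D i j)) ->
  forall i j, cder (fun x => (P *m A x) i j) t ((P *m D) i j).
Proof.
move=> h i j; under eq_fun do rewrite mxE; rewrite mxE.
apply: (@cder_sum _ _ _ (fun u x => P i u * A x u j)) => u.
by apply: cder_eq (cderM (cder_cst (P i u) t) (h u j)) _; rewrite mul0r add0r.
Qed.

(** Jacobi's formula, reduced to the identity matrix by multiplication with the constant inverse of
    [A t]. *)
Lemma cder_det m (A : R -> 'M[C]_m) (t : R) (D : 'M[C]_m) : A t \in unitmx ->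
  (forall i j, cder (fun x => A x i j) t (D i j)) ->
  cder (fun x => \det (A x)) t (\det (A t) * \tr (invmx (A t) *m D)).
Proof.
move=> u h; have h1 := @cder_det1 m (fun x => invmx (A t) *m A x) t _ (mulVmx u) (cder_mulmx (invmx (A t)) h).
apply: cder_eq (_ : cder _ t (0 * \det (invmx (A t) *m A t) + \det (A t) * \tr (invmx (A t) *m D))) _; last first.
  by rewrite mul0r add0r.
have := cderM (cder_cst (\det (A t)) t) h1.
rewrite (_ : (fun x => _ * _) = (fun x => \det (A x))) //; apply/funext => x.
by rewrite -det_mulmx mulKVmx.
Qed.

End ComplexLimits.

(** * Continuous arguments of maps to the circle *)

Section Lift.
Variable R : realType.

Lemma cvg_sq (T : Type) (F : set_system T) (FF : Filter F) (f : T -> R) (a : R) :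
  f x @[x --> F] --> a -> f x ^+ 2 @[x --> F] --> a ^+ 2.
Proof. by move=> h; apply: cvgM. Qed.

Lemma atan_unit (c d : R) : 0 < d -> d ^+ 2 + c ^+ 2 = 1 ->
  cos (atan (c / d)) = d /\ sin (atan (c / d)) = c.
Proof.
move=> d0 e; have ce : cos (atan (c / d)) = d.
  rewrite cos_atan (_ : 1 + (c / d) ^+ 2 = d^-1 ^+ 2).
    by rewrite sqrtr_sqr ger0_norm ?invrK // invr_ge0 ltW.
  by rewrite exprMn -{1}(mulfV (_ : d ^+ 2 != 0)) ?expf_neq0 ?gt_eqF // exprVn -mulrDl e mul1r.
split=> //; have := atanK (c / d); rewrite /tan ce => /(congr1 (fun x => x * d)).
by rewrite !divfK // gt_eqF.
Qed.

Definition scl (N k : nat) (z : R * R) : R * R :=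
  (k%:R / N.+1%:R * clamp z.1, k%:R / N.+1%:R * clamp z.2).

Lemma scl_continuous N k : continuous (scl N k).
Proof.
move=> z; apply: cvg_pair2.
  have h : clamp x.1 @[x --> z] --> clamp z.1.
    by apply: (@cvg_comp _ _ _ fst (@clamp R)); [exact: cvg_fst | exact: clamp_continuous].
  by apply: cvgM; [exact: cvg_cst | exact: h].
have h : clamp x.2 @[x --> z] --> clamp z.2.
  by apply: (@cvg_comp _ _ _ snd (@clamp R)); [exact: cvg_snd | exact: clamp_continuous].
by apply: cvgM; [exact: cvg_cst | exact: h].
Qed.

(** The segment from [(0, 0)] to a point of the square is cut into [N + 1] equal pieces, with [N] so
    large that consecutive values make an acute angle. The lift is the sum of these angles, each
    given continuously by [atan]. *)
Lemma lift_square (p q : R * R -> R) : continuous p -> continuous q ->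
  (forall z, p z ^+ 2 + q z ^+ 2 = 1) -> p (0, 0) = 1 -> q (0, 0) = 0 ->
  exists al : R * R -> R, [/\ continuous al, al (0, 0) = 0 &
    forall z, cos (al z) = p (clamp z.1, clamp z.2) /\ sin (al z) = q (clamp z.1, clamp z.2)].
Proof.
move=> cp cq pq p0 q0.
(* [dt] and, further down, [cr] are the cosine and the sine of the angle from the value at [z] to
   the value at [w]. *)
pose dt (z w : R * R) := p z * p w + q z * q w.
pose K : set (R * R) := `[0, 1] `*` `[0, 1].
have cK : compact K by apply: compact_setX; exact: segment_compact.
pose P (N : nat) (z : R * R) := forall w : R * R, `|w.1 - z.1| <= N.+1%:R^-1 ->
  `|w.2 - z.2| <= N.+1%:R^-1 -> 0 < dt z w.
have [N _ hN] : \forall N \near \oo, K `<=` P N.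
  move/compact_near_coveringP: cK; apply => x _.
  have cdt : {for (x, x), continuous (fun zw : (R * R) * (R * R) => dt zw.1 zw.2)}.
    have c1 (f : R * R -> R) : continuous f -> f zw.1 @[zw --> ((x, x) : (R * R) * (R * R))] --> f x.
      by move=> cf; apply: (@cvg_comp _ _ _ fst f); [exact: cvg_fst | exact: cf].
    have c2 (f : R * R -> R) : continuous f -> f zw.2 @[zw --> ((x, x) : (R * R) * (R * R))] --> f x.
      by move=> cf; apply: (@cvg_comp _ _ _ snd f); [exact: cvg_snd | exact: cf].
    by apply: cvgD; apply: cvgM; [exact: c1 | exact: c2 | exact: c1 | exact: c2].
  have /nbhs_ballP[r /= r0 hr] : nbhs (x, x) ((fun zw : (R * R) * (R * R) => dt zw.1 zw.2) @^-1` [set y | 0 < y]).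
    by apply: cdt; apply: lt_nbhsr; rewrite /dt -!expr2 pq.
  exists (ball x (r / 2), [set N : nat | (N.+1%:R^-1 : R) < r / 2]).
    split=> /=; first by apply: nbhsx_ballx; lra.
    have r2 : 0 < r / 2 by lra.
    exact: (near_infty_natSinv_lt (PosNum r2)).
  move=> [z k] [/= [bz1 bz2] kr] w w1 w2; apply: (hr (z, w)).
  move: bz1 bz2 w1 w2 kr; rewrite /ball /= /ball /= /ball /= => bz1 bz2 w1 w2 kr.
  have tr (a b c : R) : `|a - b| < r / 2 -> `|c - b| <= k.+1%:R^-1 -> `|a - c| < r.
    move=> h1 h2; have h3 := le_lt_trans h2 kr.
    by have := ler_normD (a - b) (b - c); rewrite addrA subrK (distrC b c) => h4; lra.
  have rr : r / 2 < r by lra.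
  by split; split=> /=; [exact: lt_trans bz1 rr | exact: lt_trans bz2 rr | exact: tr bz1 w1 | exact: tr bz2 w2].
have {hN} hN z : K z -> P N z by apply: (hN N) => /=.
have sK k z : (k <= N.+1)%N -> K (scl N k z).
  move=> kN; have kk : 0 <= (k%:R / N.+1%:R : R) <= 1.
    by rewrite divr_ge0 ?ler0n //= ler_pdivrMr ?ltr0n // mul1r ler_nat.
  have [/andP[a0 a1] /andP[b0 b1]] := (clamp_itv z.1, clamp_itv z.2); case/andP: kk => k0 k1.
  split; rewrite /= in_itv /=; apply/andP; split.
  - by apply: mulr_ge0.
  - by apply: mulr_ile1.
  - by apply: mulr_ge0.
  - by apply: mulr_ile1.
have pos_dt k z : (k < N.+1)%N -> 0 < dt (scl N k z) (scl N k.+1 z).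
  move=> kN; apply: hN; first by apply: sK; exact: ltnW.
    rewrite /= -mulrBl -mulrBl -natrB // subSnn mul1r normrM ger0_norm ?invr_ge0 ?ler0n //.
    have /andP[a0 a1] := clamp_itv z.1; rewrite ger0_norm // ler_piMr // invr_ge0 ler0n //.
  rewrite /= -mulrBl -mulrBl -natrB // subSnn mul1r normrM ger0_norm ?invr_ge0 ?ler0n //.
  have /andP[a0 a1] := clamp_itv z.2; rewrite ger0_norm // ler_piMr // invr_ge0 ler0n //.
pose cr (z w : R * R) := p z * q w - q z * p w.
pose an k z := atan (cr (scl N k z) (scl N k.+1 z) / dt (scl N k z) (scl N k.+1 z)).
exists (fun z => \sum_(k < N.+1) an k z); split.
- move=> z; apply: (@cvg_sumr _ _ _ _ _ _ _ (fun k z => an (nat_of_ord k) z)) => k _.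
  have cs (f : R * R -> R) j : continuous f -> f (scl N j w) @[w --> z] --> f (scl N j z).
    move=> cf; apply: (@cvg_comp _ _ _ (scl N j) f); [exact: scl_continuous | exact: cf].
  have cdt : dt (scl N k w) (scl N k.+1 w) @[w --> z] --> dt (scl N k z) (scl N k.+1 z).
    by apply: cvgD; apply: cvgM; apply: cs.
  have ccr : cr (scl N k w) (scl N k.+1 w) @[w --> z] --> cr (scl N k z) (scl N k.+1 z).
    by apply: cvgB; apply: cvgM; apply: cs.
  have hq : cr (scl N k w) (scl N k.+1 w) / dt (scl N k w) (scl N k.+1 w) @[w --> z] -->
      cr (scl N k z) (scl N k.+1 z) / dt (scl N k z) (scl N k.+1 z).
    apply: cvgM; first exact: ccr.
    by apply: cvgV; [rewrite gt_eqF ?pos_dt | exact: cdt].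
  apply: (@cvg_comp _ _ _ (fun w => cr (scl N k w) (scl N k.+1 w) / dt (scl N k w) (scl N k.+1 w)) atan).
    exact: hq.
  exact: continuous_atan.
- rewrite big1 // => k _; rewrite /an /cr /scl /= clamp_lo // !mulr0 q0 mulr0 mul0r subrr mul0r.
  exact: atan0.
move=> z; have H j : (j <= N.+1)%N -> cos (\sum_(k < j) an k z) = p (scl N j z) /\
    sin (\sum_(k < j) an k z) = q (scl N j z).
  elim: j => [_|j IH jN].
    by rewrite big_ord0 cos0 sin0 /scl !mul0r p0 q0.
  have [c s] := IH (ltnW jN); rewrite big_ord_recr /= cosD sinD c s.
  have h1 := pq (scl N j z); have h2 := pq (scl N j.+1 z).
  have [->->] : cos (an j z) = dt (scl N j z) (scl N j.+1 z) /\ sin (an j z) = cr (scl N j z) (scl N j.+1 z).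
    by apply: atan_unit; [exact: pos_dt | rewrite -[RHS]mulr1 -{1}h1 -{1}h2 /dt /cr; ring].
  move: h1 h2; rewrite /dt /cr; set a := p _; set b := q _; set a' := p _; set b' := q _ => h1 h2.
  by split; rewrite -[RHS]mulr1 -h1; ring.
have [] := H N.+1 (leqnn _); rewrite /scl divff ?pnatr_eq0 // !mul1r.
by split.
Qed.

Lemma is_deriveDr (f g : R -> R) (t df dg : R) : is_derive t 1 f df -> is_derive t 1 g dg ->
  is_derive t 1 (fun x => f x + g x) (df + dg).
Proof. by move=> hf hg; exact: (is_deriveD hf hg). Qed.

(** The function [al] is only known to be continuous. Near [t] its increment is the arctangent of
    [u / v], where [u] and [v] are the sine and cosine of the increment times one positive factor,
    and this quotient can be differentiated. *)
Lemma lift_derive (a b rho al : R -> R) (t da db : R) :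
  (\forall x \near t, [/\ a x = rho x * cos (al x), b x = rho x * sin (al x) & 0 < rho x]) ->
  {for t, continuous al} -> is_derive t 1 a da -> is_derive t 1 b db ->
  is_derive t 1 al ((db * a t - da * b t) / (a t ^+ 2 + b t ^+ 2)).
Proof.
move=> nr cal ha hb; have [at0 bt0 rt0] := nbhs_singleton nr.
pose u x := b x * a t - a x * b t; pose v x := a x * a t + b x * b t.
have du : is_derive t 1 u (db * a t - da * b t).
  have -> : u = (fun x => a t * b x + (- b t) * a x) by apply/funext => x; rewrite /u; ring.
  have h1 : is_derive t 1 (fun x => a t * b x) (a t * db).
    by apply: is_derive_eq (is_deriveMr (is_derive_cst (a t) t 1) hb) _; rewrite mul0r add0r.
  have h2 : is_derive t 1 (fun x => - b t * a x) (- b t * da).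
    by apply: is_derive_eq (is_deriveMr (is_derive_cst (- b t) t 1) ha) _; rewrite mul0r add0r.
  by apply: is_derive_eq (is_deriveDr h1 h2) _; ring.
have dv : is_derive t 1 v (da * a t + db * b t).
  have h1 : is_derive t 1 (fun x => a x * a t) (da * a t).
    by apply: is_derive_eq (is_deriveMr ha (is_derive_cst (a t) t 1)) _; rewrite mulr0 addr0.
  have h2 : is_derive t 1 (fun x => b x * b t) (db * b t).
    by apply: is_derive_eq (is_deriveMr hb (is_derive_cst (b t) t 1)) _; rewrite mulr0 addr0.
  exact: is_deriveDr.
have vt : v t = rho t ^+ 2.
  by rewrite /v at0 bt0 -[RHS]mulr1 -(cos2Dsin2 (al t)); ring.
have v0 : v t != 0 by rewrite vt expf_neq0 // gt_eqF.
have ut : u t = 0 by rewrite /u mulrC subrr.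
have dV : is_derive t 1 (fun x => u x * (v x)^-1) ((db * a t - da * b t) * (v t)^-1).
  by apply: is_derive_eq (is_deriveMr du (is_deriveV v0 dv)) _; rewrite ut mul0r addr0.
have dA : is_derive t 1 (fun x => atan (u x * (v x)^-1)) ((db * a t - da * b t) * (v t)^-1).
  apply: is_derive_eq (is_derive_comp (is_derive1_atan _) dV) _.
  by rewrite ut mul0r expr0n /= addr0 invr1 mulr1.
have dB : is_derive t 1 (fun x => al t + atan (u x * (v x)^-1)) ((db * a t - da * b t) * (v t)^-1).
  by apply: is_derive_eq (is_deriveDr (is_derive_cst (al t) t 1) dA) _; rewrite add0r.
have -> : a t ^+ 2 + b t ^+ 2 = v t by rewrite /v; ring.
apply: near_eq_is_derive dB.
have pi2 : 0 < pi / 2 :> R by rewrite divr_gt0 // pi_gt0.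
have nal : \forall x \near t, `|al x - al t| < pi / 2.
  by have /cvgrPdist_lt/(_ _ pi2) := cal; apply: filterS => x; rewrite distrC.
apply: filterS2 nr nal => x [ax bx rx] hx.
have hI : al x - al t \in `](- (pi / 2)), (pi / 2)[%R.
  by rewrite in_itv /=; rewrite ltr_norml in hx.
rewrite -[RHS](subrK (al t)) addrC; congr (_ + _); rewrite -[RHS]tanK //; congr atan.
have cx : 0 < cos (al x - al t) by apply: cos_gt0_pihalf; rewrite in_itv in hI.
have vx : v x = rho x * rho t * cos (al x - al t).
  by rewrite /v ax bx at0 bt0 cosB; ring.
have ux : u x = rho x * rho t * sin (al x - al t).
  by rewrite /u ax bx at0 bt0 sinB; ring.
by rewrite vx ux /tan -mulf_div divff ?mul1r // mulf_neq0 // gt_eqF.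
Qed.

End Lift.

(** * Krein contractions *)

Section Contraction.
Variables (R : realType) (n : nat).
Hypothesis n0 : (0 < n)%N.
Local Notation C := R[i].
Local Notation M := 'M[R]_(n + n).
Local Notation V := 'cV[R]_(n + n).
Local Notation CV := 'cV[C]_(n + n).
Local Notation J := (J0 R n).
Local Notation Jc := (J0c R n).
Local Notation toC := (real_complex R).
Local Notation Re := (@complex.Re R).
Local Notation Im := (@complex.Im R).

Definition kq (x : CV) : R := Im (Hf x x).
Definition c2 (x : CV) : R := qform 1%:M (cre x) + qform 1%:M (cim x).
Definition cv (u : V) : CV := map_mx toC u.
(** On eigenvectors of [J] for [i] this multiplies by [1 - eta], for [-i] by [1 + eta]: it shrinks
    Krein-positive and stretches Krein-negative directions. *)
Definition cE (eta : R) : 'M[C]_(n + n) := 1%:M + ('i%C * toC eta) *: Jc.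

Lemma qform1E (u : V) : qform 1%:M u = (u^T *m u) 0 0.
Proof. by rewrite /qform mulmx1. Qed.

Lemma qform1J (u : V) : qform 1%:M (J *m u) = qform 1%:M u.
Proof. by rewrite !qform1E trmx_mul trJ mulmxN mulNmx mulmxA -[u^T *m J *m J]mulmxA JJ mulmxN mulmx1 mulNmx opprK. Qed.

Lemma qform1_lin (a b : R) (v w : V) : qform 1%:M (a *: v + b *: w) =
  a ^+ 2 * qform 1%:M v + 2 * a * b * (v^T *m w) 0 0 + b ^+ 2 * qform 1%:M w.
Proof.
rewrite !qform1 [(v^T *m w) 0 0]mxE !mulr_sumr -!big_split /=; apply: eq_bigr => i _.
by rewrite !mxE; ring.
Qed.

Lemma qform1_ge0 (u : V) : 0 <= qform 1%:M u.
Proof. by rewrite qform1 sumr_ge0 // => i _; exact: sqr_ge0. Qed.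

Lemma c2_ge0 x : 0 <= c2 x. Proof. by rewrite addr_ge0 // qform1_ge0. Qed.

Lemma c2_gt0 x : x != 0 -> 0 < c2 x.
Proof.
move=> /csplit_neq0 /orP[] h; have := qform1_gt0 h; rewrite /c2.
  by have := qform1_ge0 (cim x); lra.
by have := qform1_ge0 (cre x); lra.
Qed.

Lemma c2E x : c2 x = \sum_i (Re (x i 0) ^+ 2 + Im (x i 0) ^+ 2).
Proof. by rewrite /c2 !qform1 -big_split /=; apply: eq_bigr => i _; rewrite !mxE. Qed.

Lemma c2D x y : c2 (x + y) <= 2 * c2 x + 2 * c2 y.
Proof.
rewrite !c2E !mulr_sumr -big_split /=; apply: ler_sum => i _; rewrite mxE cReD cImD.
set a := Re _; set b := Im _; set c := Re _; set d := Im _.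
have := sqr_ge0 (a - c); have := sqr_ge0 (b - d); rewrite !sqrrB !sqrrD; lra.
Qed.

Lemma c2Z (a : C) x : c2 (a *: x) = (Re a ^+ 2 + Im a ^+ 2) * c2 x.
Proof.
rewrite !c2E mulr_sumr; apply: eq_bigr => i _; rewrite mxE cReM cImM; ring.
Qed.

Lemma c2_cv u : c2 (cv u) = qform 1%:M u.
Proof. by rewrite c2E qform1; apply: eq_bigr => i _; rewrite mxE /= expr0n addr0. Qed.

Lemma Hf_cv (u v : V) : Hf (cv u) (cv v) = toC (omega0 u v).
Proof.
have -> : omega0 u v = (v^T *m J *m u) 0 0 by rewrite omegaC omegaE trJ mulmxN mulNmx mxE opprK.
rewrite /Hf.
have -> : star (cv v) = map_mx toC v^T.
  by apply/matrixP => i j; rewrite !mxE conjc_real.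
by rewrite /J0c /cv -!map_mxM mxE.
Qed.

Lemma kqE x : kq x = 2 * omega0 (cim x) (cre x).
Proof.
rewrite /kq {1 2}(csplit x) -/(cv _) -/(cv (cim x)) HfDl !HfDr !HfZl !HfZr !Hf_cv.
rewrite !omegaxx !cImD !cImM !cReM /= (omegaC (cre x)) /=; ring.
Qed.

Lemma kq_cv u : kq (cv u) = 0.
Proof.
rewrite kqE; have -> : cim (cv u) = 0 by apply/matrixP => i j; rewrite !mxE.
by rewrite omegaC omega0r oppr0 mulr0.
Qed.

Lemma kq_le x : kq x <= c2 x.
Proof.
rewrite kqE /c2; set a := cre x; set b := cim x.
have := qform1_ge0 (1 *: b + 1 *: (J *m a)).
have -> : omega0 b a = - omega0 b (J *m (J *m a)) by rewrite mulmxA JJ mulNmx mul1mx omegaN opprK.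
by rewrite qform1_lin omegaJ qform1J; lra.
Qed.

Lemma symp_J : symplectic J.
Proof. by apply/sympE; rewrite trJ !mulNmx JJ mulNmx mul1mx opprK. Qed.

Lemma kq_cE eta x : kq (cE eta *m x) = (1 + eta ^+ 2) * kq x - 2 * eta * c2 x.
Proof.
rewrite /kq mulmxDl mul1mx -scalemxAl HfDl !HfDr !HfZl !HfZr.
have hJ : Hf (Jc *m x) (Jc *m x) = Hf x x by rewrite /J0c Hf_symp //; exact: symp_J.
have hq : c2 x = - Re (Hf (Jc *m x) x).
  by rewrite /J0c -Qc_Hf /Qc !omegaJ /c2 !qform1E.
rewrite hJ (HfC (Jc *m x) x) hq; have := Hf_im x; case: (Hf x x) => a b /= ->.
by case: (Hf _ x) => c d /=; ring.
Qed.

Lemma kq_contract (W : M) eta x : symplectic W -> 0 <= eta <= 1 ->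
  kq (cmx W *m cE eta *m x) <= kq x - eta * c2 x.
Proof.
move=> sW /andP[e0 e1]; rewrite -mulmxA /kq Hf_symp // -/(kq _) kq_cE -/(kq x).
have h1 := kq_le x; have h2 : eta ^+ 2 * kq x <= eta * c2 x.
  apply: le_trans (_ : eta ^+ 2 * c2 x <= _); first by rewrite ler_wpM2l ?sqr_ge0.
  by rewrite ler_wpM2r ?c2_ge0 // expr2 ler_piMr.
lra.
Qed.

Lemma kqD x z : kq (x + z) = kq x + kq z + 2 * Im (Hf x z).
Proof.
rewrite /kq HfDl !HfDr (HfC x z) !cImD; case: (Hf x z) => a b /=; ring.
Qed.

(** An eigenvector for [-1] would keep the value of [kq], which the contraction strictly lowers. *)
Lemma unit1A (W : M) eta : symplectic W -> 0 < eta <= 1 -> 1%:M + cmx W *m cE eta \in unitmx.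
Proof.
move=> sW /andP[e0 e1]; set A := _ *m _; rewrite -unitmx_tr -row_free_unit -kermx_eq0.
apply/negPn/negP => /rowV0Pn [v]; rewrite sub_kermx => /eqP h v0.
pose x : CV := v^T; have x0 : x != 0.
  by apply: contra v0 => /eqP/(congr1 trmx); rewrite trmxK trmx0 => ->.
have hx : A *m x = - x.
  have : (1%:M + A) *m x = 0 by rewrite -[_ *m _]trmxK trmx_mul trmxK h trmx0.
  by rewrite mulmxDl mul1mx => /eqP; rewrite addrC addr_eq0 => /eqP.
have e01 : 0 <= eta <= 1 by rewrite ltW.
have := kq_contract x sW e01; rewrite -/A hx.
have -> : kq (- x) = kq x by rewrite /kq -scaleN1r HfZl HfZr; case: (Hf x x) => a b /=; ring.
by have := c2_gt0 x0; nra.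
Qed.

Lemma Im_quad (P : 'M[C]_(n + n)) (v : V) :
  Im ((map_mx toC v^T *m P *m cv v) 0 0) = qform (map_mx Im P) v.
Proof.
rewrite /qform [in LHS]mxE [in RHS]mxE Im_sum; apply: eq_bigr => j _.
have h1 : cv v j 0 = toC (v j 0) by rewrite mxE.
rewrite cImM h1 /= mulr0 add0r; congr (_ * _).
rewrite [in LHS]mxE [in RHS]mxE Im_sum; apply: eq_bigr => i _.
have h2 : (map_mx toC v^T) 0 i = toC (v^T 0 i) by rewrite mxE.
by rewrite h2 cImM /= mul0r addr0; congr (_ * _); rewrite mxE.
Qed.

(** A real vector has Krein value zero. With [x = B (cv u)], so that [cv u = x + A x], this turns
    the imaginary part of the pairing of [x] with [u] into half the Krein drop from [x] to [A x]. *)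
Lemma Im_form (W : M) eta (u : V) A B : symplectic W -> 0 < eta <= 1 ->
  A = cmx W *m cE eta -> B = invmx (1%:M + A) ->
  eta / 2 * c2 (B *m cv u) <= qform (map_mx Im (B *m Jc)) (- (J *m u)).
Proof.
move=> sW e01 eA eB; have uA := unit1A sW e01; rewrite -eA in uA.
set v := - (J *m u); have Jv : J *m v = u by rewrite /v mulmxN mulmxA JJ mulNmx mul1mx opprK.
have Jcv : Jc *m cv v = cv u by rewrite /J0c /cv -Jv map_mxM.
set x := B *m cv u; have yx : (1%:M + A) *m x = cv u by rewrite /x eB mulKVmx.
have sv : star (cv v) = star (cv u) *m Jc.
  have -> : cv v = cmx (- J) *m cv u by rewrite /cv /v -map_mxM mulNmx.
  by rewrite star_mul linearN /= trJ opprK.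
have -> : qform (map_mx Im (B *m Jc)) v = Im (Hf x (cv u)).
  rewrite /Hf -sv /x -Jcv [B *m (Jc *m _)]mulmxA mulmxA.
  have -> : star (cv v) = map_mx toC v^T by apply/matrixP => i j; rewrite !mxE conjc_real.
  by rewrite Im_quad.
have e1 : cv u = x + A *m x by rewrite -yx mulmxDl mul1mx.
clearbody x; have k0 := kq_cv u; rewrite e1 kqD in k0; rewrite e1 HfDr cImD -/(kq x).
have e01' : 0 <= eta <= 1 by case/andP: e01 => /ltW -> ->.
by have h := kq_contract x sW e01'; rewrite -eA in h; clear -k0 h; lra.
Qed.

(** [N] may fail to be symmetric, so [trace_det_AMGM] is applied to [N + N^T], whose form is twice
    that of [N]. The rank-one part [c v v^T] of [S] contributes [c] times the form at [v]. *)
Lemma trace_posdef_ge (S N : M) (c : R) (v : V) : S^T = S -> posdef N ->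
  posdef (S - c *: (v *m v^T)) -> c * qform N v <= \tr (S *m N).
Proof.
move=> sS pN pS; set Q := S - _ in pS; pose Ns := N + N^T.
have qt u : qform N^T u = qform N u.
  by rewrite /qform -[in LHS](trmxK u) -!trmx_mul mulmxA mxE trmxK.
have sN : Ns^T = Ns by rewrite /Ns linearD /= trmxK addrC.
have pNs : posdef Ns by move=> u u0; rewrite qformD qt addr_gt0 ?pN.
have sQ : Q^T = Q by rewrite /Q linearB /= linearZ /= sS trmx_mul trmxK.
have nn : (0 < n + n)%N by rewrite addn_gt0 n0.
have [h _] := trace_det_AMGM nn sQ sN pS pNs.
have tS : \tr (S *m N^T) = \tr (S *m N).
  by rewrite -mxtrace_tr trmx_mul trmxK sS mxtrace_mulC.
have tv P : \tr (v *m v^T *m P) = qform P v.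
  by rewrite -mulmxA mxtrace_mulC /qform /mxtrace big_ord1.
have e : \tr (Q *m Ns) = 2 * \tr (S *m N) - 2 * (c * qform N v).
  rewrite /Q mulmxBl raddfB /= -scalemxAl mxtraceZ tv /Ns qformD qt mulmxDr mxtraceD tS; ring.
by move: h; rewrite e; lra.
Qed.

Lemma posdef_sub_rank1 (S : M) (m c : R) (v : V) : 0 <= c -> (forall w, m * qform 1%:M w <= qform S w) ->
  c * qform 1%:M v < m -> posdef (S - c *: (v *m v^T)).
Proof.
move=> c0 hS hc w w0.
have e : qform (S - c *: (v *m v^T)) w = qform S w - c * ((v^T *m w) 0 0) ^+ 2.
  rewrite -scaleNr qformD qformZ mulNr; congr (_ - _ * _).
  rewrite /qform mulmxA -mulmxA mxE big_ord1 expr2; congr (_ * _).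
  by rewrite -[LHS](mxE trmx_key (fun i j => (w^T *m v) j i)) -/(trmx _) trmx_mul trmxK.
have cs : ((v^T *m w) 0 0) ^+ 2 <= qform 1%:M v * qform 1%:M w.
  have a0 := qform1_gt0 w0; set a := qform 1%:M w in a0 *; set b := (_ *m _) 0 0.
  have := qform1_ge0 (a *: v + (- b) *: w); rewrite qform1_lin -/a -/b.
  move=> h; have : 0 <= a * (a * qform 1%:M v - b ^+ 2) by move: h; rewrite (_ : _ + _ = a * (a * qform 1%:M v - b ^+ 2)) //; ring.
  by rewrite pmulr_rge0 // subr_ge0 mulrC.
rewrite e; have := hS w; have w1 := qform1_gt0 w0.
have : c * ((v^T *m w) 0 0) ^+ 2 <= c * qform 1%:M v * qform 1%:M w by rewrite -mulrA ler_wpM2l.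
have : c * qform 1%:M v * qform 1%:M w < m * qform 1%:M w by rewrite ltr_pM2r.
lra.
Qed.

End Contraction.

(** * Decrease of the argument along a timelike curve *)

Section Crossing.
Variables (R : realType) (n : nat).
Hypothesis n0 : (0 < n)%N.
Local Notation C := R[i].
Local Notation M := 'M[R]_(n + n).
Local Notation V := 'cV[R]_(n + n).
Local Notation CV := 'cV[C]_(n + n).
Local Notation J := (J0 R n).
Local Notation Jc := (J0c R n).
Local Notation toC := (real_complex R).
Local Notation Re := (@complex.Re R).
Local Notation Im := (@complex.Im R).

Lemma drop_arith (a0 a1 a2 a3 T1 T2 T3 c0 eta ts : R) : 0 < eta -> 0 < ts - eta -> ts < 1 ->
  0 <= T1 -> c0 / eta <= T2 -> 0 <= T3 -> a1 - a0 = - T1 * (ts - eta - 0) ->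
  a2 - a1 = - T2 * (ts - (ts - eta)) -> a3 - a2 = - T3 * (1 - ts) -> a3 <= a0 - c0.
Proof.
move=> e0 l1 ts1 p1 p2 p3 h1 h2 h3.
have g1 : 0 <= T1 * (ts - eta - 0) by rewrite mulr_ge0 // subr0 ltW.
have g3 : 0 <= T3 * (1 - ts) by rewrite mulr_ge0 // subr_ge0 ltW.
have g2 : c0 <= T2 * eta by rewrite -ler_pdivrMr.
have e2 : ts - (ts - eta) = eta by ring.
rewrite e2 mulNr in h2; rewrite mulNr in h1; rewrite mulNr in h3; lra.
Qed.

Section Curve.
Variables (W D : R -> M).
Hypotheses (hW : C1on W D).
Hypotheses (sW : forall t, 0 <= t <= 1 -> symplectic (W t)).
Hypotheses (pW : forall t, 0 <= t <= 1 -> sp_plus (D t *m invmx (W t))).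

Let A eta t := cmx (W t) *m cE n eta.
Let B eta t := invmx (1%:M + A eta t).
Let S t := sform (D t *m invmx (W t)).
Let N eta t := map_mx Im (B eta t *m Jc).

Lemma cder_entry eta t i j : cder (fun x => (1%:M + A eta x) i j) t ((cmx (D t) *m cE n eta) i j).
Proof.
under eq_fun do rewrite mxE.
apply: cder_eq (cderD (cder_cst ((1%:M : 'M[C]_(n + n)) i j) t) (_ : cder _ t ((cmx (D t) *m cE n eta) i j))) (add0r _).
rewrite /A; under eq_fun do rewrite mxE; rewrite [X in cder _ _ X]mxE.
apply: (@cder_sum _ _ _ _ (fun u x => cmx (W x) i u * cE n eta u j)) => u.
have h : cder (fun x => cmx (W x) i u) t (cmx (D t) i u).
  rewrite mxE; under eq_fun do rewrite mxE.
  by split=> /=; [exact: hW.1 | exact: is_derive_cst].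
by apply: cder_eq (cderM h (cder_cst _ t)) _; rewrite mulr0 addr0.
Qed.

Lemma Im_trace (P : M) (Q : 'M[C]_(n + n)) : Im (\tr (cmx P *m Q)) = \tr (P *m map_mx Im Q).
Proof.
rewrite /mxtrace Im_sum; apply: eq_bigr => i _; rewrite [in LHS]mxE [in RHS]mxE Im_sum.
apply: eq_bigr => j _; have h : cmx P i j = toC (P i j) by rewrite mxE.
by rewrite h cImM /= mul0r addr0; congr (_ * _); rewrite mxE.
Qed.

(** The trace is the logarithmic derivative of [det (1 + A)]. The identity [A B = 1 - B] reduces it
    to a real trace minus the trace of [X B], whose imaginary part pairs the velocity form [S] with
    [N]. *)
Lemma Im_logder eta t : 0 <= t <= 1 -> 0 < eta <= 1 ->
  Im (\tr (B eta t *m (cmx (D t) *m cE n eta))) = - \tr (S t *m N eta t).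
Proof.
move=> tI eI; have uA := unit1A (sW tI) eI; have [uW _ _] := symp_inv (sW tI).
set X := D t *m invmx (W t); have DX : D t = X *m W t by rewrite /X mulmxKV.
have AB : A eta t *m B eta t = 1%:M - B eta t.
  have e := mulmxV uA; rewrite -/(A eta t) mulmxDl mul1mx -/(B eta t) in e.
  by rewrite -e addrAC subrr add0r.
have -> : cmx (D t) *m cE n eta = cmx X *m A eta t by rewrite DX cmxM mulmxA.
rewrite mulmxA mxtrace_mulC mulmxA -mulmxA mxtrace_mulC -mulmxA.
have -> : \tr (B eta t *m (cmx X *m A eta t)) = \tr (cmx X *m (A eta t *m B eta t)).
  by rewrite mxtrace_mulC mulmxA.
rewrite AB mulmxBr mulmx1 raddfB /= cImD cImN.
have -> : Im (\tr (cmx X)) = 0.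
  by rewrite /mxtrace Im_sum big1 // => i _; rewrite mxE.
rewrite add0r; congr (- _).
have XS : X = J *m S t by rewrite /S /sform mulmxA trJ mulmxN JJ opprK mul1mx.
by rewrite XS cmxM -/(J0c R n) -mulmxA mxtrace_mulC -mulmxA Im_trace.
Qed.

Lemma N_posdef eta t : 0 <= t <= 1 -> 0 < eta <= 1 -> posdef (N eta t).
Proof.
move=> tI eI v v0; have uA := unit1A (sW tI) eI.
have := @Im_form R n (W t) eta (J *m v) _ _ (sW tI) eI erefl erefl.
rewrite mulmxA JJ mulNmx mul1mx opprK -/(A eta t) -/(B eta t) -/(N eta t); apply: lt_le_trans.
case/andP: eI => e0 _; rewrite mulr_gt0 ?divr_gt0 //; apply: c2_gt0.
apply/eqP => h; move/eqP: v0; apply.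
have h2 : cv (J *m v) = 0 by rewrite -[cv _](mulKVmx uA) -/(B eta t) h mulmx0.
have : J *m v = 0.
  by apply/matrixP => i j; have := congr1 (fun z : CV => Re (z i j)) h2; rewrite !mxE.
by move/(congr1 (mulmx J)); rewrite mulmxA JJ mulNmx mul1mx mulmx0 => /eqP; rewrite oppr_eq0 => /eqP.
Qed.

Lemma SN_ge0 eta t : 0 <= t <= 1 -> 0 < eta <= 1 -> 0 <= \tr (S t *m N eta t).
Proof.
move=> tI eI; have [sS pS] := (sp_plusE _).1 (pW tI).
have := @trace_posdef_ge R n n0 (S t) (N eta t) 0 0 sS (N_posdef tI eI).
by rewrite mul0r scale0r subr0; apply.
Qed.

(** Near the crossing [1 + A] sends [v] to a vector of size [eta], so [B] is as large as [1 / eta]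
    in some direction and [Im_form] makes the trace at least [c0 / eta]. Over a time [eta] this
    yields a drop independent of [eta]. *)
Lemma SN_drop (ts : R) (v : V) : 0 <= ts <= 1 -> v != 0 -> W ts *m v = - v ->
  exists2 c0 : R, 0 < c0 & forall eta t, 0 < eta <= 1 -> 0 <= t <= 1 -> `|t - ts| <= eta ->
    c0 / eta <= \tr (S t *m N eta t).
Proof.
move=> tsI v0 Wv; have cW := C1on_cont hW.
pose S' t := sform (D t *m sinv (W t)).
have cS' : continuous S'.
  move=> t; apply: (@cvg_mulmx _ _ (nbhs t) _ _ _ _ (fun=> J^T) (fun t => D t *m sinv (W t))).
    exact: cvg_cst.
  apply: (@cvg_mulmx _ _ (nbhs t) _ _ _ _ D (fun t => sinv (W t))); first exact: hW.2.
  have h : W x @[x --> t] --> W t by exact: cW.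
  apply: cvgN.
  apply: (@cvg_mulmx _ _ (nbhs t) _ _ _ _ (fun x => J *m (W x)^T) (fun=> J)); last exact: cvg_cst.
  apply: (@cvg_mulmx _ _ (nbhs t) _ _ _ _ (fun=> J) (fun x => (W x)^T)); first exact: cvg_cst.
  exact: (@cvg_trmx _ _ (nbhs t) _ _ _ W).
have eS t : 0 <= t <= 1 -> S' t = S t.
  by move=> tI; rewrite /S' /S; have [_ -> _] := symp_inv (sW tI).
have [m m0 hm] : exists2 m : R, 0 < m & forall t, 0 <= t <= 1 -> forall w, m * qform 1%:M w <= qform (S t) w.
  have [||m m0 hm] := @form_dominates R _ S' (fun=> 1%:M) 0 1 cS'.
  - by move=> t; exact: cvg_cst.
  - by move=> t tI; rewrite eS //; have [] := (sp_plusE _).1 (pW tI).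
  by exists m => // t tI w; rewrite -(eS t tI); exact: hm.
have [K K0 hK] : exists2 K : R, 0 < K & forall t, 0 <= t <= 1 ->
    qform 1%:M ((W t - W ts) *m v) <= K * (t - ts) ^+ 2.
  have cd : continuous (fun t => qform 1%:M (D t *m v)).
    move=> t; apply: (@cvg_qform _ _ (nbhs t) _ _ (fun=> 1%:M) (fun t => D t *m v)); first exact: cvg_cst.
    by apply: (@cvg_mulmx _ _ (nbhs t) _ _ _ _ D (fun=> v)); [exact: hW.2 | exact: cvg_cst].
  have I01 : (0 : R) <= 1 by [].
  have [c _ hc] := EVT_max I01 (continuous_subspaceT cd).
  set K := qform 1%:M (D c *m v) in hc.
  have K0 : 0 <= K by exact: qform1_ge0.
  exists ((n + n)%:R * K + 1); first by rewrite ltr_wpDl // mulr_ge0.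
  move=> t tI; apply: (@le_trans _ _ ((n + n)%:R * K * (t - ts) ^+ 2)); last first.
    by rewrite ler_wpM2r ?sqr_ge0 // lerDl.
  rewrite qform1 -mulrA -[X in X * _]/((n + n)%:R) -[(n + n)%:R]/(1 *+ (n + n)) mulr_natl.
  rewrite -[X in _ *+ X](card_ord (n + n)) -sumr_const; apply: ler_sum => i _.
  have dW (x : R) : is_derive x 1 (fun x => (W x *m v) i 0) ((D x *m v) i 0).
    by have := mder_mul (hW.1 x) (mder_cst v x) i 0; rewrite mulmx0 addr0.
  have key a b : 0 <= a -> a < b -> b <= 1 -> ((W b *m v) i 0 - (W a *m v) i 0) ^+ 2 <= K * (b - a) ^+ 2.
    move=> a0 ab b1; have [x /andP[x1 x2] ->] := incr_of_derive ab (fun x _ => dW x).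
    rewrite exprMn ler_wpM2r ?sqr_ge0 //; apply: le_trans (hc x _).
      by rewrite qform1 (bigD1 i) //= lerDl sumr_ge0 // => j _; exact: sqr_ge0.
    by rewrite in_itv /=; apply/andP; split; lra.
  rewrite mulmxBl !mxE -/((W t *m v) i 0); case/andP: tI => t0 t1; case/andP: tsI => ts0 ts1.
  have [tl|tl|->] := ltgtP t ts; last by rewrite !subrr expr0n mulr0.
    by have := key t ts t0 tl ts1; rewrite -sqrrN opprB -[X in _ <= _ * X]sqrrN opprB ![(_ *m _) _ _]mxE.
  by have := key ts t ts0 tl t1; rewrite ![(_ *m _) _ _]mxE.
have [K2 K20 hK2] : exists2 K2 : R, 0 < K2 & forall t, 0 <= t <= 1 -> qform 1%:M (W t *m (J *m v)) <= K2.
  have cd : continuous (fun t => qform 1%:M (W t *m (J *m v))).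
    move=> t; apply: (@cvg_qform _ _ (nbhs t) _ _ (fun=> 1%:M) (fun t => W t *m (J *m v))); first exact: cvg_cst.
    by apply: (@cvg_mulmx _ _ (nbhs t) _ _ _ _ W (fun=> J *m v)); [exact: cW | exact: cvg_cst].
  have I01 : (0 : R) <= 1 by [].
  have [c _ hc] := EVT_max I01 (continuous_subspaceT cd).
  exists (qform 1%:M (W c *m (J *m v)) + 1); first by rewrite ltr_wpDl // qform1_ge0.
  by move=> t tI; apply: le_trans (hc t _) _; rewrite ?in_itv // lerDl.
set q := qform 1%:M v; have q0 : 0 < q by exact: qform1_gt0.
(* The constants of the two cases at the end: of the two summands of [v] below, one has squared
   length at least [q / 4]. *)
pose c1 := m / (2 * K) * (q / 8); pose c3 := m / (2 * K2) * (q / 8).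
have c10 : 0 < c1 by rewrite !mulr_gt0 // ?invr_gt0 ?mulr_gt0.
have c30 : 0 < c3 by rewrite !mulr_gt0 // ?invr_gt0 ?mulr_gt0.
exists (Num.min c1 c3); first by rewrite lt_min c10.
move=> eta t eI tI tts; have /andP[e0 e1] := eI.
have uA := unit1A (sW tI) eI; have pN := N_posdef tI eI.
have [sS pS] := (sp_plusE _).1 (pW tI).
pose y1 := (W t - W ts) *m v; pose y2 := W t *m (J *m v).
(* Since [W ts v = - v], the image of [v] under [1 + A] is [(W t - W ts) v + i eta W t J v];
   applying [B] splits [v] accordingly. *)
have ev : cv v = B eta t *m cv y1 + ('i%C * toC eta) *: (B eta t *m cv y2).
  rewrite scalemxAr -mulmxDr; have -> : cv y1 + ('i%C * toC eta) *: cv y2 = (1%:M + A eta t) *m cv v.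
    rewrite /A mulmxDl mul1mx -mulmxA /cE mulmxDl mul1mx -scalemxAl mulmxDr -scalemxAr addrA.
    congr (_ + _ *: _); last by rewrite /J0c /cv /y2 !map_mxM.
    by rewrite /y1 mulmxBl Wv opprK addrC /cv map_mxD map_mxM.
  by rewrite mulKmx.
have step c u : 0 <= c -> c * qform 1%:M u < m -> c * (eta / 2 * c2 (B eta t *m cv u)) <= \tr (S t *m N eta t).
  move=> cc hc; apply: le_trans (_ : c * qform (N eta t) (- (J *m u)) <= _).
    by rewrite ler_wpM2l //; exact: (@Im_form R n (W t) eta u _ _ (sW tI) eI erefl erefl).
  apply: trace_posdef_ge => //; apply: posdef_sub_rank1 => //; first exact: hm.
  have -> : qform 1%:M (- (J *m u)) = qform 1%:M u.
    by rewrite -scaleN1r qformZu sqrrN expr1n mul1r qform1J.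
  exact: hc.
have : q <= 2 * c2 (B eta t *m cv y1) + 2 * (eta ^+ 2 * c2 (B eta t *m cv y2)).
  rewrite /q -c2_cv ev; apply: le_trans (c2D _ _) _; rewrite c2Z.
  have -> : Re ('i%C * toC eta) ^+ 2 + Im ('i%C * toC eta) ^+ 2 = eta ^+ 2 by rewrite /=; ring.
  by [].
set z1 := c2 _; set z2 := c2 _ => hq.
have ts2 : (t - ts) ^+ 2 <= eta ^+ 2.
  by rewrite -(real_normK (num_real (t - ts))) ler_sqr ?nnegrE // ltW.
have [h|h] := leP (q / 4) z1.
  pose c := m / (2 * K * eta ^+ 2).
  have e20 : 0 < eta ^+ 2 by exact: exprn_gt0.
  have cc : 0 < c by rewrite divr_gt0 // !mulr_gt0.
  apply: le_trans (step c y1 (ltW cc) _); last first.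
    apply: le_lt_trans (_ : c * (K * eta ^+ 2) < m).
      by rewrite ler_wpM2l ?(ltW cc) //; apply: le_trans (hK t tI) _; rewrite ler_wpM2l ?(ltW K0).
    have -> : c * (K * eta ^+ 2) = m / 2 by rewrite /c; field; rewrite !gt_eqF.
    lra.
  apply: le_trans (_ : c1 / eta <= _); first by rewrite ler_wpM2r ?invr_ge0 ?(ltW e0) // ge_min lexx.
  have -> : c1 / eta = c * (eta / 2 * (q / 4)) by rewrite /c /c1; field; rewrite !gt_eqF.
  by rewrite ler_wpM2l ?(ltW cc) // ler_wpM2l // divr_ge0 // ltW.
have h2 : q / 4 <= eta ^+ 2 * z2 by lra.
pose c := m / (2 * K2); have cc : 0 < c by rewrite divr_gt0 // mulr_gt0.
apply: le_trans (step c y2 (ltW cc) _); last first.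
  apply: le_lt_trans (_ : c * K2 < m); first by rewrite ler_wpM2l ?(ltW cc) ?hK2.
  have -> : c * K2 = m / 2 by rewrite /c; field; rewrite gt_eqF.
  lra.
apply: le_trans (_ : c3 / eta <= _); first by rewrite ler_wpM2r ?invr_ge0 ?(ltW e0) // ge_min lexx orbT.
have -> : c3 / eta = c * (eta^-1 / 2 * (q / 4)) by rewrite /c /c3; field; rewrite !gt_eqF.
rewrite ler_wpM2l ?(ltW cc) //; apply: le_trans (_ : eta^-1 / 2 * (eta ^+ 2 * z2) <= _).
  by rewrite ler_wpM2l // divr_ge0 // invr_ge0 ltW.
have -> : eta^-1 / 2 * (eta ^+ 2 * z2) = eta / 2 * z2 by field; rewrite gt_eqF.
by [].
Qed.

Lemma lift_logder (eta : R) (k : C) (al rho : R -> R) (t : R) : 0 < t < 1 -> 0 < eta <= 1 ->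
  continuous al -> (forall x, 0 <= x <= 1 -> [/\ Re (\det (1%:M + A eta x) * k) = rho x * cos (al x),
    Im (\det (1%:M + A eta x) * k) = rho x * sin (al x) & 0 < rho x]) ->
  is_derive t 1 al (- \tr (S t *m N eta t)).
Proof.
move=> /andP[t0 t1] eI cal h; have tI : 0 <= t <= 1 by rewrite !ltW.
have uA := unit1A (sW tI) eI.
have [da db] := cderM (cder_det uA (cder_entry eta t)) (cder_cst k t).
have near01 : \forall x \near t, 0 <= x <= 1.
  have := @near_in_itvoo R 0 1 t; rewrite in_itv /= t0 t1 => /(_ isT).
  by apply: filterS => x; rewrite in_itv /= => /andP[/ltW -> /ltW ->].
have hn : \forall x \near t, [/\ Re (\det (1%:M + A eta x) * k) = rho x * cos (al x),
    Im (\det (1%:M + A eta x) * k) = rho x * sin (al x) & 0 < rho x].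
  by apply: filterS near01 => x; exact: h.
apply: is_derive_eq (lift_derive hn (cal t) da db) _.
rewrite -(Im_logder tI eI) -/(B eta t) mulr0 addr0.
have [e1 e2 r0] := h t tI; rewrite e1 e2.
set d := \det _ in e1 e2 *; set ta := \tr _.
have -> : d * ta * k = (d * k) * ta by rewrite mulrAC.
rewrite cReM cImM e1 e2.
have -> : (rho t * cos (al t)) ^+ 2 + (rho t * sin (al t)) ^+ 2 = rho t ^+ 2.
  by rewrite -[RHS]mulr1 -(cos2Dsin2 (al t)); ring.
apply: (@mulIf _ (rho t ^+ 2)); first by rewrite expf_neq0 // gt_eqF.
rewrite divfK ?expf_neq0 ?gt_eqF // -[X in _ = Im ta * X]mulr1 -(cos2Dsin2 (al t)); ring.
Qed.

(** The drop is collected on [[ts - eta, ts]], where the slope is at most [- c0 / eta]; before and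
    after this window the lift does not increase. *)
Lemma lift_drop (eta : R) (k : C) (al rho : R -> R) (ts c0 : R) : 0 < ts < 1 -> 0 < eta <= 1 -> eta < ts ->
  (forall t, 0 <= t <= 1 -> `|t - ts| <= eta -> c0 / eta <= \tr (S t *m N eta t)) ->
  continuous al -> (forall x, 0 <= x <= 1 -> [/\ Re (\det (1%:M + A eta x) * k) = rho x * cos (al x),
    Im (\det (1%:M + A eta x) * k) = rho x * sin (al x) & 0 < rho x]) ->
  al 1 <= al 0 - c0.
Proof.
move=> /andP[ts0 ts1] eI ets hc cal h; have /andP[e0 e1] := eI.
have dal (x : R) : 0 < x < 1 -> is_derive x 1 al (- \tr (S x *m N eta x)).
  by move=> xI; exact: lift_logder cal h.
have mv (a b : R) : 0 <= a -> a < b -> b <= 1 -> exists2 c : R, a < c < b & al b - al a = - \tr (S c *m N eta c) * (b - a).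
  move=> a0 ab b1; have [||c] := @MVT R al (fun x => - \tr (S x *m N eta x)) a b ab.
  - by move=> x; rewrite in_itv /= => /andP[ax xb]; apply: dal; apply/andP; split; lra.
  - exact: continuous_subspaceT.
  by rewrite in_itv /= => cI e; exists c.
have l1 : 0 < ts - eta by lra.
have l2 : ts - eta < ts by lra.
have l3 : ts - eta <= 1 by lra.
have [x1 /andP[a1 b1] h1] := mv 0 (ts - eta) (lexx _) l1 l3.
have [x2 /andP[a2 b2] h2] := mv (ts - eta) ts (ltW l1) l2 (ltW ts1).
have [x3 /andP[a3 b3] h3] := mv ts 1 (ltW ts0) ts1 (lexx _).
have i1 : 0 <= x1 <= 1 by clear h1 h2 h3; apply/andP; split; lra.
have i2 : 0 <= x2 <= 1 by clear h1 h2 h3; apply/andP; split; lra.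
have i3 : 0 <= x3 <= 1 by clear h1 h2 h3; apply/andP; split; lra.
have i4 : `|x2 - ts| <= eta by clear h1 h2 h3; rewrite ler_norml; apply/andP; split; lra.
have p1 := SN_ge0 i1 eI; have p3 := SN_ge0 i3 eI; have p2 := hc x2 i2 i4.
exact: (drop_arith e0 l1 ts1 p1 p2 p3 h1 h2 h3).
Qed.

End Curve.
End Crossing.

(** * Homotopy argument excluding the eigenvalue -1 *)

Section CrossingLemma.
Variables (R : realType) (n : nat).
Hypothesis n0 : (0 < n)%N.
Local Notation C := R[i].
Local Notation M := 'M[R]_(n + n).
Local Notation V := 'cV[R]_(n + n).
Local Notation toC := (real_complex R).
Local Notation Re := (@complex.Re R).
Local Notation Im := (@complex.Im R).

Lemma pos_on_segment (f : R -> R) (L : R) : 0 <= L -> continuous f -> 0 < f 0 ->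
  (forall u, 0 <= u <= L -> f u != 0) -> forall u, 0 <= u <= L -> 0 < f u.
Proof.
move=> L0 cf f0 nz u /andP[u0 uL]; rewrite ltNge; apply/negP => fu.
have [||c] := @IVT R f 0 u 0 u0.
- exact: continuous_subspaceT.
- by rewrite ge_min le_max fu (ltW f0) orbT.
rewrite in_itv /= => /andP[c0 cu] e; have := nz c; rewrite e eqxx c0 (le_trans cu uL).
by move=> /(_ isT).
Qed.

Lemma mul_divK (a b : R) : 0 < a -> b = a * (b / a).
Proof. by move=> a0; rewrite mulrC divfK // gt_eqF. Qed.

Lemma clampK (x : R) : clamp (clamp x) = clamp x.
Proof. by rewrite clamp_id // clamp_itv. Qed.

Lemma no_minus1_unit (A : M) : (forall x : V, x != 0 -> A *m x != - x) -> 1%:M + A \in unitmx.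
Proof.
move=> h; rewrite -unitmx_tr -row_free_unit -kermx_eq0.
apply/negPn/negP => /rowV0Pn [v]; rewrite sub_kermx => /eqP hv v0.
pose x : V := v^T; have x0 : x != 0.
  by apply: contra v0 => /eqP/(congr1 trmx); rewrite trmxK trmx0 => ->.
have := h x x0; have : (1%:M + A) *m x = 0 by rewrite -[_ *m _]trmxK trmx_mul trmxK hv trmx0.
by rewrite mulmxDl mul1mx => /eqP; rewrite addrC addr_eq0 => ->.
Qed.

Section Square.
Variable H : R * R -> M.
Hypothesis cH : continuous H.
Let Hc z := H (clamp z.1, clamp z.2).
Let dd eta z := \det (1%:M + cmx (Hc z) *m cE n eta).
(** Multiplication by the conjugate of the corner value makes the argument start at [0]. *)
Let g eta z := dd eta z * conjc (dd eta (0, 0)).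

Lemma Hc_continuous : continuous Hc.
Proof.
move=> z; apply: (@cvg_comp _ _ _ (fun z : R * R => (clamp z.1, clamp z.2)) H); last exact: cH.
apply: cvg_pair2.
  by apply: (@cvg_comp _ _ _ fst (@clamp R)); [exact: cvg_fst | exact: clamp_continuous].
by apply: (@cvg_comp _ _ _ snd (@clamp R)); [exact: cvg_snd | exact: clamp_continuous].
Qed.

Lemma dd_ccvg (T : Type) (F : set_system T) (FF : Filter F) (e : T -> R) (z : T -> R * R) e0 z0 :
  e x @[x --> F] --> e0 -> z x @[x --> F] --> z0 -> ccvg F (fun x => dd (e x) (z x)) (dd e0 z0).
Proof.
move=> he hz; apply: mcvg_det; apply: mcvgD; first exact: mcvg_cst.
apply: mcvgM.
  apply: mcvg_cmx; exact: (@cvg_comp _ _ _ z Hc _ _ _ hz (@Hc_continuous z0)).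
apply: mcvgD; first exact: mcvg_cst.
apply: mcvgZ; last exact: mcvg_cst.
by apply: ccvgM; [exact: ccvg_cst | exact: ccvg_toC].
Qed.

Lemma g_ccvg (T : Type) (F : set_system T) (FF : Filter F) (e : T -> R) (z : T -> R * R) e0 z0 :
  e x @[x --> F] --> e0 -> z x @[x --> F] --> z0 -> ccvg F (fun x => g (e x) (z x)) (g e0 z0).
Proof.
move=> he hz; apply: ccvgM; first exact: dd_ccvg.
apply: ccvg_conj; apply: (dd_ccvg FF he (z := fun=> (0, 0))); exact: cvg_cst.
Qed.

Lemma dd0 z : dd 0 z = toC (\det (1%:M + Hc z)).
Proof.
rewrite /dd /cE; have -> : 'i%C * toC 0 = 0 by rewrite rmorph0 mulr0.
rewrite scale0r addr0 mulmx1 -det_map_mx map_mxD map_mx1 //.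
Qed.

End Square.

(** For [eta = 0] the determinant is real and positive along the other three sides of the square, so
    for small [eta] its argument stays above [- c1] there. A crossing on the side of [W] would lower
    the argument by [c0], whatever the small [eta], between the same two corners. *)
Lemma crossing (W D : R -> M) (H : R * R -> M) : C1on W D ->
  (forall t, 0 <= t <= 1 -> symplectic (W t)) ->
  (forall t, 0 <= t <= 1 -> sp_plus (D t *m invmx (W t))) ->
  continuous H -> (forall s t, 0 <= s <= 1 -> 0 <= t <= 1 -> symplectic (H (s, t))) ->
  (forall t, 0 <= t <= 1 -> H (0, t) = W t) -> (forall s, 0 <= s <= 1 -> H (s, 0) = 1%:M) ->
  (forall t, 0 <= t <= 1 -> forall x : V, x != 0 -> H (1, t) *m x != - x) ->
  (forall s, 0 <= s <= 1 -> forall x : V, x != 0 -> H (s, 1) *m x != - x) ->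
  forall t, 0 <= t <= 1 -> forall x : V, x != 0 -> W t *m x != - x.
Proof.
move=> hW sW pW cH sH H0 Hs0 H1 Hs1 t tI x x0; apply/negP => /eqP Wx.
have I0 : 0 <= (0 : R) <= 1 by rewrite lexx ler01.
have I1 : 0 <= (1 : R) <= 1 by rewrite lexx ler01.
have no2 (y : V) : y != 0 -> 1%:M *m y != - y.
  rewrite mul1mx => y0; rewrite -subr_eq0 opprK -mulr2n -scaler_nat scaler_eq0 negb_or y0.
  by rewrite pnatr_eq0.
have tI' : 0 < t < 1.
  case/andP: tI => t0 t1; rewrite !lt_neqAle t0 t1 !andbT; apply/andP; split; apply/eqP => e.
    by have := no2 x x0; rewrite -(Hs0 0 I0) (H0 0 I0) e Wx eqxx.
  by have := Hs1 0 I0 x x0; rewrite (H0 1 I1) -e Wx eqxx.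
have [c0 c00 hc0] := SN_drop n0 hW sW pW tI x0 Wx.
(* Cut down to [1], below [pi / 2], so that a bound on the sine bounds the angle. *)
pose c1 := Num.min c0 1; have c10 : 0 < c1 by rewrite lt_min c00 ltr01.
have c11 : c1 <= 1 by rewrite ge_min lexx orbT.
have c1c : c1 <= c0 by rewrite ge_min lexx.
have pi2 := @pi_ge2 R.
have sc1 : 0 < sin c1 by apply: sin_gt0_pi; rewrite ?in_itv /= c10 /=; lra.
pose Hc (z : R * R) := H (clamp z.1, clamp z.2).
pose dd eta z := \det (1%:M + cmx (Hc z) *m cE n eta).
pose g eta z := dd eta z * conjc (dd eta (0, 0)).
(* The three sides, run through as [u] goes from [0] to [3]: along [t = 0], then along [s = 1], then
   back along [t = 1]. *)
pose ga (u : R) : R * R := (clamp (Num.min u (3 - u)), clamp (u - 1)).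
have cga : continuous ga.
  move=> u; apply: cvg_pair2.
    apply: (@cvg_comp _ _ _ (fun u : R => Num.min u (3 - u)) (@clamp R)); last exact: clamp_continuous.
    apply: (@continuous_min _ _ (fun u : R => u) (fun u : R => 3 - u)); first exact: cvg_id.
    by apply: cvgB; [exact: cvg_cst | exact: cvg_id].
  apply: (@cvg_comp _ _ _ (fun u : R => u - 1) (@clamp R)); last exact: clamp_continuous.
  by apply: cvgB; [exact: cvg_id | exact: cvg_cst].
have ga_no u : 0 <= u <= 3 -> forall y : V, y != 0 -> Hc (ga u) *m y != - y.
  move=> /andP[u0 u3] y y0; rewrite /Hc /ga /= !clampK.
  have [h|h] := leP u 1.
    rewrite (@clamp_lo _ (u - 1)); last by lra.
    by rewrite Hs0 ?clamp_itv //; exact: no2.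
  have [h'|h'] := leP u 2.
    rewrite (@clamp_hi _ (Num.min _ _)); last by rewrite le_min; apply/andP; split; lra.
    by apply: H1 => //; exact: clamp_itv.
  by rewrite (@clamp_hi _ (u - 1)); [apply: Hs1 => //; exact: clamp_itv | lra].
have cHg : continuous (fun u => \det (1%:M + Hc (ga u))).
  move=> u; apply: (@cvg_det _ _ (nbhs u) _ _ (fun u => 1%:M + Hc (ga u))).
  apply: cvgD; first exact: cvg_cst.
  by apply: (@cvg_comp _ _ _ ga Hc); [exact: cga | exact: (Hc_continuous cH)].
have Hc0 : Hc (0, 0) = 1%:M by rewrite /Hc /= clamp_lo // Hs0.
have ga0 : ga 0 = (0, 0).
  by rewrite /ga; congr (_, _); apply: clamp_lo; rewrite ?ge_min ?lexx //; lra.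
have ga3 : ga 3 = (0, 1).
  rewrite /ga; congr (_, _); first by apply: clamp_lo; rewrite subrr ge_min lexx orbT.
  by apply: clamp_hi; lra.
have d2 : 0 < \det (1%:M + 1%:M : M).
  have -> : (1%:M + 1%:M : M) = (1 + 1)%:M by rewrite raddfD.
  by rewrite det_scalar exprn_gt0.
have pdet u : 0 <= u <= 3 -> 0 < \det (1%:M + Hc (ga u)).
  move: u; apply: pos_on_segment => //; first by rewrite ga0 Hc0.
  move=> u uI; have := no_minus1_unit (ga_no u uI); rewrite unitmxE unitfE //.
have g0 u : g 0 (ga u) = toC (\det (1%:M + Hc (ga u)) * \det (1%:M + 1%:M : M)).
  by rewrite /g /dd !(dd0 H) -/(Hc _) -/(Hc (0, 0)) Hc0 conjc_real rmorphM.
have [eta [eI et hg]] : exists eta, [/\ 0 < eta <= 1, eta < t &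
    forall u, 0 <= u <= 3 -> `|Im (g eta (ga u))| < sin c1 * Re (g eta (ga u))].
  have cK : compact (`[0, 3]%classic : set R) by exact: segment_compact.
  pose PP (eta u : R) : Prop := `|Im (g eta (ga u))| < sin c1 * Re (g eta (ga u)).
  (* The inequality holds at [eta = 0], where the imaginary part vanishes; compactness of [[0, 3]]
     makes one [eta] serve all three sides. *)
  have : \forall eta \near (0 : R), `[0, 3]%classic `<=` PP eta.
    have ncov := (compact_near_coveringP _).1 cK.
    apply: (ncov R (nbhs (0 : R)) PP _) => u; rewrite /= in_itv /= => uI.
    have [h1 h2] : ccvg (nbhs (u, 0)) (fun w : R * R => g w.2 (ga w.1)) (g 0 (ga u)).
      apply: (@g_ccvg H cH _ (nbhs ((u, 0) : R * R)) _ snd (fun w : R * R => ga w.1)); first exact: cvg_snd.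
      by apply: (@cvg_comp _ _ _ fst ga); [exact: cvg_fst | exact: cga].
    have h3 : sin c1 * Re (g w.2 (ga w.1)) - `|Im (g w.2 (ga w.1))| @[w --> ((u, 0) : R * R)] -->
       sin c1 * Re (g 0 (ga u)) - `|Im (g 0 (ga u))|.
      by apply: cvgB; [apply: cvgM; [exact: cvg_cst | exact: h1] | apply: cvg_norm; exact: h2].
    have h4 : 0 < sin c1 * Re (g 0 (ga u)) - `|Im (g 0 (ga u))|.
      by rewrite g0 /= normr0 subr0 !mulr_gt0 // pdet.
    have hh : \forall w \near ((u, 0) : R * R), 0 < sin c1 * Re (g w.2 (ga w.1)) - `|Im (g w.2 (ga w.1))|.
      exact: (cvgr_gt _ h3 _ h4).
    by apply: filterS hh => -[a b] /=; rewrite subr_gt0.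
  move=> /nbhs_ballP[r /= r0 hr]; case/andP: tI' => t0 t1.
  exists (Num.min (r / 2) (t / 2)).
  have h1 : Num.min (r / 2) (t / 2) <= r / 2 by rewrite ge_min lexx.
  have h2 : Num.min (r / 2) (t / 2) <= t / 2 by rewrite ge_min lexx orbT.
  have h3 : 0 < Num.min (r / 2) (t / 2) by rewrite lt_min !divr_gt0.
  split; [rewrite h3 /=; lra | lra |].
  move=> u uI; apply: hr; last by rewrite /= in_itv.
  by rewrite /ball /= sub0r normrN gtr0_norm //; lra.
have sHc z : symplectic (Hc z) by apply: sH; exact: clamp_itv.
have ddu z : dd eta z != 0.
  by have := unit1A (sHc z) eI; rewrite unitmxE unitfE.
pose rr z := Re (g eta z) ^+ 2 + Im (g eta z) ^+ 2.
have rr0 z : 0 < rr z.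
  rewrite lt_neqAle addr_ge0 ?sqr_ge0 // andbT eq_sym /rr; apply/negP => /eqP h.
  have gn : g eta z != 0 by rewrite mulf_neq0 // conjc_eq0.
  move/eqP: gn; apply; apply: C_ext => /=; apply/eqP; rewrite -sqrf_eq0; apply/eqP.
    by apply/le_anti; rewrite sqr_ge0 -h lerDl sqr_ge0.
  by apply/le_anti; rewrite sqr_ge0 -h lerDr sqr_ge0.
have cg z : ccvg (nbhs z) (fun z => g eta z) (g eta z).
  by apply: (@g_ccvg H cH _ (nbhs z) _ (fun=> eta) id); [exact: cvg_cst | exact: cvg_id].
have crr : continuous rr.
  by move=> z; have [h1 h2] := cg z; apply: cvgD; apply: cvg_sq.
pose sq z := Num.sqrt (rr z); have sq0 z : 0 < sq z by rewrite sqrtr_gt0.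
have csq : continuous sq.
  by move=> z; apply: (@cvg_comp _ _ _ rr Num.sqrt); [exact: crr | exact: sqrt_continuous].
have sqK z : sq z ^+ 2 = rr z by rewrite sqr_sqrtr // ltW.
have gb : Im (g eta (0, 0)) = 0 /\ 0 < Re (g eta (0, 0)).
  rewrite /g -sqr_normc -add_Re2_Im2 /=; split=> //.
  have := ddu (0, 0); set d := dd _ _ => dn; rewrite lt_neqAle addr_ge0 ?sqr_ge0 // andbT eq_sym.
  apply/negP => /eqP h; move/eqP: dn; apply; apply: C_ext => /=; apply/eqP; rewrite -sqrf_eq0; apply/eqP.
    by apply/le_anti; rewrite sqr_ge0 -h lerDl sqr_ge0.
  by apply/le_anti; rewrite sqr_ge0 -h lerDr sqr_ge0.
have [al [cal al0 hal]] : exists al : R * R -> R, [/\ continuous al, al (0, 0) = 0 &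
    forall z, Re (g eta z) = sq z * cos (al z) /\ Im (g eta z) = sq z * sin (al z)].
  have [|||||al [cal al0 hal]] := @lift_square R (fun z => Re (g eta z) / sq z) (fun z => Im (g eta z) / sq z).
  - move=> z; have [h1 _] := cg z; apply: cvgM; first exact: h1.
    by apply: cvgV; [rewrite gt_eqF | exact: csq].
  - move=> z; have [_ h1] := cg z; apply: cvgM; first exact: h1.
    by apply: cvgV; [rewrite gt_eqF | exact: csq].
  - by move=> z; rewrite !exprMn -mulrDl exprVn sqK -/(rr z) divff // gt_eqF ?rr0.
  - have [h1 h2] := gb; rewrite /sq /rr h1 expr0n addr0 sqrtr_sqr ger0_norm ?(ltW h2) // divff //.
    by rewrite gt_eqF.
  - by have [-> _] := gb; rewrite mul0r.
  exists al; split=> // z; have [-> ->] := hal z.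
  have gz : g eta (clamp z.1, clamp z.2) = g eta z by rewrite /g /dd /Hc /= !clampK.
  have sz : sq (clamp z.1, clamp z.2) = sq z by rewrite /sq /rr gz.
  by rewrite gz sz; split; exact: (mul_divK _ (sq0 z)).
have cal0 : continuous (fun u => al (0, u)).
  move=> u; apply: (@cvg_comp _ _ _ (fun u : R => (0, u)) al); last exact: cal.
  by apply: cvg_pair2; [exact: cvg_cst | exact: cvg_id].
have drop : al (0, 1) <= al (0, 0) - c0.
  apply: (lift_drop n0 hW sW pW tI' eI et (fun t h1 h2 => hc0 eta t eI h1 h2) cal0
     (k := conjc (dd eta (0, 0))) (rho := fun u => sq (0, u))) => u uI.
  have -> : \det (1%:M + cmx (W u) *m cE n eta) * conjc (dd eta (0, 0)) = g eta (0, u).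
    have HW : Hc (0, u) = W u by rewrite /Hc /= clamp_lo // clamp_id // H0.
    by rewrite -HW.
  by have [-> ->] := hal (0, u).
have cag : continuous (fun u => al (ga u)).
  by move=> u; apply: (@cvg_comp _ _ _ ga al); [exact: cga | exact: cal].
have cpos u : 0 <= u <= 3 -> 0 < cos (al (ga u)) /\ `|sin (al (ga u))| < sin c1.
  move=> uI; have := hg u uI; have [-> ->] := hal (ga u) => h.
  rewrite normrM (gtr0_norm (sq0 _)) mulrCA ltr_pM2l // in h.
  have cp : 0 < cos (al (ga u)) by rewrite -(pmulr_rgt0 _ sc1); apply: le_lt_trans h.
  split=> //; apply: lt_le_trans h _; rewrite ger_pMr // cos_le1 //.
(* The cosine stays positive along the three sides, so the lift, which starts at [0], never reaches
   [pi / 2] in absolute value, and its sine then determines it. *)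
have nz u : 0 <= u <= 3 -> al (ga u) < pi / 2 /\ - (pi / 2) < al (ga u).
  have L3 : (0 : R) <= 3 by [].
  have p2 : 0 < pi / 2 :> R by lra.
  split.
    rewrite -subr_gt0; apply: (@pos_on_segment (fun u => pi / 2 - al (ga u)) 3) => //.
    - by move=> v; apply: cvgB; [exact: cvg_cst | exact: cag].
    - by rewrite ga0 al0 subr0.
    move=> v vI; have [cp _] := cpos v vI; rewrite subr_eq0; apply: contraTneq cp => <-.
    by rewrite cos_pihalf ltxx.
  rewrite -subr_gt0 opprK; apply: (@pos_on_segment (fun u => al (ga u) + pi / 2) 3) => //.
  - by move=> v; apply: cvgD; [exact: cag | exact: cvg_cst].
  - by rewrite ga0 al0 add0r.
  move=> v vI; have [cp _] := cpos v vI; rewrite addr_eq0; apply: contraTneq cp => ->.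
  by rewrite cosN cos_pihalf ltxx.
have I3 : 0 <= (3 : R) <= 3 by rewrite lexx andbT.
have [_] := cpos 3 I3; have [h1 h2] := nz 3 I3; rewrite ga3 in h1 h2 *; rewrite ltr_norml => /andP[h3 _].
have : - c1 < al (0, 1).
  have m := @ltr_sin R; rewrite -m ?sinN // in_itv /=; have pg := pi_ge2 R; clear -h1 h2 h3 c10 c11 pg; apply/andP; split; lra.
rewrite al0 in drop; lra.
Qed.

End CrossingLemma.

(** * Polynomials approximating arccos *)

Section FourthRoot.
Variable R : realType.

(* Newton iteration for (1 - x^2)^(-1/4): the defect is squared at each step. *)
Fixpoint rpoly (k : nat) : {poly R} :=
  if k is k'.+1 then rpoly k' * (1 + 4^-1 *: (1 - (1 - 'X^2) * rpoly k' ^+ 4)) else 1.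

(** Zero when [r^4 = 1 / (1 - x^2)], that is, when [- r^2] is the derivative of [arccos]. A fourth
    root is approximated so that the derivative of the resulting polynomial is minus a square, which
    later makes [Nm] congruent to [Pm]. *)
Definition defect (r x : R) : R := 1 - (1 - x ^+ 2) * r ^+ 4.

Lemma rpolyS k x : (rpoly k.+1).[x] =
  (rpoly k).[x] * (1 + 4^-1 * defect (rpoly k).[x] x).
Proof. by rewrite /defect /= !hornerE. Qed.

Lemma defect_factor_bounds (a b c : R) : 0 <= a <= 1 -> 0 <= b <= 1 -> 0 <= c <= 1 ->
  0 <= 5 / 8 + 5 / 16 * a + 15 / 256 * b + c / 256 <= 1.
Proof. by move=> /andP[? ?] /andP[? ?] /andP[? ?]; apply/andP; split; lra. Qed.

Lemma rpoly_bound (rho : R) k x : 0 <= rho < 1 -> `|x| <= rho ->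
  0 <= defect (rpoly k).[x] x <= (rho ^+ 2) ^+ k.+1 /\ 0 < (rpoly k).[x].
Proof.
move=> /andP[rho0 rho1] xr.
have x2 : 0 <= x ^+ 2 <= rho ^+ 2.
  by rewrite sqr_ge0 /= -(real_normK (num_real x)) ler_sqr ?nnegrE.
have rho2 : 0 <= rho ^+ 2 <= 1 by rewrite sqr_ge0 /= expr_le1 // ltW.
elim: k => [|k [/andP[e0 e1] r0]].
  rewrite /defect /= hornerC expr1n mulr1 expr1 ltr01; split=> //.
  by case/andP: x2 => ? ?; apply/andP; split; lra.
rewrite rpolyS; set r := (rpoly k).[x] in e0 e1 r0 *; set e := defect r x in e0 e1 *.
have e2 : e <= rho ^+ 2.
  case/andP: rho2 => q0 q1; apply: (le_trans e1); rewrite exprS; apply: ler_piMr => //.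
  exact: exprn_ile1.
have el1 : e <= 1 by case/andP: rho2 => _; apply: le_trans.
have r'0 : 0 < r * (1 + 4^-1 * e) by rewrite mulr_gt0 // ltr_pwDl // mulr_ge0.
have E : defect (r * (1 + 4^-1 * e)) x = 1 - (1 - e) * (1 + 4^-1 * e) ^+ 4.
  by rewrite /defect exprMn mulrA (_ : (1 - x ^+ 2) * r ^+ 4 = 1 - e) // /e /defect; ring.
split=> //; rewrite E.
(* The coefficients in the bracket are positive and sum to [1], so for [e] in [[0, 1]] the new
   defect lies between [0] and [e^2]. *)
have E2 : 1 - (1 - e) * (1 + 4^-1 * e) ^+ 4 =
  e ^+ 2 * (5 / 8 + 5 / 16 * e + 15 / 256 * e ^+ 2 + e ^+ 3 / 256) by field.
have ee : 0 <= e ^+ 2 by exact: sqr_ge0.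
have ee1 : e ^+ 2 <= 1 by rewrite expr_le1.
have e3 : 0 <= e ^+ 3 <= 1 by rewrite exprn_ge0 //= expr_le1.
have /andP[q0 q1] : 0 <= 5 / 8 + 5 / 16 * e + 15 / 256 * e ^+ 2 + e ^+ 3 / 256 <= 1.
  by apply: defect_factor_bounds; rewrite ?e0 ?ee.
have le2 : 1 - (1 - e) * (1 + 4^-1 * e) ^+ 4 <= e ^+ 2.
  by rewrite E2 ler_piMr.
apply/andP; split; first by rewrite E2 mulr_ge0.
apply: (le_trans le2); rewrite expr2 [X in _ <= X]exprS; apply: ler_pM => //.
Qed.

Lemma good_poly (rho eps : R) : 0 <= rho < 1 -> 0 < eps -> exists r : {poly R},
  forall x, `|x| <= rho -> 0 <= defect r.[x] x <= eps /\ 0 < r.[x].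
Proof.
move=> rho01 e0; have /andP[rho0 rho1] := rho01.
have [k hk] : exists k, (rho ^+ 2) ^+ k < eps.
  have h : `|rho ^+ 2| < 1 by rewrite ger0_norm ?sqr_ge0 // expr_lt1.
  have /cvgrPdist_lt/(_ _ e0)[k _ hk] := cvg_expr h.
  exists k; have := hk k (leqnn k); rewrite /= sub0r normrN ger0_norm //.
  by rewrite exprn_ge0 // sqr_ge0.
exists (rpoly k) => x xr; have [/andP[h1 h2] h3] := rpoly_bound k rho01 xr.
split=> //; rewrite h1 /= (le_trans h2) // (le_trans _ (ltW hk)) // exprS.
by rewrite ler_piMl ?exprn_ge0 ?sqr_ge0 // expr_le1 // ltW.
Qed.

Lemma antiderivative (p : {poly R}) (c : R) : exists Q : {poly R}, deriv Q = p /\ Q.[0] = c.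
Proof.
exists (\poly_(i < (size p).+1) (if i is j.+1 then p`_j / j.+1%:R else c)); split.
  apply/polyP => i; rewrite coef_deriv coef_poly ltnS; case: ltnP => h.
    by rewrite -[LHS]mulr_natr divfK // pnatr_eq0.
  by rewrite mul0rn nth_default.
by rewrite horner_coef0 coef_poly.
Qed.

(** The derivative of [Q (cos t) - t] is [s - 1] with [s = r(cos t)^2 sin t], and [s^2] is one minus
    the defect, so [1 - s] lies between [0] and [eps]. The comparison starts at [pi / 2], where both
    terms agree, and [|cos|] stays below [rho] on the way to [th]. *)
Lemma primitive_close (rho eps : R) (r Q : {poly R}) (th : R) :
  (forall x, `|x| <= rho -> 0 <= defect r.[x] x <= eps /\ 0 < r.[x]) ->
  deriv Q = - r ^+ 2 -> Q.[0] = pi / 2 -> 0 <= th <= pi -> `|cos th| <= rho ->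
  `|Q.[cos th] - th| <= eps * pi.
Proof.
move=> hr dQ Q0 /andP[th0 thpi] cr.
pose h t := Q.[cos t] - t; pose dh t := r.[cos t] ^+ 2 * sin t - 1.
have dh' (t : R) : is_derive t 1 h (dh t).
  have h1 : is_derive (cos t) 1 (horner Q) (deriv Q).[cos t] by exact: is_derive_poly.
  have h2 := is_derive_comp h1 (is_derive_cos t).
  have hh := is_deriveB h2 (is_derive_id t 1); apply: is_derive_eq hh _.
  by rewrite /dh dQ hornerN horner_exp; ring.
have pi0 : 0 < pi :> R by exact: pi_gt0.
have h0 : h (pi / 2) = 0 by rewrite /h cos_pihalf Q0 subrr.
have bd t : 0 <= t <= pi -> `|cos t| <= rho -> `|dh t| <= eps.
  move=> tI ct; have [/andP[e0 e1] r0] := hr _ ct.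
  set s := r.[cos t] ^+ 2 * sin t.
  have s0 : 0 <= s by rewrite mulr_ge0 ?sqr_ge0 // sin_ge0_pi.
  have s2 : s ^+ 2 = 1 - defect r.[cos t] (cos t).
    rewrite /s /defect exprMn sin2cos2 -exprM; ring.
  have s1 : s <= 1 by rewrite -(ler_pXn2r (ltn0Sn 1)) ?nnegrE // expr1n s2; lra.
  have s3 : s ^+ 2 <= s by rewrite expr2 ler_piMr.
  by rewrite /dh -/s ler0_norm; lra.
have ab (a b : R) : 0 <= a -> a < b -> b <= pi -> (forall t, a <= t <= b -> `|cos t| <= rho) ->
    `|h b - h a| <= eps * pi.
  move=> a0 lab bpi ct; have [c /andP[c1 c2] ->] := incr_of_derive lab (fun x _ => dh' x).
  rewrite normrM; apply: ler_pM => //.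
    by apply: bd; [rewrite (le_trans a0 (ltW c1)) (le_trans (ltW c2)) | apply: ct; rewrite !ltW].
  by rewrite ger0_norm; lra.
have cosm (x y : R) : 0 <= x -> y <= pi -> x <= y -> cos y <= cos x.
  move=> x0 ypi; rewrite le_eqVlt => /orP[/eqP -> //|xy]; apply: ltW.
  by rewrite ltr_cos // in_itv /=; apply/andP; split; lra.
have [e|e|e] := ltgtP th (pi / 2).
- rewrite -[X in `|X|]/(h th) -[h th]subr0 -h0 distrC; apply: ab => //; first by lra.
  move=> t /andP[t1 t2]; apply: le_trans cr.
  have c1 : 0 <= cos t by rewrite -cos_pihalf; apply: cosm; lra.
  have c2 : cos t <= cos th by apply: cosm; lra.
  by rewrite !ger0_norm //; lra.
- rewrite -[X in `|X|]/(h th) -[h th]subr0 -h0; apply: ab => //; first by lra.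
  move=> t /andP[t1 t2]; apply: le_trans cr.
  have c1 : cos t <= 0 by rewrite -cos_pihalf; apply: cosm; lra.
  have c2 : cos th <= cos t by apply: cosm; lra.
  by rewrite !ler0_norm //; lra.
rewrite e -[X in `|X|]/(h (pi / 2)) h0 normr0 mulr_ge0 ?(ltW pi0) //.
have [/andP[e0 e1] _] := hr _ cr; exact: le_trans e0 e1.
Qed.

End FourthRoot.

(** * Derivative of the trace of a matrix polynomial *)

Section TraceDerivative.
Variable R : realType.

(** [D] need not commute with [A t], so the derivative of [Q (A)] is not [Q' (A) D]; the two agree
    under the trace against any [B] commuting with [A t]. The arbitrary [B] is what makes the
    induction on [Q] go through. *)
Lemma mder_horner m (A : R -> 'M[R]_m.+1) (t : R) D (Q : {poly R}) : mder A t D ->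
  exists2 DQ, mder (fun x => horner_mx (A x) Q) t DQ & forall B, B *m A t = A t *m B ->
    \tr (B *m DQ) = \tr (B *m horner_mx (A t) (deriv Q) *m D).
Proof.
move=> dA; elim/poly_ind: Q => [|Q c [DQ dQ hQ]].
  exists 0; last by move=> B _; rewrite deriv0 rmorph0 !mulmx0 mul0mx.
  by rewrite (_ : (fun x => _) = (fun=> 0)) //; [exact: mder_cst | apply/funext => x; rewrite rmorph0].
exists (DQ *m A t + horner_mx (A t) Q *m D).
  rewrite (_ : (fun x => _) = (fun x => horner_mx (A x) Q *m A x + c%:M)).
    by rewrite -[X in mder _ _ X]addr0; apply: mder_add; [exact: mder_mul | exact: mder_cst].
  by apply/funext => x; rewrite rmorphD rmorphM /= horner_mx_X horner_mx_C.
move=> B BA; rewrite derivD derivC addr0 derivM derivX mulr1 rmorphD rmorphM /= horner_mx_X.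
rewrite !mulmxDr !mulmxDl !raddfD /= !mulmxA; congr (_ + _).
rewrite mxtrace_mulC mulmxA hQ; last by rewrite -mulmxA BA mulmxA.
congr (\tr (_ *m D)); rewrite -BA -!mulmxA; congr (_ *m _).
have h : horner_mx (A t) ('X * Q^`()) = horner_mx (A t) (Q^`() * 'X) by rewrite mulrC.
by move: h; rewrite !rmorphM /= horner_mx_X.
Qed.

Lemma is_derive_trace_horner m (A : R -> 'M[R]_m.+1) (t : R) D (Q : {poly R}) : mder A t D ->
  is_derive t 1 (fun x => \tr (horner_mx (A x) Q)) (\tr (horner_mx (A t) (deriv Q) *m D)).
Proof.
move=> dA; have [DQ dQ h] := mder_horner Q dA.
apply: is_derive_eq (mder_trace dQ) _.
by have := h 1%:M; rewrite !mul1mx mulmx1 => ->.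
Qed.

End TraceDerivative.

(** * Splitting a vector into eigenvectors *)

Section EigenDecomposition.
Variables (C : fieldType) (m : nat) (A : 'M[C]_m).

(** The product of the factors [A - l], applied to a vector one factor at a time: suited to
    induction on the list, and meaningful in every dimension. *)
Fixpoint kill (s : seq C) (y : 'cV[C]_m) : 'cV[C]_m :=
  if s is l :: s' then kill s' (A *m y - l *: y) else y.

End EigenDecomposition.

Lemma kill_horner (C : fieldType) m (A : 'M[C]_m.+1) s y :
  kill A s y = horner_mx A (\prod_(x <- s) ('X - x%:P)) *m y.
Proof.
elim: s y => [|l s IH] y /=; first by rewrite big_nil rmorph1 mul1mx.
rewrite IH big_cons mulrC rmorphM /= -mulmxE -mulmxA; congr (_ *m _).
by rewrite rmorphB /= horner_mx_X horner_mx_C mulmxBl mul_scalar_mx.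
Qed.

Lemma kill_char_poly (C : fieldType) m (A : 'M[C]_m) s y :
  char_poly A = \prod_(x <- s) ('X - x%:P) -> kill A s y = 0.
Proof.
case: m A y => [|m] A y e; first exact: flatmx0.
by rewrite kill_horner -e Cayley_Hamilton mul0mx.
Qed.

Section EigenDecomposition2.
Variables (C : fieldType) (m : nat) (A : 'M[C]_m).

Lemma sum_if_eq (u : seq C) l (y : 'cV[C]_m) : uniq u -> l \in u ->
  \sum_(k <- u) (if k == l then y else 0) = y.
Proof.
move=> uu lu; rewrite (bigD1_seq l) //= eqxx big1 ?addr0 // => k /negPf -> //.
Qed.

(** The hypothesis says that the eigenvalues in [s] are semisimple. Dividing the eigencomponents of
    [A y - l y] by [k - l] removes all of them except the one for [l], and semisimplicity puts the
    remainder into the eigenspace of [l]. *)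
Lemma kill_decomp s y : (forall (l : C) (x : 'cV[C]_m), l \in s ->
    A *m (A *m x - l *: x) = l *: (A *m x - l *: x) -> A *m x = l *: x) -> kill A s y = 0 ->
  exists2 f : C -> 'cV[C]_m, (forall l, A *m f l = l *: f l) & y = \sum_(l <- undup s) f l.
Proof.
elim: s y => [|l r IH] y ss /= e.
  by exists (fun=> 0) => [l|]; rewrite ?mulmx0 ?scaler0 // big_nil.
have [|f hf z] := IH _ _ e.
  by move=> k x kr; apply: ss; rewrite in_cons kr orbT.
pose g k := if k == l then 0 else (k - l)^-1 *: f k.
pose y1 := y - \sum_(k <- undup r) g k.
have Ag k : A *m g k = k *: g k.
  by rewrite /g; case: eqP => _; rewrite ?mulmx0 ?scaler0 // -scalemxAr hf !scalerA mulrC.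
have ey : A *m y1 - l *: y1 = \sum_(k <- undup r) (if k == l then f l else 0).
  have -> : A *m y1 - l *: y1 = (A *m y - l *: y) - \sum_(k <- undup r) (k - l) *: g k.
    under eq_bigr do rewrite scalerBl -Ag.
    rewrite sumrB -mulmx_sumr -scaler_sumr /y1 mulmxBr scalerBr !opprB.
    by rewrite [X in _ + X]addrC addrACA; congr (_ + _); rewrite addrC.
  rewrite z -sumrB; apply: eq_bigr => k _; rewrite /g; case: eqP => [->|/eqP kl].
    by rewrite scaler0 subr0.
  by rewrite scalerA divff ?scale1r ?subrr // subr_eq0.
have Ay1 : A *m y1 = l *: y1.
  apply: ss; first exact: mem_head.
  rewrite ey mulmx_sumr scaler_sumr; apply: eq_bigr => k _.
  by case: eqP => _; rewrite ?mulmx0 ?scaler0.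
exists (fun k => g k + (if k == l then y1 else 0)).
  move=> k; rewrite mulmxDr scalerDr Ag; congr (_ + _).
  by case: eqP => [->|_]; rewrite ?mulmx0 ?scaler0.
rewrite big_split /= -[if l \in r then _ else _]/(undup (l :: r)) sum_if_eq ?undup_uniq ?mem_undup ?mem_head //.
have -> : \sum_(k <- undup (l :: r)) g k = \sum_(k <- undup r) g k.
  by rewrite /=; case: ifP => // _; rewrite big_cons {1}/g eqxx add0r.
by rewrite /y1 addrC subrK.
Qed.

End EigenDecomposition2.

(** * Elliptic matrices have a positive form *)

Section EllipticForm.
Variables (R : realType) (n' : nat).
Local Notation n := n'.+1.
Local Notation C := R[i].
Local Notation M := 'M[R]_(n + n).
Local Notation CV := 'cV[C]_(n + n).

Lemma Hf_eigen_orth (W : M) (x y : CV) (l k : C) : symplectic W -> `|k| = 1 -> l != k ->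
  cmx W *m x = l *: x -> cmx W *m y = k *: y -> Hf x y = 0.
Proof.
move=> sW uk lk ex ey; have := Hf_symp x y sW; rewrite ex ey HfZl HfZr mulrA.
move/eqP; rewrite -subr_eq0 -{2}[Hf x y]mul1r -mulrBl mulf_eq0 => /orP[|/eqP //].
have kk : k * conjc k = 1 by rewrite -sqr_normc uk expr1n.
rewrite -kk -mulrBl mulf_eq0 subr_eq0 (negPf lk) /= conjc_eq0 => /eqP k0.
by move: uk; rewrite k0 normr0 => /eqP; rewrite eq_sym oner_eq0.
Qed.

(** In the lower half plane the conjugate eigenvector is used: conjugation reverses both factors,
    and the product keeps its sign. *)
Lemma Sp_ell_eigen_sign (W : M) (x : CV) (l : C) : Sp_ell W -> Defs.eigenvalue W l ->
  cmx W *m x = l *: x -> x != 0 -> 0 < complex.Im l * complex.Im (Hf x x).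
Proof.
move=> [sW [hu hk]].
have pos k (z : CV) : Defs.eigenvalue W k -> 0 < complex.Im k -> cmx W *m z = k *: z -> z != 0 ->
    0 < complex.Im (Hf z z).
  move=> hk' k0 ez z0; have := hk k hk' k0 z^T; rewrite trmxK kappa_real ltcR; apply.
    apply/gen_eigenspaceP; rewrite trmxK.
    have e0 : (cmx W - k%:M) *m z = 0 by rewrite mulmxBl ez mul_scalar_mx subrr.
    have pw (q : nat) : (0 < q)%N -> (cmx W - k%:M) ^+ q *m z = 0.
      by case: q => // q _; rewrite exprSr -mulmxE -mulmxA e0 mulmx0.
    exact: pw.
  by apply: contra z0 => /eqP/(congr1 trmx); rewrite trmxK trmx0 => ->.
move=> el ex x0; have [u [n1 nm1]] := hu l el.
have [i0|i0|i0] := ltgtP 0 (complex.Im l).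
- by rewrite mulr_gt0 // (pos l).
- have ec : cmx W *m conjv x = conjc l *: conjv x.
    by rewrite -conjv_mul ex; apply/matrixP => a b; rewrite !mxE rmorphM.
  have := pos (conjc l) (conjv x) (eigenvalue_conj el) _ ec; rewrite conjv_eq0 => /(_ _ x0) h.
  have {h} : 0 < complex.Im (Hf (conjv x) (conjv x)) by apply: h; case: (l) i0 => a b /=; rewrite oppr_gt0.
  rewrite Hf_conjv; case: (Hf x x) => a b /=; rewrite oppr_gt0 => b0; nra.
- exfalso; case: l {el ex} u n1 nm1 i0 => a b /= u n1 nm1 b0; subst b.
  have : a ^+ 2 = 1.
    have := add_Re2_Im2 (a +i* 0)%C; rewrite u expr1n /= expr0n addr0 => /eqP.
    by rewrite eq_complex /= => /andP[/eqP].
  move/eqP; rewrite -[X in _ == X](expr1n _ 2) eqf_sqr => /orP[] /eqP e.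
    by move/eqP: n1; apply; rewrite e.
  by move/eqP: nm1; apply; rewrite e; apply/eqP; rewrite eq_complex /= oppr0 !eqxx.
Qed.

(** Semisimplicity splits a real vector into eigenvectors, orthogonal to each other for [Hf]; the
    form becomes a sum of terms [Im l] times Krein value, all nonnegative and at least one
    positive. *)
Lemma ell_form (W : M) : Sp_ell W -> forall x : 'cV[R]_(n + n), x != 0 -> 0 < omega0 x (W *m x).
Proof.
move=> hW x x0; have [sW [hu hk]] := hW.
have [s es] : exists s : seq C, char_poly (cmx W) = \prod_(x <- s) ('X - x%:P).
  have [s hs] := closed_field_poly_normal (char_poly (cmx W)).
  by exists s; rewrite {1}hs (eqP (char_poly_monic _)) scale1r.
have ev l : l \in s -> Defs.eigenvalue W l by move=> ls; rewrite /Defs.eigenvalue es root_prod_XsubC.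
pose y : CV := map_mx (real_complex R) x.
have [|f hf ey] := @kill_decomp C _ (cmx W) s y _ (kill_char_poly _ es).
  move=> l z ls h; have [u _] := hu l (ev l ls).
  have [||//|//] := @gen_eigen_semisimple R n W l sW u _ 2 z.
    move=> v v0 hv; have := Sp_ell_eigen_sign hW (ev l ls) hv v0.
    by apply: contraTneq => ->; rewrite mulr0 ltxx.
  rewrite expr2 -mulmxE -mulmxA !mulmxBl !mul_scalar_mx.
  by rewrite -/(cmx W *m z - l *: z) h subrr.
have yx : cre y = x by apply/matrixP => i j; rewrite !mxE.
have yi : cim y = 0 by apply/matrixP => i j; rewrite !mxE.
have -> : omega0 x (W *m x) = Qc W y by rewrite /Qc yx yi mulmx0 omega0r addr0.
have sq : Qc W y = \sum_(l <- undup s) complex.Im l * complex.Im (Hf (f l) (f l)).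
  rewrite Qc_Hf {1}ey mulmx_sumr.
  have -> : Hf (\sum_(l <- undup s) cmx W *m f l) y = \sum_(l <- undup s) l * Hf (f l) (f l).
    rewrite (big_morph (fun z => Hf z y) (fun a b => HfDl a b y) (Hf0l y)).
    apply: eq_big_seq => l; rewrite mem_undup => ls; rewrite hf HfZl; congr (_ * _).
    rewrite ey (big_morph (fun z => Hf (f l) z) (HfDr (f l)) (_ : Hf (f l) 0 = 0)); last first.
      by rewrite HfC Hf0l conjc0 oppr0.
    rewrite (bigD1_seq l) ?undup_uniq ?mem_undup //= big1_seq ?addr0 // => k /andP[kl].
    rewrite mem_undup => ks; apply: (@Hf_eigen_orth W (f l) (f k) l k) => //; last by rewrite eq_sym.
    by have [] := hu k (ev k ks).
  rewrite (big_morph _ (_ : {morph (@complex.Re R) : a b / a + b >-> a + b}) (_ : complex.Re 0 = 0)) //; last first.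
    by move=> [a b] [c d].
  rewrite -sumrN; apply: eq_bigr => l _; have := Hf_im (f l); case: (Hf _ _) => a b /= ->.
  by case: l => c d /=; ring.
have ge l : l \in undup s -> 0 <= complex.Im l * complex.Im (Hf (f l) (f l)).
  rewrite mem_undup => ls; have [->|f0] := eqVneq (f l) 0; first by rewrite Hf0l mulr0.
  exact: ltW (Sp_ell_eigen_sign hW (ev l ls) (hf l) f0).
have [l ls f0] : exists2 l, l \in undup s & f l != 0.
  apply: contrapT => hn; move/eqP: x0; apply; rewrite -yx ey.
  rewrite big1_seq; first by apply/matrixP => i j; rewrite !mxE.
  by move=> l /= ls; apply/eqP/negPn/negP => f0; apply: hn; exists l.
rewrite sq (bigD1_seq l) ?undup_uniq //= ltr_pwDl //.
  by apply: (Sp_ell_eigen_sign hW (ev l _) (hf l) f0); rewrite -mem_undup.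
by rewrite big_seq_cond sumr_ge0 // => k /andP[ks _]; exact: ge.
Qed.

End EllipticForm.

(** * Limits along ultrafilters *)

Section Ultra.
Variable R : realType.

(** Ultrafilters stand in for convergent subsequences: any finite family of bounded functions
    converges along one and the same ultrafilter. *)
Lemma ultra_cvg (T : Type) (F : set_system T) (UF : UltraFilter F) (f : T -> R) (B : R) :
  F [set x | `|f x| <= B] -> exists2 a, f x @[x --> F] --> a & `|a| <= B.
Proof.
move=> hB; have PF := @ultra_proper _ _ UF.
have [a [aK ca]] : exists a, (`[-B, B]%classic `&` cluster (f @ F)) a.
  apply: (@segment_compact R (- B) B (f @ F)).
  by rewrite /nbhs /= /fmap /=; apply: filterS hB => x /=; rewrite in_itv /= -ler_norml.
exists a; last by move: aK; rewrite /= in_itv /= ler_norml.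
move=> U Ua; have [//|h] := in_ultra_setVsetC (f @^-1` U) UF.
by have [x [nx xx]] := ca (~` U) U h Ua; case: (nx xx).
Qed.

Lemma ball_ultra (T : Type) (M : pseudoMetricType R) (P : set T) (g : T -> M) (W0 : M) :
  (forall d : R, 0 < d -> exists2 x, P x & ball W0 d (g x)) ->
  exists U : set_system T, [/\ UltraFilter U, U P & g x @[x --> U] --> W0].
Proof.
move=> h; pose F := filter_from [set d : R | 0 < d] (fun d => P `&` [set x | ball W0 d (g x)]).
have FF : ProperFilter F.
  apply: filter_from_proper; last by move=> d d0; have [x Px bx] := h d d0; exists x.
  apply: filter_from_filter; first by exists 1 => /=.
  move=> d e d0 e0; exists (Num.min d e); first by rewrite /= lt_min d0.
  move=> x [Px bx]; split; split=> //=; apply: le_ball bx; rewrite ge_min lexx ?orbT //.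
have [U [UU FU]] := ultraFilterLemma FF; have PU := @ultra_proper _ _ UU.
exists U; split=> //.
  by apply: FU; exists 1 => //= x [].
move=> B /nbhs_ballP[e e0 he]; apply: FU; exists e => // x [_ bx]; exact: he.
Qed.

Lemma poly_eq_all (p q : {poly R}) : (forall a, p.[a] = q.[a]) -> p = q.
Proof.
move=> h; apply/eqP; rewrite -subr_eq0; apply/negPn/negP => n0.
pose s := [seq (k%:R : R) | k <- iota 0 (size (p - q))].
have us : uniq s by rewrite map_inj_uniq ?iota_uniq // => i j /eqP; rewrite eqr_nat => /eqP.
have rs : all (root (p - q)) s by apply/allP => x _; rewrite rootE !hornerE h subrr.
by have := max_poly_roots n0 rs us; rewrite size_map size_iota ltnn.
Qed.

End Ultra.

(** * Angles of the spectrum *)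

Section Spectrum.
Variables (R : realType) (n : nat).
Local Notation C := R[i].
Local Notation M := 'M[R]_(n + n).
Local Notation toC := (real_complex R).

Definition ES (W : M) (th : 'I_n -> R) := (forall j, 0 <= th j <= pi) /\
  char_poly (cmx W) = \prod_(j < n) (('X - (expi (th j))%:P) * ('X - (expi (- th j))%:P)).

Definition quadpoly (c : R) : {poly R} := 'X^2 - (2 * c) *: 'X + 1.

Lemma expi_pair (t : R) : ('X - (expi t)%:P) * ('X - (expi (- t))%:P) = map_poly toC (quadpoly (cos t)).
Proof.
rewrite /quadpoly rmorphD rmorphB /= map_polyXn map_polyZ /= map_polyX rmorph1.
have e1 : expi t + expi (- t) = toC (2 * cos t).
  by rewrite /expi cosN sinN; apply/eqP; rewrite eq_complex /= subrr eqxx andbT mulr_natl mulr2n.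
have e2 : expi t * expi (- t) = 1.
  rewrite /expi cosN sinN; apply/eqP; rewrite eq_complex /=; apply/andP; split; apply/eqP.
    by rewrite mulrN opprK -!expr2 cos2Dsin2.
  by rewrite mulrN [sin t * _]mulrC addrC subrr.
have e3 : (expi t)%:P * (expi (- t))%:P = 1 by rewrite -polyCM e2.
by rewrite -e1 -mul_polyC polyCD -e3; ring.
Qed.

Lemma cmx_char_poly (W : M) : char_poly (cmx W) = map_poly toC (char_poly W).
Proof. by rewrite map_char_poly. Qed.

Lemma ES_real (W : M) th : (forall j, 0 <= th j <= pi) ->
  (ES W th <-> char_poly W = \prod_(j < n) quadpoly (cos (th j))).
Proof.
move=> h; rewrite /ES cmx_char_poly; under eq_bigr do rewrite expi_pair.
rewrite -rmorph_prod; split=> [[_]|-> //].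
move=> e; apply: (@map_inj_poly _ _ (real_complex R)) e; [exact: fmorph_inj | exact: rmorph0].
Qed.

(** The angles are bounded, so they converge along the ultrafilter; evaluating the real
    characteristic polynomials at every point identifies the spectrum of the limit. *)
Lemma ES_cvg (T : Type) (F : set_system T) (UF : UltraFilter F) (W : T -> M) (W0 : M)
    (th : T -> 'I_n -> R) : W x @[x --> F] --> W0 -> F [set x | ES (W x) (th x)] ->
  exists2 th0, ES W0 th0 & forall j, th x j @[x --> F] --> th0 j.
Proof.
move=> cW hF; have PF := @ultra_proper _ _ UF.
have hb j : F [set x | 0 <= th x j <= pi] by apply: filterS hF => x [/(_ j)].
have hl j : exists a : R, th x j @[x --> F] --> a.
  have [|a ca _] := @ultra_cvg R T F UF (fun x => th x j) pi; last by exists a.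
  by apply: filterS (hb j) => x /andP[a b]; rewrite /= ger0_norm.
have [th0 hth] := choice hl; exists th0 => //.
have h0 j : 0 <= th0 j <= pi.
  apply/andP; split.
    apply: (@closed_cvg _ _ F PF (fun x => th x j) (fun y : R => 0 <= y) (@closed_ge R 0) _ _ (hth j)).
    by apply: filterS (hb j) => x /andP[].
  apply: (@closed_cvg _ _ F PF (fun x => th x j) (fun y : R => y <= pi) (@closed_le R pi) _ _ (hth j)).
  by apply: filterS (hb j) => x /andP[].
apply/ES_real => //; apply: poly_eq_all => a; rewrite char_poly_eval.
rewrite horner_prod; under eq_bigr do rewrite /quadpoly !hornerE.
have c1 : \det (a%:M - W x) @[x --> F] --> \det (a%:M - W0).
  have h : a%:M - W x @[x --> F] --> a%:M - W0 by apply: cvgB; [exact: cvg_cst | exact: cW].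
  exact: (@cvg_det _ _ F _ _ (fun x => a%:M - W x)).
have c2 : \prod_(j < n) (a ^+ 2 - 2 * cos (th x j) * a + 1) @[x --> F] -->
    \prod_(j < n) (a ^+ 2 - 2 * cos (th0 j) * a + 1).
  apply: (@cvg_prodr _ _ F _ _ _ _ (fun j x => a ^+ 2 - 2 * cos (th x j) * a + 1)) => j _.
  have h : cos (th x j) @[x --> F] --> cos (th0 j).
    by apply: (@cvg_comp _ _ _ (th ^~ j) cos); [exact: hth | exact: continuous_cos].
  apply: cvgD; last exact: cvg_cst.
  apply: cvgB; first exact: cvg_cst.
  by apply: cvgM; [apply: cvgM; [exact: cvg_cst | exact: h] | exact: cvg_cst].
have e : F [set x | \det (a%:M - W x) = \prod_(j < n) (a ^+ 2 - 2 * cos (th x j) * a + 1)].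
  apply: filterS hF => x e /=; have [b _] := e; move/ES_real: e => /(_ b) e.
  rewrite -char_poly_eval e horner_prod; apply: eq_bigr => j _.
  by rewrite /quadpoly !hornerE.
have c3 : \det (a%:M - W x) @[x --> F] --> \prod_(j < n) (a ^+ 2 - 2 * cos (th0 j) * a + 1).
  apply: cvg_trans c2; apply: near_eq_cvg; apply: filterS e => x /= e; exact: esym.
exact: cvg_unique c1 c3.
Qed.

Lemma ES_roots (W : M) th : ES W th -> char_poly (cmx W) =
  \prod_(x <- [seq expi (th j) | j <- enum 'I_n] ++ [seq expi (- th j) | j <- enum 'I_n]) ('X - x%:P).
Proof.
move=> [_ ->]; rewrite big_cat !big_map /= big_split /=.
by congr (_ * _); rewrite big_enum.
Qed.

(** The sum of [acos (Re x)] over all roots counts every angle twice and does not depend on the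
    order of the list. *)
Lemma ES_uniq (W : M) th th' : ES W th -> ES W th' -> \sum_j th j = \sum_j th' j.
Proof.
move=> h h'; have /eqP := ES_roots h'; rewrite (ES_roots h) => /eqP /prod_XsubC_eq pe.
have key (t : 'I_n -> R) : (forall j, 0 <= t j <= pi) ->
   \sum_(x <- [seq expi (t j) | j <- enum 'I_n] ++ [seq expi (- t j) | j <- enum 'I_n]) acos (complex.Re x)
    = 2 * \sum_j t j.
  move=> tb; rewrite big_cat /= 2!big_map.
  rewrite [X in X + _]big_enum [X in _ + X]big_enum /= -big_split /= mulr_sumr; apply: eq_bigr => j _.
  by rewrite cosN cosK ?in_itv ?tb //=; ring.
have /mulfI : 2 * \sum_j th j = 2 * \sum_j th' j.
  by rewrite -(key _ h.1) -(key _ h'.1); apply: perm_big.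
by apply; rewrite pnatr_eq0.
Qed.

Lemma ES_cont (W0 : M) th0 (e : R) : ES W0 th0 -> 0 < e -> exists2 d : R, 0 < d &
  forall W th, ES W th -> ball W0 d W -> `|\sum_j th j - \sum_j th0 j| < e.
Proof.
move=> E0 e0; apply: contrapT => hn.
have [U [UU UP UW]] : exists U : set_system (M * ('I_n -> R)), [/\ UltraFilter U,
    U [set z | ES z.1 z.2 /\ e <= `|\sum_j z.2 j - \sum_j th0 j|] & fst x @[x --> U] --> W0].
  apply: ball_ultra => d d0; apply: contrapT => hd; apply: hn; exists d => // W th EW bW.
  rewrite ltNge; apply/negP => le; apply: hd; exists (W, th) => //; split=> //.
have PU := @ultra_proper _ _ UU.
have [|th1 E1 c1] := @ES_cvg _ U UU fst W0 snd UW; first by apply: filterS UP => z [].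
have cs : \sum_j (snd x) j @[x --> U] --> \sum_j th1 j.
  by apply: (@cvg_sumr _ _ U _ _ _ _ (fun j (x : M * ('I_n -> R)) => x.2 j)) => j _; exact: c1.
rewrite (ES_uniq E1 E0) in cs.
have /cvgrPdist_lt/(_ _ e0) h := cs.
have [z [h1 [_ h2]]] := filter_ex (filterI h UP).
by move: h1; rewrite /= distrC ltNge h2.
Qed.

Lemma conj_roots (W : M) (s : seq C) : char_poly (cmx W) = \prod_(x <- s) ('X - x%:P) ->
  perm_eq s [seq conjc x | x <- s].
Proof.
move=> e; apply: prod_XsubC_eq; rewrite -e big_map.
have -> : \prod_(x <- s) ('X - (conjc x)%:P) = map_poly (@conjc R) (\prod_(x <- s) ('X - x%:P)).
  by rewrite rmorph_prod /=; apply: eq_bigr => x _; rewrite map_polyXsubC.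
rewrite -e cmx_char_poly -map_poly_comp; apply/polyP => i; rewrite !coef_map /=.
by rewrite oppr0.
Qed.

Lemma char_poly_roots (m : nat) (A : 'M[C]_m) :
  exists2 s : seq C, char_poly A = \prod_(x <- s) ('X - x%:P) & size s = m.
Proof.
have [s hs] := closed_field_poly_normal (char_poly A).
rewrite (eqP (char_poly_monic A)) scale1r in hs; exists s => //.
by have := size_char_poly A; rewrite hs size_prod_XsubC => -[].
Qed.

Lemma unit_expi (x : C) : `|x| = 1 -> 0 <= complex.Im x -> expi (acos (complex.Re x)) = x.
Proof.
case: x => a b /= h b0.
have ab : a ^+ 2 + b ^+ 2 = 1.
  have := add_Re2_Im2 (a +i* b)%C; rewrite h expr1n /= => /eqP; rewrite eq_complex /= => /andP[/eqP].
  by [].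
have a1 : -1 <= a <= 1 by apply/andP; split; nra.
rewrite /expi acosK ?in_itv //= sin_acos // (_ : 1 - a ^+ 2 = b ^+ 2); last by rewrite -ab; ring.
by rewrite sqrtr_sqr ger0_norm.
Qed.

Lemma big_nth_ord (T : Type) (x0 : T) (s : seq T) k (F : T -> {poly C}) : size s = k ->
  \prod_(x <- s) F x = \prod_(j < k) F (nth x0 s j).
Proof. by move=> <-; rewrite (big_nth x0) big_mkord. Qed.

(** No root is real and conjugation permutes the roots, so those in the upper half plane and their
    conjugates make up the whole list. *)
Lemma ell_ES (W : M) : Sp_ell W -> exists2 th, ES W th & forall j, 0 < th j < pi.
Proof.
move=> [_ [hu _]]; have [s es ss] := char_poly_roots (cmx W).
have rt x : x \in s -> `|x| = 1 /\ complex.Im x != 0.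
  move=> xs; have [|u [n1 nm1]] := hu x; first by rewrite /Defs.eigenvalue es root_prod_XsubC.
  split=> //; apply/eqP; move: u n1 nm1; case: x {xs} => a b /= u n1 nm1 b0; subst b.
  have : a ^+ 2 = 1.
    have := add_Re2_Im2 (a +i* 0)%C; rewrite u expr1n /= expr0n addr0 => /eqP.
    by rewrite eq_complex /= => /andP[/eqP].
  move/eqP; rewrite -[X in _ == X](expr1n _ 2) eqf_sqr => /orP[] /eqP e.
    by move/eqP: n1; apply; rewrite e.
  by move/eqP: nm1; apply; rewrite e; apply/eqP; rewrite eq_complex /= oppr0 !eqxx.
pose sp := [seq x <- s | 0 < complex.Im x].
have p1 : perm_eq s (sp ++ [seq conjc x | x <- sp]).
  rewrite perm_sym; apply: perm_trans (_ : perm_eq (sp ++ [seq x <- s | predC (fun x => 0 < complex.Im x) x]) _).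
    rewrite perm_cat2l; have /(perm_filter (predC (fun x => 0 < complex.Im x))) := conj_roots es.
    rewrite perm_sym => h; apply: perm_trans h; rewrite filter_map /sp.
    rewrite (@eq_in_filter _ (fun x => 0 < complex.Im x) (preim (fun x => conjc x) (predC (fun x => 0 < complex.Im x)))) // => x /rt[_ x0] /=.
    by case: x x0 => a b /= b0; rewrite oppr_gt0 -leNgt le_eqVlt eq_sym (negPf b0).
  by rewrite perm_filterC.
have sz : size sp = n by have := perm_size p1; rewrite ss size_cat size_map => e; apply/eqP; rewrite -(@eqn_pmul2l 2) // !mul2n -!addnn e.
have sP j : (j < n)%N -> nth 0 sp j \in sp by move=> jn; rewrite mem_nth // sz.
exists (fun j => acos (complex.Re (nth 0 sp j))).
  split.
    move=> j; have := sP j (ltn_ord j); rewrite mem_filter => /andP[i0 /rt[u _]].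
    have : -1 <= complex.Re (nth 0 sp j) <= 1.
      have := add_Re2_Im2 (nth 0 sp j); rewrite u expr1n => /eqP; rewrite eq_complex /= => /andP[/eqP h _].
      by have := sqr_ge0 (complex.Im (nth 0 sp j)); set z := complex.Re _ in h *; set y := complex.Im _ in h * => ?; apply/andP; split; nra.
    by move=> h; rewrite acos_ge0 // acos_lepi.
  rewrite es (perm_big _ p1) /= big_cat big_map /= !(big_nth_ord 0 _ sz) -big_split /=.
  apply: eq_bigr => j _; have := sP j (ltn_ord j); rewrite mem_filter => /andP[i0 /rt[u _]].
  have e := unit_expi u (ltW i0); rewrite e; congr (_ * ('X - _%:P)).
  by rewrite -{1}e /expi cosN sinN.
move=> j; have := sP j (ltn_ord j); rewrite mem_filter => /andP[i0 /rt[u _]].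
have e := unit_expi u (ltW i0); set t := acos _ in e *.
have : 0 < sin t by move: i0; rewrite -e.
have /andP[t0 t1] : 0 <= t <= pi.
  rewrite /t; have : -1 <= complex.Re (nth 0 sp j) <= 1.
    have := add_Re2_Im2 (nth 0 sp j); rewrite u expr1n => /eqP; rewrite eq_complex /= => /andP[/eqP h _].
    by have := sqr_ge0 (complex.Im (nth 0 sp j)); set z := complex.Re _ in h *; set y := complex.Im _ in h * => ?; apply/andP; split; nra.
  by move=> h; rewrite acos_ge0 // acos_lepi.
move=> s0; rewrite !lt_neqAle t0 t1 !andbT; apply/andP; split; apply/eqP => e'.
  by move: s0; rewrite -e' sin0 ltxx.
by move: s0; rewrite e' sinpi ltxx.
Qed.

End Spectrum.

(** * Polynomials in a matrix of any size *)

Section Hmx.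
Variable K : comNzRingType.

Definition hmx m : 'M[K]_m -> {poly K} -> 'M[K]_m :=
  match m with 0 => fun A _ => A | m'.+1 => fun A p => horner_mx A p end.

Lemma hmxMX m (A : 'M[K]_m) p c : hmx A (p * 'X + c%:P) = hmx A p *m A + c%:M.
Proof.
case: m A => [|m] A; first by rewrite [LHS]flatmx0 [RHS]flatmx0.
by rewrite /= rmorphD rmorphM /= horner_mx_X horner_mx_C.
Qed.

Lemma hmx0 m (A : 'M[K]_m) : hmx A 0 = 0.
Proof. by case: m A => [|m] A; [exact: flatmx0 | rewrite /= rmorph0]. Qed.

Lemma hmxM m (A : 'M[K]_m) p q : hmx A (p * q) = hmx A p *m hmx A q.
Proof. by case: m A => [|m] A; [rewrite [LHS]flatmx0 [RHS]flatmx0 | rewrite /= rmorphM]. Qed.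

Lemma hmxN m (A : 'M[K]_m) p : hmx A (- p) = - hmx A p.
Proof. by case: m A => [|m] A; [rewrite [LHS]flatmx0 [RHS]flatmx0 | rewrite /= rmorphN]. Qed.

Lemma hmx_intertwine m (A A' B : 'M[K]_m) p : A *m B = B *m A' -> hmx A p *m B = B *m hmx A' p.
Proof.
move=> h; elim/poly_ind: p => [|p c IH]; first by rewrite !hmx0 mul0mx mulmx0.
by rewrite !hmxMX mulmxDl mulmxDr -mulmxA h mulmxA IH mulmxA mul_scalar_mx mul_mx_scalar.
Qed.

Lemma hmx_tr m (A : 'M[K]_m) p : (hmx A p)^T = hmx A^T p.
Proof.
elim/poly_ind: p => [|p c IH]; first by rewrite !hmx0 trmx0.
rewrite !hmxMX [LHS]raddfD /= trmx_mul IH tr_scalar_mx; congr (_ + _).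
by rewrite -(hmx_intertwine (A := A^T) (A' := A^T) (B := A^T)).
Qed.

End Hmx.

Lemma hmx_map (K L : comNzRingType) (f : {rmorphism K -> L}) m (A : 'M[K]_m) p :
  map_mx f (hmx A p) = hmx (map_mx f A) (map_poly f p).
Proof.
elim/poly_ind: p => [|p c IH]; first by rewrite rmorph0 !hmx0 map_mx0.
by rewrite rmorphD rmorphM /= map_polyX map_polyC /= !hmxMX map_mxD map_mxM IH map_scalar_mx.
Qed.

Lemma is_derive_trace_hmx (R : realType) m (A : R -> 'M[R]_m) (t : R) D (Q : {poly R}) : mder A t D ->
  is_derive t 1 (fun x => \tr (hmx (A x) Q)) (\tr (hmx (A t) (deriv Q) *m D)).
Proof.
case: m A D => [|m] A D dA; last exact: is_derive_trace_horner.
rewrite (_ : (fun x => _) = (fun=> 0)); last by apply/funext => x; rewrite /mxtrace big_ord0.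
by rewrite /mxtrace big_ord0; exact: is_derive_cst.
Qed.

Lemma spec_hmx (C : numClosedFieldType) m (A : 'M[C]_m) s (f : {poly C}) :
  char_poly A = \prod_(x <- s) ('X - x%:P) ->
  \tr (hmx A f) = \sum_(x <- s) f.[x] /\ \det (hmx A f) = \prod_(x <- s) f.[x].
Proof.
case: m A => [|m] A e; last by split; [exact: trace_horner | exact: det_horner].
have : size s = 0%N by have := size_char_poly A; rewrite e size_prod_XsubC => -[].
by move/size0nil => ->; rewrite !big_nil /mxtrace big_ord0 det_mx00.
Qed.

(** * Speed of the sum of the angles *)

Section LengthBound.
Variables (R : realType) (n : nat).
Hypothesis n0 : (0 < n)%N.
Local Notation M := 'M[R]_(n + n).
Local Notation V := 'cV[R]_(n + n).
Local Notation J := (J0 R n).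
Local Notation toC := (real_complex R).

Lemma poly_eq_ge1 (p q : {poly R}) : (forall a, 1 <= a -> p.[a] = q.[a]) -> p = q.
Proof.
move=> h; apply/eqP; rewrite -subr_eq0; apply/negPn/negP => nz.
pose s := [seq (k.+1%:R : R) | k <- iota 0 (size (p - q))].
have us : uniq s by rewrite map_inj_uniq ?iota_uniq // => i j /eqP; rewrite eqr_nat eqSS => /eqP.
have rs : all (root (p - q)) s.
  by apply/allP => x /mapP[k _ ->]; rewrite rootE !hornerE h ?subrr // ler1n.
by have := max_poly_roots nz rs us; rewrite size_map size_iota ltnn.
Qed.

(** The cosine of [W]: for symplectic [W] with spectrum [ES W th] the eigenvalues are the
    [cos (th j)], each twice. *)
Definition Cm (W : M) : M := 2^-1 *: (W + sinv W).

(** For [a = (b + 1 / b) / 2] the product [(b - W) (1 / b - W)] equals [-2 W (a - Cm W)], which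
    expresses the determinant through two values of the characteristic polynomial of [W]. A real [b]
    exists when [a >= 1], and infinitely many points identify a polynomial. *)
Lemma char_poly_Cm (W : M) th : symplectic W -> ES W th ->
  char_poly (Cm W) = \prod_(j < n) ('X - (cos (th j))%:P) ^+ 2.
Proof.
move=> sW E; have [tb _] := E; have [uW iW _] := symp_inv sW.
have chi z : \det (z%:M - W) = \prod_(j < n) (z ^+ 2 - 2 * cos (th j) * z + 1).
  move/(ES_real W tb): E => e; rewrite -char_poly_eval e horner_prod.
  by apply: eq_bigr => j _; rewrite /quadpoly !hornerE.
have ev : (-1) ^+ (n + n) = 1 :> R by rewrite addnn -mul2n exprM sqrrN expr1n expr1n.
have dW : \det W = 1.
  have := chi 0; rewrite raddf0 sub0r -scaleN1r detZ ev mul1r => ->.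
  by apply: big1 => j _; rewrite expr0n mulr0 subr0 add0r.
apply: poly_eq_ge1 => a a1; rewrite char_poly_eval horner_prod.
pose b := a + Num.sqrt (a ^+ 2 - 1).
have a2 : 0 <= a ^+ 2 - 1 by nra.
have bb : b ^+ 2 + 1 = 2 * a * b.
  by rewrite /b; have := sqr_sqrtr a2; set r := Num.sqrt _ => h; nra.
have b0 : 0 < b by rewrite /b ltr_pwDl ?sqrtr_ge0 // (lt_le_trans ltr01).
have bn : b != 0 by rewrite gt_eqF.
clearbody b; have ab : a = (b + b^-1) / 2.
  by apply: (mulIf bn); rewrite mulrAC mulrDl mulVf // -expr2 bb; field.
have e1 : (b%:M - W) *m (b^-1%:M - W) = (- 2) *: (W *m (a%:M - Cm W)).
  rewrite /Cm !mulmxDl !mulmxDr !mulNmx !mulmxN -iW !mul_scalar_mx !mul_mx_scalar -scalemxAr mulmxDr mulmxV //.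
  move: (W *m W) => A; rewrite ab; apply/matrixP => i j; rewrite !mxE.
  by case: (i == j); rewrite ?mulr1n ?mulr0n; field.
have := congr1 (fun A => \det A) e1; rewrite det_mulmx !chi detZ det_mulmx dW mul1r.
have -> : (- 2 : R) ^+ (n + n) = \prod_(j < n) 4.
  by rewrite addnn -mul2n exprM sqrrN prodr_const card_ord; congr (_ ^+ _); rewrite -natrX.
rewrite -big_split /= => h.
have -> : \prod_(j < n) (('X - (cos (th j))%:P) ^+ 2).[a] = \prod_(j < n) (a - cos (th j)) ^+ 2.
  by apply: eq_bigr => j _; rewrite !hornerE.
have p4 : \prod_(j < n) (4 : R) != 0 by rewrite prodr_const expf_neq0.
apply: (mulfI p4); rewrite -h -big_split /=; apply: eq_bigr => j _.
set c := cos _; have -> : b ^+ 2 - 2 * c * b + 1 = 2 * b * (a - c) by rewrite addrAC bb; ring.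
have -> : b^-1 ^+ 2 - 2 * c * b^-1 + 1 = 2 * b^-1 * (a - c).
  apply: (mulIf (expf_neq0 2 bn)); rewrite mulrDl mulrBl -exprMn mulVf // expr1n mul1r.
  have -> : 1 - 2 * c * b^-1 * b ^+ 2 + b ^+ 2 = 2 * a * b - 2 * c * b by rewrite -bb; field.
  by field.
by rewrite expr2; field.
Qed.

Lemma spec_Cm (W : M) th (f : {poly R}) : symplectic W -> ES W th ->
  \tr (hmx (Cm W) f) = 2 * \sum_j f.[cos (th j)] /\
  \det (hmx (Cm W) f) = (\prod_j f.[cos (th j)]) ^+ 2.
Proof.
move=> sW E; have e := char_poly_Cm sW E.
pose s := [seq toC (cos (th j)) | j <- index_enum 'I_n] ++ [seq toC (cos (th j)) | j <- index_enum 'I_n].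
have es : char_poly (cmx (Cm W)) = \prod_(x <- s) ('X - x%:P).
  have -> : \prod_(x <- s) ('X - x%:P) = (\prod_j ('X - (toC (cos (th j)))%:P)) ^+ 2.
    by rewrite /s big_cat big_map expr2.
  rewrite cmx_char_poly e rmorph_prod /= -prodrXl.
  by apply: eq_bigr => j _; rewrite rmorphXn /= map_polyXsubC.
have [ht hd] := spec_hmx (map_poly toC f) es.
have hh j : (map_poly toC f).[toC (cos (th j))] = toC f.[cos (th j)] by rewrite horner_map.
split; apply: (fmorph_inj toC).
  have h1 : toC (\tr (hmx (Cm W) f)) = \tr (hmx (cmx (Cm W)) (map_poly toC f)).
    by rewrite -hmx_map /mxtrace rmorph_sum; apply: eq_bigr => i _; rewrite mxE.
  have -> : 2 * \sum_j f.[cos (th j)] = \sum_j f.[cos (th j)] + \sum_j f.[cos (th j)] by ring.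
  apply: (etrans h1); rewrite ht /s big_cat !big_map /= rmorphD rmorph_sum /=.
  by congr (_ + _); apply: eq_bigr => j _; exact: hh.
have h1 : toC (\det (hmx (Cm W) f)) = \det (hmx (cmx (Cm W)) (map_poly toC f)).
  by rewrite -hmx_map det_map_mx.
apply: (etrans h1); rewrite hd /s big_cat !big_map /= /= rmorphXn rmorph_prod /= expr2.
by congr (_ * _); apply: eq_bigr => j _; exact: hh.
Qed.

(** The sine of [W] up to a factor [i]: its square is [Cm W] squared minus [1]. *)
Definition Kc (W : M) : M := (- 2^-1) *: (W - sinv W).

Lemma Cm_J (W : M) : symplectic W -> Cm W *m J = J *m (Cm W)^T.
Proof.
move=> sW; have [uW iW s2] := symp_inv sW.
have e1 : sinv W *m J = J *m W^T.
  by rewrite /sinv mulNmx -[J *m W^T *m J *m J]mulmxA JJ mulmxN mulmx1 opprK.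
have e2 : W *m J = J *m (sinv W)^T.
  rewrite /sinv [(- _)^T]raddfN /= !trmx_mul trmxK !trJ mulmxN !mulNmx !mulmxN opprK mulmxA.
  by rewrite !mulmxA JJ !mulNmx mul1mx opprK.
rewrite /Cm -scalemxAl mulmxDl e1 e2 [(_ *: _)^T]linearZ /= -scalemxAr [(_ + _)^T]raddfD /= mulmxDr.
by rewrite addrC.
Qed.

(** A symmetric matrix whose form at [u] is that of [W] at [J u]; its determinant, the product of
    the [sin^2], measures how far the spectrum is from [1] and [-1]. *)
Definition Pm (W : M) : M := Kc W *m J.

Lemma Pm_form (W : M) u : symplectic W -> qform (Pm W) u = omega0 (J *m u) (W *m (J *m u)).
Proof.
move=> sW; have [uW iW s2] := symp_inv sW; set y := J *m u.
have uy : u = - (J *m y) by rewrite /y mulmxA JJ mulNmx mul1mx opprK.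
have key A : (u^T *m A *m y) 0 0 = - omega0 y (A *m y).
  by rewrite omegaE {1}uy [(- _)^T]raddfN /= trmx_mul !mulNmx [LHS]mxE !mulmxA.
have e : omega0 y (sinv W *m y) = - omega0 y (W *m y).
  by rewrite (symp_omega_inv y y s2) -iW invmxK omegaC.
have h3 (A B : 'M[R]_1) (x z : R) : (x *: A + z *: B) 0 0 = x * A 0 0 + z * B 0 0 by rewrite !mxE.
have -> : qform (Pm W) u = ((- 2^-1) *: (u^T *m W *m y) + 2^-1 *: (u^T *m sinv W *m y)) 0 0.
  rewrite /qform /Pm /Kc -!mulmxA -/y -scalemxAl -scalemxAr mulmxBl mulmxBr scalerBr !scaleNr opprK.
  by [].
by rewrite h3 !key e; field.
Qed.

Lemma Pm_sym (W : M) : symplectic W -> (Pm W)^T = Pm W.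
Proof.
move=> sW; have [uW iW s2] := symp_inv sW.
have e1 : sinv W *m J = J *m W^T.
  by rewrite /sinv mulNmx -[J *m W^T *m J *m J]mulmxA JJ mulmxN mulmx1 opprK.
have e2 : W *m J = J *m (sinv W)^T.
  rewrite /sinv [(- _)^T]raddfN /= !trmx_mul trmxK !trJ mulmxN !mulNmx !mulmxN opprK mulmxA.
  by rewrite !mulmxA JJ !mulNmx mul1mx opprK.
rewrite /Pm /Kc trmx_mul [(_ *: _)^T]linearZ /= -scalemxAr -scalemxAl [(_ - _)^T]raddfB /= mulmxBr mulmxBl.
by rewrite e1 e2 trJ !mulNmx opprK addrC.
Qed.

Lemma Kc2 (W : M) : symplectic W -> Kc W *m Kc W = hmx (Cm W) ('X^2 - 1).
Proof.
move=> sW; have [uW iW s2] := symp_inv sW.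
have -> : ('X^2 - 1 : {poly R}) = (0 * 'X + 1%:P) * 'X * 'X + (-1)%:P.
  by rewrite mul0r add0r polyC1 mul1r -expr2 polyCN polyC1.
rewrite -[(0 * 'X + 1%:P) * 'X]addr0 -polyC0 !hmxMX hmx0 mul0mx add0r mul1mx raddf0 addr0.
rewrite /Kc /Cm -iW -!scalemxAl -!scalemxAr !scalerA !mulmxDl !mulmxDr !mulNmx !mulmxN mulmxV // mulVmx //.
move: (W *m W) (invmx W *m invmx W) => A B; apply/matrixP => i j; rewrite !mxE.
by case: (i == j); rewrite ?mulr1n ?mulr0n; field.
Qed.

Lemma Pm_posdef (W : M) : symplectic W ->
  (forall u : V, u != 0 -> 0 < omega0 u (W *m u)) -> posdef (Pm W).
Proof.
move=> sW qW u u0; rewrite Pm_form // qW //; apply: contra u0 => /eqP/(congr1 (mulmx J)).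
by rewrite mulmxA JJ mulNmx mul1mx mulmx0 => /eqP; rewrite oppr_eq0.
Qed.

(** [Kc2] only gives the square of this determinant; positivity of [Pm] selects the root. *)
Lemma det_Pm (W : M) th : symplectic W -> (forall u : V, u != 0 -> 0 < omega0 u (W *m u)) -> ES W th ->
  \det (Pm W) = \prod_j (1 - cos (th j) ^+ 2).
Proof.
move=> sW qW E; have dP0 : 0 < \det (Pm W) by apply: posdef_det_gt0; [exact: Pm_sym | exact: Pm_posdef].
have dK : \det (Pm W) = \det (Kc W) by rewrite /Pm det_mulmx detJ mulr1.
have h0 : 0 <= \prod_j (1 - cos (th j) ^+ 2).
  by apply: prodr_ge0 => j _; have := cos2Dsin2 (th j); have := sqr_ge0 (sin (th j)); lra.
have h1 : \det (Pm W) ^+ 2 = (\prod_j (1 - cos (th j) ^+ 2)) ^+ 2.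
  rewrite dK expr2 -det_mulmx Kc2 //; have [_ ->] := spec_Cm ('X^2 - 1) sW E.
  by rewrite -!prodrXl; apply: eq_bigr => j _; rewrite !hornerE; ring.
by apply/eqP; rewrite -(eqrXn2 (n := 2)) ?(ltW dP0) // h1.
Qed.

Definition Nm (W : M) (r : {poly R}) : M := hmx (Cm W) (r ^+ 2) *m Pm W.

(** One factor [r (Cm W)] can be moved to the right of [Pm], because [Cm W] commutes with [Kc W] and
    [J] turns it into its transpose. This makes [Nm] symmetric, with positivity inherited from
    [Pm]. *)
Lemma Nm_conj (W : M) r : symplectic W -> Nm W r = hmx (Cm W) r *m Pm W *m (hmx (Cm W) r)^T.
Proof.
move=> sW; have [uW iW s2] := symp_inv sW.
have cK : Cm W *m Kc W = Kc W *m Cm W.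
  rewrite /Cm /Kc -!scalemxAl -!scalemxAr !scalerA [_ * (- _)]mulrC; congr (_ *: _).
  rewrite -iW !mulmxDl !mulmxDr !mulNmx !mulmxN mulmxV // mulVmx //.
  by move: (W *m W) (invmx W *m invmx W) => A B; apply/matrixP => i j; rewrite !mxE; ring.
rewrite /Nm expr2 hmxM /Pm -!mulmxA; congr (_ *m _).
rewrite [LHS]mulmxA (hmx_intertwine r cK) -mulmxA; congr (_ *m _).
by rewrite hmx_tr; exact: hmx_intertwine (Cm_J sW).
Qed.

(** The right-hand side is the speed of the approximate sum of angles in [FQ_derive]. The
    determinant of [Nm] is a product of factors [r^4 sin^2], each one minus a defect, so
    [trace_det_AMGM] bounds the trace below by nearly [2 n G X]. *)
Lemma key_ineq (W X : M) th (r : {poly R}) (eps : R) : symplectic W ->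
  (forall u : V, u != 0 -> 0 < omega0 u (W *m u)) -> ES W th -> sp_plus X -> 0 <= eps <= 1 ->
  (forall j, 0 <= defect r.[cos (th j)] (cos (th j)) <= eps /\ 0 < r.[cos (th j)]) ->
  n%:R * ((1 - eps) * G X) <= 2^-1 * \tr (sform X *m Nm W r).
Proof.
move=> sW qW E pX /andP[e0 e1] hr; have [sS pS] := (sp_plusE X).1 pX.
have pP := Pm_posdef sW qW.
have [_ dr] := spec_Cm r sW E.
have rp : 0 < \prod_j r.[cos (th j)] by apply: prodr_gt0 => j _; have [] := hr j.
have ur : hmx (Cm W) r \in unitmx by rewrite unitmxE unitfE dr expf_neq0 // gt_eqF.
have sN : (Nm W r)^T = Nm W r.
  by rewrite Nm_conj // trmx_mul trmx_mul trmxK Pm_sym // mulmxA.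
have pN : posdef (Nm W r).
  move=> u u0; have -> : qform (Nm W r) u = qform (Pm W) ((hmx (Cm W) r)^T *m u).
    by rewrite Nm_conj // /qform trmx_mul trmxK !mulmxA.
  apply: pP; apply: contra u0 => /eqP h; apply/eqP.
  by rewrite -[u](mulKmx (_ : (hmx (Cm W) r)^T \in unitmx)) ?unitmx_tr // h mulmx0.
have nn : (0 < n + n)%N by rewrite addn_gt0 n0.
have [tp am] := trace_det_AMGM nn sN sS pN pS.
have dP := det_Pm sW qW E.
have dN : (1 - eps) ^+ n <= \det (Nm W r).
  rewrite Nm_conj // det_mulmx det_mulmx det_tr dr dP.
  have -> : (\prod_j r.[cos (th j)]) ^+ 2 * (\prod_j (1 - cos (th j) ^+ 2)) * (\prod_j r.[cos (th j)]) ^+ 2 =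
     \prod_j (1 - defect r.[cos (th j)] (cos (th j))).
    rewrite mulrAC -!prodrXl -!big_split /=; apply: eq_bigr => j _; rewrite /defect; ring.
  rewrite -[X in _ ^+ X](card_ord n) -prodr_const; apply: ler_prod => j _.
  by have [/andP[h1 h2] _] := hr j; apply/andP; split; lra.
have G0 := G_ge0 X.
have GN : G X ^+ (n + n) = \det (sform X).
  rewrite det_sform G_sp_plus // -powR_mulrn ?powR_ge0 // -powRrM mulVf ?pnatr_eq0 -?lt0n // powRr1 //.
  exact: ltW (sp_plus_det pX).
have ee : 0 <= 1 - eps by lra.
have dS : 0 < \det (sform X) by exact: posdef_det_gt0.
have fin : (1 - eps) * G X <= \tr (Nm W r *m sform X) / (n + n)%:R.
  rewrite -(ler_pXn2r nn) ?nnegrE ?mulr_ge0 // ?divr_ge0 ?(ltW tp) //.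
  apply: le_trans am; rewrite exprMn GN ler_wpM2r ?(ltW dS) //; apply: le_trans dN.
  (* Only [n] factors [1 - eps] occur in the bound for the determinant of [Nm], against [2 n] here;
     the extra ones are at most [1]. *)
  by rewrite exprD ler_piMr ?exprn_ge0 // exprn_ile1 //; lra.
rewrite mxtrace_mulC.
have N0 : 0 < (n + n)%:R :> R by rewrite ltr0n.
rewrite ler_pdivlMr // in fin.
have -> : n%:R * ((1 - eps) * G X) = 2^-1 * ((1 - eps) * G X * (n + n)%:R) by rewrite natrD; field.
by rewrite ler_pM2l // invr_gt0.
Qed.

Lemma mder_Cm (W : R -> M) (t : R) (D : M) : mder W t D -> mder (fun x => Cm (W x)) t (2^-1 *: (D + sinv D)).
Proof.
move=> h; have h1 : mder (fun x => W x + sinv (W x)) t (D + sinv D).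
  apply: mder_add => //; rewrite /sinv; apply: mder_opp.
  have h2 : mder (fun x => J *m (W x)^T) t (J *m D^T).
    by apply: mder_eq (mder_mul (mder_cst J t) (mder_tr h)) _; rewrite mul0mx add0r.
  by apply: mder_eq (mder_mul h2 (mder_cst J t)) _; rewrite mulmx0 addr0.
move=> i j; have h3 := h1 i j.
have -> : (2^-1 *: (D + sinv D)) i j = 2^-1 * (D + sinv D) i j by rewrite mxE.
rewrite (_ : (fun x => _) = (fun x => 2^-1 * (W x + sinv (W x)) i j)); last by apply/funext => x; rewrite mxE.
by apply: is_derive_eq (is_deriveMr (is_derive_cst (2^-1 : R) t 1) h3) _; rewrite mul0r add0r.
Qed.

Lemma FQ_derive (W D : R -> M) (t : R) (Q r : {poly R}) : C1on W D -> symplectic (W t) ->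
  sp_plus (D t *m invmx (W t)) -> deriv Q = - r ^+ 2 ->
  is_derive t 1 (fun x => 2^-1 * \tr (hmx (Cm (W x)) Q))
    (2^-1 * \tr (sform (D t *m invmx (W t)) *m Nm (W t) r)).
Proof.
move=> hW sW [spX _] dQ; have [uW iW s2] := symp_inv sW.
set X := D t *m invmx (W t) in spX *; have DX : D t = X *m W t by rewrite /X mulmxKV.
clearbody X; have h := is_derive_trace_hmx Q (mder_Cm (hW.1 t)).
apply: is_derive_eq (is_deriveMr (is_derive_cst (2^-1 : R) t 1) h) _; rewrite mul0r add0r; congr (_ * _).
(* This is the derivative of the inverse, [- W^-1 X]: [sinv] is linear, and membership of [X] in
   [sp] moves [J] across its transpose. *)
have sD : sinv (D t) = - (sinv (W t) *m X).
  have sX : X^T *m J = - (J *m X).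
    have := (spE X).1 spX; rewrite /sform trmx_mul trmxK trJ mulNmx => ->; by [].
  rewrite DX /sinv trmx_mul !mulmxA -[J *m (W t)^T *m X^T *m J]mulmxA sX mulmxN mulNmx !opprK.
  by rewrite !mulmxA.
rewrite dQ hmxN mulNmx raddfN /= /Nm /Pm /Kc; set H := hmx _ _.
have cH A : Cm (W t) *m A = A *m Cm (W t) -> H *m A = A *m H by move=> c; exact: hmx_intertwine.
have HW : H *m W t = W t *m H.
  by apply: cH; rewrite /Cm -scalemxAl -scalemxAr mulmxDl mulmxDr -iW mulmxV // mulVmx.
have HWi : H *m sinv (W t) = sinv (W t) *m H.
  by apply: cH; rewrite /Cm -scalemxAl -scalemxAr mulmxDl mulmxDr -iW mulmxV // mulVmx.
have JS : J *m sform X = X by rewrite /sform mulmxA trJ mulmxN JJ opprK mul1mx.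
move: JS; set S := sform X; clearbody S => JS.
have -> : \tr (S *m (H *m ((- 2^-1) *: (W t - sinv (W t)) *m J))) =
   - (2^-1 * (\tr (X *m (H *m W t)) - \tr (X *m (H *m sinv (W t))))).
  rewrite !mulmxA mxtrace_mulC !mulmxA JS -scalemxAr mxtraceZ mulNr; congr (- (_ * _)).
  by rewrite -!mulmxA mulmxBr mulmxBr raddfB.
congr (- _); rewrite -scalemxAr mxtraceZ sD mulmxBr raddfB /=; congr (_ * (_ - _)).
  by rewrite DX HW mxtrace_mulC -mulmxA.
by rewrite mulmxA mxtrace_mulC.
Qed.

End LengthBound.

Lemma lim_eps (R : realType) (A B C : R) : 0 <= C -> (forall e, 0 < e < 1 -> (1 - e) * A <= B + e * C) -> A <= B.
Proof.
move=> C0 h; rewrite leNgt; apply/negP => AB.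
pose d := A - B; pose K := `|A| + C + d + 1.
have A0 := normr_ge0 A; have A1 := ler_norm A.
have d0 : 0 < d by rewrite subr_gt0.
have K0 : 0 < K by rewrite /K; lra.
have e0 : 0 < d / (2 * K) < 1.
  by rewrite divr_gt0 ?mulr_gt0 //= ltr_pdivrMr ?mulr_gt0 // /K; lra.
have := h _ e0; set e := d / (2 * K) in e0 *.
have eK : e * K = d / 2 by rewrite /e; field; rewrite gt_eqF.
have : e * (A + C) <= e * K by case/andP: e0 => e0 _; rewrite ler_wpM2l ?(ltW e0) // /K; lra.
rewrite eK /d; lra.
Qed.

(** * Length bound for elliptic timelike curves *)

Section LengthIntegral.
Variables (R : realType) (n : nat).
Hypothesis n0 : (0 < n)%N.
Local Notation M := 'M[R]_(n + n).
Local Notation V := 'cV[R]_(n + n).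
Local Notation J := (J0 R n).
Local Notation mu := (@lebesgue_measure R).

(** Integrating from [-1] with room up to [2] puts [[0, 1]] in the interior, so that two-sided
    derivatives exist at its ends. *)
Lemma primitive_exists (g : R -> R) : continuous g -> exists2 Gam : R -> R,
  (forall t : R, -1 < t < 2 -> is_derive t 1 Gam (g t)) &
  forall k : R, (\int[mu]_(t in `[0%R, 1%R]) (k * g t)%:E = (k * (Gam 1 - Gam 0))%:E)%E.
Proof.
move=> cg; pose Gam x := (\int[mu]_(t in [set` `[(-1 : R), x]]) g t)%R.
have ig : mu.-integrable `[(-1 : R), 2] (EFin \o g).
  by apply: continuous_compact_integrable; [exact: segment_compact | exact: continuous_subspaceT].
have dG (t : R) : -1 < t < 2 -> is_derive t 1 Gam (g t).
  move=> /andP[t1 t2]; have [d e] := continuous_FTC1_closed t2 ig t1 (cg t).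
  have e2 : 'D_1 Gam t = g t by rewrite -derive1E; exact: e.
  exact: (DeriveDef d e2).
exists Gam => // k.
have dkG (t : R) : -1 < t < 2 -> is_derive t 1 (fun x => k * Gam x) (k * g t).
  move=> tI; apply: is_derive_eq (is_deriveMr (is_derive_cst k t 1) (dG t tI)) _.
  by rewrite mul0r add0r.
have ck (t : R) : -1 < t < 2 -> {for t, continuous (fun x => k * Gam x)}.
  by move=> tI; exact: is_derive_continuous (dkG t tI).
rewrite (@continuous_FTC2 R (fun x => k * g x) (fun x => k * Gam x) 0 1) //.
- by rewrite -EFinB -mulrBr.
- by apply: continuous_subspaceT => x; apply: cvgM; [exact: cvg_cst | exact: cg].
- split.
  + move=> x; rewrite in_itv /= => /andP[x0 x1].
    by have [] := dkG x _ => //; apply/andP; split; lra.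
  + by apply: cvg_at_right_filter; apply: ck; apply/andP; split; lra.
  + by apply: cvg_at_left_filter; apply: ck; apply/andP; split; lra.
- move=> x; rewrite in_itv /= => /andP[x0 x1]; rewrite derive1E.
  have xI : -1 < x < 2 by apply/andP; split; lra.
  by have [_ ->] := dkG x xI.
Qed.

Lemma timelike_prim (W D : R -> M) : C1on W D ->
  (forall t, 0 <= t <= 1 -> symplectic (W t)) ->
  (forall t, 0 <= t <= 1 -> sp_plus (D t *m invmx (W t))) ->
  exists Gam : R -> R, (forall t : R, 0 <= t <= 1 -> is_derive t 1 Gam (G (D t *m invmx (W t)))) /\
  forall k : R, (\int[mu]_(t in `[0%R, 1%R]) (k * G (D t *m invmx (W t)))%:E = (k * (Gam 1 - Gam 0))%:E)%E.
Proof.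
move=> hW sW pW; have cW := C1on_cont hW.
pose d t := \det (D t *m sinv (W t)).
have cd : continuous d.
  move=> t; apply: (@cvg_det _ _ (nbhs t) _ _ (fun t => D t *m sinv (W t))).
  apply: (@cvg_mulmx _ _ (nbhs t) _ _ _ _ D (fun t => sinv (W t))); first exact: hW.2.
  have h : W x @[x --> t] --> W t by exact: cW.
  apply: cvgN.
  apply: (@cvg_mulmx _ _ (nbhs t) _ _ _ _ (fun x => J *m (W x)^T) (fun=> J)); last exact: cvg_cst.
  apply: (@cvg_mulmx _ _ (nbhs t) _ _ _ _ (fun=> J) (fun x => (W x)^T)); first exact: cvg_cst.
  exact: (@cvg_trmx _ _ (nbhs t) _ _ _ W).
have dE t : 0 <= t <= 1 -> d t = \det (D t *m invmx (W t)).
  by move=> tI; rewrite /d; have [_ -> _] := symp_inv (sW t tI).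
have d0 t : 0 < d (clamp t).
  by rewrite dE ?clamp_itv //; apply: sp_plus_det; apply: pW; exact: clamp_itv.
pose g t := powR (d (clamp t)) ((n + n)%:R^-1).
have cg : continuous g.
  move=> t; have cp := is_derive_continuous (is_derive1_powR ((n + n)%:R^-1) (d0 t)).
  apply: (@cvg_comp _ _ _ (fun t => d (clamp t)) (fun x => powR x ((n + n)%:R^-1))); last exact: cp.
  by apply: (@cvg_comp _ _ _ (@clamp R) d); [exact: clamp_continuous | exact: cd].
have gE t : 0 <= t <= 1 -> g t = G (D t *m invmx (W t)).
  by move=> tI; rewrite /g clamp_id // dE // G_sp_plus //; exact: pW.
have [Gam dG iG] := primitive_exists cg; exists Gam; split.
  by move=> t tI; rewrite -gE //; apply: dG; case/andP: tI => a b; apply/andP; split; lra.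
move=> k; rewrite -iG; apply: eq_integral => t; rewrite inE /= in_itv /= => tI.
by rewrite gE.
Qed.

Lemma prod_le_factor (x : 'I_n -> R) i : (forall j, 0 <= x j <= 1) -> \prod_j x j <= x i.
Proof.
move=> h; rewrite (bigD1 i) //=; have /andP[x0 x1] := h i.
rewrite ler_piMr //; have : 0 <= \prod_(j < n | j != i) x j <= 1.
  apply: (big_ind (fun z => 0 <= z <= 1)) => [|a b /andP[a0 a1] /andP[b0 b1]|j _].
  - by rewrite ler01 lexx.
  - by rewrite mulr_ge0 // mulr_ile1.
  - exact: h.
by case/andP.
Qed.

(** On [[a, 1]] the determinant of [Pm] has a positive minimum [mi], and each factor [sin^2] is at
    least the whole product; hence all [|cos|] stay below one [rho < 1] and one polynomial serves.
    The form may degenerate at time [0], which is reached by letting [a] tend to [0]. *)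
Lemma length_bound (W D : R -> M) th : C1on W D ->
  (forall t, 0 <= t <= 1 -> symplectic (W t)) ->
  (forall t, 0 <= t <= 1 -> sp_plus (D t *m invmx (W t))) ->
  (forall t, 0 < t <= 1 -> forall u : V, u != 0 -> 0 < omega0 u (W t *m u)) -> ES (W 1) th ->
  exists2 L : R, (forall k : R, (\int[mu]_(t in `[0%R, 1%R]) (k * G (D t *m invmx (W t)))%:E = (k * L)%:E)%E)
    & n%:R * L <= \sum_j th j.
Proof.
move=> hW sW pW qW E1; have cW := C1on_cont hW.
have [Gam [dG iG]] := timelike_prim hW sW pW; exists (Gam 1 - Gam 0) => //.
have pip : 0 < pi :> R by exact: pi_gt0.
have nn0 : 0 < n%:R :> R by rewrite ltr0n.
have ESt t : 0 < t <= 1 -> exists tt, ES (W t) tt.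
  move=> tI; have tI' : 0 <= t <= 1 by case/andP: tI => /ltW -> ->.
  by have [tt e _] := ell_ES (form_ell n0 (sW t tI') (qW t tI)); exists tt.
have main a : 0 < a < 1 -> n%:R * (Gam 1 - Gam a) <= \sum_j th j.
  move=> /andP[a0 a1].
  apply: (@lim_eps _ _ _ (2 * (n%:R * pi))) => [|e eI]; first by rewrite !mulr_ge0 // ltW.
  have /andP[e0 e1] := eI; have e01 : 0 <= e <= 1 by rewrite !ltW.
  have cP : continuous (fun t => \det (Pm (W t))).
    move=> t; apply: (@cvg_det _ _ (nbhs t) _ _ (fun t => Pm (W t))).
    apply: (@cvg_mulmx _ _ (nbhs t) _ _ _ _ (fun t => Kc (W t)) (fun=> J)); last exact: cvg_cst.
    have h : W x @[x --> t] --> W t by exact: cW.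
    have hs : sinv (W x) @[x --> t] --> sinv (W t).
      apply: cvgN.
      apply: (@cvg_mulmx _ _ (nbhs t) _ _ _ _ (fun x => J *m (W x)^T) (fun=> J)); last exact: cvg_cst.
      apply: (@cvg_mulmx _ _ (nbhs t) _ _ _ _ (fun=> J) (fun x => (W x)^T)); first exact: cvg_cst.
      exact: (@cvg_trmx _ _ (nbhs t) _ _ _ W).
    by apply: cvgZr; apply: cvgB; [exact: h | exact: hs].
  have [c cI hc] := EVT_min (ltW a1) (continuous_subspaceT cP).
  have aI t : a <= t <= 1 -> 0 < t <= 1 by move=> /andP[h ->]; rewrite andbT; lra.
  have aI' t : a <= t <= 1 -> 0 <= t <= 1 by move=> /andP[h ->]; rewrite andbT; lra.
  rewrite in_itv /= in cI.
  set mi := \det (Pm (W c)) in hc.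
  have mi0 : 0 < mi.
    apply: posdef_det_gt0; first exact: Pm_sym (sW _ (aI' _ cI)).
    exact: Pm_posdef (sW _ (aI' _ cI)) (qW _ (aI _ cI)).
  have c2 (x : R) : 0 <= 1 - cos x ^+ 2 <= 1.
    by have := cos2Dsin2 x; have := sqr_ge0 (sin x); have := sqr_ge0 (cos x); move=> *; apply/andP; split; lra.
  have cosb t tt j : a <= t <= 1 -> ES (W t) tt -> cos (tt j) ^+ 2 <= 1 - mi.
    move=> tI Et; have := hc t; rewrite in_itv /= => /(_ tI).
    rewrite (det_Pm (sW _ (aI' _ tI)) (qW _ (aI _ tI)) Et) => h.
    by have := le_trans h (prod_le_factor j (fun j => c2 (tt j))); lra.
  have [tc Ec] := ESt c (aI _ cI).
  have mi1 : 0 <= 1 - mi by apply: le_trans (cosb c tc (Ordinal n0) cI Ec); exact: sqr_ge0.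
  pose rho := Num.sqrt (1 - mi).
  have r01 : 0 <= rho < 1.
    by rewrite sqrtr_ge0 /= -sqrtr1 ltr_sqrt //; lra.
  have cosr t tt j : a <= t <= 1 -> ES (W t) tt -> `|cos (tt j)| <= rho.
    by move=> tI Et; rewrite -sqrtr_sqr ler_wsqrtr //; exact: cosb tI Et.
  have [r hr] := good_poly r01 e0.
  have [Q [dQ Q0]] := antiderivative (- r ^+ 2) (pi / 2).
  pose FQ x := 2^-1 * \tr (hmx (Cm (W x)) Q).
  pose h x := FQ x - n%:R * (1 - e) * Gam x.
  have dh t : a <= t <= 1 -> is_derive t 1 h (2^-1 * \tr (sform (D t *m invmx (W t)) *m Nm (W t) r)
       - n%:R * (1 - e) * G (D t *m invmx (W t))).
    move=> tI; have h1 := FQ_derive hW (sW _ (aI' _ tI)) (pW _ (aI' _ tI)) dQ.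
    have h2 := is_deriveMr (is_derive_cst (n%:R * (1 - e) : R) t 1) (dG t (aI' _ tI)).
    by apply: is_derive_eq (is_deriveB h1 h2) _; rewrite mul0r add0r.
  have [x xI eh] := incr_of_derive a1 dh.
  have xI' : a <= x <= 1 by case/andP: xI => /ltW -> /ltW ->.
  have [tx Ex] := ESt x (aI _ xI').
  have key := key_ineq n0 (sW _ (aI' _ xI')) (qW _ (aI _ xI')) Ex (pW _ (aI' _ xI')) e01
     (fun j => hr _ (cosr x tx j xI' Ex)).
  have hge : 0 <= h 1 - h a.
    by rewrite eh mulr_ge0 //; [rewrite subr_ge0 -mulrA; exact: key | lra].
  have FE t tt : a <= t <= 1 -> ES (W t) tt -> `|FQ t - \sum_j tt j| <= n%:R * (e * pi).
    move=> tI Et; rewrite /FQ; have [-> _] := spec_Cm Q (sW _ (aI' _ tI)) Et.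
    have -> : 2^-1 * (2 * \sum_j Q.[cos (tt j)]) = \sum_j Q.[cos (tt j)] by field.
    rewrite -sumrB; apply: le_trans (ler_norm_sum _ _ _) _.
    rewrite -[X in _ <= X%:R * _](card_ord n) mulr_natl -sumr_const; apply: ler_sum => j _.
    by apply: (primitive_close hr dQ Q0); [exact: Et.1 | exact: cosr tI Et].
  have I1 : a <= 1 <= (1 : R) by rewrite (ltW a1) lexx.
  have Ia : a <= a <= 1 by rewrite lexx (ltW a1).
  have [ta Ea] := ESt a (aI _ Ia).
  have := FE 1 th I1 E1; have := FE a ta Ia Ea; rewrite !ler_norml => /andP[f1 _] /andP[_ f2].
  (* The sum of the angles at time [a] is dropped from the estimate; it has the favourable sign. *)
  have sa : 0 <= \sum_j ta j by apply: sumr_ge0 => j _; have /andP[] := Ea.1 j.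
  move: hge; rewrite /h.
  have -> : (1 - e) * (n%:R * (Gam 1 - Gam a)) = n%:R * (1 - e) * Gam 1 - n%:R * (1 - e) * Gam a by ring.
  have -> : e * (2 * (n%:R * pi)) = n%:R * (e * pi) + n%:R * (e * pi) by ring.
  move: f1 f2; set u := n%:R * (e * pi); set v := n%:R * (1 - e) * Gam 1; set w := n%:R * (1 - e) * Gam a.
  lra.
(* [Gam] is continuous at [0], so a violation over the whole interval would persist for some small
   positive starting time. *)
rewrite leNgt; apply/negP => lt.
have I0 : 0 <= (0 : R) <= 1 by rewrite lexx ler01.
have cG0 : {for 0, continuous Gam} := is_derive_continuous (dG 0 I0).
have cc : n%:R * (Gam 1 - Gam x) @[x --> (0 : R)] --> n%:R * (Gam 1 - Gam 0).
  by apply: cvgM; [exact: cvg_cst | apply: cvgB; [exact: cvg_cst | exact: cG0]].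
have hh : \forall x \near (0 : R), \sum_j th j < n%:R * (Gam 1 - Gam x) by exact: (cvgr_gt _ cc _ lt).
have /nbhs_ballP[r /= r0 hr] := hh.
pose x := Num.min (r / 2) (1 / 2).
have x0 : 0 < x by rewrite lt_min !divr_gt0.
have x1 : x <= r / 2 by rewrite ge_min lexx.
have x2 : x <= 1 / 2 by rewrite ge_min lexx orbT.
have : \sum_j th j < n%:R * (Gam 1 - Gam x).
  by apply: hr; rewrite /ball /= sub0r normrN gtr0_norm //; lra.
rewrite ltNge main //; apply/andP; split; lra.
Qed.

End LengthIntegral.

(** * Generalized eigenspaces as kernels of products *)

Section KillKernel.
Variables (C : fieldType) (m : nat) (A : 'M[C]_m).
Local Notation V := 'cV[C]_m.

Definition pm (s : seq C) : 'M[C]_m := foldr (fun l B => B *m (A - l%:M)) 1%:M s.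

Lemma kill_pm s (y : V) : kill A s y = pm s *m y.
Proof.
elim: s y => [|l s IH] y /=; first by rewrite mul1mx.
by rewrite IH -mulmxA mulmxBl mul_scalar_mx.
Qed.

Lemma kill0 s : kill A s 0 = 0. Proof. by rewrite kill_pm mulmx0. Qed.
Lemma killZ s a (x : V) : kill A s (a *: x) = a *: kill A s x.
Proof. by rewrite !kill_pm scalemxAr. Qed.
Lemma killB s (x y : V) : kill A s (x - y) = kill A s x - kill A s y.
Proof. by rewrite !kill_pm mulmxBr. Qed.
Lemma kill_cat s t (y : V) : kill A (s ++ t) y = kill A t (kill A s y).
Proof. by elim: s y => //= l s IH y; rewrite IH. Qed.
Lemma kill_mulA s (y : V) : kill A s (A *m y) = A *m kill A s y.
Proof.
elim: s y => //= l s IH y; rewrite -IH; congr (kill A s _).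
by rewrite mulmxBr -scalemxAr.
Qed.
Lemma kill_comm s t (y : V) : kill A s (kill A t y) = kill A t (kill A s y).
Proof.
elim: t y => //= l t IH y; rewrite IH; congr (kill A t _).
by rewrite killB killZ kill_mulA.
Qed.

Lemma kill_eigen s l (y : V) : A *m y = l *: y -> kill A s y = (\prod_(k <- s) (l - k)) *: y.
Proof.
move=> e; elim: s => [|k s IH] /=; first by rewrite big_nil scale1r.
by rewrite big_cons e -scalerBl killZ IH scalerA.
Qed.

Lemma kill_disjoint s t (x : V) : {in s, forall l, l \notin t} -> kill A s x = 0 -> kill A t x = 0 -> x = 0.
Proof.
elim: s x => [|l s IH] x dis //= h1 h2.
have e : A *m x - l *: x = 0.
  apply: IH => //; first by move=> k ks; apply: dis; rewrite in_cons ks orbT.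
  by rewrite killB killZ kill_mulA h2 mulmx0 scaler0 subr0.
move/eqP: e; rewrite subr_eq0 => /eqP e.
move: h2; rewrite (kill_eigen t e) => /eqP; rewrite scaler_eq0 => /orP[|/eqP //].
rewrite prodf_seq_eq0 => /hasP[k kt]; rewrite subr_eq0 => /eqP ek.
by have := dis l (mem_head _ _); rewrite ek kt.
Qed.

Definition Kx (s : seq C) : 'M[C]_m := kermx (pm s)^T.

Lemma KxP s (v : 'rV[C]_m) : (v <= Kx s)%MS <-> kill A s v^T = 0.
Proof.
rewrite sub_kermx kill_pm; split=> [/eqP/(congr1 trmx)|h].
  by rewrite trmx_mul trmxK trmx0.
by apply/eqP/(can_inj trmxK); rewrite trmx_mul trmxK trmx0.
Qed.

End KillKernel.

Lemma rank_Kx (C : numClosedFieldType) m (A : 'M[C]_m) (s t : seq C) :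
  char_poly A = \prod_(x <- s ++ t) ('X - x%:P) -> {in s, forall x, x \notin t} ->
  \rank (Kx A s) = size s.
Proof.
case: m A => [|m] A e dis.
  have := size_char_poly A; rewrite e size_prod_XsubC size_cat => -[] /eqP.
  by rewrite addn_eq0 => /andP[/eqP -> _]; apply/eqP; rewrite -leqn0 rank_leq_row.
have <- := mxrank_ker_prod e dis; rewrite /Kx !mxrank_ker mxrank_tr; congr (_ - \rank _)%N.
apply: (can_inj trmxK); apply/row_matrixP => i; apply: (can_inj trmxK).
by rewrite !tr_row !trmxK !colE -kill_pm kill_horner.
Qed.

(** The two kernels meet only in zero, and by [rank_Kx] their dimensions add up to [m]. *)
Lemma full_Kx (C : numClosedFieldType) m (A : 'M[C]_m) (s t : seq C) (y : 'cV[C]_m) :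
  char_poly A = \prod_(x <- s ++ t) ('X - x%:P) -> {in s, forall x, x \notin t} ->
  exists a b, [/\ y = a + b, kill A s a = 0 & kill A t b = 0].
Proof.
move=> e dis; have rs := rank_Kx e dis.
have dis' : {in t, forall x, x \notin s}.
  by move=> x xt; apply/negP => xs; have := dis x xs; rewrite xt.
have e' : char_poly A = \prod_(x <- t ++ s) ('X - x%:P).
  by rewrite e; apply: perm_big; rewrite perm_catC.
have rt := rank_Kx e' dis'.
have sz : (size s + size t)%N = m.
  by have := size_char_poly A; rewrite e size_prod_XsubC size_cat => -[].
have cap0 : (Kx A s :&: Kx A t)%MS = 0.
  apply/eqP/rowV0P => v; rewrite sub_capmx => /andP[/KxP h1 /KxP h2].
  by apply: (can_inj trmxK); rewrite trmx0; exact: kill_disjoint dis h1 h2.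
have full : (y^T <= Kx A s + Kx A t)%MS.
  apply: submx_full; rewrite /row_full -[X in _ == X]sz -rs -rt -mxrank_sum_cap cap0 mxrank0 addn0.
  by [].
have [[u v] /= euv] := sub_addsmxP full.
exists (u *m Kx A s)^T, (v *m Kx A t)^T; split.
- by rewrite -linearD /= -euv trmxK.
- by apply/KxP; exact: submxMl.
- by apply/KxP; exact: submxMl.
Qed.

(** * Krein orthogonality of generalized eigenspaces *)

Section Orthogonality.
Variables (R : realType) (n : nat).
Local Notation C := R[i].
Local Notation M := 'M[R]_(n + n).
Local Notation CV := 'cV[C]_(n + n).

(** With [W x = a x + x'] and [W y = b y + y'], invariance of [Hf] expresses
    [(a conjc b - 1) Hf x y] through pairings that involve [x'] or [y']. These have shorter lists
    and vanish by the double induction. *)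
Lemma kill_orth (W : M) (s t : seq C) (x y : CV) : symplectic W ->
  (forall a b, a \in s -> b \in t -> a * conjc b != 1) ->
  kill (cmx W) s x = 0 -> kill (cmx W) t y = 0 -> Hf x y = 0.
Proof.
move=> sW; have Hf0r z : Hf z 0 = 0 by rewrite HfC Hf0l conjc0 oppr0.
elim: s x t y => [|a s IHs] x t y h; first by move=> /= ->; rewrite Hf0l.
elim: t y h => [|b t IHt] y h hx; first by move=> /= ->.
move=> hy; set x' := cmx W *m x - a *: x; set y' := cmx W *m y - b *: y.
have Wx : cmx W *m x = a *: x + x' by rewrite /x' addrC subrK.
have Wy : cmx W *m y = b *: y + y' by rewrite /y' addrC subrK.
have z1 : Hf x y' = 0.
  by apply: IHt => // c d cs dt; apply: h => //; rewrite in_cons dt orbT.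
have z2 : Hf x' y = 0.
  by apply: (IHs x' (b :: t)) => // c d cs dt; apply: h => //; rewrite in_cons cs orbT.
have z3 : Hf x' y' = 0.
  by apply: (IHs x' t) => // c d cs dt; apply: h => //; rewrite in_cons ?cs ?dt orbT.
have := Hf_symp x y sW; rewrite {}Wx {}Wy; move: z1 z2 z3; clearbody x' y' => z1 z2 z3; rewrite HfDl !HfDr !HfZl !HfZr z1 z2 z3 !mulr0 !addr0 mulrA.
move/eqP; rewrite -subr_eq0 -{2}[Hf x y]mul1r -mulrBl mulf_eq0 subr_eq0.
by rewrite (negPf (h a b _ _)) ?mem_head //= => /eqP.
Qed.

Lemma gen_eigen_kill (W : M) l (v : 'rV[C]_(n + n)) :
  (v <= gen_eigenspace W l)%MS <-> kill (cmx W) (nseq (n + n) l) v^T = 0.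
Proof.
rewrite gen_eigenspaceP.
have -> k (y : CV) : kill (cmx W) (nseq k l) y = (cmx W - l%:M) ^+ k *m y.
  elim: k y => [|k IH] y /=; first by rewrite expr0 mul1mx.
  by rewrite IH exprSr -mulmxE -mulmxA mulmxBl mul_scalar_mx.
by [].
Qed.

Lemma conj_unit (l : C) : `|l| = 1 -> l * conjc l = 1.
Proof. by move=> u; rewrite -sqr_normc u expr1n. Qed.

Lemma Hf_nondeg (x : CV) : (forall y, Hf x y = 0) -> x = 0.
Proof.
move=> h; apply/eqP/negPn/negP => x0; have := c2_gt0 x0.
have -> : c2 x = - complex.Re (Hf (J0c R n *m x) x).
  by rewrite /J0c -Qc_Hf /Qc !omegaJ /c2 !qform1E.
by rewrite HfC h conjc0 oppr0 /= oppr0 ltxx.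
Qed.

(** For unimodular [l] every other eigenvalue [b] satisfies [l conjc b != 1], so the complementary
    generalized eigenspaces are orthogonal to this one, and nondegeneracy of [Hf] on the whole space
    restricts to it. *)
Lemma gen_eigenspace_spec (W : M) l (s : seq C) : symplectic W -> `|l| = 1 ->
  char_poly (cmx W) = \prod_(x <- s) ('X - x%:P) ->
  \rank (gen_eigenspace W l) = count_mem l s /\
  (forall x : CV, kill (cmx W) (nseq (n + n) l) x = 0 ->
     (forall y, kill (cmx W) (nseq (n + n) l) y = 0 -> Hf x y = 0) -> x = 0) /\
  (forall x : CV, kill (cmx W) (nseq (n + n) l) x = 0 <-> kill (cmx W) (nseq (count_mem l s) l) x = 0).
Proof.
move=> sW ul es; pose r := count_mem l s; pose t := [seq x <- s | x != l].
have pe : perm_eq s (nseq r l ++ t).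
  have -> : nseq r l = [seq x <- s | pred1 l x].
    by rewrite /r -size_filter; apply/esym/all_pred1P; exact: filter_all.
  have -> : t = [seq x <- s | predC (pred1 l) x] by apply: eq_filter.
  by rewrite perm_sym perm_filterC.
have es' : char_poly (cmx W) = \prod_(x <- nseq r l ++ t) ('X - x%:P) by rewrite es; exact: perm_big.
have dis k : {in nseq k l, forall x, x \notin t}.
  by move=> x; rewrite mem_nseq => /andP[_ /eqP ->]; rewrite mem_filter eqxx.
have rk := rank_Kx es' (dis r); rewrite size_nseq in rk.
have sub k (y : CV) : (r <= k)%N -> kill (cmx W) (nseq r l) y = 0 -> kill (cmx W) (nseq k l) y = 0.
  by move=> rk' h; rewrite -(subnKC rk') nseqD kill_cat h kill0.
have rN : (r <= n + n)%N.
  by have := size_char_poly (cmx W); rewrite es' size_prod_XsubC size_cat size_nseq => -[] <-; rewrite leq_addr.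
have eq x : kill (cmx W) (nseq (n + n) l) x = 0 <-> kill (cmx W) (nseq r l) x = 0.
  split; last exact: sub.
  move=> hx; have [a [b [e ha hb]]] := full_Kx x es' (dis r).
  have b0 : b = 0.
    apply: (kill_disjoint (dis (n + n)%N)) hb.
    have -> : b = x - a by rewrite e addrC addKr.
    by rewrite killB hx (sub _ _ rN ha) subr0.
  by rewrite e b0 addr0.
split; [|split=> //].
  rewrite -[RHS]/r -[RHS]rk; apply/eqP; rewrite eqn_leq; apply/andP; split; apply: mxrankS; apply/rV_subP => v.
    by move=> /gen_eigen_kill/eq/KxP.
  by move=> /KxP/eq/gen_eigen_kill.
move=> x hx h; apply: Hf_nondeg => y.
have [a [b [-> ha hb]]] := full_Kx y es' (dis r).
rewrite HfDr h ?add0r; last exact/eq.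
apply: (kill_orth sW _ hx hb) => c d; rewrite mem_nseq mem_filter => /andP[_ /eqP ->] /andP[dl _].
apply: contra dl => /eqP e; have := conj_unit ul; rewrite -e => /mulfI.
have l0 : l != 0 by apply/eqP => l0; move: ul; rewrite l0 normr0 => /eqP; rewrite eq_sym oner_eq0.
by move=> /(_ l0)/(can_inj (@conjcK R)) ->.
Qed.

End Orthogonality.

(** * Krein signature *)

Section KreinIndex.
Variables (R : realType) (n : nat).
Local Notation C := R[i].
Local Notation M := 'M[R]_(n + n).
Local Notation CV := 'cV[C]_(n + n).
Local Notation Re := (@complex.Re R).
Local Notation Im := (@complex.Im R).
Local Notation Jc := (J0c R n).

Lemma krein_kq (E : 'M[C]_(n + n)) : krein_posdef_on E <->
  forall v : 'rV[C]_(n + n), (v <= E)%MS -> v != 0 -> 0 < kq v^T.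
Proof.
by split=> h v vE v0; have := h v vE v0; rewrite kappa_real ltcR.
Qed.

Lemma krein_p_max (W : M) l (U : 'M[C]_(n + n)) : (U <= gen_eigenspace W l)%MS ->
  krein_posdef_on U -> (\rank U <= krein_p W l)%N.
Proof.
move=> h1 h2; have rU : (\rank U < (n + n).+1)%N by rewrite ltnS rank_leq_row.
apply: (@leq_bigmax_cond _ _ (fun k : 'I_(n + n).+1 => nat_of_ord k) (Ordinal rU)).
by apply/asboolP; exists U.
Qed.

Lemma krein_p_ex (W : M) l : exists2 U : 'M[C]_(n + n), (U <= gen_eigenspace W l)%MS &
  \rank U = krein_p W l /\ krein_posdef_on U.
Proof.
pose P : pred 'I_(n + n).+1 := fun k => `[< exists Vs : 'M[C]_(n + n),
              (Vs <= gen_eigenspace W l)%MS /\ \rank Vs = k /\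
              krein_posdef_on Vs >].
have P0 : (0 < #|P|)%N.
  apply/card_gt0P; exists ord0; apply/asboolP; exists 0; rewrite sub0mx mxrank0; split=> //; split=> //.
  by move=> v; rewrite submx0 => /eqP ->; rewrite eqxx.
have [k /asboolP[U [h1 [h2 h3]]] e] := @eq_bigmax_cond _ P (fun k => nat_of_ord k) P0.
exists U => //; split=> //; rewrite h2 -e; exact: eq_bigl.
Qed.

Lemma kqZ (a : C) (x : CV) : kq (a *: x) = (Re a ^+ 2 + Im a ^+ 2) * kq x.
Proof.
rewrite /kq HfZl HfZr mulrA -sqr_normc -add_Re2_Im2 cImM /= mul0r addr0; by [].
Qed.

Lemma kq0 : kq (0 : CV) = 0. Proof. by rewrite /kq Hf0l. Qed.

(** A null vector of a semidefinite form is orthogonal to everything: otherwise adding to [v] a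
    small multiple of [w] with a suitable phase would give a positive value. *)
Lemma kq_orth_zero (Q : 'M[C]_(n + n)) (v w : 'rV[C]_(n + n)) :
  (forall u : 'rV[C]_(n + n), (u <= Q)%MS -> kq u^T <= 0) -> (v <= Q)%MS -> (w <= Q)%MS ->
  kq v^T = 0 -> Hf v^T w^T = 0.
Proof.
move=> hQ vQ wQ kv; set h := Hf _ _; apply/eqP/negPn/negP => h0.
pose a := Re h ^+ 2 + Im h ^+ 2; have a0 : 0 < a.
  rewrite lt_neqAle addr_ge0 ?sqr_ge0 // andbT eq_sym; apply: contra h0 => /eqP e.
  by apply/eqP/C_ext => /=; apply/eqP; rewrite -sqrf_eq0; apply/eqP/le_anti; rewrite sqr_ge0 -e ?lerDl ?lerDr sqr_ge0.
have key (t : R) : 2 * t * a + t ^+ 2 * a * kq w^T <= 0.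
  (* The phase of [c] makes the cross term equal to [2 t |h|^2]. *)
  pose c : C := Complex (t * Im h) (- (t * Re h)).
  have := hQ (v + c *: w); rewrite addmx_sub ?scalemx_sub // => /(_ isT).
  rewrite linearD /= linearZ /= kqD kv add0r kqZ HfZr -/h /c /a.
  by case: h {h0 a a0 c} => p q /= hh; apply: le_trans hh; rewrite le_eqVlt; apply/orP; left; apply/eqP; ring.
set k := kq w^T in key; have := key 1; have := key (1 / (1 - k)) => h1 h2.
have k1 : k < 0 by nra.
have d0 : 0 < 1 - k by lra.
have := h1; have -> : 2 * (1 / (1 - k)) * a + (1 / (1 - k)) ^+ 2 * a * k = a * (2 - k) / (1 - k) ^+ 2.
  by field; rewrite gt_eqF.
rewrite leNgt => /negP; apply; rewrite divr_gt0 ?exprn_gt0 ?mulr_gt0 //; lra.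
Qed.

(** [Q] is the orthogonal complement, inside the generalized eigenspace, of a positive subspace of
    maximal dimension. Maximality makes it negative semidefinite, and nondegeneracy makes it
    definite. *)
Lemma krein_decomp (W : M) l (s : seq C) : symplectic W -> `|l| = 1 ->
  char_poly (cmx W) = \prod_(x <- s) ('X - x%:P) ->
  exists Q : 'M[C]_(n + n), [/\ (Q <= gen_eigenspace W l)%MS,
    (count_mem l s <= krein_p W l + \rank Q)%N &
    forall v : 'rV[C]_(n + n), (v <= Q)%MS -> v != 0 -> kq v^T < 0].
Proof.
move=> sW ul es; have [rE [nd _]] := gen_eigenspace_spec sW ul es.
set E := gen_eigenspace W l in rE *; set k := krein_p W l.
have [U UE [rU /krein_kq pU]] := krein_p_ex W l; rewrite -/k in rU.
pose cj := map_mx (@conjc R).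
pose Z : 'M[C]_(n + n) := Jc^T *m (map_mx (@conjc R) U)^T; pose Q := (E :&: kermx Z)%MS.
have oU v u : (v <= kermx Z)%MS -> (u <= U)%MS -> Hf v^T u^T = 0.
  move=> /sub_kermxP hv /submxP[a ->]; rewrite /Hf /star.
  have -> : (map_mx (@conjc R) (a *m U)^T)^T = map_mx (@conjc R) a *m map_mx (@conjc R) U.
    by rewrite -map_trmx trmxK map_mxM.
  rewrite -!mulmxA.
  have -> : map_mx (@conjc R) U *m (Jc *m v^T) = (v *m Z)^T by rewrite /Z !trmx_mul !trmxK mulmxA.
  by rewrite hv trmx0 mulmx0 mxE.
have rQ : (count_mem l s <= k + \rank Q)%N.
  have rZ : (\rank Z <= k)%N.
    by rewrite -rU /Z; apply: leq_trans (mxrankM_maxr _ _) _; rewrite mxrank_tr mxrank_map.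
  have e : addn (\rank (E + kermx Z)%MS) (\rank Q) = addn (\rank E) (\rank (kermx Z)) := mxrank_sum_cap E (kermx Z).
  have e2 := mxrank_ker Z.
  have := rank_leq_col (E + kermx Z)%MS; have := rank_leq_row Z; lia.
have le0 v : (v <= Q)%MS -> kq v^T <= 0.
  rewrite sub_capmx => /andP[vE vZ]; rewrite leNgt; apply/negP => kv.
  have vu u : (u <= U)%MS -> Hf u^T v^T = 0 by move=> uU; rewrite HfC oU // conjc0 oppr0.
  have nvU : ~~ (v <= U)%MS.
    by apply/negP => vU; move: kv; rewrite /kq oU // ltxx.
  have rk : (\rank (U + v)%MS <= k)%N.
    have s1 : (U + v <= gen_eigenspace W l)%MS.
      by rewrite addsmx_sub; apply/andP; split; [exact: UE | exact: vE].
    apply: krein_p_max s1 _; apply/krein_kq => w /sub_addsmxP[[a b] /= ->] w0.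
    rewrite linearD /= [b]mx11_scalar mul_scalar_mx linearZ /= kqD kqZ HfZr vu ?submxMl //.
    rewrite mulr0 /= mulr0 addr0; set b0 := b 0 0.
    have [e|nz] := eqVneq (a *m U) 0.
      rewrite e trmx0 kq0 add0r mulr_gt0 // lt_neqAle addr_ge0 ?sqr_ge0 // andbT eq_sym.
      apply/negP => /eqP e2; move/eqP: w0; apply; rewrite e add0r [b]mx11_scalar mul_scalar_mx -/b0.
      have -> : b0 = 0.
        by apply: C_ext => /=; apply/eqP; rewrite -sqrf_eq0; apply/eqP/le_anti; rewrite sqr_ge0 -e2 ?lerDl ?lerDr sqr_ge0.
      by rewrite scale0r.
    have := pU _ (submxMl a U) nz; have : 0 <= (Re b0 ^+ 2 + Im b0 ^+ 2) * kq v^T.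
      by rewrite mulr_ge0 ?addr_ge0 ?sqr_ge0 // ltW.
    lra.
  have : (U < U + v)%MS by rewrite ltmxE addsmxSl addsmx_sub submx_refl /= nvU.
  by rewrite ltmxErank => /andP[_]; rewrite rU ltnNge rk.
have cap0 : (U :&: Q)%MS = 0.
  apply/eqP/rowV0P => v; rewrite sub_capmx => /andP[vU]; rewrite sub_capmx => /andP[_ vZ].
  by apply/eqP/negPn/negP => v0; have := pU v vU v0; rewrite /kq oU // ltxx.
have full : (E <= U + Q)%MS.
  have sub : (U + Q <= E)%MS by rewrite addsmx_sub UE capmxSl.
  rewrite -(geq_leqif (mxrank_leqif_sup sub)) rE.
  by have := mxrank_sum_cap U Q; rewrite cap0 mxrank0 addn0 rU => ->.
exists Q; split=> //; first exact: capmxSl.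
move=> v vQ v0; rewrite lt_neqAle le0 // andbT; apply/negP => /eqP kv; move/eqP: v0; apply.
apply: (can_inj trmxK); rewrite trmx0; apply: nd.
  by apply/gen_eigen_kill; apply: submx_trans vQ _; exact: capmxSl.
move=> y hy; have yE : (y^T <= E)%MS by apply/gen_eigen_kill; rewrite trmxK.
have /sub_addsmxP[[a b] /= e] := submx_trans yE full.
have vZ : (v <= kermx Z)%MS by apply: submx_trans vQ _; exact: capmxSr.
have h1 : Hf v^T (a *m U)^T = 0 by exact: oU vZ (submxMl a U).
have h2 : Hf v^T (b *m Q)^T = 0 by exact: (kq_orth_zero le0 vQ (submxMl b Q) kv).
have -> : y = (a *m U)^T + (b *m Q)^T by rewrite -[LHS]trmxK e [LHS]raddfD.
by rewrite HfDr h1 h2 addr0.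
Qed.

End KreinIndex.

(** * Orbits under contracting eigenvalues *)

Section Decay.
Variable R : realType.
Local Notation C := R[i].
Local Notation Re := (@complex.Re R).
Local Notation Im := (@complex.Im R).

Lemma contract_seq (rho : R) (b e : nat -> R) : 0 <= rho < 1 -> (forall k, 0 <= b k) ->
  (forall k, b k.+1 <= rho * b k + e k) -> e k @[k --> \oo] --> 0 -> b k @[k --> \oo] --> 0.
Proof.
move=> /andP[r0 r1] b0 hb ce; apply/cvgrPdist_le => eps eps0.
pose d := eps / 2 * (1 - rho); have d0 : 0 < d by rewrite mulr_gt0 ?divr_gt0 // subr_gt0.
have /cvgrPdist_le/(_ _ d0)[K _ hK] := ce.
have he k : (K <= k)%N -> e k <= d.
  by move=> Kk; have := hK k Kk; rewrite sub0r normrN; apply: le_trans; exact: ler_norm.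
have bd j : b (K + j)%N <= rho ^+ j * b K + eps / 2.
  elim: j => [|j IH]; first by rewrite addn0 expr0 mul1r lerDl; lra.
  rewrite addnS; apply: le_trans (hb _) _.
  have h1 := he (K + j)%N (leq_addr _ _).
  have h2 : rho * b (K + j)%N <= rho * (rho ^+ j * b K + eps / 2) by rewrite ler_wpM2l.
  by rewrite exprS; rewrite /d in h1; lra.
have cr : rho ^+ j * b K @[j --> \oo] --> 0.
  rewrite -(mul0r (b K)); apply: cvgM; last exact: cvg_cst.
  by apply: cvg_expr; rewrite ger0_norm.
have e2 : 0 < eps / 2 by lra.
have /cvgrPdist_le/(_ _ e2)[L _ hL] := cr.
exists (K + L)%N => //= k kl; rewrite sub0r normrN ger0_norm //.
have := bd (k - K)%N; rewrite subnKC; last by apply: leq_trans kl; exact: leq_addr.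
move=> h; apply: le_trans h _; have := hL (k - K)%N; rewrite /= leq_subRL; last first.
  by apply: leq_trans kl; exact: leq_addr.
move=> /(_ kl); rewrite sub0r normrN => h; have := le_trans (ler_norm _) h; lra.
Qed.

(** The modulus as an element of [R], whereas [|z|] has type [R[i]]; limits and orderings are taken
    in the reals. *)
Definition cn (z : C) : R := Num.sqrt (Re z ^+ 2 + Im z ^+ 2).

Lemma cnE z : `|z| = (cn z)%:C%C. Proof. exact: normc_def. Qed.
Lemma cn_ge0 z : 0 <= cn z. Proof. exact: sqrtr_ge0. Qed.
Lemma cnM a b : cn (a * b) = cn a * cn b.
Proof. by apply: (fmorph_inj (real_complex R)); rewrite rmorphM /= -!cnE normrM. Qed.
Lemma cnD a b : cn (a + b) <= cn a + cn b.
Proof. by rewrite -lecR rmorphD /= -!cnE ler_normD. Qed.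
Lemma cn_ltr z : (`|z| < 1) = (cn z < 1).
Proof. by rewrite cnE -(ltcR (cn z) 1). Qed.
Lemma cn2 z : cn z ^+ 2 = Re z ^+ 2 + Im z ^+ 2.
Proof. by rewrite sqr_sqrtr // addr_ge0 ?sqr_ge0. Qed.

Lemma cn_Re z : `|Re z| <= cn z /\ `|Im z| <= cn z.
Proof.
have h := cn2 z; have h0 := cn_ge0 z.
by split; rewrite -ler_sqr ?nnegrE // real_normK ?num_real // h ?lerDl ?lerDr sqr_ge0.
Qed.

Lemma cn_cvg (T : Type) (F : set_system T) (FF : Filter F) (f : T -> C) a :
  ccvg F f a -> cn (f x) @[x --> F] --> cn a.
Proof.
move=> [h1 h2]; apply: (@cvg_comp _ _ _ (fun x => Re (f x) ^+ 2 + Im (f x) ^+ 2) Num.sqrt).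
  2: exact: sqrt_continuous.
by apply: cvgD; apply: cvg_sq.
Qed.

Lemma cn0 : cn 0 = 0. Proof. by rewrite /cn /= expr0n addr0 sqrtr0. Qed.

Lemma ccvg0 (T : Type) (F : set_system T) (FF : Filter F) (f : T -> C) :
  cn (f x) @[x --> F] --> 0 <-> ccvg F f 0.
Proof.
split=> [h|h]; last by rewrite -cn0; exact: cn_cvg.
by split; apply/cvgr0Pnorm_le => e e0; move/cvgr0Pnorm_le: h => /(_ e e0); apply: filterS => x;
  rewrite (ger0_norm (cn_ge0 _)); apply: le_trans; have [] := cn_Re (f x).
Qed.

(** With [y' = B y - l y], the orbit satisfies [B^(k+1) y = l B^k y + B^k y']: a contraction driven
    by a term that tends to zero by induction on the list. *)
Lemma kill_decay m (B : 'M[C]_m) (s : seq C) (y : 'cV[C]_m) : {in s, forall l, `|l| < 1} ->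
  kill B s y = 0 -> mcvg \oo (fun k => iter k (mulmx B) y) 0.
Proof.
elim: s y => [|l s IH] y hs /= h.
  have e k : iter k (mulmx B) y = 0 by rewrite h; elim: k => //= k ->; rewrite mulmx0.
  by move=> i j; under eq_fun do rewrite e; exact: ccvg_cst.
have {IH} := IH _ _ h; set y' := B *m y - l *: y => /(_ _) IH i j.
have {}IH := IH (fun k ks => hs k (mem_behead (s := l :: s) ks)) i j.
rewrite mxE; rewrite mxE in IH; apply/ccvg0; move/ccvg0: IH => IH.
have rec k : iter k.+1 (mulmx B) y = l *: iter k (mulmx B) y + iter k (mulmx B) y'.
  elim: k => [|k IHk]; first by rewrite /= /y' addrC subrK.
  by rewrite iterS {1}IHk mulmxDr -scalemxAr.
apply: (@contract_seq (cn l) (fun k => cn (iter k (mulmx B) y i j)) (fun k => cn (iter k (mulmx B) y' i j))) => //.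
- by rewrite cn_ge0 -cn_ltr hs // mem_head.
- by move=> k; exact: cn_ge0.
- move=> k; have -> : iter k.+1 (mulmx B) y i j = l * iter k (mulmx B) y i j + iter k (mulmx B) y' i j.
    by rewrite rec !mxE.
  by apply: le_trans (cnD _ _) _; rewrite cnM.
Qed.

(** [f] strictly decreases at the first step and never increases afterwards along the orbit of [y],
    which tends to [0], where [f] vanishes. *)
Lemma kill_pos m (B : 'M[C]_m) (f : 'cV[C]_m -> R) (s : seq C) (y : 'cV[C]_m) :
  {in s, forall l, `|l| < 1} -> (forall x, x != 0 -> f (B *m x) < f x) ->
  (forall u : nat -> 'cV[C]_m, mcvg \oo u 0 -> f (u k) @[k --> \oo] --> 0) ->
  kill B s y = 0 -> y != 0 -> 0 < f y.
Proof.
move=> hs hf cf h y0; pose u k := iter k (mulmx B) y.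
have cu := cf _ (kill_decay hs h).
have f0 : f 0 = 0.
  have c0 : f 0 @[k --> \oo] --> 0 by apply: (cf (fun=> 0)) => i j; exact: ccvg_cst.
  have c1 : f 0 @[k --> \oo] --> f 0 by exact: cvg_cst.
  exact: cvg_unique c1 c0.
have step x : f (B *m x) <= f x.
  by have [->|x0] := eqVneq x 0; [rewrite mulmx0 | exact: ltW (hf x x0)].
have mono k : f (iter k.+1 (mulmx B) y) <= f (B *m y).
  by elim: k => [|k IH] //; apply: le_trans (step _) IH.
apply: le_lt_trans (hf y y0).
apply: (@closed_cvg _ _ \oo _ (fun k => f (iter k (mulmx B) y)) (fun z : R => z <= f (B *m y)) (@closed_le R _) _ _ cu).
by exists 1%N => // k /=; case: k => // k _; exact: mono.
Qed.

End Decay.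

(** * Limits of eigenvalues and of definite subspaces *)

Section RootLimits.
Variables (R : realType) (m : nat).
Local Notation C := R[i].
Local Notation Re := (@complex.Re R).
Local Notation Im := (@complex.Im R).
Variables (T : Type) (F : set_system T) (UF : UltraFilter F).
Let PF : ProperFilter F := @ultra_proper _ _ UF.

Lemma poly_eq_allC (p q : {poly C}) : (forall a, p.[a] = q.[a]) -> p = q.
Proof.
move=> h; apply/eqP; rewrite -subr_eq0; apply/negPn/negP => n0.
pose s := [seq (k%:R : C) | k <- iota 0 (size (p - q))].
have us : uniq s by rewrite map_inj_uniq ?iota_uniq // => i j /eqP; rewrite eqr_nat => /eqP.
have rs : all (root (p - q)) s by apply/allP => x _; rewrite rootE !hornerE h subrr.
by have := max_poly_roots n0 rs us; rewrite size_map size_iota ltnn.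
Qed.

Lemma cn_sum (I : Type) (r : seq I) (P : pred I) (f : I -> C) :
  cn (\sum_(i <- r | P i) f i) <= \sum_(i <- r | P i) cn (f i).
Proof.
elim: r => [|i r IH]; first by rewrite !big_nil /cn /= expr0n addr0 sqrtr0.
by rewrite !big_cons; case: ifP => // _; apply: le_trans (cnD _ _) _; rewrite lerD2l.
Qed.

Lemma cn_eq0 (z : C) : (cn z == 0) = (z == 0).
Proof.
apply/eqP/eqP => [h|->]; last by rewrite /cn /= expr0n addr0 sqrtr0.
by apply/eqP; rewrite -normr_eq0 cnE h.
Qed.

Lemma eig_bound (A : 'M[C]_m) l : root (char_poly A) l -> cn l <= \sum_i \sum_j cn (A i j).
Proof.
rewrite -eigenvalue_root_char => /eigenvalueP[v hv v0].
set K := \sum_i _; pose S := \sum_j cn (v 0 j).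
have S0 : 0 < S.
  have [j vj] : exists j, v 0 j != 0.
    apply: contrapT => h; move/eqP: v0; apply; apply/rowP => j; rewrite mxE.
    by apply/eqP/negPn/negP => vj; apply: h; exists j.
  rewrite /S (bigD1 j) //= ltr_pwDl ?sumr_ge0 // => [|i _]; last exact: cn_ge0.
  by rewrite lt_neqAle cn_ge0 andbT eq_sym cn_eq0.
rewrite -(ler_pM2r S0) {1}/S mulr_sumr.
apply: le_trans (_ : \sum_j \sum_i cn (v 0 i) * cn (A i j) <= _).
  apply: ler_sum => j _; rewrite -cnM.
  have -> : l * v 0 j = \sum_i v 0 i * A i j by have := congr1 (fun z : 'rV_m => z 0 j) hv; rewrite !mxE => ->.
  apply: le_trans (cn_sum _ _ _) _; apply: ler_sum => i _; by rewrite cnM.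
rewrite exchange_big /= [K * S]mulrC /S mulr_suml; apply: ler_sum => i _.
rewrite -mulr_sumr ler_wpM2l ?cn_ge0 // /K [X in _ <= X](bigD1 i) //= lerDl.
by apply: sumr_ge0 => k _; apply: sumr_ge0 => j _; exact: cn_ge0.
Qed.

(** Every labelled root is bounded by the entries of the matrix and so converges along the
    ultrafilter, however irregular the labelling is in [x]. *)
Lemma roots_cvg (A : T -> 'M[C]_m) A0 (l : T -> 'I_m -> C) : mcvg F A A0 ->
  F [set x | char_poly (A x) = \prod_i ('X - (l x i)%:P)] ->
  exists2 l0, (forall i, ccvg F (l ^~ i) (l0 i)) & char_poly A0 = \prod_i ('X - (l0 i)%:P).
Proof.
move=> cA hl.
have cS : \sum_i \sum_j cn (A x i j) @[x --> F] --> \sum_i \sum_j cn (A0 i j).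
  apply: (@cvg_sumr _ _ F _ _ _ _ (fun i x => \sum_j cn (A x i j))) => i _.
  by apply: (@cvg_sumr _ _ F _ _ _ _ (fun j x => cn (A x i j))) => j _; exact: cn_cvg.
set K := \sum_i _ in cS.
have bK : F [set x | \sum_i \sum_j cn (A x i j) <= K + 1].
  by have := cvgr_le _ cS (K + 1); apply; rewrite ltrDl.
have bl i : F [set x | cn (l x i) <= K + 1].
  apply: filterS2 hl bK => x /= e; apply: le_trans; apply: eig_bound.
  by rewrite e /root horner_prod (bigD1 i) //= !hornerE subrr mul0r.
have cl i : exists a : C, ccvg F (l ^~ i) a.
  have [|a ca _] := @ultra_cvg R T F UF (fun x => Re (l x i)) (K + 1).
    by apply: filterS (bl i) => x; apply: le_trans; have [] := cn_Re (l x i).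
  have [|b cb _] := @ultra_cvg R T F UF (fun x => Im (l x i)) (K + 1).
    by apply: filterS (bl i) => x; apply: le_trans; have [] := cn_Re (l x i).
  by exists (Complex a b).
have [l0 hl0] := choice cl; exists l0 => //; apply: poly_eq_allC => a.
have c1 : ccvg F (fun x => (char_poly (A x)).[a]) (char_poly A0).[a].
  under eq_fun do rewrite char_poly_eval; rewrite char_poly_eval; apply: mcvg_det.
  by apply: mcvgD; [exact: mcvg_cst | exact: mcvgN].
have c2 : ccvg F (fun x => \prod_i (a - l x i)) (\prod_i (a - l0 i)).
  apply: (@ccvg_prod _ _ F _ _ _ _ (fun i x => a - l x i)) => i _.
  by apply: ccvgD; [exact: ccvg_cst | apply: ccvgN; exact: hl0].
have e : F [set x | (char_poly (A x)).[a] = \prod_i (a - l x i)].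
  by apply: filterS hl => x /= ->; rewrite horner_prod; apply: eq_bigr => i _; rewrite !hornerE.
have c3 : ccvg F (fun x => (char_poly (A x)).[a]) (\prod_i (a - l0 i)).
  case: c2 => h1 h2; split.
    by apply: cvg_trans h1; apply: near_eq_cvg; apply: filterS e => x /= ->.
  by apply: cvg_trans h2; apply: near_eq_cvg; apply: filterS e => x /= ->.
rewrite (ccvg_unique PF c1 c3) horner_prod; apply: eq_bigr => i _; by rewrite !hornerE.
Qed.

Lemma pm_mcvg (A : T -> 'M[C]_m) A0 (l : T -> 'I_m -> C) l0 (e : seq 'I_m) : mcvg F A A0 ->
  (forall i, ccvg F (l ^~ i) (l0 i)) ->
  mcvg F (fun x => pm (A x) [seq l x i | i <- e]) (pm A0 [seq l0 i | i <- e]).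
Proof.
move=> cA cl; elim: e => [|i e IH] /=; first exact: mcvg_cst.
apply: mcvgM => //; apply: mcvgD => //; apply: mcvgN => a b.
under eq_fun do rewrite mxE; rewrite mxE; case: (a == b) => /=; last exact: ccvg_cst.
exact: cl.
Qed.

(** A definite subspace of the limit is carried to nearby spectral subspaces by [Q x], the product
    over roots tending elsewhere. If its dimension exceeded the number of roots in [S1] tending to
    [la], some nonzero combination would lie in the part belonging to the roots outside [S1], where
    [f <= 0]; normalized combinations converge and contradict positivity. *)
Lemma perturb (A : T -> 'M[C]_m) A0 (l : T -> 'I_m -> C) l0 (la : C) (f : 'cV[C]_m -> R)
    (S1 : {set 'I_m}) (V : 'M[C]_m) :
  mcvg F A A0 -> (forall i, ccvg F (l ^~ i) (l0 i)) ->
  F [set x | char_poly (A x) = \prod_i ('X - (l x i)%:P)] ->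
  (forall (y : T -> 'cV[C]_m) y0, mcvg F y y0 -> f (y x) @[x --> F] --> f y0) ->
  (forall (a : R) y, f (a%:C%C *: y) = a ^+ 2 * f y) ->
  F [set x | forall y, kill (A x) [seq l x i | i <- enum [set i | (l0 i == la) && (i \notin S1)]%SET] y = 0 -> f y <= 0] ->
  F [set x | forall i j, i \in S1 -> l0 i = la -> j \notin S1 -> l0 j = la -> l x i != l x j] ->
  (V <= Kx A0 (nseq m la))%MS -> (forall v, (v <= V)%MS -> v != 0 -> 0 < f v^T) ->
  (\rank V <= #|[set i | (l0 i == la) && (i \in S1)]%SET|)%N.
Proof.
move=> cA cl hch cf fZ h1 h2 VE fV.
set ino := [set i | _ && (i \notin S1)]%SET in h1; set ini := [set i | _ && (i \in S1)]%SET.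
pose out := [set i | l0 i != la]%SET.
rewrite leqNgt; apply/negP => klt; set k := \rank V in klt.
pose E := Kx A0 (nseq m la).
pose Q x := pm (A x) [seq l x i | i <- enum out]; pose Q0 := pm A0 [seq l0 i | i <- enum out].
have cQ : mcvg F Q Q0 by exact: pm_mcvg.
have dis0 : {in nseq m la, forall z, z \notin [seq l0 i | i <- enum out]}.
  move=> z; rewrite mem_nseq => /andP[_ /eqP ->]; apply/mapP => -[i1]; rewrite mem_enum inE => /eqP ni e.
  by apply: ni; rewrite e.
have EQ : (E *m Q0^T <= E)%MS.
  apply/rV_subP => v /submxP[D ->]; apply/KxP.
  rewrite mulmxA trmx_mul trmxK -kill_pm kill_comm.
  by have -> : kill A0 (nseq m la) (D *m E)^T = 0; [apply/KxP; exact: submxMl | rewrite kill0].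
have EE : (E <= E *m Q0^T)%MS.
  rewrite -(geq_leqif (mxrank_leqif_sup EQ)) -(mxrank_mul_ker E Q0^T).
  have -> : (E :&: kermx Q0^T)%MS = 0; last by rewrite mxrank0 addn0.
  apply/eqP/rowV0P => v; rewrite sub_capmx => /andP[/KxP e1 /KxP e2].
  by apply: (can_inj trmxK); rewrite trmx0; exact: kill_disjoint dis0 e1 e2.
have bE : (row_base V <= E *m Q0^T)%MS.
  by apply: submx_trans EE; apply: submx_trans VE; rewrite eq_row_base.
have [D eD] := submxP bE.
(* [Q0] is invertible on [E], so the basis of [V] can be written through it; replacing [Q0] by [Q x]
   moves the basis into the spectral subspace of the roots near [la]. *)
pose Vx x := D *m E *m (Q x)^T.
have cVx : mcvg F Vx (row_base V).
  rewrite eD mulmxA; apply: mcvgM; first exact: mcvg_cst.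
  by move=> i j; under eq_fun do rewrite mxE; rewrite mxE; exact: cQ.
have far : F [set x | forall i j, l0 i = la -> l0 j != la -> l x i != l x j].
  have : forall i, F [set x | forall j, l0 i = la -> l0 j != la -> l x i != l x j].
    move=> i; apply: filter_forall => j.
    case: (pselect (l0 i = la)) => e1; last by apply: filterE => x /e1.
    case: (pselect (l0 j = la)) => [e2|/eqP e2]; first by apply: filterE => x _; rewrite e2 eqxx.
    have [//|h] := in_ultra_setVsetC [set x | l0 i = la -> l0 j != la -> l x i != l x j] UF.
    exfalso; move/eqP: e2; apply; rewrite -e1.
    have {}h : F [set x | l x i = l x j].
      by apply: filterS h => x /= hx; apply/eqP/negPn/negP => ne; apply: hx.
    apply: (ccvg_unique PF (cl j)); case: (cl i) => c1 c2; split.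
      by apply: cvg_trans c1; apply: near_eq_cvg; apply: filterS h => x /= ->.
    by apply: cvg_trans c2; apply: near_eq_cvg; apply: filterS h => x /= ->.
  by move=> hh; apply: filter_forall.
pose good x (c : 'rV[C]_k) : Prop := [/\ \sum_j (Re (c 0 j) ^+ 2 + Im (c 0 j) ^+ 2) = 1 & f (c *m Vx x)^T <= 0].
have hgood : F [set x | exists c : 'rV[C]_k, good x c].
  apply: filterS2 (filterI h1 h2) (filterI hch far) => x [/= g1 g2] [/= g3 g4].
  (* The factors of the roots outside [S1] map the rows into a space whose dimension is the number
     of roots in [S1] near [la], smaller than [k]; a vector in the left kernel of [Y] is the
     combination sought. *)
  pose P := pm (A x) [seq l x i | i <- enum ino]; pose Y := Vx x *m P^T.
  pose s := [seq l x i | i <- enum ini]; pose t := [seq l x i | i <- enum ino] ++ [seq l x i | i <- enum out].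
  have perm : perm_eq (index_enum 'I_m) (enum ini ++ (enum ino ++ enum out)).
    apply: uniq_perm; first exact: index_enum_uniq.
      rewrite !cat_uniq !enum_uniq /= andbT; apply/andP; split; apply/hasPn => i.
        by rewrite mem_cat !mem_enum !inE => /orP[/andP[-> /negPf ->]|/negPf ->].
      by rewrite !mem_enum !inE => /negPf ->.
    move=> i; rewrite mem_index_enum !mem_cat !mem_enum !inE.
    by case: (l0 i == la); case: (i \in S1).
  have est : char_poly (A x) = \prod_(z <- s ++ t) ('X - z%:P).
    by rewrite g3 (perm_big _ perm) /= /s /t -!map_cat big_map.
  have dis : {in s, forall z, z \notin t}.
    move=> z /mapP[i1]; rewrite mem_enum inE => /andP[/eqP e1 e2] ->; rewrite mem_cat; apply/norP; split.
      apply/mapP => -[j]; rewrite mem_enum inE => /andP[/eqP e3 e4] e5.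
      by have := g2 i1 j e2 e1 e4 e3; rewrite e5 eqxx.
    apply/mapP => -[j]; rewrite mem_enum inE => e4 e5.
    by have := g4 i1 j e1 e4; rewrite e5 eqxx.
  have rs := rank_Kx est dis; rewrite size_map -cardE in rs.
  have YK : (Y <= Kx (A x) s)%MS.
    apply/rV_subP => v /submxP[c ->]; apply/KxP; rewrite /Y /Vx !mulmxA trmx_mul trmxK -kill_pm.
    rewrite trmx_mul trmxK -kill_pm -!kill_cat catA; apply: kill_char_poly; rewrite est.
    by apply: perm_big; rewrite /t perm_catC perm_cat2r perm_catC.
  have rY : (\rank Y < k)%N by apply: leq_ltn_trans klt; rewrite -rs mxrankS.
  have /rowV0Pn[c cY c0] : kermx Y != 0.
    by rewrite -mxrank_eq0 mxrank_ker subn_eq0 -ltnNge.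
  have fc : f (c *m Vx x)^T <= 0.
    apply: g1; rewrite kill_pm; apply: (can_inj trmxK); rewrite trmx_mul trmxK trmx0.
    by move/sub_kermxP: cY; rewrite /Y mulmxA.
  pose q := \sum_j (Re (c 0 j) ^+ 2 + Im (c 0 j) ^+ 2).
  have q0 : 0 < q.
    rewrite lt_neqAle sumr_ge0 ?andbT => [|j _]; last by rewrite addr_ge0 ?sqr_ge0.
    rewrite eq_sym; apply/negP => /eqP e; move/eqP: c0; apply; apply/rowP => j; rewrite mxE.
    have : Re (c 0 j) ^+ 2 + Im (c 0 j) ^+ 2 <= 0.
      by rewrite -e /q (bigD1 j) //= lerDl sumr_ge0 // => i _; rewrite addr_ge0 ?sqr_ge0.
    rewrite -cn2 => h; apply/eqP; rewrite -cn_eq0 -sqrf_eq0; apply/eqP/le_anti; by rewrite h sqr_ge0.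
  pose a := (Num.sqrt q)^-1.
  have a2 : a ^+ 2 = q^-1 by rewrite exprVn sqr_sqrtr // ltW.
  exists (a%:C%C *: c); split.
    have -> : \sum_j (Re ((a%:C%C *: c) 0 j) ^+ 2 + Im ((a%:C%C *: c) 0 j) ^+ 2) = a ^+ 2 * q.
      rewrite /q mulr_sumr; apply: eq_bigr => j _; rewrite mxE cReM cImM /=; ring.
    by rewrite a2 mulVf // gt_eqF.
  by rewrite -scalemxAl linearZ /= fZ mulr_ge0_le0 // sqr_ge0.
have [c hc] : exists c : T -> 'rV[C]_k, forall x, (exists c, good x c) -> good x (c x).
  have : forall x, exists c : 'rV[C]_k, (exists c, good x c) -> good x c.
    move=> x; have [[c gc]|ng] := EM (exists c, good x c); first by exists c.
    by exists 0 => /ng.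
  by move/choice => [c hc]; exists c.
have gc : F [set x | good x (c x)] by apply: filterS hgood => x; exact: hc.
have bj x j : good x (c x) -> Re (c x 0 j) ^+ 2 + Im (c x 0 j) ^+ 2 <= 1.
  move=> [<- _]; rewrite (bigD1 j) //= lerDl sumr_ge0 // => i _; by rewrite addr_ge0 ?sqr_ge0.
have cc j : exists a : C, ccvg F (fun x => c x 0 j) a.
  have [|a ca _] := @ultra_cvg R T F UF (fun x => Re (c x 0 j)) 1.
    apply: filterS gc => x /(bj x j) h /=; rewrite ler_norml; have := sqr_ge0 (Im (c x 0 j)).
    by move=> h'; apply/andP; split; nra.
  have [|b cb _] := @ultra_cvg R T F UF (fun x => Im (c x 0 j)) 1.
    apply: filterS gc => x /(bj x j) h /=; rewrite ler_norml; have := sqr_ge0 (Re (c x 0 j)).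
    by move=> h'; apply/andP; split; nra.
  by exists (Complex a b).
have [c0 hc0] := choice cc; pose cr : 'rV[C]_k := \row_j c0 j.
have ccr : mcvg F c cr by move=> i j; rewrite ord1 mxE; exact: hc0.
have n1 : \sum_j (Re (cr 0 j) ^+ 2 + Im (cr 0 j) ^+ 2) = 1.
  have h : \sum_j (Re (c x 0 j) ^+ 2 + Im (c x 0 j) ^+ 2) @[x --> F] -->
      \sum_j (Re (cr 0 j) ^+ 2 + Im (cr 0 j) ^+ 2).
    apply: (@cvg_sumr _ _ F _ _ _ _ (fun j x => Re (c x 0 j) ^+ 2 + Im (c x 0 j) ^+ 2)) => j _.
    by have [r1 r2] := ccr 0 j; apply: cvgD; apply: cvg_sq.
  have h' : \sum_j (Re (c x 0 j) ^+ 2 + Im (c x 0 j) ^+ 2) @[x --> F] --> (1 : R).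
    by apply: cvg_trans (@cvg_cst _ (1 : R) _ F _); apply: near_eq_cvg; apply: filterS gc => x [->].
  exact: cvg_unique h h'.
have le0 : f (cr *m row_base V)^T <= 0.
  have h : f (c x *m Vx x)^T @[x --> F] --> f (cr *m row_base V)^T.
    apply: cf; have hm := mcvgM PF ccr cVx.
    by move=> i j; under eq_fun do rewrite mxE; rewrite mxE; exact: hm.
  apply: (@closed_cvg _ _ F PF (fun x => f (c x *m Vx x)^T) (fun z : R => z <= 0) (@closed_le R 0) _ _ h).
  by apply: filterS gc => x [].
have : 0 < f (cr *m row_base V)^T.
  apply: fV; first by apply: submx_trans (submxMl _ _) _; rewrite eq_row_base.
  apply/eqP => e; have cr0 : cr = 0.
    by apply/eqP; rewrite -(mulmx_free_eq0 _ (row_base_free V)) e.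
  by move/eqP: n1; rewrite cr0 big1 ?(eq_sym 0) ?oner_eq0 // => j _; rewrite mxE /= expr0n addr0.
by rewrite ltNge le0.
Qed.

End RootLimits.

(** * Products and counts over symmetric spectra *)

Section RootCombinatorics.
Variable R : realType.
Local Notation C := R[i].
Local Notation Re := (@complex.Re R).
Local Notation Im := (@complex.Im R).

Lemma mup_prod_XsubC (s : seq C) l : mup l (\prod_(x <- s) ('X - x%:P)) = count_mem l s.
Proof.
elim: s => [|x s IH] /=; first by rewrite big_nil mupNroot // root1.
rewrite big_cons mupM ?polyXsubC_eq0 ?monic_neq0 ?monic_prod_XsubC // IH; congr (_ + _)%N.
by have := mup_XsubCX 1 l x; rewrite expr1 => ->; case: eqP.
Qed.

Lemma sum_undup_count (r : seq C) (P : pred C) :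
  (\sum_(x <- undup r | P x) count_mem x r = count P r)%N.
Proof.
rewrite -sum1_count -[RHS]big_undup_iterop_count.
apply: eq_bigr => x _; rewrite Monoid.iteropE /=.
by elim: (count_mem x r) => //= k <-.
Qed.

Lemma prod_by_value (I : finType) (l0 : I -> C) (S : {set I}) (P : pred C) :
  \prod_(x <- undup [seq l0 i | i <- index_enum I] | P x) x ^+ #|[set i | (l0 i == x) && (i \in S)]%SET| =
  \prod_(i | P (l0 i) && (i \in S)) l0 i.
Proof.
under eq_bigr => x _.
  rewrite -prodr_const (eq_bigl (fun i => (l0 i == x) && (i \in S))); last by move=> i; rewrite !inE.
  rewrite (eq_bigr l0); last by move=> i /andP[/eqP ->].
  over.
rewrite (exchange_big_dep (fun i => P (l0 i) && (i \in S))) /=; last first.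
  by move=> x i Px /andP[/eqP -> ->]; rewrite Px.
apply: eq_bigr => i /andP[Pi iS]; rewrite big_mkcond (bigD1_seq (l0 i)) ?undup_uniq //=; last first.
  by rewrite mem_undup; apply/mapP; exists i; rewrite ?mem_index_enum.
rewrite Pi eqxx iS /= big1 ?mulr1 // => x xi; rewrite eq_sym (negPf xi) /= andbF; by [].
Qed.

Lemma neg_real (x : C) : (x < 0) = (Im x == 0) && (Re x < 0).
Proof. by rewrite ltcE /= eq_sym. Qed.

Lemma prod_signs (r : seq C) (Q : pred C) :
  \prod_(x <- r | Q x) (if x < 0 then -1 else 1 : C) = (-1) ^+ count (fun x => Q x && (x < 0)) r.
Proof.
elim: r => [|x r IH]; first by rewrite big_nil.
rewrite big_cons /=; case: (Q x); rewrite ?add0n //=; case: ifP => _; rewrite IH ?exprS ?mul1r //.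
Qed.

(** Nonreal roots come in conjugate pairs whose phases cancel; positive roots have phase [1] and
    negative ones [-1]. *)
Lemma inner_prod (r : seq C) : perm_eq r [seq conjc x | x <- r] -> {in r, forall x, x != 0} ->
  \prod_(x <- r | `|x| < 1) (x / `|x|) = (-1) ^+ count (fun x => (x < 0) && (`|x| < 1)) r.
Proof.
move=> pe nz; rewrite (bigID (fun x => 0 < Im x)) /= [X in _ * X](bigID (fun x => Im x < 0)) /= mulrA.
have -> : \prod_(x <- r | (`|x| < 1) && ~~ (0 < Im x) && (Im x < 0)) (x / `|x|) =
   \prod_(x <- r | (`|x| < 1) && (0 < Im x)) (conjc x / `|x|).
  rewrite (perm_big _ pe) /= big_map; apply: eq_big => [x|x _].
    have -> : `|conjc x| = `|x| by exact: normcJ.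
    by case: x => a b /=; rewrite !oppr_lt0 oppr_gt0 -andbA; case: (ltgtP b 0).
  by have -> : `|conjc x| = `|x| by exact: normcJ.
rewrite -big_split /= big_seq_cond big1 ?mul1r => [|x /and3P[xr _ _]]; last first.
  have xn : `|x| != 0 by rewrite normr_eq0 nz.
  by rewrite mulf_div -sqr_normc -expr2 divff // expf_neq0.
rewrite big_seq_cond (eq_bigr (fun x => if x < 0 then -1 else 1)); last first.
  move=> x /andP[xr /andP[/andP[_ i1] i2]].
  have ix : Im x = 0 by apply/eqP; case: ltgtP i1 i2.
  have x0 := nz x xr; have xR : x = (Re x)%:C%C by apply: C_ext.
  have rn : Re x != 0 by apply: contra x0 => /eqP e; rewrite xR e.
  case: ifP => h.
    by rewrite ltr0_norm // invrN mulrN divff.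
  have p : 0 < x by rewrite xR ltcR lt_neqAle eq_sym rn leNgt /=; move: h; rewrite neg_real ix eqxx /= => ->.
  by rewrite gtr0_norm // divff.
rewrite -big_seq_cond prod_signs; congr (_ ^+ _); apply: eq_count => x /=.
rewrite neg_real; case: (ltgtP (Im x) 0) => // h; by rewrite ?andbF ?andbT //= andbC.
Qed.

(** Negative roots other than [-1] pair off with their inverses, one inside and one outside the
    disc. *)
Lemma count_neg (r : seq C) : perm_eq r [seq x^-1 | x <- r] -> {in r, forall x, x != 0} ->
  count (fun x => x < 0) r = addn (count (fun x => (x < 0) && (`|x| < 1)) r).*2 (count_mem (-1) r).
Proof.
move=> pe nz; have e1 : count (fun x => (x < 0) && (1 < `|x|)) r = count (fun x => (x < 0) && (`|x| < 1)) r.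
  rewrite (seq.permP pe) count_map; apply: eq_in_count => x xr /=.
  by rewrite invr_lt0 normfV invf_gt1 // normr_gt0 nz.
rewrite -addnn -{1}e1.
have pt (x : C) : nat_of_bool (x < 0) = addn (addn ((x < 0) && (1 < `|x|)) ((x < 0) && (`|x| < 1))) (x == -1).
  have [x0|x0] /= := boolP (x < 0); last first.
    by case: eqP => // e; move: x0; rewrite e ltrN10.
  have : `|x| \is Num.real by rewrite normr_real.
  have -> : (x == -1) = (`|x| == 1) by rewrite ltr0_norm // eqr_oppLR.
  move=> xr; have := real_ltgtP xr (real1 _).
  by case=> h; rewrite ?(lt_eqF h) ?(gt_eqF h) ?h.
elim: r {pe nz e1} => //= x r ->; by rewrite pt addnACA; congr addn; exact: addnACA.
Qed.

End RootCombinatorics.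

(** * A formula for [upsilon] by phases of selected roots *)

Section Upsilon.
Variables (R : realType) (n : nat).
Local Notation C := R[i].
Local Notation M := 'M[R]_(n + n).
Local Notation CV := 'cV[C]_(n + n).
Local Notation Re := (@complex.Re R).
Local Notation Im := (@complex.Im R).
Local Notation toC := (real_complex R).

(** The inverse of [W] is conjugate by [J] to the transpose of [W], so it has the same
    characteristic polynomial. *)
Lemma inv_roots (W : M) (s : seq C) : symplectic W ->
  char_poly (cmx W) = \prod_(x <- s) ('X - x%:P) ->
  {in s, forall x, x != 0} /\ perm_eq s [seq x^-1 | x <- s].
Proof.
move=> sW es; have [uW iW _] := symp_inv sW; have JJ' := JJ R n.
have dc : \det (cmx W) != 0.
  by rewrite /cmx det_map_mx /= fmorph_eq0 -unitfE -unitmxE.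
have nz : {in s, forall x, x != 0}.
  move=> x xs; apply/eqP => x0; have : root (char_poly (cmx W)) 0 by rewrite es root_prod_XsubC -x0.
  rewrite /root char_poly_eval raddf0 sub0r -scaleN1r detZ mulf_eq0 (negPf dc) orbF.
  by rewrite expf_eq0 oppr_eq0 oner_eq0 andbF.
split=> //.
have sz : size s = (n + n)%N by have := size_char_poly (cmx W); rewrite es size_prod_XsubC => -[].
have uc : cmx W \in unitmx by rewrite unitmxE unitfE.
have ci : char_poly (invmx (cmx W)) = char_poly (cmx W).
  have -> : invmx (cmx W) = cmx (sinv W) by rewrite -iW /cmx map_invmx.
  have uJ : J0 R n \in unitmx by rewrite unitmxE detJ unitr1.
  have iJ : invmx (J0 R n) = - J0 R n.
    by rewrite -[LHS]mulmx1 -[1%:M]opprK -JJ' mulmxN mulmxA mulVmx // mul1mx.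
  rewrite !cmx_char_poly; congr map_poly.
  have -> : sinv W = J0 R n *m W^T *m invmx (J0 R n) by rewrite iJ mulmxN.
  by rewrite char_poly_similar // char_poly_tr.
pose c := \det (invmx (cmx W)) * \prod_(x <- s) x.
have key : \prod_(x <- s) ('X - x%:P) = c *: \prod_(x <- s) ('X - (x^-1)%:P).
  apply/eqP; rewrite -subr_eq0; apply/negPn/negP => pn.
  have ev (a : C) : a != 0 -> root (\prod_(x <- s) ('X - x%:P) - c *: \prod_(x <- s) ('X - (x^-1)%:P)) a.
    move=> a0; rewrite /root !hornerE -es -{1}ci char_poly_eval.
    have -> : a%:M - invmx (cmx W) = invmx (cmx W) *m (- a *: (a^-1%:M - cmx W)).
      rewrite -scalemxAr mulmxBr (mulVmx uc) scalerBr mul_mx_scalar scalerA mulNr (divff a0).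
      by rewrite scaleN1r scaleNr opprK scalemx1 addrC.
    rewrite det_mulmx detZ -char_poly_eval es !horner_prod /c -mulrA subr_eq0; apply/eqP; congr (_ * _).
    have pw : (- a) ^+ (n + n) = \prod_(x <- s) (- a) by rewrite big_const_seq count_predT sz -iter_mulr_1.
    rewrite pw -!big_split /=; apply: eq_big_seq => x xs; rewrite !hornerE.
    by have := nz x xs => x0; field; rewrite a0 x0.
  pose t := [seq (k.+1%:R : C) | k <- iota 0 (size (\prod_(x <- s) ('X - x%:P) - c *: \prod_(x <- s) ('X - (x^-1)%:P)))].
  have ut : uniq t.
    rewrite map_inj_uniq; first exact: iota_uniq.
    by move=> i j /eqP; rewrite eqr_nat eqSS => /eqP.
  have rt : all (root (\prod_(x <- s) ('X - x%:P) - c *: \prod_(x <- s) ('X - (x^-1)%:P))) t.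
    by apply/allP => x /mapP[k _ ->]; apply: ev; rewrite pnatr_eq0.
  by have := max_poly_roots pn rt ut; rewrite size_map size_iota ltnn.
have c1 : c = 1.
  have := congr1 lead_coef key; rewrite lead_coefZ.
  rewrite (eqP (monic_prod_XsubC _ _ _)) -(big_map (fun x => x^-1) xpredT (fun x => 'X - x%:P)).
  by rewrite (eqP (monic_prod_XsubC _ _ _)) mulr1.
apply: prod_XsubC_eq; rewrite key c1 scale1r big_map; by [].
Qed.

End Upsilon.

Section UpsilonFormula.
Variables (R : realType) (n : nat).
Local Notation C := R[i].
Local Notation M := 'M[R]_(n + n).
Local Notation CV := 'cV[C]_(n + n).
Local Notation Re := (@complex.Re R).
Local Notation Im := (@complex.Im R).
Local Notation toC := (real_complex R).
Local Notation N := (n + n)%N.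

Lemma fsbig_set_seq (T : Type) (idx : T) (op : Monoid.com_law idx) (X : set C) (r : seq C) (F : C -> T) :
  uniq r -> (forall x, X x <-> x \in r) -> \big[op/idx]_(x \in X) F x = \big[op/idx]_(x <- r) F x.
Proof.
move=> ur h; have -> : X = [set` r] by apply/seteqP; split => x /h.
by rewrite -fsbig_seq.
Qed.

(** [S] is meant as the set of labels whose roots approach from inside the disc. Off the circle it
    holds the inner roots, whose phases reduce to a sign; on the circle it holds [krein_p] copies of
    each eigenvalue. At [-1] these are half of the multiplicity, which matches the share of [-1] in
    the count of negative eigenvalues in [upsilon]. *)
Lemma ups_formula (W0 : M) (l0 : 'I_N -> C) (S : {set 'I_N}) : symplectic W0 ->
  char_poly (cmx W0) = \prod_i ('X - (l0 i)%:P) ->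
  (forall i, i \in S -> `|l0 i| <= 1) -> (forall i, `|l0 i| < 1 -> i \in S) ->
  (forall la, `|la| = 1 -> #|[set i | (l0 i == la) && (i \in S)]%SET| = krein_p W0 la) ->
  #|[set i | l0 i == -1]%SET| = (krein_p W0 (-1)).*2 ->
  upsilon W0 = \prod_(i in S) (l0 i / `|l0 i|).
Proof.
move=> sW es H1 H2 H3 H4.
pose rs := [seq l0 i | i <- index_enum 'I_N].
have ers : char_poly (cmx W0) = \prod_(x <- rs) ('X - x%:P) by rewrite es /rs big_map.
have [nz pinv] := inv_roots sW ers; have pconj := conj_roots ers.
have ev x : Defs.eigenvalue W0 x <-> x \in rs by rewrite /Defs.eigenvalue ers root_prod_XsubC.
pose pb (x : C) := [&& `|x| == 1, x != 1 & x != -1].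
have m2E : (\sum_(l \in [set l | Defs.eigenvalue W0 l /\ (l < 0)%R]) mup l (char_poly (cmx W0)))%N =
    count (fun x => x < 0) rs.
  rewrite (@fsbig_set_seq _ _ _ _ [seq x <- undup rs | x < 0]) ?filter_uniq ?undup_uniq //; last first.
    by move=> x; rewrite mem_filter mem_undup /= ev; split=> [[-> ->]|/andP[]].
  rewrite big_filter -sum_undup_count; apply: eq_bigr => x _.
  by rewrite ers mup_prod_XsubC.
rewrite /upsilon m2E (@fsbig_set_seq _ _ _ _ [seq x <- undup rs | pb x]) ?filter_uniq ?undup_uniq //; last first.
  move=> x; rewrite mem_filter mem_undup /= /pb ev; split=> [[-> [/eqP -> [-> ->]]]|]; first by [].
  by move=> /andP[/and3P[/eqP -> -> ->] ->].
rewrite big_filter (_ : \prod_(x <- undup rs | pb x) x ^+ krein_p W0 x =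
    \prod_(i | pb (l0 i) && (i \in S)) l0 i); last first.
  rewrite -prod_by_value; apply: eq_bigr => x /and3P[/eqP ux _ _]; by rewrite H3.
have cm1 : count_mem (-1 : C) rs = (krein_p W0 (-1)).*2.
  rewrite -H4 /rs count_map -sum1_count -sum1_card; apply: eq_bigl => i; by rewrite inE.
rewrite (count_neg pinv nz) cm1 -doubleD doubleK exprD -(inner_prod pconj nz).
set P1 := \prod_(i | _) l0 i.
have -> : \prod_(x <- rs | `|x| < 1) (x / `|x|) = \prod_(i | `|l0 i| < 1) (l0 i / `|l0 i|).
  by rewrite /rs big_map.
rewrite [RHS](bigID (fun i => `|l0 i| < 1)) /=.
have -> : \prod_(i in S | `|l0 i| < 1) (l0 i / `|l0 i|) = \prod_(i | `|l0 i| < 1) (l0 i / `|l0 i|).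
  by apply: eq_bigl => i; case: (boolP (`|l0 i| < 1)) => [/H2 ->|]; rewrite ?andbF.
rewrite -mulrA; congr (_ * _).
have un i : i \in S -> ~~ (`|l0 i| < 1) -> `|l0 i| = 1.
  by move=> /H1 h1 h2; apply/eqP; move: h1; rewrite le_eqVlt (negPf h2) orbF.
rewrite (eq_bigr l0); last by move=> i /andP[iS h]; rewrite un // divr1.
rewrite (bigID (fun i => l0 i == -1)) /=; congr (_ * _).
  rewrite (eq_bigr (fun=> -1 : C)); last by move=> i /andP[_ /eqP].
  rewrite -H3 ?normrN1 // -prodr_const; apply: eq_bigl => i; rewrite inE.
  have [->|] := eqVneq (l0 i) (-1); rewrite ?andbF // normrN1 ltxx !andbT; by [].
rewrite [RHS](bigID (fun i => l0 i == 1)) /= [X in _ = X * _]big1 ?mul1r; last first.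
  by move=> i /andP[_ /eqP].
apply: eq_bigl => i; rewrite /pb; have [iS|iS] := boolP (i \in S); last by rewrite andbF.
rewrite andbT /=; have [h|h] := boolP (`|l0 i| < 1); first by rewrite (lt_eqF h).
by rewrite (un i iS h) eqxx /= andbC.
Qed.

End UpsilonFormula.

(** * Continuity of [upsilon] *)

Section UpsilonContinuity.
Variables (R : realType) (n : nat).
Hypothesis n0 : (0 < n)%N.
Local Notation C := R[i].
Local Notation M := 'M[R]_(n + n).
Local Notation CV := 'cV[C]_(n + n).
Local Notation Re := (@complex.Re R).
Local Notation Im := (@complex.Im R).
Local Notation toC := (real_complex R).
Local Notation N := (n + n)%N.

Definition AE (z : M * R) : 'M[C]_N := cmx z.1 *m cE n z.2.

Definition roots_of (A : 'M[C]_N) : 'I_N -> C :=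
  fun i => nth 0 (sval (cid2 (char_poly_roots A))) i.

Lemma roots_ofP (A : 'M[C]_N) : char_poly A = \prod_i ('X - (roots_of A i)%:P).
Proof.
rewrite /roots_of; case: cid2 => s /= es ss; rewrite {1}es.
by rewrite (big_nth_ord 0 _ ss).
Qed.

Definition Psi (A : 'M[C]_N) : C := \prod_(i | `|roots_of A i| < 1) (roots_of A i / `|roots_of A i|).

Lemma kq_cvg (T : Type) (F : set_system T) (FF : Filter F) (y : T -> CV) y0 : mcvg F y y0 ->
  kq (y x) @[x --> F] --> kq y0.
Proof.
move=> h; have hs : mcvg F (fun x => star (y x)) (star y0).
  by move=> i j; rewrite /star; under eq_fun do rewrite !mxE; rewrite !mxE; apply: ccvg_conj; exact: h.
have [_ //] := mcvgM FF (mcvgM FF hs (mcvg_cst FF (J0c R n))) h 0 0.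
Qed.

Lemma AE_strict z x : symplectic z.1 -> 0 < z.2 <= 1 -> x != 0 -> kq (AE z *m x) < kq x.
Proof.
move=> sW eI x0; have eI' : 0 <= z.2 <= 1 by case/andP: eI => /ltW -> ->.
apply: le_lt_trans (kq_contract x sW eI') _.
by rewrite ltrBlDr ltrDl mulr_gt0 ?c2_gt0 //; case/andP: eI.
Qed.

(** A kernel vector of [1 + i eta J] would have length [eta] times its own, which [eta < 1]
    excludes. *)
Lemma AE_unit z : symplectic z.1 -> 0 < z.2 < 1 -> AE z \in unitmx.
Proof.
move=> sW /andP[e0 e1]; rewrite -unitmx_tr -row_free_unit -kermx_eq0.
apply/negPn/negP => /rowV0Pn [v]; rewrite sub_kermx => /eqP h v0.
pose x : CV := v^T; have x0 : x != 0.
  by apply: contra v0 => /eqP/(congr1 trmx); rewrite trmxK trmx0 => ->.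
have hx : AE z *m x = 0 by rewrite -[_ *m _]trmxK trmx_mul trmxK h trmx0.
have [uW _ _] := symp_inv sW.
have uc : cmx z.1 \in unitmx by rewrite /cmx map_unitmx.
have hE : cE n z.2 *m x = 0.
  have hx' : cmx z.1 *m (cE n z.2 *m x) = 0 by rewrite mulmxA.
  by rewrite -[LHS](mulKmx uc) hx' mulmx0.
have e : x = - (('i%C * toC z.2) *: (J0c R n *m x)).
  by move/eqP: hE; rewrite /cE mulmxDl mul1mx -scalemxAl addr_eq0 => /eqP.
have c2N (y : CV) : c2 (- y) = c2 y by rewrite -scaleN1r c2Z /=; ring.
have c2J : c2 (J0c R n *m x) = c2 x.
  rewrite /c2 /J0c.
  have -> : cre (cmx (J0 R n) *m x) = J0 R n *m cre x.
    apply/matrixP => i j; rewrite !mxE Re_sum; apply: eq_bigr => k _; rewrite !mxE cReM /= mul0r subr0; by [].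
  have -> : cim (cmx (J0 R n) *m x) = J0 R n *m cim x.
    apply/matrixP => i j; rewrite !mxE Im_sum; apply: eq_bigr => k _; rewrite !mxE cImM /= mul0r addr0; by [].
  by rewrite !qform1J.
have := c2_gt0 x0; have e2 : c2 x = z.2 ^+ 2 * c2 x.
  by rewrite {1}e c2N c2Z c2J /=; congr (_ * _); ring.
move=> p; have : (1 - z.2 ^+ 2) * c2 x = 0 by rewrite mulrBl mul1r -e2 subrr.
move/eqP; rewrite mulf_eq0 (gt_eqF p) orbF subr_eq0 => /eqP; nra.
Qed.

Lemma inside_pos z (s : seq C) (y : CV) : symplectic z.1 -> 0 < z.2 < 1 ->
  {in s, forall l, `|l| < 1} -> kill (AE z) s y = 0 -> y != 0 -> 0 < kq y.
Proof.
move=> sW eI hs; have eI' : 0 < z.2 <= 1 by case/andP: eI => -> /ltW ->.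
apply: kill_pos => //; first by move=> x; exact: AE_strict.
move=> u cu; rewrite -(kq0 R n); exact: (@kq_cvg nat \oo _ u 0 cu).
Qed.

Lemma kill_inv (A : 'M[C]_N) (s : seq C) (y : CV) : A \in unitmx -> {in s, forall l, l != 0} ->
  kill A s y = 0 -> kill (invmx A) [seq l^-1 | l <- s] y = 0.
Proof.
move=> uA; elim: s y => [|l s IH] y hs //= h.
have -> : invmx A *m y - l^-1 *: y = (- l^-1) *: (invmx A *m (A *m y - l *: y)).
  have l0 : l != 0 by apply: hs; exact: mem_head.
  rewrite mulmxBr mulKmx // -scalemxAr scalerBr !scalerA mulNr mulVf // scaleN1r opprK scaleNr addrC.
  by [].
rewrite killZ kill_mulA IH ?mulmx0 ?scaler0 // => k ks; apply: hs; by rewrite in_cons ks orbT.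
Qed.

(** The inverse matrix has the inverse roots, inside the disc, and raises [kq], so [kill_pos]
    applies to it with [- kq]. *)
Lemma outside_neg z (s : seq C) (y : CV) : symplectic z.1 -> 0 < z.2 < 1 ->
  {in s, forall l, 1 < `|l|} -> kill (AE z) s y = 0 -> y != 0 -> kq y < 0.
Proof.
move=> sW eI hs h y0; have eI' : 0 < z.2 <= 1 by case/andP: eI => -> /ltW ->.
have uA := AE_unit sW eI; rewrite -oppr_gt0.
have nz : {in s, forall l, l != 0}.
  by move=> l ls; apply/eqP => l0; have := hs l ls; rewrite l0 normr0 ltr10.
have h2 := kill_inv uA nz h.
apply: (@kill_pos R _ (invmx (AE z)) (fun y => - kq y) [seq l^-1 | l <- s] y) => //.
- move=> _ /mapP[l ls ->]; rewrite normfV invf_lt1 ?hs //; exact: lt_trans ltr01 (hs l ls).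
- move=> x x0; rewrite ltrN2; have ix : invmx (AE z) *m x != 0.
    by apply: contra x0 => /eqP e; rewrite -[x](mulKVmx uA) e mulmx0.
  by have := AE_strict sW eI' ix; rewrite mulKVmx.
- move=> u cu; rewrite -oppr0 -(kq0 R n); apply: cvgN; exact: (@kq_cvg nat \oo _ u 0 cu).
Qed.

End UpsilonContinuity.

Section UpsilonLimit.
Variables (R : realType) (n : nat).
Local Notation C := R[i].
Local Notation M := 'M[R]_(n + n).
Local Notation CV := 'cV[C]_(n + n).
Local Notation Re := (@complex.Re R).
Local Notation Im := (@complex.Im R).
Local Notation toC := (real_complex R).
Local Notation N := (n + n)%N.

Lemma AE_root_norm (z : M * R) l : symplectic z.1 -> 0 < z.2 <= 1 -> root (char_poly (AE z)) l -> `|l| != 1.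
Proof.
move=> sW eI; rewrite -char_poly_tr -eigenvalue_root_char => /eigenvalueP[v hv v0].
apply/eqP => u; have x0 : v^T != 0.
  by apply: contra v0 => /eqP/(congr1 trmx); rewrite trmxK trmx0 => ->.
have hx : AE z *m v^T = l *: v^T by rewrite -[LHS]trmxK trmx_mul trmxK hv [LHS]linearZ.
have := AE_strict sW eI x0; rewrite hx kqZ.
have -> : Re l ^+ 2 + Im l ^+ 2 = 1 by rewrite -cn2; move: u; rewrite cnE => /(congr1 Re) /= ->; rewrite expr1n.
by rewrite mul1r ltxx.
Qed.

Lemma kq_conj (v : 'rV[C]_N) : kq (map_mx (@conjc R) v)^T = - kq v^T.
Proof.
have -> : (map_mx (@conjc R) v)^T = conjv v^T by rewrite /conjv map_trmx.
by rewrite /kq Hf_conjv; case: (Hf _ _).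
Qed.

Lemma sub_conj (v : 'rV[C]_N) (Q : 'M[C]_N) : (v <= map_mx (@conjc R) Q)%MS -> (map_mx (@conjc R) v <= Q)%MS.
Proof.
move=> /submxP[D ->]; rewrite map_mxM -map_mx_comp.
have -> : map_mx (@conjc R \o @conjc R) Q = Q by apply/matrixP => i j; rewrite mxE /= conjcK.
exact: submxMl.
Qed.

Lemma gen_eigen_conj_sub (W : M) l (Q : 'M[C]_N) : conjc l = l -> (Q <= gen_eigenspace W l)%MS ->
  (map_mx (@conjc R) Q <= gen_eigenspace W l)%MS.
Proof.
move=> cl QE; apply/rV_subP => v /sub_conj vQ; apply/gen_eigenspaceP.
have /gen_eigenspaceP h := submx_trans vQ QE.
have := gen_eigen_conj h; rewrite cl.
have -> : conjv (map_mx (@conjc R) v)^T = v^T by apply/matrixP => i j; rewrite !mxE conjcK.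
by [].
Qed.

Lemma map_conj_eq0 (v : 'rV[C]_N) : (map_mx (@conjc R) v == 0) = (v == 0).
Proof.
apply/eqP/eqP => [h|->]; last by apply/matrixP => i j; rewrite !mxE conjc0.
apply/rowP => j; have := congr1 (fun w : 'rV_N => w 0 j) h; rewrite !mxE => /eqP.
by rewrite conjc_eq0 => /eqP.
Qed.

Section UL.
Variables (F : set_system (M * R)) (UF : UltraFilter F) (W0 : M).
Hypotheses (sW0 : symplectic W0) (c1 : fst z @[z --> F] --> W0) (c2 : snd z @[z --> F] --> (0 : R)).
Hypothesis good : F [set z | symplectic z.1 /\ 0 < z.2 < 1].
Let PF : ProperFilter F := @ultra_proper _ _ UF.

Lemma AE_mcvg : mcvg F (@AE R n) (cmx W0).
Proof.
have -> : cmx W0 = cmx W0 *m cE n 0.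
  by rewrite /cE rmorph0 mulr0 scale0r addr0 mulmx1.
apply: mcvgM; first exact: mcvg_cmx.
apply: mcvgD; first exact: mcvg_cst.
apply: mcvgZ; last exact: mcvg_cst.
by apply: ccvgM; [exact: ccvg_cst | exact: ccvg_toC].
Qed.

(** Positive subspaces at a unimodular [la] are bounded in dimension by the inner roots tending to
    [la], negative ones by the outer roots, both by [perturb]. The two bounds add up to the
    multiplicity, so the inner roots number exactly [krein_p]. *)
Lemma ups_limit : ccvg F (fun z => Psi (AE z)) (upsilon W0).
Proof.
pose l z := roots_of (@AE R n z).
have hch : F [set z | char_poly (@AE R n z) = \prod_i ('X - (l z i)%:P)].
  by apply: filterE => z; exact: roots_ofP.
have [l0 cl es] := roots_cvg UF AE_mcvg hch.
have rl z i : root (char_poly (@AE R n z)) (l z i).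
  by rewrite roots_ofP /root horner_prod (bigD1 i) //= !hornerE subrr mul0r.
have n1 : F [set z | forall i, `|l z i| != 1].
  apply: filterS good => z [sz ez] i; apply: (AE_root_norm sz) (rl z i).
  by case/andP: ez => -> /ltW ->.
(* The ultrafilter decides for each label whether its root lies inside the disc, so that [S] does
   not depend on [z]. *)
have hb i : exists b : bool, F [set z | (`|l z i| < 1) = b].
  have [h|h] := in_ultra_setVsetC [set z | `|l z i| < 1] UF.
    by exists true; apply: filterS h => z /= ->.
  by exists false; apply: filterS h => z /= /negP/negbTE.
have [b hb'] := choice hb; pose S := [set i | b i]%SET.
have hS : F [set z | forall i, (`|l z i| < 1) = (i \in S)].
  by apply: filter_forall => i; apply: filterS (hb' i) => z /= ->; rewrite inE.
pose rs := [seq l0 i | i <- index_enum 'I_N].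
have ers : char_poly (cmx W0) = \prod_(x <- rs) ('X - x%:P) by rewrite es /rs big_map.
have [nz _] := inv_roots sW0 ers.
have l0nz i : l0 i != 0 by apply: nz; apply/mapP; exists i; rewrite ?mem_index_enum.
have H1 i : i \in S -> `|l0 i| <= 1.
  move=> iS; rewrite cnE -[X in _ <= X]/((1 : R)%:C%C) lecR.
  apply: (@closed_cvg _ _ F PF (fun z => cn (l z i)) (fun y : R => y <= 1) (@closed_le R 1) _ _ (cn_cvg PF (cl i))).
  by apply: filterS hS => z /(_ i); rewrite iS cn_ltr => /ltW.
have H2 i : `|l0 i| < 1 -> i \in S.
  move=> h; apply/negPn/negP => iS; move: h; rewrite cn_ltr ltNge => /negP; apply.
  apply: (@closed_cvg _ _ F PF (fun z => cn (l z i)) (fun y : R => 1 <= y) (@closed_ge R 1) _ _ (cn_cvg PF (cl i))).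
  by apply: filterS hS => z /(_ i); rewrite (negPf iS) cn_ltr leNgt => ->.
have KxE la (U : 'M[C]_N) : (U <= gen_eigenspace W0 la)%MS -> (U <= Kx (cmx W0) (nseq N la))%MS.
  by move=> h; apply/rV_subP => v vU; apply/KxP/gen_eigen_kill; exact: submx_trans vU h.
have big z i : (forall i, `|l z i| != 1) -> (forall i, (`|l z i| < 1) = (i \in S)) -> i \notin S -> 1 < `|l z i|.
  move=> h1 h2 iS; have := h1 i; have := h2 i; rewrite (negPf iS).
  have := real_ltgtP (normr_real (l z i)) (@real1 C).
  by case=> // ->; rewrite eqxx.
have pertP la (U : 'M[C]_N) : (U <= gen_eigenspace W0 la)%MS ->
    (forall v : 'rV[C]_N, (v <= U)%MS -> v != 0 -> 0 < kq v^T) ->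
    (\rank U <= #|[set i | (l0 i == la) && (i \in S)]%SET|)%N.
  move=> UE pU; apply: (@perturb R N (M * R)%type F UF (@AE R n) (cmx W0) l l0 la (@kq R n) S U AE_mcvg cl hch _ _ _ _ (KxE _ _ UE) pU).
  - by move=> y y0; exact: kq_cvg.
  - by move=> a y; rewrite kqZ /= expr0n addr0.
  - apply: filterS2 good (filterI n1 hS) => z [sz ez] [g1 g2] y ky.
    have [->|y0] := eqVneq y 0; first by rewrite kq0.
    apply: ltW; apply: (outside_neg sz ez _ ky y0) => x /mapP[i1]; rewrite mem_enum inE => /andP[_ iS] ->.
    exact: big.
  - apply: filterS hS => z g i j iS _ jS _; apply/eqP => e.
    by have := g i; rewrite e g iS (negPf jS).
have pertN la (U : 'M[C]_N) : (U <= gen_eigenspace W0 la)%MS ->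
    (forall v : 'rV[C]_N, (v <= U)%MS -> v != 0 -> kq v^T < 0) ->
    (\rank U <= #|[set i | (l0 i == la) && (i \in ~: S)]%SET|)%N.
  move=> UE pU; apply: (@perturb R N (M * R)%type F UF (@AE R n) (cmx W0) l l0 la (fun y => - @kq R n y) (~: S) U AE_mcvg cl hch _ _ _ _ (KxE _ _ UE) _).
  - by move=> y y0 cy; apply: cvgN; exact: kq_cvg.
  - by move=> a y; rewrite kqZ /= expr0n addr0 mulrN.
  - apply: filterS2 good (filterI n1 hS) => z [sz ez] [g1 g2] y ky.
    have [->|y0] := eqVneq y 0; first by rewrite kq0 oppr0.
    rewrite oppr_le0; apply: ltW; apply: (inside_pos sz ez _ ky y0) => x /mapP[i1].
    by rewrite mem_enum !inE negbK => /andP[_ iS] ->; rewrite g2 inE.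
  - apply: filterS hS => z g i j; rewrite !finset.in_setC negbK => iS _ jS _; apply/eqP => e.
    by have := g i; rewrite e g (negPf iS) jS.
  - by move=> v vU v0; rewrite oppr_gt0 pU.
have cnt la : count_mem la rs = (#|[set i | (l0 i == la) && (i \in S)]%SET| + #|[set i | (l0 i == la) && (i \in ~: S)]%SET|)%N.
  rewrite /rs count_map -sum1_count (bigID (mem S)) /= -!sum1_card.
  by congr (_ + _)%N; apply: eq_bigl => i; rewrite !inE.
have both la : `|la| = 1 -> exists2 Q : 'M[C]_N, (Q <= gen_eigenspace W0 la)%MS &
    [/\ #|[set i | (l0 i == la) && (i \in S)]%SET| = krein_p W0 la,
        #|[set i | (l0 i == la) && (i \in ~: S)]%SET| = \rank Q &
        forall v : 'rV[C]_N, (v <= Q)%MS -> v != 0 -> kq v^T < 0].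
  move=> ul; have [Q [QE rQ nQ]] := krein_decomp sW0 ul ers; exists Q => //.
  have [U UE [rU /krein_kq pU]] := krein_p_ex W0 la.
  have h1 := pertP la U UE pU; have h2 := pertN la Q QE nQ; rewrite rU in h1; rewrite cnt in rQ.
  by split=> //; apply/eqP; rewrite eqn_leq; apply/andP; split; lia.
have H3 la : `|la| = 1 -> #|[set i | (l0 i == la) && (i \in S)]%SET| = krein_p W0 la.
  by move=> /both[Q _ []].
(* Complex conjugation preserves the generalized eigenspace of a real eigenvalue and reverses the
   Krein form, so the positive and negative indices at [-1] agree. *)
have H4 : #|[set i | l0 i == -1]%SET| = (krein_p W0 (-1)).*2.
  have u1 : `|-1 : C| = 1 by rewrite normrN1.
  have cj : conjc (-1 : C) = -1 by rewrite rmorphN1.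
  have [Q QE [e1 e2 nQ]] := both _ u1; have [U UE [rU /krein_kq pU]] := krein_p_ex W0 (-1).
  have h1 : (\rank Q <= krein_p W0 (-1)%R)%N.
    rewrite -(mxrank_map (@conjc R) Q); apply: krein_p_max; first exact: gen_eigen_conj_sub.
    apply/krein_kq => v /sub_conj vQ v0; have := nQ _ vQ; rewrite map_conj_eq0 kq_conj => /(_ v0).
    by rewrite oppr_lt0.
  have h2 : (krein_p W0 (-1)%R <= \rank Q)%N.
    rewrite -rU -e2 -(mxrank_map (@conjc R) U); apply: pertN; first exact: gen_eigen_conj_sub.
    move=> v /sub_conj vU v0; have := pU _ vU; rewrite map_conj_eq0 kq_conj => /(_ v0).
    by rewrite oppr_gt0.
  have -> : #|[set i | l0 i == -1]%SET| = count_mem (-1) rs.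
    by rewrite /rs count_map -sum1_count -sum1_card; apply: eq_bigl => i; rewrite inE.
  by rewrite cnt e1 e2 -addnn; congr (_ + _)%N; apply/eqP; rewrite eqn_leq h1.
rewrite (ups_formula sW0 es H1 H2 H3 H4).
have c3 : ccvg F (fun z => \prod_(i in S) (l z i / `|l z i|)) (\prod_(i in S) (l0 i / `|l0 i|)).
  apply: (@ccvg_prod R _ F PF _ _ _ (fun i z => l z i / `|l z i|)) => i _; apply: ccvgM; first exact: cl.
  have cnz : cn (l0 i) != 0 by rewrite cn_eq0.
  rewrite cnE -fmorphV /=; under eq_fun do rewrite cnE -fmorphV /=.
  by apply: ccvg_toC; apply: cvgV => //; exact: cn_cvg.
have eqF : F [set z | Psi (AE z) = \prod_(i in S) (l z i / `|l z i|)].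
  by apply: filterS hS => z g; rewrite /Psi; apply: eq_bigl => i; rewrite -/(l z) g.
case: c3 => a1 a2; split.
  by apply: cvg_trans a1; apply: near_eq_cvg; apply: filterS eqF => z /= ->.
by apply: cvg_trans a2; apply: near_eq_cvg; apply: filterS eqF => z /= ->.
Qed.

End UL.

(** Both [upsilon W] and [upsilon W0] are compared with the same [Psi (AE (W, eta))]. The bound at
    [W0] holds on a whole ball of pairs, which leaves [eta] free to depend on [W]. *)
Lemma upsilon_cont (W0 : M) (e : R) : symplectic W0 -> 0 < e -> exists2 d : R, 0 < d &
  forall W, symplectic W -> ball W0 d W -> cn (upsilon W - upsilon W0) < e.
Proof.
have key (W1 : M) (e1 : R) : symplectic W1 -> 0 < e1 -> exists2 d : R, 0 < d &
    forall z : M * R, symplectic z.1 -> 0 < z.2 < 1 -> ball (W1, 0 : R) d z -> cn (Psi (AE z) - upsilon W1) < e1.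
  move=> s1 e10; apply: contrapT => hn.
  have [U [UU UP UW]] : exists U : set_system (M * R), [/\ UltraFilter U,
      U [set z | (symplectic z.1 /\ 0 < z.2 < 1) /\ e1 <= cn (Psi (AE z) - upsilon W1)] &
      id z @[z --> U] --> (W1, 0 : R)].
    apply: ball_ultra => d d0; apply: contrapT => hd; apply: hn; exists d => // z sz ez bz.
    by rewrite ltNge; apply/negP => le; apply: hd; exists z.
  have PU := @ultra_proper _ _ UU.
  have g1 : fst z @[z --> U] --> W1.
    by apply: (@cvg_comp _ _ _ id fst _ _ _ UW); exact: cvg_fst.
  have g2 : snd z @[z --> U] --> (0 : R).
    by apply: (@cvg_comp _ _ _ id snd _ _ _ UW); exact: cvg_snd.
  have UP' : U [set z | symplectic z.1 /\ 0 < z.2 < 1] by apply: filterS UP => z [].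
  have c := ups_limit UU s1 g1 g2 UP'.
  have c' : ccvg U (fun z => Psi (AE z) - upsilon W1) 0.
    rewrite -(subrr (upsilon W1)); apply: ccvgD => //; exact: ccvg_cst.
  have /cvgrPdist_lt/(_ _ e10) h := cn_cvg PU c'.
  have [z [h1 [_ h2]]] := filter_ex (filterI h UP).
  by move: h1; rewrite /= cn0 sub0r normrN ger0_norm ?cn_ge0 // ltNge h2.
move=> s0 e0; have e2 : 0 < e / 2 by lra.
have [d d0 hd] := key W0 _ s0 e2; exists d => // W sW bW.
have [d' d'0 hd'] := key W _ sW e2.
pose eta := Num.min (Num.min d d') 1 / 2.
have m0 : 0 < Num.min (Num.min d d') 1 by rewrite !lt_min d0 d'0 ltr01.
have m1 : Num.min (Num.min d d') 1 <= 1 by rewrite ge_min lexx orbT.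
have m2 : Num.min (Num.min d d') 1 <= d by rewrite !ge_min lexx.
have m3 : Num.min (Num.min d d') 1 <= d' by rewrite !ge_min lexx orbT.
have et : 0 < eta < 1 by rewrite /eta; apply/andP; split; lra.
have b1 : ball (W0, 0 : R) d (W, eta).
  by split=> //=; rewrite /ball /= sub0r normrN gtr0_norm; case/andP: et => //; rewrite /eta; lra.
have b2 : ball (W, 0 : R) d' (W, eta).
  split=> /=; first exact: ballxx.
  by rewrite /ball /= sub0r normrN gtr0_norm; case/andP: et => //; rewrite /eta; lra.
have h1 := hd (W, eta) sW et b1; have h2 := hd' (W, eta) sW et b2.
have -> : upsilon W - upsilon W0 = (Psi (AE (W, eta)) - upsilon W0) + (-1) * (Psi (AE (W, eta)) - upsilon W).
  by move: (upsilon W) (upsilon W0) (Psi _) => A B Q; ring.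
apply: le_lt_trans (cnD _ _) _; rewrite cnM.
have -> : cn (-1 : C) = 1 by rewrite /cn /= oppr0 expr0n addr0 sqrrN expr1n sqrtr1.
by rewrite mul1r; have := ltrD h1 h2; rewrite -splitr.
Qed.

End UpsilonLimit.

(** * Distance bound for causal curves *)

Section DistanceBound.
Variables (R : realType) (n : nat).
Hypothesis n0 : (0 < n)%N.
Local Notation M := 'M[R]_(n + n).
Local Notation V := 'cV[R]_(n + n).
Local Notation J := (J0 R n).
Local Notation mu := (@lebesgue_measure R).

Lemma qform_bound m (A : 'M[R]_m) u :
  `|qform A u| <= (\sum_i \sum_j `|A i j|) * qform 1%:M u.
Proof.
have ui (i : 'I_m) : u i 0 ^+ 2 <= qform 1%:M u.
  by rewrite qform1 (bigD1 i) //= lerDl; apply: sumr_ge0 => j _; exact: sqr_ge0.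
have uij (i j : 'I_m) : `|u i 0| * `|u j 0| <= qform 1%:M u.
  have := ui i; have := ui j; have := sqr_ge0 (`|u i 0| - `|u j 0|).
  by rewrite -[u i 0 ^+ 2]real_normK ?num_real // -[u j 0 ^+ 2]real_normK ?num_real // => *; nra.
have -> : qform A u = \sum_j \sum_i u i 0 * A i j * u j 0.
  by rewrite /qform mxE; apply: eq_bigr => j _; rewrite !mxE mulr_suml; apply: eq_bigr => i _; rewrite mxE.
rewrite exchange_big mulr_suml; apply: le_trans (ler_norm_sum _ _ _) _; apply: ler_sum => i _.
rewrite mulr_suml; apply: le_trans (ler_norm_sum _ _ _) _; apply: ler_sum => j _.
have -> : u i 0 * A i j * u j 0 = A i j * (u i 0 * u j 0) by ring.
by rewrite normrM normrM ler_wpM2l.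
Qed.

(** A C1 step whose derivative is a tent of height [1 / h] on [[p, p + 2 h]], built from three
    translates of [psq]; the weight [K] makes the total rise [1]. *)
Lemma bump (p h : R) : 0 <= p -> 0 < h -> p + 2 * h <= 1 -> exists psi dpsi : R -> R,
  [/\ forall t : R, is_derive t 1 psi (dpsi t), continuous dpsi, psi 0 = 0, psi 1 = 1 &
   forall t, 0 <= dpsi t <= h^-1 /\ (dpsi t != 0 -> p <= t <= p + 2 * h)].
Proof.
move=> p0 h0 ph; pose K := (2 * h ^+ 2)^-1; have hn : h != 0 by rewrite gt_eqF.
have Kh : K * (2 * h ^+ 2) = 1 by rewrite mulVf // mulf_neq0 // expf_neq0.
have K0 : 0 < K by rewrite invr_gt0 mulr_gt0 // exprn_gt0.
pose psi t := 0 + K * (psq (- p + 1 * t) + ((0 + (-2) * psq (- (p + h) + 1 * t)) + psq (- (p + 2 * h) + 1 * t))).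
pose dpsi t := 2 * K * pos (- p + 1 * t) + ((- 4 * K) * pos (- (p + h) + 1 * t) + 2 * K * pos (- (p + 2 * h) + 1 * t)).
have dsh c (t : R) : is_derive t 1 (fun x => psq (c + 1 * x)) (1 * (2 * pos (c + 1 * t))).
  by apply: is_derive_comp; [exact: is_derive_psq | exact: is_derive_affine].
have dp t : 0 <= dpsi t <= h^-1 /\ (dpsi t != 0 -> p <= t <= p + 2 * h).
  have hi : h^-1 = 2 * K * h by rewrite /K; field.
  rewrite /dpsi hi !mul1r.
  have [x0|x0] := leP t p.
    by rewrite !pos_0 ?mulr0 ?addr0 ?eqxx; [split=> //; rewrite lexx /=; nra | lra | lra | lra].
  have [x1|x1] := leP t (p + h).
    rewrite (@pos_id _ (- p + t)) ?(@pos_0 _ (- (p + h) + t)) ?(@pos_0 _ (- (p + 2 * h) + t)); [|lra..].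
    by split=> [|_]; apply/andP; split; nra.
  have [x2|x2] := leP t (p + 2 * h).
    rewrite (@pos_id _ (- p + t)) ?(@pos_id _ (- (p + h) + t)) ?(@pos_0 _ (- (p + 2 * h) + t)); [|lra..].
    by split=> [|_]; apply/andP; split; nra.
  rewrite !pos_id; [|lra..].
  have -> : 2 * K * (- p + t) + (- 4 * K * (- (p + h) + t) + 2 * K * (- (p + 2 * h) + t)) = 0 by ring.
  by rewrite eqxx lexx /=; split=> //; nra.
exists psi, dpsi; split=> //.
- move=> t; have e := is_derive_comp (is_derive_affine 0 K _) (is_deriveDr (dsh (- p) t)
    (is_deriveDr (is_derive_comp (is_derive_affine 0 (-2) _) (dsh (- (p + h)) t)) (dsh (- (p + 2 * h)) t))).
  by apply: (is_derive_eq e); rewrite /dpsi; ring.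
- move=> t; apply: cvgD; last apply: cvgD.
  + exact: (@cont_pos_affine R (2 * K) (- p) 1 t).
  + exact: (@cont_pos_affine R (- 4 * K) (- (p + h)) 1 t).
  + exact: (@cont_pos_affine R (2 * K) (- (p + 2 * h)) 1 t).
- by rewrite /psi /psq !pos_0; [ring | lra..].
- rewrite /psi /psq !pos_id; [|lra..].
  by apply: etrans Kh; ring.
Qed.

Lemma ell_form_pos (W : M) (x : V) : Sp_ell W -> x != 0 -> 0 < omega0 x (W *m x).
Proof. by move: n n0 W x => [|n'] // _ W x sW x0; exact: ell_form. Qed.

(** With [y = Rot n a x] the equation reads [A y = - Rot n a y], and the form of a rotation is its
    sine times the squared length. When [sin a > 0] and the form of [A] is nonnegative, the rotated
    matrix thus has no eigenvalue [-1]. *)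
Lemma rot_minus1 (A : M) (a : R) (x : V) : x != 0 ->
  Rot n (- (a + a)) *m A *m Rot n a *m x = - x ->
  exists2 y : V, y != 0 & omega0 y (A *m y) = - (sin a * qform 1%:M y).
Proof.
move=> x0 e; exists (Rot n a *m x).
  apply: contra x0 => /eqP h; apply/eqP.
  by rewrite -[x]mul1mx -(RotN n (- a)) opprK -mulmxA h mulmx0.
have -> : A *m (Rot n a *m x) = - (Rot n a *m (Rot n a *m x)).
  have -> : A *m (Rot n a *m x) = Rot n (a + a) *m (Rot n (- (a + a)) *m A *m Rot n a *m x).
    by rewrite !mulmxA RotN mul1mx.
  by rewrite e mulmxN -RotD mulmxA.
by rewrite omegaN omega_Rot.
Qed.

(** Supplies the time interval on which the backward rotation of the push is paid for. *)
Lemma uniform_positive (X : R -> M) (t1 : R) : continuous X -> 0 <= t1 <= 1 ->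
  (forall t, 0 <= t <= 1 -> sp (X t)) -> sp_plus (X t1) ->
  exists p h m : R, [/\ 0 <= p, 0 < h, p + 2 * h <= 1, 0 < m &
    forall t, p <= t <= p + 2 * h -> psd (X t - m *: J)].
Proof.
move=> cX /andP[t0 t1'] sX pX; have [_ pd] := (sp_plusE (X t1)).1 pX.
have cS : continuous (fun t => sform (X t)).
  by move=> t; apply: cvg_mulmx; [exact: cvg_cst | exact: cX].
have [|||e e0 he] := @form_dominates R (n + n) (fun=> sform (X t1)) (fun=> 1%:M) 0 1.
- by move=> t; exact: cvg_cst.
- by move=> t; exact: cvg_cst.
- by [].
pose f t := \sum_i \sum_j `|(sform (X t) - sform (X t1)) i j|.
have cf : f t @[t --> t1] --> f t1.
  apply: cvg_sumr => i _; apply: cvg_sumr => j _; apply: cvg_norm; apply: cvg_mx_entry.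
  by apply: cvgB; [exact: cS | exact: cvg_cst].
have f0 : f t1 = 0.
  by rewrite /f big1 // => i _; rewrite big1 // => j _; rewrite subrr mxE normr0.
have /cf/nbhs_ballP[d /= d0 hd] : nbhs (f t1) (ball (f t1) (e / 2)).
  by apply: nbhsx_ballx; rewrite divr_gt0.
pose h := Num.min d 1 / 8.
have [h0 hd' h1] : [/\ 0 < h, h < d / 4 & h < 4^-1].
  have m0 : 0 < Num.min d 1 by rewrite lt_min d0 ltr01.
  have m1 : Num.min d 1 <= d by rewrite ge_min lexx.
  have m2 : Num.min d 1 <= 1 by rewrite ge_min lexx orbT.
  by rewrite /h; split; lra.
(* The interval is taken to the right or to the left of [t1], whichever side stays inside [[0, 1]];
   its length [2 h] is below [1/2]. *)
pose p := if t1 <= 2^-1 then t1 else t1 - 2 * h.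
have pI : [/\ 0 <= p, p + 2 * h <= 1 & forall t, p <= t <= p + 2 * h -> 0 <= t <= 1 /\ `|t1 - t| < d].
  rewrite /p; case: (leP t1 2^-1) => ht; split; try lra; move=> t /andP[a b];
    by split; [apply/andP; split; lra | rewrite ltr_norml; apply/andP; split; lra].
case: pI => q0 q1 q2; exists p, h, (e / 2); split=> //; first by rewrite divr_gt0.
move=> t tI; have [tI' td] := q2 t tI; split.
  by rewrite -scaleNr; apply: spD; [exact: sX | apply: spZ; exact: sp_J].
move=> u; rewrite mulmxBl omegaD omegaN -scalemxAl omegaZ omegaJ.
have -> : (u^T *m u) 0 0 = qform 1%:M u by rewrite /qform mulmx1.
have I1 : 0 <= (1 : R) <= 1 by rewrite lexx ler01.
have h2 := he 1 I1 u; have := qform_bound (sform (X t) - sform (X t1)) u.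
have ft : f t < e / 2.
  have /= := hd t td; rewrite /ball /= f0 sub0r normrN => h3.
  exact: le_lt_trans (ler_norm _) h3.
rewrite -/(f t) ler_norml => /andP[h3 _].
have -> : omega0 u (X t *m u) = qform (sform (X t1)) u + qform (sform (X t) - sform (X t1)) u.
  by rewrite omega_qform -qformD addrC subrK.
have q0' := posdef_ge0 u (@posdef1 R (n + n)).
have : f t * qform 1%:M u <= e / 2 * qform 1%:M u by rewrite ler_wpM2r // ltW.
by move: h2 h3 => /=; lra.
Qed.

Section Causal.
Variables (w c D : R -> M) (th0 : 'I_n -> R).
Hypotheses (hc : C1on c D) (c0 : c 0 = 1%:M) (cw : homotopic c w).
Hypothesis sc : forall t, 0 <= t <= 1 -> symplectic (c t).
Hypothesis pc : forall t, 0 <= t <= 1 -> psd (D t *m invmx (c t)).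
Hypothesis cl : in_closure_ell w.
Hypothesis E0 : ES (w 1) th0.
Hypothesis qw : forall u : V, 0 <= omega0 u (w 1 *m u).
Let X t := D t *m invmx (c t).

Section Push.
Variables (p h m a : R) (psi dpsi : R -> R).
Hypotheses (h0 : 0 < h) (m0 : 0 < m) (a0 : 0 < a) (ahm : 2 * a < h * m) (a1 : a <= 1).
Hypothesis XI : forall t, p <= t <= p + 2 * h -> psd (X t - m *: J).
Hypothesis dpsiE : forall t : R, is_derive t 1 psi (dpsi t).
Hypotheses (cdpsi : continuous dpsi) (psi0 : psi 0 = 0) (psi1 : psi 1 = 1).
Hypothesis dpsiI : forall t, 0 <= dpsi t <= h^-1 /\ (dpsi t != 0 -> p <= t <= p + 2 * h).
(** The share of the velocity spent on the left rotation, which turns at speed at most [2 a / h]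
    during a time when the velocity dominates [m J]. *)
Let kap := 2 * a / (h * m).
(** The right rotation at speed [a] makes the velocity definite at all times. The left rotation by
    [-2 a] outweighs it, which is what [rot_minus1] needs to keep [-1] out at the end. *)
Let phi t := 0 + (- (a + a)) * psi t.
Let dphi t := dpsi t * (- (a + a)).
Let chi t := 0 + a * t.
Let P := rcurve phi chi c.
Let DP := rcurveD phi dphi chi (fun=> a) c D.

Lemma push_C1 : C1on P DP.
Proof.
apply: rcurve_C1 => //.
- by move=> t; apply: (is_derive_comp (is_derive_affine 0 _ _)); exact: dpsiE.
- by move=> t; apply: cvgM; [exact: cdpsi | exact: cvg_cst].
- by move=> t; exact: is_derive_affine.
- by move=> t; exact: cvg_cst.
Qed.

Lemma kapI : 0 < kap < 1.
Proof.
have hm : 0 < h * m by exact: mulr_gt0.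
by rewrite /kap divr_gt0 ?mulr_gt0 //= ltr_pdivrMr // mul1r.
Qed.

Lemma push_vel t : 0 <= t <= 1 -> sp_plus (DP t *m invmx (P t)) /\
  (1 - kap) * G (X t) <= G (DP t *m invmx (P t)).
Proof.
move=> tI; have sR : symplectic (Rot n (phi t)) by exact: Rot_symp.
have /andP[k0 k1] := kapI.
have hm : 0 < h * m by exact: mulr_gt0.
rewrite /DP /P rcurve_vel; last exact: sc.
set Y := _ + _; have pY1 : psd (kap *: X t - (dpsi t * (a + a)) *: J).
  have [z|nz] := eqVneq (dpsi t) 0.
    by rewrite z mul0r scale0r subr0; apply: psdZ; [exact: ltW | exact: pc].
  have [/andP[d0 d1] dI] := dpsiI t.
  have -> : kap *: X t - (dpsi t * (a + a)) *: J = kap *: (X t - m *: J) + (kap * m - dpsi t * (a + a)) *: J.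
    by rewrite scalerBr scalerA scalerBl addrA subrK.
  apply: psdD; first by apply: psdZ; [exact: ltW | exact: XI (dI nz)].
  apply: psdZ; last exact: sp_plus_psd (sp_plusJ R n).
  have -> : kap * m = h^-1 * (a + a).
    rewrite /kap; field; by rewrite !gt_eqF.
  by rewrite -mulrBl; apply: mulr_ge0; [rewrite subr_ge0 | rewrite addr_ge0 // ltW].
have pY3 : sp_plus (a *: (c t *m J *m invmx (c t))).
  by apply: sp_plusZ => //; apply: sp_plus_conj (sp_plusJ R n); exact: sc.
have pX : psd ((1 - kap) *: X t) by apply: psdZ; [rewrite subr_ge0 ltW | exact: pc].
have eY : Y = (1 - kap) *: X t + (a *: (c t *m J *m invmx (c t)) + (kap *: X t - (dpsi t * (a + a)) *: J)).
  rewrite /Y /dphi mulrN scaleNr -/(X t).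
  move: (X t) (a *: (c t *m J *m invmx (c t))) ((dpsi t * (a + a)) *: J) => A B C.
  by rewrite scalerBl scale1r; apply/matrixP => i j; rewrite !mxE; ring.
have spp := sp_plus_add pY3 pY1.
split.
  by apply: sp_plus_conj => //; rewrite eY addrC; apply: sp_plus_add.
rewrite GJ // eY -GZ ?subr_gt0 //; apply: G_mono => //; exact: sp_plus_psd.
Qed.

Lemma push_symp t : 0 <= t <= 1 -> symplectic (P t).
Proof. by move=> tI; apply: rcurve_symp; exact: sc. Qed.

Lemma push_0 : P 0 = 1%:M.
Proof. by rewrite /P /rcurve /phi /chi psi0 !mulr0 !addr0 Rot0 c0 !mul1mx. Qed.

Lemma push_1 : P 1 = Rot n (- (a + a)) *m w 1 *m Rot n a.
Proof. by rewrite /P /rcurve /phi /chi psi1 !mulr1 !add0r (homotopic_end cw). Qed.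

(** [crossing] is applied to the rotated homotopy. By [rot_minus1] an eigenvalue [-1] would give a
    vector with negative form, impossible for the elliptic matrices on one side and for [w 1]; the
    end of the homotopy stays so close to [w 1] that the determinant remains nonzero there. *)
Lemma push_no_minus1 t : 0 <= t <= 1 -> forall x : V, x != 0 -> P t *m x != - x.
Proof.
have I0 : 0 <= (0 : R) <= 1 by rewrite lexx ler01.
have I1 : 0 <= (1 : R) <= 1 by rewrite lexx ler01.
have pi1 : 1 < pi :> R by have := pi_ge2 R; lra.
have sa : 0 < sin a by apply: sin_gt0_pi; rewrite a0 /=; apply: le_lt_trans pi1.
pose F (A : M) := Rot n (- (a + a)) *m A *m Rot n a.
have nw (x : V) : x != 0 -> F (w 1) *m x != - x.
  move=> x0; apply/eqP => e; have [y y0 ey] := rot_minus1 x0 e.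
  have := qw y; rewrite ey oppr_ge0 leNgt mulr_gt0 //; exact: qform1_gt0.
have cF : \det (1%:M + F A) @[A --> w 1] --> \det (1%:M + F (w 1)).
  apply: (@cvg_det _ _ (nbhs (w 1)) _ _ (fun A : M => 1%:M + F A)).
  apply: (@cvgD _ _ _ (nbhs (w 1)) _ (fun=> 1%:M) F); first exact: cvg_cst.
  apply: (@cvg_mulmx _ _ (nbhs (w 1)) _ _ _ _ (fun A : M => Rot n (- (a + a)) *m A) (fun=> Rot n a)); last exact: cvg_cst.
  by apply: (@cvg_mulmx _ _ (nbhs (w 1)) _ _ _ _ (fun=> Rot n (- (a + a))) id); [exact: cvg_cst | exact: cvg_id].
have d1 : 0 < `|\det (1%:M + F (w 1))|.
  by rewrite normr_gt0 -unitfE -unitmxE; exact: no_minus1_unit.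
have /cF/nbhs_ballP[e /= e0 he] : nbhs (\det (1%:M + F (w 1))) (ball (\det (1%:M + F (w 1))) `|\det (1%:M + F (w 1))|).
  exact: nbhsx_ballx.
have nb (A : M) (x : V) : ball (w 1) e A -> x != 0 -> F A *m x != - x.
  move=> /he /=; rewrite /ball /= => bA x0; apply/eqP => ex.
  have dn : \det (1%:M + F A) != 0.
    by apply/eqP => z; move: bA; rewrite z subr0 ltxx.
  have uA : 1%:M + F A \in unitmx by rewrite unitmxE unitfE.
  by move/eqP: x0; apply; rewrite -[x](mulKmx uA) mulmxDl mul1mx ex subrr mulmx0.
have [v [hv [ev tr]]] := cl e0.
have /htpy_trackE[H [cH H01 Hs sH]] := homotopic_track cw tr (ballxx _ e0).
(* The left angle is interpolated between [psi t] and [t], so that on the elliptic side the two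
   angles are [-2 a t] and [a t], as [rot_minus1] requires. *)
pose K (z : R * R) := Rot n (- (a + a) * ((1 - z.1) * psi z.2 + z.1 * z.2)) *m H z *m Rot n (a * z.2).
move: t; apply: (@crossing R n n0 P DP K push_C1 push_symp).
- by move=> t tI; have [] := push_vel tI.
- move=> z; apply: cvg_mulmx; last first.
    by apply: cvg_Rot; apply: cvgM; [exact: cvg_cst | exact: cvg_snd].
  apply: cvg_mulmx; last exact: cH.
  apply: cvg_Rot; apply: cvgM; first exact: cvg_cst.
  apply: cvgD; last by apply: cvgM; [exact: cvg_fst | exact: cvg_snd].
  apply: cvgM; first by apply: cvgB; [exact: cvg_cst | exact: cvg_fst].
  by apply: (@cvg_comp _ _ _ snd psi); [exact: cvg_snd | exact: is_derive_continuous (dpsiE _)].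
- move=> s t sI tI; apply: symp_mul; last exact: Rot_symp.
  by apply: symp_mul; [exact: Rot_symp | exact: sH].
- move=> t tI; rewrite /K /P /rcurve /phi /chi /= subr0 mul1r mul0r addr0 !add0r.
  by have [-> _] := H01 t tI.
- move=> s sI; rewrite /K /= psi0 !mulr0 addr0 mulr0 !Rot0 mul1mx mulmx1.
  by have [-> _] := Hs s sI.
- move=> t tI x x0; apply/eqP; rewrite /K /= subrr mul0r add0r mul1r.
  have [_ ->] := H01 t tI; have -> : - (a + a) * t = - (a * t + a * t) by ring.
  move=> ex; have [y y0 ey] := rot_minus1 x0 ex.
  case/andP: tI => t0 t1; have [z|tn] := eqVneq t 0.
    have v0 : v 0 = 1%:M by case: hv => _ [].
    move: ex; rewrite z v0 mulr0 addr0 oppr0 Rot0 !mul1mx => /eqP.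
    by rewrite -subr_eq0 opprK -mulr2n -scaler_nat scaler_eq0 pnatr_eq0 (negPf x0).
  have tp : 0 < t by rewrite lt_neqAle eq_sym tn.
  have sv : Sp_ell (v t) by apply: ev; rewrite in_setE /= in_itv /= tp.
  have := ell_form_pos sv y0; rewrite ey oppr_gt0 ltNge mulr_ge0 //.
    by apply: sin_ge0_pi; rewrite mulr_ge0 ?(ltW a0) //= (le_trans (mulr_ile1 (ltW a0) t0 a1 t1)) // ltW.
  by apply: ltW; exact: qform1_gt0.
- move=> s sI x x0; rewrite /K /= psi1 !mulr1 subrK mulr1.
  by apply: nb => //; have [] := Hs s sI.
Qed.

Lemma push_bound : exists th (L : R), [/\ ES (Rot n (- (a + a)) *m w 1 *m Rot n a) th,
  (lengthG c <= ((1 - kap)^-1 * L)%:E)%E & n%:R * L <= \sum_j th j].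
Proof.
have /andP[k0 k1] := kapI.
have pv t : 0 <= t <= 1 -> sp_plus (DP t *m invmx (P t)) by move=> tI; have [] := push_vel tI.
have q t : 0 < t <= 1 -> forall u : V, u != 0 -> 0 < omega0 u (P t *m u).
  move=> /andP[t0 t1] u u0.
  apply: (no_minus1_form push_C1 push_0 _ _ _ t0 u0) => [s /andP[s0 s1]|s /andP[s0 s1]|s /andP[s0 s1]].
  - by apply: push_symp; rewrite s0 (le_trans s1).
  - by apply: pv; rewrite s0 (le_trans s1).
  - by apply: push_no_minus1; rewrite (ltW s0) (le_trans s1).
have I1 : 0 <= (1 : R) <= 1 by rewrite lexx ler01.
have I1' : 0 < (1 : R) <= 1 by rewrite lexx ltr01.
have [th Eth _] := ell_ES (form_ell n0 (push_symp I1) (q 1 I1')).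
have [L iL nL] := length_bound n0 push_C1 push_symp pv q Eth.
exists th, L; split; [by rewrite -push_1 | | exact: nL].
rewrite (lengthGE hc) -iL; apply: le_integral_ge0 => t; rewrite /= in_itv /= => tI.
  exact: G_ge0.
have [_ h1] := push_vel tI.
by rewrite mulrC ler_pdivlMr ?subr_gt0 // mulrC.
Qed.

End Push.

Lemma causal_eps (e : R) : 0 < e < 1 -> exists L : R,
  (lengthG c <= ((1 - e)^-1 * L)%:E)%E /\ n%:R * L <= \sum_j th0 j + e.
Proof.
move=> /andP[e0 e1]; have nn0 : 0 < n%:R :> R by rewrite ltr0n.
have S0 : 0 <= \sum_j th0 j by apply: sumr_ge0 => j _; have [/(_ j)/andP[]] := E0.
(* If the velocity is never definite, [G] vanishes along the curve and the length is [0]; otherwise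
   one definite instant supplies the interval for the push. *)
have [[t1 t1I pX]|nX] := pselect (exists2 t1, 0 <= t1 <= 1 & sp_plus (X t1)); last first.
  exists 0; rewrite mulr0 mulr0 (lengthGE hc); split; last by rewrite addr_ge0 // ltW.
  rewrite [X in (X <= _)%E](_ : _ = 0%E) //; apply: integral0_eq => t; rewrite /= in_itv /= => tI.
  by rewrite /G; case: asboolP => // h; case: nX; exists t.
have cX : continuous (fun t => D t *m sinv (c t)).
  by move=> t; apply: cvg_mulmx; [exact: hc.2 | apply: cvg_sinv; exact: C1on_cont hc t].
have eX t : 0 <= t <= 1 -> D t *m sinv (c t) = X t.
  by move=> tI; have [_ iW _] := symp_inv (sc tI); rewrite /X iW.
have [||p [h [m [p0 h0 ph m0 hm]]]] := uniform_positive cX t1I.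
- by move=> t tI; rewrite eX //; case: (pc tI).
- by rewrite eX.
have [psi [dpsi [d1 d2 d3 d4 d5]]] := bump p0 h0 ph.
have [d dp hd] := ES_cont E0 e0.
have cR : Rot n (- (a + a)) *m w 1 *m Rot n a @[a --> (0 : R)] --> w 1.
  have eR : Rot n (- (0 + 0)) *m w 1 *m Rot n 0 = w 1 by rewrite addr0 oppr0 Rot0 mul1mx mulmx1.
  rewrite -[X in _ --> X]eR.
  apply: cvg_mulmx; last by apply: cvg_Rot; exact: cvg_id.
  apply: cvg_mulmx; last exact: cvg_cst.
  by apply: cvg_Rot; apply: cvgN; apply: cvgD; exact: cvg_id.
have /cR/nbhs_ballP[r /= r0 hr] : nbhs (w 1) (ball (w 1) d) by exact: nbhsx_ballx.
have hm0 : 0 < h * m by exact: mulr_gt0.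
(* The three bounds keep the pushed endpoint in the ball where the sum of the angles is controlled,
   ensure [a <= 1], and make the share [2 a / (h m)] at most [e]. *)
pose a := Num.min (r / 2) (Num.min 1 (e * (h * m) / 2)) .
have [a0 ar a1 ae] : [/\ 0 < a, a < r, a <= 1 & 2 * a <= e * (h * m)].
  have x1 : a <= r / 2 by rewrite ge_min lexx.
  have x2 : a <= 1 by rewrite !ge_min lexx orbT.
  have x3 : a <= e * (h * m) / 2 by rewrite !ge_min lexx !orbT.
  by split=> //; [rewrite !lt_min ltr01 !divr_gt0 ?mulr_gt0 | lra | lra].
have ahm : 2 * a < h * m by apply: le_lt_trans ae _; rewrite gtr_pMl.
have XI t : p <= t <= p + 2 * h -> psd (X t - m *: J).
  move=> tI; rewrite -eX; first exact: hm.
  by case/andP: tI => t2 t3; rewrite (le_trans p0 t2) (le_trans t3 ph).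
have [th [L [Eth lL nL]]] := push_bound h0 m0 a0 ahm a1 XI d1 d2 d3 d4 d5.
have L0 : 0 <= L.
  have : (0 <= lengthG c)%E by apply: integral_ge0 => t _; rewrite lee_fin G_ge0.
  move=> /le_trans/(_ lL); rewrite lee_fin pmulr_rge0 // invr_gt0 subr_gt0.
  by rewrite ltr_pdivrMr // mul1r.
exists L; split.
  apply: le_trans lL _; rewrite lee_fin ler_wpM2r // lef_pV2 ?posrE ?subr_gt0 //.
    by rewrite lerD2l lerN2 ler_pdivrMr.
  by rewrite ltr_pdivrMr // mul1r.
have hb : ball (w 1) d (Rot n (- (a + a)) *m w 1 *m Rot n a).
  by apply: hr; rewrite /ball /= sub0r normrN gtr0_norm.
have := hd _ _ Eth hb; rewrite ltr_norml => /andP[_ h2].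
by apply: le_trans nL _; lra.
Qed.

(** A single application of [causal_eps] excludes infinite length; the sharp constant then comes
    from letting [e] tend to [0]. *)
Lemma causal_bound : (lengthG c <= (n%:R^-1 * \sum_j th0 j)%:E)%E.
Proof.
have nn0 : 0 < n%:R :> R by rewrite ltr0n.
have l0 : (0 <= lengthG c)%E by apply: integral_ge0 => t _; rewrite lee_fin G_ge0.
case El: (lengthG c) l0 => [l| |] // l0; last first.
  have [|L [h _]] := @causal_eps 2^-1; first by apply/andP; split; lra.
  by move: h; rewrite El leye_eq.
rewrite lee_fin ler_pdivlMl //; apply: (@lim_eps R _ _ 1) => // e eI.
have [L [h1 h2]] := causal_eps eI; move: h1; rewrite El lee_fin.
case/andP: eI => e0 e1; rewrite ler_pdivlMl ?subr_gt0 // => h1.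
rewrite mulr1; apply: le_trans h2; rewrite mulrCA ler_pM2l //.
Qed.

End Causal.

Lemma dist_bound (w : R -> M) th0 : in_closure_ell w -> ES (w 1) th0 ->
  (forall u : V, 0 <= omega0 u (w 1 *m u)) -> (dist_id w <= (n%:R^-1 * \sum_j th0 j)%:E)%E.
Proof.
move=> cl E0 qw; rewrite /dist_id; case: asboolP => _; last first.
  rewrite lee_fin mulr_ge0 ?invr_ge0 //; apply: sumr_ge0 => j _.
  by have [/(_ j)/andP[]] := E0.
apply: ge_ereal_sup => _ [c [cc [c0 cw]] <-].
have /causalE[D [hc sc vc]] := cc.
apply: (causal_bound hc c0 cw sc _ cl E0 qw) => t tI.
by apply: closure_psd => //; have [] := vc t tI.
Qed.

End DistanceBound.

(** * The lift of [upsilon] and its end value *)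

Section MaslovLift.
Variables (R : realType) (n : nat).
Local Notation C := R[i].
Local Notation M := 'M[R]_(n + n).
Local Notation V := 'cV[R]_(n + n).
Local Notation Re := (@complex.Re R).
Local Notation Im := (@complex.Im R).

Lemma expiD (a b : R) : expi (a + b) = expi a * expi b.
Proof. by apply: C_ext; rewrite ?cReM ?cImM /= ?cosD ?sinD //; ring. Qed.

Lemma expi0 : expi 0 = 1 :> C.
Proof. by rewrite /expi cos0 sin0. Qed.

Lemma expi_prod (I : Type) (r : seq I) (th : I -> R) :
  \prod_(j <- r) expi (th j) = expi (\sum_(j <- r) th j).
Proof. by rewrite (big_morph _ expiD expi0). Qed.

Lemma expi_inj (x y : R) : expi x = expi y -> cos (x - y) = 1 /\ sin (x - y) = 0.
Proof.
move=> [ec es]; rewrite cosB sinB ec es; split; last by ring.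
by rewrite -!expr2 cos2Dsin2.
Qed.

Lemma sin_norm_eq0 (x : R) : sin x = 0 -> sin `|x| = 0.
Proof. by move=> h; case: (ger0P x) => _ //; rewrite sinN h oppr0. Qed.

Lemma sin_small (x : R) : 0 < x <= 1 -> 0 < sin x.
Proof.
move=> /andP[x0 x1]; apply: sin_gt0_pi; rewrite x0 /=.
by apply: le_lt_trans x1 _; have := pi_ge2 R; lra.
Qed.

Lemma dist_IVT (f g : R -> R) (t c : R) : continuous f -> continuous g -> f 0 = g 0 -> 0 <= t ->
  0 <= c <= `|f t - g t| -> exists2 u, 0 <= u <= t & `|f u - g u| = c.
Proof.
move=> cf cg e t0 cI; have cd : continuous (fun t => `|f t - g t|).
  by move=> x; apply: cvg_norm; apply: cvgB; [exact: cf | exact: cg].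
have [||u uI eu] := @IVT R (fun t => `|f t - g t|) 0 t c t0.
- exact: continuous_subspaceT.
- rewrite e subrr normr0; case/andP: cI => c0 c1.
  by rewrite ge_min c0 /= le_max c1 orbT.
by exists u => //; move: uI; rewrite in_itv.
Qed.

(** The difference of two lifts is continuous with zero sine; if it left [0], its absolute value
    would take a value in [(0, 1]], where the sine is positive. *)
Lemma lift_unique (f g : R -> R) : continuous f -> continuous g -> f 0 = g 0 ->
  (forall t, 0 <= t <= 1 -> expi (f t) = expi (g t)) -> forall t, 0 <= t <= 1 -> f t = g t.
Proof.
move=> cf cg e0 h t /andP[t0 t1]; apply/eqP; rewrite -subr_eq0; apply/negP => /negP ne.
pose c := Num.min `|f t - g t| 1.
have cI : 0 < c <= 1 by rewrite lt_min normr_gt0 ne ltr01 /= ge_min lexx orbT.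
have [|u /andP[u0 u1] eu] := @dist_IVT f g t c cf cg e0 t0.
  by case/andP: cI => /ltW -> _; rewrite ge_min lexx.
have [|_ s0] := expi_inj (h u _); first by rewrite u0 (le_trans u1).
by have := sin_small cI; rewrite -eu sin_norm_eq0 // ltxx.
Qed.

Lemma prod_count (u t : seq C) : uniq u -> {subset t <= u} ->
  \prod_(x <- u) x ^+ count_mem x t = \prod_(x <- t) x.
Proof.
move=> uu; elim: t => [|y t IH] su; first by rewrite big_nil big1.
rewrite big_cons -IH; last by move=> x xt; apply: su; rewrite in_cons xt orbT.
have yu : y \in u by apply: su; exact: mem_head.
rewrite (bigD1_seq y) //= [in RHS](bigD1_seq y) //= eqxx add1n exprS -mulrA; congr (_ * (_ * _)).
by apply: eq_bigr => x xy; rewrite eq_sym (negPf xy) add0n.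
Qed.

Lemma ups_unit (W : M) : Re (upsilon W) ^+ 2 + Im (upsilon W) ^+ 2 = 1.
Proof.
have [s es _] := char_poly_roots (cmx W).
have ev x : Defs.eigenvalue W x <-> x \in s by rewrite /Defs.eigenvalue es root_prod_XsubC.
have : `|upsilon W| = 1.
  rewrite /upsilon normrM normrX normrN1 expr1n mul1r.
  pose pb (x : C) := [&& `|x| == 1, x != 1 & x != -1].
  rewrite (@fsbig_set_seq _ _ _ _ _ [seq x <- undup s | pb x]) ?filter_uniq ?undup_uniq //; last first.
    move=> x; rewrite mem_filter mem_undup /= /pb ev; split=> [[-> [/eqP -> [-> ->]]]|]; first by [].
    by move=> /andP[/and3P[/eqP -> -> ->] ->].
  rewrite big_filter normr_prod big1 // => x /and3P[/eqP ux _ _].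
  by rewrite normrX ux expr1n.
by rewrite cnE -cn2 => /(congr1 Re) /= ->; rewrite expr1n.
Qed.

Lemma eigenvalue1 (l : C) : Defs.eigenvalue (1%:M : M) l -> l = 1.
Proof.
rewrite /Defs.eigenvalue /root /cmx map_scalar_mx char_poly_eval /= -raddfB det_scalar.
by rewrite expf_eq0 subr_eq0 => /andP[_ /eqP].
Qed.

Lemma ups1 : upsilon (1%:M : M) = 1.
Proof.
rewrite /upsilon (_ : [set l | _ /\ (l < 0)%R] = set0); last first.
  by apply/seteqP; split => // l /= [/eigenvalue1 ->]; rewrite ltr10.
rewrite (_ : [set l | _ /\ _ /\ _] = set0); last first.
  by apply/seteqP; split => // l /= [/eigenvalue1 -> [_ []]]; rewrite eqxx.
by rewrite !fsbig_set0 mulr1.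
Qed.

Lemma ES1 : ES (1%:M : M) (fun=> 0).
Proof.
have b (j : 'I_n) : 0 <= (0 : R) <= pi by rewrite lexx pi_ge0.
apply/(ES_real _ b); apply: poly_eq_all => a.
rewrite char_poly_eval -raddfB det_scalar horner_prod prodr_const card_ord cos0 exprD -exprMn.
by congr (_ ^+ _); rewrite /quadpoly !hornerE; ring.
Qed.

(** Above the real axis the generalized eigenspaces are Krein-positive, so [krein_p] is the full
    multiplicity; conjugation makes those below negative, where [krein_p] is [0]. Each angle is thus
    counted once. *)
Lemma ups_ell (W : M) th : Sp_ell W -> ES W th -> upsilon W = expi (\sum_j th j).
Proof.
move=> eW E; have [sW [hu hk]] := eW; have [tb _] := E; have es := ES_roots E.
set s1 := [seq expi (th j) | j <- enum 'I_n] in es; set s2 := [seq expi (- th j) | j <- enum 'I_n] in es.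
have ev x : Defs.eigenvalue W x <-> x \in s1 ++ s2 by rewrite /Defs.eigenvalue es root_prod_XsubC.
have i1 x : x \in s1 -> 0 < Im x.
  move=> xs; have [ux [n1 nm1]] := hu x (proj2 (ev x) ltac:(by rewrite mem_cat xs)).
  move: xs n1 nm1 => /mapP[j _ ->] n1 nm1 /=; have /andP[t0 t1] := tb j.
  apply: sin_gt0_pi; rewrite !lt_neqAle t0 t1 !andbT; apply/andP; split; apply/eqP => e.
    by move/eqP: n1; apply; rewrite -e expi0.
  by move/eqP: nm1; apply; rewrite e /expi cospi sinpi; apply: C_ext; rewrite /= ?oppr0.
have i2 x : x \in s2 -> Im x < 0.
  move=> /mapP[j js ->] /=; rewrite sinN oppr_lt0.
  by apply: (i1 (expi (th j))); apply/mapP; exists j.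
have kp x : x \in s1 ++ s2 -> krein_p W x = count_mem x s1.
  move=> xs; have [ux _] := hu x (proj2 (ev x) xs).
  have [rk _] := gen_eigenspace_spec sW ux es.
  have [U UE [rU pU]] := krein_p_ex W x.
  move: xs; rewrite mem_cat => /orP[xs|xs].
    have ex : Defs.eigenvalue W x by apply/ev; rewrite mem_cat xs.
    have c2 : count_mem x s2 = 0%N.
      by apply/count_memPn; apply/negP => /i2 /(lt_trans (i1 x xs)); rewrite ltxx.
    apply/eqP; rewrite eqn_leq; move: rk; rewrite count_cat c2 addn0 => <-.
    apply/andP; split; first by rewrite -rU mxrankS.
    by apply: krein_p_max => //; exact: hk x ex (i1 x xs).
  have ex : Defs.eigenvalue W x by apply/ev; rewrite mem_cat xs orbT.
  have -> : count_mem x s1 = 0%N.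
    by apply/count_memPn; apply/negP => /i1 h; have := lt_trans h (i2 x xs); rewrite ltxx.
  apply/eqP; rewrite -rU mxrank_eq0; apply/negPn/negP => U0.
  have [v vU v0] := rowV0Pn U0.
  have := (krein_kq U).1 pU v vU v0.
  have /gen_eigenspaceP h := submx_trans vU UE.
  have hc := gen_eigen_conj h.
  have ic : 0 < Im (conjc x) by have := i2 x xs; case: (x) => a b /=; rewrite oppr_gt0.
  have := (krein_kq _).1 (hk (conjc x) (eigenvalue_conj ex) ic) (map_mx (@conjc R) v).
  rewrite kq_conj oppr_gt0 map_conj_eq0 => h2 h3.
  have hv : (map_mx (@conjc R) v <= gen_eigenspace W (conjc x))%MS.
    apply/gen_eigenspaceP; have -> : (map_mx (@conjc R) v)^T = conjv v^T by rewrite /conjv map_trmx.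
    exact: hc.
  by have := lt_trans h3 (h2 hv v0); rewrite ltxx.
have nneg : [set l | Defs.eigenvalue W l /\ (l < 0)%R] = set0.
  apply/seteqP; split => // l /= [el l0]; have [ul [_ /eqP]] := hu l el; apply.
  by move: ul; rewrite ltr0_norm // => <-; rewrite opprK.
rewrite /upsilon nneg fsbig_set0 expr0 mul1r.
rewrite (@fsbig_set_seq _ _ _ _ _ (undup (s1 ++ s2))) ?undup_uniq //; last first.
  move=> x; rewrite mem_undup /= ev; split=> [[]|xs] //; split=> //.
  by have [-> [-> ->]] := hu x (proj2 (ev x) xs).
rewrite (eq_big_seq (fun x => x ^+ count_mem x s1)); last first.
  by move=> x; rewrite mem_undup => /kp ->.
rewrite prod_count ?undup_uniq //; last by move=> x xs; rewrite mem_undup mem_cat xs.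
by rewrite /s1 big_map expi_prod big_enum.
Qed.

Lemma ups_ccvg (T : Type) (F : set_system T) (FF : Filter F) (g : T -> M) (W0 : M) :
  (forall x, symplectic (g x)) -> symplectic W0 -> g x @[x --> F] --> W0 ->
  ccvg F (fun x => upsilon (g x)) (upsilon W0).
Proof.
move=> sg s0 cg.
have key (e : R) : 0 < e -> \forall x \near F, cn (upsilon (g x) - upsilon W0) < e.
  move=> e0; have [d d0 h] := upsilon_cont s0 e0.
  have hb : F [set x | ball W0 d (g x)] by apply: cg; exact: nbhsx_ballx.
  by apply: filterS hb => x; exact: h.
split; apply/cvgrPdist_lt => e e0; apply: filterS (key e e0) => x /(le_lt_trans _); apply.
  by rewrite distrC -cReN -cReD; exact: (cn_Re _).1.
by rewrite distrC -cImN -cImD; exact: (cn_Re _).2.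
Qed.

Lemma ups_lift (H : R * R -> M) : continuous H -> H (0, 0) = 1%:M ->
  (forall s t, 0 <= s <= 1 -> 0 <= t <= 1 -> symplectic (H (s, t))) ->
  exists al : R * R -> R, [/\ continuous al, al (0, 0) = 0 &
    forall s t, 0 <= s <= 1 -> 0 <= t <= 1 -> expi (al (s, t)) = upsilon (H (s, t))].
Proof.
move=> cH H0 sH; pose Hc z := H (clamp z.1, clamp z.2).
have cHc : continuous Hc by exact: Hc_continuous.
have sHc z : symplectic (Hc z) by apply: sH; exact: clamp_itv.
have cc z := ups_ccvg (nbhs_filter z) sHc (sHc z) (cHc z).
have c0 : clamp 0 = 0 :> R by exact: clamp_lo.
have H00 : upsilon (Hc (0, 0)) = 1 by rewrite /Hc /= c0 H0 ups1.
have [|||||al [ca a0 ha]] := @lift_square R (fun z => Re (upsilon (Hc z))) (fun z => Im (upsilon (Hc z))).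
- by move=> z; exact: (cc z).1.
- by move=> z; exact: (cc z).2.
- by move=> z; exact: ups_unit.
- by rewrite H00.
- by rewrite H00.
exists al; split=> // s t sI tI; have [h1 h2] := ha (s, t).
have e : Hc (clamp (s, t).1, clamp (s, t).2) = H (s, t) by rewrite /Hc /= !clampK !clamp_id.
by rewrite e in h1 h2; apply: C_ext; [exact: h1 | exact: h2].
Qed.

Lemma path_clamp (p : R -> M) : is_path p -> [/\ continuous (p \o @clamp R), p 0 = 1%:M,
  (forall t, 0 <= t <= 1 -> symplectic (p t)) & forall t, symplectic (p (clamp t))].
Proof.
move=> [/within_clamp cp [p0 sp]].
have sp' t : 0 <= t <= 1 -> symplectic (p t) by move=> tI; apply: sp; rewrite in01.
by split=> // t; apply: sp'; exact: clamp_itv.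
Qed.

(** Along an elliptic path the sum of the angles is itself the lift; [ES_cont] gives its continuity
    although the angles are chosen separately at each time. *)
Lemma ell_angle_lift (v : R -> M) : is_path v -> (forall t, t \in `]0, 1] -> Sp_ell (v t)) ->
  exists S : R -> R, [/\ continuous S, S 0 = 0,
    (forall t, 0 <= t <= 1 -> expi (S t) = upsilon (v t)) &
    exists2 th, ES (v 1) th & S 1 = \sum_j th j].
Proof.
move=> /path_clamp[cv v0 sv svc] ev.
have ev' t : 0 < t <= 1 -> Sp_ell (v t) by move=> tI; apply: ev; rewrite in_setE /= in_itv.
have ex t : 0 <= t <= 1 -> exists th, ES (v t) th.
  move=> /andP[t0 t1]; have [->|tn] := eqVneq t 0; first by exists (fun=> 0); rewrite v0; exact: ES1.
  have [|th h _] := ell_ES (ev' t _); last by exists th.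
  by rewrite lt_neqAle eq_sym tn t0.
have [th hth] : {th : R -> 'I_n -> R & forall t, ES (v (clamp t)) (th t)}.
  by apply: (@choice R ('I_n -> R) (fun t th => ES (v (clamp t)) th)) => t; apply: ex; exact: clamp_itv.
have c0 : clamp 0 = 0 :> R by exact: clamp_lo.
have c1 : clamp 1 = 1 :> R by exact: clamp_hi.
exists (fun t => \sum_j th t j); split.
- move=> t; apply/cvgrPdist_lt => e e0; have [d d0 h] := ES_cont (hth t) e0.
  have hb : \forall x \near t, ball (v (clamp t)) d (v (clamp x)) by apply: cv; exact: nbhsx_ballx.
  by apply: filterS hb => x hx; rewrite distrC; exact: h (hth x) hx.
- have := hth 0; rewrite c0 v0 => h; rewrite (ES_uniq h ES1) big1 //.
- move=> t tI; have := hth t; rewrite clamp_id // => h; case/andP: tI => t0 t1.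
  have [z|tn] := eqVneq t 0; last by rewrite (ups_ell (ev' t _) h) // lt_neqAle eq_sym tn t0.
  by move: h; rewrite z v0 => h; rewrite (ES_uniq h ES1) big1 // expi0 ups1.
- by exists (th 1) => //; have := hth 1; rewrite c1.
Qed.

Lemma closure_ell_end (w : R -> M) : in_closure_ell w ->
  exists U : set_system M, [/\ UltraFilter U, U (@Sp_ell R n) & x @[x --> U] --> w 1].
Proof.
move=> cl; apply: (@ball_ultra R M M (@Sp_ell R n) id (w 1)) => d d0.
have [v [hv [ev /htpy_trackE[H [_ H1 Hs _]]]]] := cl d d0.
have I1 : 0 <= (1 : R) <= 1 by rewrite lexx ler01.
exists (v 1); first by apply: ev; rewrite in_setE /= in_itv /= ltr01 lexx.
by have [_ <-] := H1 1 I1; have [] := Hs 1 I1.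
Qed.

Lemma closure_ell_spectrum (w : R -> M) : in_closure_ell w -> exists th, ES (w 1) th.
Proof.
move=> /closure_ell_end[U [UU US Uw]].
have PU := @ultra_proper _ _ UU.
have [th hth] : {th : M -> 'I_n -> R & forall W, Sp_ell W -> ES W (th W)}.
  apply: (@choice _ _ (fun W t => Sp_ell W -> ES W t)) => W.
  have [eW|nW] := pselect (Sp_ell W); last by exists (fun=> 0).
  by have [th h _] := ell_ES eW; exists th.
have [|th0 h _] := @ES_cvg R n M U UU id (w 1) th Uw; last by exists th0.
by apply: filterS US => W; exact: hth.
Qed.

Lemma closure_ell_form (w : R -> M) : (0 < n)%N -> in_closure_ell w ->
  forall u : V, 0 <= omega0 u (w 1 *m u).
Proof.
move=> n0 /closure_ell_end[U [UU US Uw]] u; rewrite leNgt; apply/negP => neg.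
have u0 : u != 0 by apply/eqP => z; move: neg; rewrite z mulmx0 omega0r ltxx.
have PU := @ultra_proper _ _ UU.
have c := @cvg_omega R n _ U (@filter_filter _ _ PU) u (fun x => x) (w 1) u Uw.
have h1 : U [set x | omega0 u (x *m u) < 0] := c _ (lt_nbhsl neg).
have [x [/= eW h]] := filter_ex (filterI US h1).
suff : 0 < omega0 u (x *m u) by rewrite ltNge ltW.
move: n n0 x u u0 eW {US Uw neg c h1 h PU UU U w} => [|n'] // _ x u u0 eW; exact: ell_form.
Qed.

(** The lift along [w] is compared through the homotopy square with the one along a nearby elliptic
    path. The end of the homotopy moves only in a small ball, so the two end values differ by less
    than [e], and so do the two sums of angles. *)
Lemma maslov_end (w : R -> M) th0 : is_path w -> in_closure_ell w -> ES (w 1) th0 ->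
  exists2 f, maslov_lift w f & 2 * pi * f 1 = \sum_j th0 j.
Proof.
move=> pw cl E0; have [cw w0 sw swc] := path_clamp pw.
have I0 : 0 <= (0 : R) <= 1 by rewrite lexx ler01.
have I1 : 0 <= (1 : R) <= 1 by rewrite lexx ler01.
have c0 : clamp 0 = 0 :> R by exact: clamp_lo.
(* Applied to a square that is constant in [s], the lift on squares provides the lift along a
   path. *)
have [|||al [ca a00 ha]] := @ups_lift (fun z => w (clamp z.2)).
- by move=> z; apply: (@cvg_comp _ _ _ snd (w \o @clamp R)); [exact: cvg_snd | exact: cw].
- by rewrite /= c0 w0.
- by move=> s t _ _; exact: swc.
have cf (g : R * R -> R) : continuous g -> continuous (fun t : R => g (0, t)) /\
    continuous (fun t : R => g (1, t)) /\ continuous (fun s : R => g (s, 0)) /\ continuous (fun s : R => g (s, 1)).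
  move=> cg; split; last split; last split; move=> t.
  - apply: (@cvg_comp _ _ _ (fun t : R => (0 : R, t)) g _ _ _ _ (cg _)).
    by apply: cvg_pair2; [exact: cvg_cst | exact: cvg_id].
  - apply: (@cvg_comp _ _ _ (fun t : R => (1 : R, t)) g _ _ _ _ (cg _)).
    by apply: cvg_pair2; [exact: cvg_cst | exact: cvg_id].
  - apply: (@cvg_comp _ _ _ (fun t : R => (t, 0 : R)) g _ _ _ _ (cg _)).
    by apply: cvg_pair2; [exact: cvg_id | exact: cvg_cst].
  - apply: (@cvg_comp _ _ _ (fun t : R => (t, 1 : R)) g _ _ _ _ (cg _)).
    by apply: cvg_pair2; [exact: cvg_id | exact: cvg_cst].
have pin : 2 * pi != 0 :> R by rewrite mulf_neq0 ?pnatr_eq0 // gt_eqF ?pi_gt0.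
have ha0 t : 0 <= t <= 1 -> expi (al (0, t)) = upsilon (w t).
  by move=> tI; rewrite -[in RHS](clamp_id tI); exact: (ha 0 t I0 tI).
suff end1 : al (0, 1) = \sum_j th0 j.
  exists (fun t => al (0, t) / (2 * pi)); last by rewrite mulrC divfK.
  split; first by apply: continuous_subspaceT => t; apply: cvgM; [exact: (cf al ca).1 | exact: cvg_cst].
  split; first by rewrite a00 mul0r.
  by move=> t; rewrite in01 => tI; rewrite mulrC divfK // ha0.
suff close (e : R) : 0 < e < 1 -> `|al (0, 1) - \sum_j th0 j| < 2 * e.
  apply/eqP; rewrite -subr_eq0 -normr_eq0 eq_le normr_ge0 andbT.
  apply: (@lim_eps R _ _ 2) => // e eI; have /andP[e0 e1] := eI.
  rewrite add0r mulrC; apply: le_trans (_ : _ <= `|al (0, 1) - \sum_j th0 j|) _.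
    by rewrite ler_piMr // gerBl ltW.
  by rewrite mulrC; exact: ltW (close e eI).
move=> eI; have /andP[e0 e1] := eI.
have ce : cos e < 1.
  have s0 : 0 < sin e by apply: sin_small; rewrite e0 ltW.
  by have := cos2Dsin2 e; have := cos_le1 e; nra.
(* The chord of angle [e] on the unit circle: if the lift moved by exactly [e], then [upsilon] would
   move by this length. *)
pose eta := Num.sqrt (2 - 2 * cos e).
have eta0 : 0 < eta by rewrite sqrtr_gt0; lra.
have eta2 : eta ^+ 2 = 2 - 2 * cos e by rewrite sqr_sqrtr //; lra.
have [d1 d10 h1] := ES_cont E0 e0.
have [d2 d20 h2] := upsilon_cont (sw 1 I1) eta0.
have dm : 0 < Num.min d1 d2 by rewrite lt_min d10.
have [v [pv [ev /htpy_trackE[H [cH H01 Hs sH]]]]] := cl _ dm.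
have [_ v0 _ _] := path_clamp pv.
have [|be [cb b00 hb]] := ups_lift cH _ sH; first by have [-> _] := Hs 0 I0.
have [be0 [be1 [bs0 bs1]]] := cf be cb.
have [S [cS S0 hS [th1 E1 S1]]] := ell_angle_lift pv ev.
have e01 : be (0, 1) = al (0, 1).
  apply: (@lift_unique (fun t => be (0, t)) (fun t => al (0, t)) be0 (cf al ca).1 _ _ 1 I1).
    by rewrite a00 b00.
  by move=> t tI; rewrite (hb 0 t I0 tI) (ha0 t tI); have [-> _] := H01 t tI.
have bs00 s : 0 <= s <= 1 -> be (s, 0) = 0.
  apply: (@lift_unique (fun s => be (s, 0)) (fun=> 0) bs0 _ b00) => [t|t tI]; first exact: cvg_cst.
  by rewrite hb // expi0; have [-> _] := Hs t tI; exact: ups1.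
have e11 : be (1, 1) = \sum_j th1 j.
  rewrite -S1; apply: (@lift_unique (fun t => be (1, t)) S be1 cS _ _ 1 I1).
    by rewrite S0 bs00.
  by move=> t tI; rewrite (hb 1 t I1 tI) (hS t tI); have [_ ->] := H01 t tI.
have b1 : ball (w 1) d1 (v 1).
  have [_ hb1] := Hs 1 I1; have [_ <-] := H01 1 I1.
  by apply: le_ball hb1; rewrite ge_min lexx.
have k1 : `|be (1, 1) - \sum_j th0 j| < e by rewrite e11; exact: h1 E1 b1.
have k2 : `|be (1, 1) - be (0, 1)| < e.
  rewrite ltNge; apply/negP => ge.
  have [||u uI eu] := @dist_IVT (fun s => be (s, 1)) (fun=> be (0, 1)) 1 e bs1 _ erefl ler01.
  - by move=> t; exact: cvg_cst.
  - by rewrite (ltW e0).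
  have [_ hbu] := Hs u uI.
  have := h2 (H (u, 1)) (sH u 1 uI I1) (le_ball _ hbu); rewrite ge_min lexx orbT => /(_ isT).
  have -> : upsilon (w 1) = expi (be (0, 1)) by rewrite (hb 0 1 I0 I1); have [-> _] := H01 1 I1.
  rewrite -(hb u 1 uI I1); set x := be (u, 1); set y := be (0, 1) => lt.
  have : cn (expi x - expi y) ^+ 2 < eta ^+ 2 by rewrite ltrXn2r // ?nnegrE ?cn_ge0 // ltW.
  rewrite eta2 cn2 cReD cImD cReN cImN /=.
  have ecos : cos e = cos (x - y).
    by rewrite -eu /x /y; case: (ger0P (be (u, 1) - be (0, 1))) => _ //; rewrite cosN.
  rewrite ecos cosB; have := cos2Dsin2 x; have := cos2Dsin2 y; nra.
rewrite -e01; move: k1 k2; rewrite !ltr_norml => /andP[a1 a2] /andP[a3 a4].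
by apply/andP; split; lra.
Qed.

End MaslovLift.

Theorem theorem4 (R : realType) (n : nat) (hn : (0 < n)%N)
  (w : R -> 'M[R]_(n + n)) (hw : is_path w) :
  (in_closure_ell w ->
     exists theta : 'I_n -> R,
       (forall j, 0 <= theta j <= pi) /\
       char_poly (cmx (w 1)) =
         \prod_(j < n) (('X - (expi (theta j))%:P) * ('X - (expi (- theta j))%:P)) /\
       exists f : R -> R, maslov_lift w f /\
         (dist_id w <= (2 * pi / n%:R * f 1)%:E)%E /\
         2 * pi / n%:R * f 1 = n%:R^-1 * \sum_(j < n) theta j)
  /\
  ((exists W, timelike_to w W) -> ~ in_closure_ell w -> dist_id w = +oo%E).
Proof.
split=> [cl|[W hW] ncl]; last exact: (dist_infinite hn hW ncl).
have [th E] := closure_ell_spectrum cl; exists th.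
have [f mf ef] := maslov_end hw cl E; have [tb ch] := E.
do 2 split=> //; exists f; split=> //.
have e : 2 * pi / n%:R * f 1 = n%:R^-1 * \sum_(j < n) th j by rewrite -ef mulrAC mulrC.
by split=> //; rewrite e; exact: (dist_bound hn cl E (closure_ell_form hn cl)).
Qed.
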